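(* Let $\Omega$ be a domain in $\mathbb{C}^n$. Let $\varepsilon\in(0,1]$, $k\in\{0,1\}$, and set $\varepsilon_k=\frac{k+\varepsilon}{2}$. Suppose $p\in\partial\Omega$ is a $\mathcal{C}^{k+2,\varepsilon}$-smooth strictly pseudoconvex boundary point of $\Omega$. Then there exist a constant $C>0$ and a neighborhood $U$ of $p$ such that for all $z\in\Omega\cap U$ and $X\in\mathbb{C}^n$, $$(1-C\delta_\Omega(z)^{\varepsilon_k})\Bigl(\frac{|\langle\partial\delta_\Omega(z),X\rangle|^2}{\delta^2_\Omega(z)}+\frac{L(z;X)}{\delta_\Omega(z)}\Bigr)^{1/2}\leq\kappa_\Omega(z;X)\leq (1+C\delta_\Omega(z)^{\varepsilon_k})\Bigl(\frac{|\langle\partial\delta_\Omega(z),X\rangle|^2}{\delta^2_\Omega(z)}+\frac{L(z;X)}{\delta_\Omega(z)}\Bigr)^{1/2}.$$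
   Context: $\delta_\Omega(z)$ is the Euclidean distance from $z$ to $\partial\Omega$ (which is of class $\mathcal C^2$ in $\Omega$ near $p$). $\langle\partial\delta_\Omega(z),X\rangle=\sum_{j=1}^n\frac{\partial\delta_\Omega}{\partial z_j}(z)X_j$, and $L(z;X)=\sum_{j,l=1}^n\frac{\partial^2(-\delta_\Omega)}{\partial z_j\partial\bar z_l}(z)X_j\bar X_l$ is the Levi form of $-\delta_\Omega$. The Kobayashi metric is $\kappa_{\Omega}(z;X)=\inf\{|\alpha|:\exists\varphi\in \mathcal{O}(\mathbb{D},\Omega),\ \varphi(0)=z,\ \alpha\varphi'(0)=X\}$, where $\mathbb D$ is the unit disc. A boundary point $p$ is a $\mathcal{C}^{k+2,\varepsilon}$-smooth strictly pseudoconvex boundary point if there are a neighborhood $W$ of $p$ and $\rho\in\mathcal{C}^{k+2,\varepsilon}(W)$ with $\Omega\cap W=\{\rho<0\}$, $d\rho\neq0$ on $W$, and the Levi form of $\rho$ at $p$ positive definite on the complex tangent space at $p$; $\mathcal{C}^{m,\varepsilon}$ means $m$-th derivatives locally Hölder continuous of exponent $\varepsilon$. *)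

(* Defs.v *)
From Stdlib Require Import Reals.
From Coquelicot Require Import Coquelicot.
From mathcomp Require Import ssreflect ssrbool eqtype ssrnat fintype bigop.

Set Implicit Arguments.
Unset Strict Implicit.

Local Open Scope R_scope.
Local Open Scope C_scope.

Definition Cn (n : nat) := 'I_n -> C.

Definition vadd (n : nat) (z w : Cn n) : Cn n := fun j => z j + w j.
Definition vsub (n : nat) (z w : Cn n) : Cn n := fun j => z j - w j.
Definition vscal (n : nat) (a : C) (z : Cn n) : Cn n := fun j => a * z j.

Definition vnorm (n : nat) (z : Cn n) : R :=
  sqrt (\big[Rplus/0%R]_(j < n) (Cmod (z j) * Cmod (z j))%R).
Definition vdist (n : nat) (z w : Cn n) : R := vnorm (vsub z w).

Definition is_open (n : nat) (A : Cn n -> Prop) : Prop :=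
  forall z, A z -> exists r : R, (0 < r)%R /\ forall w, (vdist w z < r)%R -> A w.

Definition is_connected (n : nat) (A : Cn n -> Prop) : Prop :=
  forall U V : Cn n -> Prop, is_open U -> is_open V ->
    (forall z, A z -> U z \/ V z) ->
    (exists z, A z /\ U z) -> (exists z, A z /\ V z) ->
    exists z, A z /\ U z /\ V z.

Definition is_domain (n : nat) (A : Cn n -> Prop) : Prop :=
  is_open A /\ (exists z, A z) /\ is_connected A.

(** Boundary point of an open set A: in the closure, not in A. *)
Definition boundary (n : nat) (A : Cn n -> Prop) (p : Cn n) : Prop :=
  ~ A p /\ forall r : R, (0 < r)%R -> exists z, A z /\ (vdist z p < r)%R.

Definition dist_bdry (n : nat) (A : Cn n -> Prop) (z : Cn n) : R :=
  real (Glb_Rbar (fun r => exists w, boundary A w /\ r = vdist z w)).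

(** Real coordinate directions of C^n = R^{2n}:
    (j,false) is the x_j direction, (j,true) the y_j direction. *)
Definition rdir (n : nat) (d : 'I_n * bool) : Cn n :=
  fun i => if i == fst d then (if snd d then RtoC 0 + Ci else RtoC 1) else RtoC 0.

Definition pd (n : nat) (f : Cn n -> R) (d : 'I_n * bool) : Cn n -> R :=
  fun z => Derive (fun t : R => f (vadd z (vscal (RtoC t) (rdir d)))) 0%R.
Definition has_pd (n : nat) (f : Cn n -> R) (d : 'I_n * bool) (z : Cn n) : Prop :=
  ex_derive (fun t : R => f (vadd z (vscal (RtoC t) (rdir d)))) 0%R.

Fixpoint ipd (n : nat) (ds : list ('I_n * bool)) (f : Cn n -> R) : Cn n -> R :=
  match ds with
  | nil => f
  | cons d ds' => pd (ipd ds' f) d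
  end.

Definition cont_at (n : nat) (f : Cn n -> R) (z : Cn n) : Prop :=
  forall e : R, (0 < e)%R -> exists h : R, (0 < h)%R /\
    forall w, (vdist w z < h)%R -> (Rabs (f w - f z) < e)%R.

Fixpoint Ck (n : nat) (m : nat) (W : Cn n -> Prop) (f : Cn n -> R) : Prop :=
  (forall z, W z -> cont_at f z) /\
  match m with
  | O => True
  | S m' => forall d, (forall z, W z -> has_pd f d z) /\ Ck m' W (pd f d)
  end.

Definition loc_holder (n : nat) (a : R) (W : Cn n -> Prop) (g : Cn n -> R) : Prop :=
  forall z, W z -> exists r K : R, (0 < r)%R /\
    forall x y, W x -> W y -> (vdist x z < r)%R -> (vdist y z < r)%R ->
      (Rabs (g x - g y) <= K * Rpower (vdist x y) a)%R.

Definition Cka (n : nat) (m : nat) (a : R) (W : Cn n -> Prop) (f : Cn n -> R) : Prop :=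
  Ck m W f /\ forall ds : list ('I_n * bool), length ds = m -> loc_holder a W (ipd ds f).

(** Wirtinger derivatives of a real function:
    d f / d z_j = (f_{x_j} - i f_{y_j})/2, and
    d^2 f / d z_j d zbar_l = d/dz_j ( (f_{x_l} + i f_{y_l})/2 ). *)
Definition dz (n : nat) (f : Cn n -> R) (j : 'I_n) (z : Cn n) : C :=
  (pd f (j, false) z / 2, - pd f (j, true) z / 2)%R.

Definition dzdzb (n : nat) (f : Cn n -> R) (j l : 'I_n) (z : Cn n) : C :=
  ((pd (pd f (l, false)) (j, false) z + pd (pd f (l, true)) (j, true) z) / 4,
   (pd (pd f (l, true)) (j, false) z - pd (pd f (l, false)) (j, true) z) / 4)%R.

Definition dpair (n : nat) (f : Cn n -> R) (z X : Cn n) : C :=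
  \big[Cplus/RtoC 0]_(j < n) (dz f j z * X j).

(** Levi form sum_{j,l} f_{j lbar}(z) X_j conj(X_l) (a real number for f of
    class C^2; we take its real part). *)
Definition levi (n : nat) (f : Cn n -> R) (z X : Cn n) : R :=
  Re (\big[Cplus/RtoC 0]_(j < n) \big[Cplus/RtoC 0]_(l < n)
        (dzdzb f j l z * X j * Cconj (X l))).

Definition spsc_point (n : nat) (m : nat) (a : R) (A : Cn n -> Prop) (p : Cn n) : Prop :=
  exists (W : Cn n -> Prop) (rho : Cn n -> R),
    is_open W /\ W p /\ Cka m a W rho /\
    (forall z, W z -> (A z <-> (rho z < 0)%R)) /\
    (forall z, W z -> exists d, pd rho d z <> 0%R) /\
    (forall X : Cn n, (exists j, X j <> RtoC 0) -> dpair rho p X = RtoC 0 ->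
       (0 < levi rho p X)%R).

Definition holo_disc (n : nat) (A : Cn n -> Prop) (phi : C -> Cn n) : Prop :=
  forall w : C, (Cmod w < 1)%R ->
    A (phi w) /\
    forall j, @ex_derive C_AbsRing C_NormedModule (fun u => phi u j) w.

Definition kobayashi (n : nat) (A : Cn n -> Prop) (z X : Cn n) : Rbar :=
  Glb_Rbar (fun r => exists (alpha : C) (phi : C -> Cn n) (v : Cn n),
    holo_disc A phi /\ phi (RtoC 0) = z /\
    (forall j, @is_derive C_AbsRing C_NormedModule (fun u => phi u j) (RtoC 0) (v j)) /\
    (forall j, alpha * v j = X j) /\
    r = Cmod alpha).

(* Main.v *)
Require Import Defs.
From Stdlib Require Import Reals.
From Coquelicot Require Import Coquelicot.
From mathcomp Require Import ssreflect ssrbool eqtype ssrnat fintype bigop.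
From HB Require Import structures.
From mathcomp Require Import ssrfun seq.
From Stdlib Require Import Lra Psatz FunctionalExtensionality Classical ClassicalEpsilon.

Local Open Scope R_scope.

(** Let [s = - rho z], [l] the complex gradient of [rho] at [z] and [Q = |l X|^2 / s^2 + L(X, X) / s],
    where [L] is the Levi form of [rho] at [z], made positive definite by adding [K |l|^2]. A
    quadratic change of variables [h = y - q(y)] with [L(q(u), v)] equal to half the mixed cubic
    term removes the non-pluriharmonic cubic part of the Taylor expansion, so that up to an error
    [O((|y|^2 + s)^(1 + e))], [e = (k + eps) / 2], the domain is [Re w + L(y, y) < 0] with [w]
    holomorphic, and this model is a ball. Upper bound: the extremal disc of the model, slightly
    shrunk, stays in the domain. Lower bound: the Cayley transform to the ball has norm at most
    [1 + O(s^e)] along any disc near the boundary point; far away its norm is replaced by 1, and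
    the Schwarz lemma still applies to the resulting glued function because it has holomorphic
    minorants.

    It remains to replace [rho] by the distance [d]. With [q] the nearest boundary point, [nu] the
    unit normal and [P] the tangential projection there, [z = q - d nu], the gradient of [d] is
    [- nu], and its Hessian is [- H(P u, P v) / |grad rho q| + O(d)], [H] the Hessian of [rho] at [q].
    Expanding [rho] and its gradient at [q] then shows that [Q] and the same expression built
    from [- d] differ by a factor [1 + O(d^e)]. *)

(** * Finite sums and vectors *)

(** The exponent shapes the argument. Discs through [z] have size [sqrt s] in the complex tangential
    directions, so a mixed cubic term is of order [s^(3/2)], a relative error [s^(1/2)]: too coarse
    as soon as [e > 1/2]. The change of variables is solved only up to an error proportional to [s],
    which is as good as exact. In the lower bound nothing global is known about the domain, and a
    disc may leave every neighbourhood of [p]. The Cayley norm cannot be cut off directly, since at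
    depth of order 1 it differs from 1 by [O(s)] with either sign; a holomorphic factor
    [1 + kap s (w + sb)] first pushes it above 1 at one depth and below 1 at a larger one.
    Uniformity in [z] comes from quantifying every estimate over all charts with the same bounds [M]
    and [c]. Finally, [d] is given no regularity in advance. Comparing each point with the foot of
    the other yields its gradient exactly, and difference quotients of the unit normal yield its
    second derivatives up to [O(d)]; this suffices, because they are divided by [d] and weighed
    against [|X|^2 / d]. *)

Lemma Rplus_left_assoc : associative Rplus. Proof. move=> x y z; ring. Qed.
Lemma Rplus_commutative : commutative Rplus. Proof. move=> x y; ring. Qed.
Lemma Rplus_left_id : left_id 0 Rplus. Proof. move=> x; ring. Qed.
HB.instance Definition _ :=
  Monoid.isComLaw.Build R 0 Rplus Rplus_left_assoc Rplus_commutative Rplus_left_id.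
Lemma Cplus_left_assoc : associative Cplus. Proof. move=> x y z; ring. Qed.
Lemma Cplus_commutative : commutative Cplus. Proof. move=> x y; ring. Qed.
Lemma Cplus_left_id : left_id (RtoC 0) Cplus. Proof. move=> x; ring. Qed.
HB.instance Definition _ :=
  Monoid.isComLaw.Build C (RtoC 0) Cplus Cplus_left_assoc Cplus_commutative Cplus_left_id.

Definition rsum (T : finType) (F : T -> R) : R := \big[Rplus/0]_(i : T) F i.
Definition csum (T : finType) (F : T -> C) : C := \big[Cplus/RtoC 0]_(i : T) F i.
Arguments rsum {T} F.
Arguments csum {T} F.

Section Sums.
Variable T : finType.
Implicit Types (F G : T -> R) (f g : T -> C).

Lemma rsum_ext F G : (forall i, F i = G i) -> rsum F = rsum G.
Proof. by move=> h; apply: eq_bigr => i _. Qed.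

Lemma csum_ext f g : (forall i, f i = g i) -> csum f = csum g.
Proof. by move=> h; apply: eq_bigr => i _. Qed.

Lemma rsumD F G : rsum (fun i => F i + G i) = rsum F + rsum G.
Proof. by rewrite /rsum big_split. Qed.

Lemma csumD f g : csum (fun i => Cplus (f i) (g i)) = Cplus (csum f) (csum g).
Proof. by rewrite /csum big_split. Qed.

Lemma rsumZ a F : rsum (fun i => a * F i) = a * rsum F.
Proof.
rewrite /rsum; elim/big_rec2: _ => [|i x y _ ->]; ring.
Qed.

Lemma csumZ a f : csum (fun i => Cmult a (f i)) = Cmult a (csum f).
Proof.
rewrite /csum; elim/big_rec2: _ => [|i x y _ ->]; ring.
Qed.

Lemma rsumN F : rsum (fun i => - F i) = - rsum F.
Proof.
rewrite /rsum; elim/big_rec2: _ => [|i x y _ ->]; ring.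
Qed.

Lemma rsumB F G : rsum (fun i => F i - G i) = rsum F - rsum G.
Proof. by rewrite /Rminus -rsumN -rsumD. Qed.

Lemma rsum0 : rsum (fun _ : T => 0) = 0.
Proof. by rewrite /rsum big1. Qed.

Lemma csum0 : csum (fun _ : T => RtoC 0) = RtoC 0.
Proof. by rewrite /csum big1. Qed.

Lemma rsum_le F G : (forall i, F i <= G i) -> rsum F <= rsum G.
Proof.
move=> h; rewrite /rsum; elim/big_rec2: _ => [|i x y _ hxy]; first lra.
by have := h i; lra.
Qed.

Lemma rsum_ge0 F : (forall i, 0 <= F i) -> 0 <= rsum F.
Proof. by move=> h; rewrite -rsum0; apply: rsum_le. Qed.

Lemma rsumD1 F j : rsum F = F j + \big[Rplus/0]_(i | i != j) F i.
Proof. by rewrite /rsum (bigD1 j). Qed.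

Lemma rsum_ge1 F j : (forall i, 0 <= F i) -> F j <= rsum F.
Proof.
move=> h; rewrite (rsumD1 F j).
suff : 0 <= \big[Rplus/0]_(i | i != j) F i by lra.
by elim/big_rec: _ => [|i x _ hx]; [lra | have := h i; lra].
Qed.

Lemma rsum_eq0 F : (forall i, 0 <= F i) -> rsum F = 0 -> forall i, F i = 0.
Proof. by move=> h h0 i; have := rsum_ge1 F i h; have := h i; lra. Qed.

Lemma rsum_abs F : Rabs (rsum F) <= rsum (fun i => Rabs (F i)).
Proof.
rewrite /rsum; elim/big_rec2: _ => [|i x y _ hxy]; first by rewrite Rabs_R0; lra.
by apply: Rle_trans (Rabs_triang _ _) _; lra.
Qed.

Lemma csum_mod f : Cmod (csum f) <= rsum (fun i => Cmod (f i)).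
Proof.
rewrite /csum /rsum; elim/big_rec2: _ => [|i x y _ hxy]; first by rewrite Cmod_0; lra.
by apply: Rle_trans (Cmod_triangle _ _) _; lra.
Qed.

Lemma rsum_const a : rsum (fun _ : T => a) = INR #|T| * a.
Proof.
rewrite /rsum big_const; elim: #|T| => [|m IH]; first by rewrite /=; ring.
by rewrite iterS IH S_INR; ring.
Qed.

Lemma rsum_le_const F a : (forall i, F i <= a) -> rsum F <= INR #|T| * a.
Proof. by move=> h; rewrite -rsum_const; apply: rsum_le. Qed.

Lemma Re_csum f : Re (csum f) = rsum (fun i => Re (f i)).
Proof. by rewrite /csum /rsum; elim/big_rec2: _ => [|i x y _ <-]. Qed.

Lemma Im_csum f : Im (csum f) = rsum (fun i => Im (f i)).
Proof. by rewrite /csum /rsum; elim/big_rec2: _ => [|i x y _ <-]. Qed.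

Lemma Cconj_csum f : Cconj (csum f) = csum (fun i => Cconj (f i)).
Proof.
rewrite /csum; elim/big_rec2: _ => [|i x y _ <-]; first by rewrite /Cconj /= Ropp_0.
by rewrite /Cconj /=; apply: injective_projections => /=; ring.
Qed.
End Sums.

Lemma rsum_exchange (T U : finType) (F : T -> U -> R) :
  rsum (fun i => rsum (F i)) = rsum (fun j => rsum (fun i => F i j)).
Proof. by rewrite /rsum exchange_big. Qed.

Lemma csum_exchange (T U : finType) (F : T -> U -> C) :
  csum (fun i => csum (F i)) = csum (fun j => csum (fun i => F i j)).
Proof. by rewrite /csum exchange_big. Qed.

Lemma rsum_pair (n : nat) (F : 'I_n * bool -> R) :
  rsum F = rsum (fun j : 'I_n => F (j, false) + F (j, true)).
Proof.
transitivity (rsum (fun j : 'I_n => rsum (fun b : bool => F (j, b)))).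
  by rewrite /rsum pair_bigA; apply: eq_big => [[i b]|[i b] _].
apply: rsum_ext => j.
by rewrite /rsum big_bool Rplus_comm.
Qed.

Lemma rsum_mul (T : finType) (F G : T -> R) :
  rsum F * rsum G = rsum (fun i => rsum (fun j => F i * G j)).
Proof.
transitivity (rsum (fun i => rsum G * F i)); first by rewrite rsumZ Rmult_comm.
by apply: rsum_ext => i; rewrite rsumZ Rmult_comm.
Qed.

Lemma rsum_CS (T : finType) (F G : T -> R) :
  rsum (fun i => F i * G i) * rsum (fun i => F i * G i) <=
  rsum (fun i => F i * F i) * rsum (fun i => G i * G i).
Proof.
set a := rsum (fun i => F i * F i); set b := rsum (fun i => F i * G i).
set c := rsum (fun i => G i * G i).
have q t : 0 <= t * t * a - 2 * t * b + c.
  suff -> : t * t * a - 2 * t * b + c = rsum (fun i => (t * F i - G i) * (t * F i - G i)).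
    by apply: rsum_ge0 => i; apply: Rle_0_sqr.
  rewrite /a /b /c -rsumZ -(rsumZ _ (2 * t)) -rsumB -rsumD; apply: rsum_ext => i; ring.
have a0 : 0 <= a by apply: rsum_ge0 => i; apply: Rle_0_sqr.
case: (Req_dec a 0) => [az|an].
  have Fz := rsum_eq0 _ (fun i => F i * F i) (fun i => Rle_0_sqr (F i)) az.
  have -> : b = 0.
    rewrite /b -(rsum0 T); apply: rsum_ext => i.
    by have := Fz i => /Rsqr_0_uniq ->; ring.
  by rewrite az; lra.
have ap : 0 < a by lra.
have := q (b / a).
have -> : b / a * (b / a) * a - 2 * (b / a) * b + c = c - b * b / a by field.
move=> h; have : b * b / a * a <= c * a by apply: Rmult_le_compat_r; lra.
have -> : b * b / a * a = b * b by field.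
lra.
Qed.

Lemma fin_upper (T : finType) (F : T -> R) : exists M, 0 <= M /\ forall i, F i <= M.
Proof.
exists (rsum (fun i => Rabs (F i))); split; first by apply: rsum_ge0 => i; exact: Rabs_pos.
move=> i; apply: Rle_trans (Rle_abs _) _.
by apply: (rsum_ge1 _ (fun i => Rabs (F i)) i) => j; exact: Rabs_pos.
Qed.

Lemma fin_lower (T : finType) (F : T -> R) :
  (forall i, 0 < F i) -> exists m, 0 < m /\ forall i, m <= F i.
Proof.
move=> h; have [M [hM hi]] := fin_upper _ (fun i => / F i).
exists (/ (M + 1)); split; first by apply: Rinv_0_lt_compat; lra.
move=> i; rewrite -(Rinv_inv (F i)); apply: Rinv_le_contravar.
  by apply: Rinv_0_lt_compat.
by have := hi i; lra.
Qed.

Lemma C_eq (x y : C) : Re x = Re y -> Im x = Im y -> x = y.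
Proof. by move=> hr hi; apply: injective_projections. Qed.

Lemma Cmod_sq (x : C) : Cmod x * Cmod x = Re x * Re x + Im x * Im x.
Proof. by rewrite /Cmod sqrt_sqrt /Re /Im /=; [ring | nra]. Qed.

Lemma Re_plus (x y : C) : Re (Cplus x y) = Re x + Re y. Proof. by []. Qed.
Lemma Im_plus (x y : C) : Im (Cplus x y) = Im x + Im y. Proof. by []. Qed.
Lemma Re_minus (x y : C) : Re (Cminus x y) = Re x - Re y. Proof. by []. Qed.
Lemma Im_minus (x y : C) : Im (Cminus x y) = Im x - Im y. Proof. by []. Qed.
Lemma Re_opp (x : C) : Re (Copp x) = - Re x. Proof. by []. Qed.
Lemma Im_opp (x : C) : Im (Copp x) = - Im x. Proof. by []. Qed.
Lemma Re_mult (x y : C) : Re (Cmult x y) = Re x * Re y - Im x * Im y. Proof. by []. Qed.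
Lemma Im_mult (x y : C) : Im (Cmult x y) = Re x * Im y + Im x * Re y. Proof. by []. Qed.
Lemma Re_conj (x : C) : Re (Cconj x) = Re x. Proof. by []. Qed.
Lemma Im_conj (x : C) : Im (Cconj x) = - Im x. Proof. by []. Qed.
Lemma Re_RtoC (x : R) : Re (RtoC x) = x. Proof. by []. Qed.
Lemma Im_RtoC (x : R) : Im (RtoC x) = 0. Proof. by []. Qed.
Definition CE := (Re_plus, Im_plus, Re_minus, Im_minus, Re_opp, Im_opp, Re_mult, Im_mult,
                  Re_conj, Im_conj, Re_RtoC, Im_RtoC).

Lemma Cmod_Re (x : C) : Rabs (Re x) <= Cmod x.
Proof.
have h := Cmod_sq x; have h0 := Cmod_ge_0 x.
by apply: Rabs_le; split; nra.
Qed.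

Lemma Re_le_Cmod (x : C) : Re x <= Cmod x.
Proof. exact: Rle_trans (Rle_abs _) (Cmod_Re x). Qed.

Lemma Cmod_Im (x : C) : Rabs (Im x) <= Cmod x.
Proof.
have h := Cmod_sq x; have h0 := Cmod_ge_0 x.
by apply: Rabs_le; split; nra.
Qed.

Lemma Cmod_le_ReIm (x : C) : Cmod x <= Rabs (Re x) + Rabs (Im x).
Proof.
have h := Cmod_sq x; have h0 := Cmod_ge_0 x.
have h1 := Rabs_pos (Re x); have h2 := Rabs_pos (Im x).
have e1 : Re x * Re x = Rabs (Re x) * Rabs (Re x) by rewrite -Rabs_mult Rabs_pos_eq //; nra.
have e2 : Im x * Im x = Rabs (Im x) * Rabs (Im x) by rewrite -Rabs_mult Rabs_pos_eq //; nra.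
nra.
Qed.

Lemma Cmod_conj (x : C) : Cmod (Cconj x) = Cmod x.
Proof. by rewrite /Cmod /=; congr sqrt; ring. Qed.

Lemma Cconj_mult (x y : C) : Cconj (Cmult x y) = Cmult (Cconj x) (Cconj y).
Proof. by apply: C_eq; rewrite !CE; ring. Qed.

Lemma Cconj_plus (x y : C) : Cconj (Cplus x y) = Cplus (Cconj x) (Cconj y).
Proof. by apply: C_eq; rewrite !CE; ring. Qed.

Lemma Cconj_invol (x : C) : Cconj (Cconj x) = x.
Proof. by apply: C_eq; rewrite !CE; ring. Qed.

Lemma Cmod_minus_sym (x y : C) : Cmod (Cminus x y) = Cmod (Cminus y x).
Proof. by rewrite -Cmod_opp; congr Cmod; ring. Qed.

Lemma Cmod_minus_le (x y : C) : Cmod (Cminus x y) <= Cmod x + Cmod y.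
Proof. by have := Cmod_triangle x (Copp y); rewrite Cmod_opp. Qed.

Lemma Cmod_minus_ge (x y : C) : Cmod x - Cmod y <= Cmod (Cminus x y).
Proof.
have := Cmod_triangle (Cminus x y) y.
have -> : Cplus (Cminus x y) y = x by ring.
lra.
Qed.

Lemma Cmod_Cmult_conj (x : C) : Cmult x (Cconj x) = RtoC (Cmod x * Cmod x).
Proof. by rewrite Cmod_sq; apply: C_eq; rewrite !CE; ring. Qed.

Lemma RtoC_neq0 (x : R) : x <> 0 -> RtoC x <> RtoC 0.
Proof. by move=> h e; apply: h; case: e. Qed.

(** * Euclidean structure and multilinear forms on complex n-space *)

Section Vectors.
Variable n : nat.
Implicit Types (u v w z : Cn n) (a b : C).

Definition vzero : Cn n := fun _ => RtoC 0.
Definition vconj u : Cn n := fun j => Cconj (u j).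
Definition rdot u v : R := rsum (fun j => Re (u j) * Re (v j) + Im (u j) * Im (v j)).

Lemma vext u v : (forall j, u j = v j) -> u = v.
Proof. exact: functional_extensionality. Qed.

Lemma vnorm_ge0 u : 0 <= vnorm u.
Proof. exact: sqrt_pos. Qed.

Lemma rdot_ge0 u : 0 <= rdot u u.
Proof. by apply: rsum_ge0 => j; nra. Qed.

Lemma vnorm_sq u : vnorm u * vnorm u = rdot u u.
Proof.
have e : rdot u u = \big[Rplus/0]_(j < n) (Cmod (u j) * Cmod (u j)).
  by rewrite /rdot /rsum; apply: eq_bigr => j _; rewrite Cmod_sq.
rewrite /vnorm -e sqrt_sqrt //; exact: rdot_ge0.
Qed.

Lemma rdotC u v : rdot u v = rdot v u.
Proof. by apply: rsum_ext => j; ring. Qed.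

Lemma rdotDl u v w : rdot (vadd u v) w = rdot u w + rdot v w.
Proof. by rewrite /rdot -rsumD; apply: rsum_ext => j; rewrite /vadd !CE; ring. Qed.

Lemma rdotDr u v w : rdot u (vadd v w) = rdot u v + rdot u w.
Proof. by rewrite rdotC rdotDl !(rdotC u). Qed.

Lemma rdotBl u v w : rdot (vsub u v) w = rdot u w - rdot v w.
Proof. by rewrite /rdot -rsumB; apply: rsum_ext => j; rewrite /vsub !CE; ring. Qed.

Lemma rdotBr u v w : rdot u (vsub v w) = rdot u v - rdot u w.
Proof. by rewrite rdotC rdotBl !(rdotC u). Qed.

Lemma rdotZl (t : R) u v : rdot (vscal (RtoC t) u) v = t * rdot u v.
Proof. by rewrite /rdot -rsumZ; apply: rsum_ext => j; rewrite /vscal !CE; ring. Qed.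

Lemma rdotZr (t : R) u v : rdot u (vscal (RtoC t) v) = t * rdot u v.
Proof. by rewrite rdotC rdotZl rdotC. Qed.

Lemma rdot_CS u v : Rabs (rdot u v) <= vnorm u * vnorm v.
Proof.
have h0 := vnorm_ge0 u; have h1 := vnorm_ge0 v.
have h : rdot u v * rdot u v <= (vnorm u * vnorm v) * (vnorm u * vnorm v).
  have -> : vnorm u * vnorm v * (vnorm u * vnorm v) =
            (vnorm u * vnorm u) * (vnorm v * vnorm v) by ring.
  rewrite !vnorm_sq.
  pose F (w : Cn n) (d : 'I_n * bool) := if d.2 then Im (w d.1) else Re (w d.1).
  have e w w' : rdot w w' = rsum (fun d => F w d * F w' d) by rewrite rsum_pair.
  rewrite !e; exact: rsum_CS.
have : 0 <= vnorm u * vnorm v by nra.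
by move=> h2; apply: Rabs_le; split; nra.
Qed.

Lemma vnorm_triangle u v : vnorm (vadd u v) <= vnorm u + vnorm v.
Proof.
have h0 := vnorm_ge0 u; have h1 := vnorm_ge0 v; have h2 := vnorm_ge0 (vadd u v).
have h3 := vnorm_sq (vadd u v).
move: h3; rewrite rdotDl !rdotDr -!vnorm_sq (rdotC v u) => h3.
have := Rle_trans _ _ _ (Rle_abs _) (rdot_CS u v) => h4.
nra.
Qed.

Lemma vnorm_zero : vnorm vzero = 0.
Proof.
have h := vnorm_sq vzero; have h1 := vnorm_ge0 vzero.
have : rdot vzero vzero = 0.
  by rewrite /rdot -(rsum0 'I_n); apply: rsum_ext => j; rewrite /vzero !CE; ring.
move=> h2; nra.
Qed.

Lemma vnorm_scal a u : vnorm (vscal a u) = Cmod a * vnorm u.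
Proof.
have h0 := vnorm_ge0 u; have h1 := vnorm_ge0 (vscal a u); have h2 := Cmod_ge_0 a.
have h3 : vnorm (vscal a u) * vnorm (vscal a u) = (Cmod a * vnorm u) * (Cmod a * vnorm u).
  have -> : (Cmod a * vnorm u) * (Cmod a * vnorm u) =
            (Cmod a * Cmod a) * (vnorm u * vnorm u) by ring.
  rewrite !vnorm_sq Cmod_sq /rdot -rsumZ; apply: rsum_ext => j.
  by rewrite /vscal !CE; ring.
have : 0 <= Cmod a * vnorm u by nra.
nra.
Qed.

Lemma vnorm_scalR (t : R) u : vnorm (vscal (RtoC t) u) = Rabs t * vnorm u.
Proof. by rewrite vnorm_scal Cmod_R. Qed.

Lemma vnorm_opp u v : vnorm (vsub u v) = vnorm (vsub v u).
Proof.
have -> : vsub u v = vscal (RtoC (-1)) (vsub v u).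
  by apply: vext => j; rewrite /vsub /vscal; apply: C_eq; rewrite !CE; ring.
by rewrite vnorm_scalR Rabs_Ropp Rabs_R1; ring.
Qed.

Lemma vnorm_sub_le u v : vnorm (vsub u v) <= vnorm u + vnorm v.
Proof.
have -> : vsub u v = vadd u (vscal (RtoC (-1)) v).
  by apply: vext => j; rewrite /vsub /vadd /vscal; apply: C_eq; rewrite !CE; ring.
apply: Rle_trans (vnorm_triangle _ _) _.
by rewrite vnorm_scalR Rabs_Ropp Rabs_R1; lra.
Qed.

Lemma vnorm_sub_ge u v : vnorm u - vnorm v <= vnorm (vsub u v).
Proof.
have := vnorm_triangle (vsub u v) v.
have -> : vadd (vsub u v) v = u.
  by apply: vext => j; rewrite /vsub /vadd; ring.
lra.
Qed.

Lemma vdist_ge0 u v : 0 <= vdist u v.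
Proof. exact: vnorm_ge0. Qed.

Lemma vdistC u v : vdist u v = vdist v u.
Proof. exact: vnorm_opp. Qed.

Lemma vdist_triangle u v w : vdist u w <= vdist u v + vdist v w.
Proof.
rewrite /vdist; have -> : vsub u w = vadd (vsub u v) (vsub v w).
  by apply: vext => j; rewrite /vsub /vadd; ring.
exact: vnorm_triangle.
Qed.

Lemma vdist_self u : vdist u u = 0.
Proof.
rewrite /vdist -vnorm_zero; congr vnorm; apply: vext => j.
by rewrite /vsub /vzero; ring.
Qed.

Lemma vdist_add u v : vdist (vadd u v) u = vnorm v.
Proof.
by rewrite /vdist; congr vnorm; apply: vext => j; rewrite /vsub /vadd; ring.
Qed.

Lemma vadd_sub u v : vadd u (vsub v u) = v.
Proof. by apply: vext => j; rewrite /vsub /vadd; ring. Qed.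

Lemma Cmod_le_vnorm u j : Cmod (u j) <= vnorm u.
Proof.
have h0 := vnorm_ge0 u; have h1 := Cmod_ge_0 (u j).
have h : Cmod (u j) * Cmod (u j) <= vnorm u * vnorm u.
  rewrite vnorm_sq Cmod_sq /rdot.
  by apply: (rsum_ge1 _ (fun j => Re (u j) * Re (u j) + Im (u j) * Im (u j)) j) => i; nra.
nra.
Qed.

Lemma vnorm_eq0 u : vnorm u = 0 -> u = vzero.
Proof.
move=> h; apply: vext => j; apply: Cmod_eq_0.
by have := Cmod_le_vnorm u j; have := Cmod_ge_0 (u j); lra.
Qed.

Lemma vdist_eq0 u v : vdist u v = 0 -> u = v.
Proof.
move=> /vnorm_eq0 h; apply: vext => j.
have : vsub u v j = RtoC 0 by rewrite h.
rewrite /vsub => e.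
have -> : u j = Cplus (Cminus (u j) (v j)) (v j) by ring.
by rewrite e Cplus_0_l.
Qed.

Lemma vnorm_le_sum u : vnorm u <= rsum (fun j => Cmod (u j)).
Proof.
have h0 := vnorm_ge0 u.
have h1 : 0 <= rsum (fun j => Cmod (u j)) by apply: rsum_ge0 => j; exact: Cmod_ge_0.
suff : vnorm u * vnorm u <= rsum (fun j => Cmod (u j)) * rsum (fun j => Cmod (u j)) by nra.
rewrite vnorm_sq rsum_mul; apply: rsum_le => j.
rewrite -Cmod_sq; apply: (rsum_ge1 _ (fun i => Cmod (u j) * Cmod (u i)) j) => i.
by have := Cmod_ge_0 (u j); have := Cmod_ge_0 (u i); nra.
Qed.

Lemma vnorm_conj u : vnorm (vconj u) = vnorm u.
Proof. by rewrite /vnorm; congr sqrt; apply: eq_bigr => j _; rewrite /vconj Cmod_conj. Qed.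

Lemma vnorm_rdir (d : 'I_n * bool) : vnorm (rdir d) = 1.
Proof.
have h := vnorm_sq (rdir d); have h0 := vnorm_ge0 (rdir d).
suff : rdot (rdir d) (rdir d) = 1 by move=> e; nra.
rewrite /rdot (rsumD1 _ _ d.1) big1 => [|i /negbTE ni]; rewrite /rdir.
  by rewrite eqxx; case: d.2; rewrite !CE /=; ring.
by rewrite ni !CE; ring.
Qed.

(** All forms are complex multilinear in every slot. A Hermitian form is written
    [bil L u (vconj v)], so that without the conjugation the same sums are holomorphic along
    holomorphic curves. *)
Definition lin (a : 'I_n -> C) u : C := csum (fun j => Cmult (a j) (u j)).
Definition bil (S : 'I_n -> 'I_n -> C) u v : C := csum (fun j => Cmult (u j) (lin (S j) v)).
Definition tri (A : 'I_n -> 'I_n -> 'I_n -> C) u v w : C :=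
  csum (fun j => Cmult (u j) (bil (A j) v w)).

Lemma linD c u v : lin c (vadd u v) = Cplus (lin c u) (lin c v).
Proof. by rewrite /lin -csumD; apply: csum_ext => j; rewrite /vadd; ring. Qed.
Lemma linZ c b u : lin c (vscal b u) = Cmult b (lin c u).
Proof. by rewrite /lin -csumZ; apply: csum_ext => j; rewrite /vscal; ring. Qed.

Lemma bilDl S u v w : bil S (vadd u v) w = Cplus (bil S u w) (bil S v w).
Proof. by rewrite /bil -csumD; apply: csum_ext => j; rewrite /vadd; ring. Qed.
Lemma bilZl S b u v : bil S (vscal b u) v = Cmult b (bil S u v).
Proof. by rewrite /bil -csumZ; apply: csum_ext => j; rewrite /vscal; ring. Qed.
Lemma bilDr S u v w : bil S u (vadd v w) = Cplus (bil S u v) (bil S u w).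
Proof. by rewrite /bil -csumD; apply: csum_ext => j; rewrite linD; ring. Qed.
Lemma bilZr S b u v : bil S u (vscal b v) = Cmult b (bil S u v).
Proof. by rewrite /bil -csumZ; apply: csum_ext => j; rewrite linZ; ring. Qed.

Lemma triDl A u v w z : tri A (vadd u v) w z = Cplus (tri A u w z) (tri A v w z).
Proof. by rewrite /tri -csumD; apply: csum_ext => j; rewrite /vadd; ring. Qed.
Lemma triDm A u v w z : tri A u (vadd v w) z = Cplus (tri A u v z) (tri A u w z).
Proof. by rewrite /tri -csumD; apply: csum_ext => j; rewrite bilDl; ring. Qed.
Lemma triDr A u v w z : tri A u v (vadd w z) = Cplus (tri A u v w) (tri A u v z).
Proof. by rewrite /tri -csumD; apply: csum_ext => j; rewrite bilDr; ring. Qed.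

Lemma vconjD u v : vconj (vadd u v) = vadd (vconj u) (vconj v).
Proof. by apply: vext => j; rewrite /vconj /vadd Cconj_plus. Qed.
Lemma vconjZ a u : vconj (vscal a u) = vscal (Cconj a) (vconj u).
Proof. by apply: vext => j; rewrite /vconj /vscal Cconj_mult. Qed.

Lemma csum_bound (f : 'I_n -> C) (M : R) :
  (forall j, Cmod (f j) <= M) -> Cmod (csum f) <= INR n * M.
Proof.
move=> h; apply: Rle_trans (csum_mod _ f) _.
by have := rsum_le_const _ (fun j => Cmod (f j)) M h; rewrite card_ord.
Qed.

Lemma vnorm_le_const u (M : R) : (forall j, Cmod (u j) <= M) -> vnorm u <= INR n * M.
Proof.
move=> h; apply: Rle_trans (vnorm_le_sum u) _.
by have := rsum_le_const _ (fun j => Cmod (u j)) M h; rewrite card_ord.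
Qed.

Lemma lin_bound (c : 'I_n -> C) M u :
  (forall j, Cmod (c j) <= M) -> Cmod (lin c u) <= INR n * M * vnorm u.
Proof.
move=> h; rewrite Rmult_assoc; apply: csum_bound => j; rewrite Cmod_mult.
by apply: Rmult_le_compat; [exact: Cmod_ge_0 | exact: Cmod_ge_0 | exact: h | exact: Cmod_le_vnorm].
Qed.

Lemma bil_bound S M u v :
  (forall j l, Cmod (S j l) <= M) -> Cmod (bil S u v) <= INR n * (INR n * M) * vnorm u * vnorm v.
Proof.
move=> h.
have -> : INR n * (INR n * M) * vnorm u * vnorm v = INR n * (vnorm u * (INR n * M * vnorm v)) by ring.
apply: csum_bound => j; rewrite Cmod_mult.
apply: Rmult_le_compat; [exact: Cmod_ge_0 | exact: Cmod_ge_0 | exact: Cmod_le_vnorm |].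
by apply: lin_bound => l; exact: h.
Qed.

Lemma tri_bound A M u v w :
  (forall j l m, Cmod (A j l m) <= M) ->
  Cmod (tri A u v w) <= INR n * (INR n * (INR n * M)) * vnorm u * vnorm v * vnorm w.
Proof.
move=> h.
have -> : INR n * (INR n * (INR n * M)) * vnorm u * vnorm v * vnorm w =
  INR n * (vnorm u * (INR n * (INR n * M) * vnorm v * vnorm w)) by ring.
apply: csum_bound => j; rewrite Cmod_mult.
apply: Rmult_le_compat; [exact: Cmod_ge_0 | exact: Cmod_ge_0 | exact: Cmod_le_vnorm |].
by apply: bil_bound => l m; exact: h.
Qed.
End Vectors.
Arguments vzero {n}.
Arguments vconj {n}.
Arguments rdot {n}.
Arguments lin {n}.
Arguments bil {n}.
Arguments tri {n}.
(** * Complex differentiation *)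

(** Quotient-free form of the complex derivative: remainders can be added, multiplied and estimated
    without excluding [w = x]. *)
Definition cderiv (f : C -> C) (x l : C) : Prop :=
  forall e, 0 < e -> exists d, 0 < d /\ forall w, Cmod (Cminus w x) < d ->
    Cmod (Cminus (Cminus (f w) (f x)) (Cmult l (Cminus w x))) <= e * Cmod (Cminus w x).

Definition cdiff (f : C -> C) (x : C) : Prop := exists l, cderiv f x l.

Lemma is_derive_cderiv (f : C -> C) (x l : C) :
  @is_derive C_AbsRing C_NormedModule f x l <-> cderiv f x l.
Proof.
split=> [[_ h] e he|h].
  have hx : is_filter_lim (locally (x : C_AbsRing)) (x : C_AbsRing) by move=> P hP.
  have [d hd] := h x hx (mkposreal e he).
  exists d; split; first exact: cond_pos.
  move=> w hw; have := hd w hw.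
  rewrite (_ : Cminus (Cminus (f w) (f x)) (Cmult l (Cminus w x)) =
    minus (minus (f w) (f x)) (scal (minus w x) l)) //.
  by rewrite /minus /plus /opp /scal /=; rewrite /mult /=; ring.
split; first exact: is_linear_scal_l.
move=> y hy.
have -> : y = x by symmetry; apply: (is_filter_lim_locally_unique (V := AbsRing_NormedModule C_AbsRing)).
move=> [e he]; have [d [hd hw]] := h e he.
exists (mkposreal d hd) => w hwd; have := hw w hwd.
rewrite (_ : Cminus (Cminus (f w) (f x)) (Cmult l (Cminus w x)) =
    minus (minus (f w) (f x)) (scal (minus w x) l)) //.
by rewrite /minus /plus /opp /scal /=; rewrite /mult /=; ring.
Qed.

Lemma cderiv_ext (f g : C -> C) x l : (forall w, f w = g w) -> cderiv f x l -> cderiv g x l.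
Proof.
move=> h hf e he; have [d [hd hw]] := hf e he.
by exists d; split=> // w hwd; rewrite -!h; exact: hw.
Qed.

Lemma cderiv_const a x : cderiv (fun _ => a) x (RtoC 0).
Proof.
move=> e he; exists 1; split; first lra; move=> w _.
have -> : Cminus (Cminus a a) (Cmult (RtoC 0) (Cminus w x)) = RtoC 0 by ring.
by rewrite Cmod_0; have := Cmod_ge_0 (Cminus w x); nra.
Qed.

Lemma cderiv_id x : cderiv (fun w => w) x (RtoC 1).
Proof.
move=> e he; exists 1; split; first lra; move=> w _.
have -> : Cminus (Cminus w x) (Cmult (RtoC 1) (Cminus w x)) = RtoC 0 by ring.
by rewrite Cmod_0; have := Cmod_ge_0 (Cminus w x); nra.
Qed.

Lemma cderiv_plus f g x l m :
  cderiv f x l -> cderiv g x m -> cderiv (fun w => Cplus (f w) (g w)) x (Cplus l m).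
Proof.
move=> hf hg e he.
have [d1 [hd1 h1]] := hf (e / 2) ltac:(lra); have [d2 [hd2 h2]] := hg (e / 2) ltac:(lra).
exists (Rmin d1 d2); split; first exact: Rmin_pos.
move=> w hw.
have := h1 w (Rlt_le_trans _ _ _ hw (Rmin_l _ _)).
have := h2 w (Rlt_le_trans _ _ _ hw (Rmin_r _ _)).
set r1 := Cminus _ (Cmult m _); set r2 := Cminus _ (Cmult l _) => b2 b1.
have -> : Cminus (Cminus (Cplus (f w) (g w)) (Cplus (f x) (g x))) (Cmult (Cplus l m) (Cminus w x))
  = Cplus r2 r1 by rewrite /r1 /r2; ring.
by apply: Rle_trans (Cmod_triangle _ _) _; lra.
Qed.

Lemma cderiv_cont f x l : cderiv f x l ->
  exists d, 0 < d /\ forall w, Cmod (Cminus w x) < d ->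
    Cmod (Cminus (f w) (f x)) <= (Cmod l + 1) * Cmod (Cminus w x).
Proof.
move=> hf; have [d [hd h]] := hf 1 ltac:(lra); exists d; split=> // w hw.
have := h w hw; set r := Cminus _ (Cmult _ _) => hr.
have -> : Cminus (f w) (f x) = Cplus r (Cmult l (Cminus w x)) by rewrite /r; ring.
apply: Rle_trans (Cmod_triangle _ _) _; rewrite Cmod_mult; lra.
Qed.

Lemma cderiv_continuous f x l : cderiv f x l ->
  forall e, 0 < e -> exists d, 0 < d /\ forall w, Cmod (Cminus w x) < d ->
    Cmod (Cminus (f w) (f x)) < e.
Proof.
move=> hf e he; have [d [hd h]] := cderiv_cont _ _ _ hf.
have hl := Cmod_ge_0 l.
exists (Rmin d (e / (Cmod l + 1))); split.
  by apply: Rmin_pos => //; apply: Rdiv_lt_0_compat; lra.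
move=> w hw; apply: Rle_lt_trans (h w (Rlt_le_trans _ _ _ hw (Rmin_l _ _))) _.
have h2 : Cmod (Cminus w x) < e / (Cmod l + 1) := Rlt_le_trans _ _ _ hw (Rmin_r _ _).
have -> : e = (Cmod l + 1) * (e / (Cmod l + 1)) by field; lra.
by apply: Rmult_lt_compat_l; lra.
Qed.

Lemma cderiv_mult f g x l m :
  cderiv f x l -> cderiv g x m ->
  cderiv (fun w => Cmult (f w) (g w)) x (Cplus (Cmult l (g x)) (Cmult (f x) m)).
Proof.
move=> hf hg e he.
have l0 := Cmod_ge_0 l; have m0 := Cmod_ge_0 m.
have f0 := Cmod_ge_0 (f x); have g0 := Cmod_ge_0 (g x).
pose e1 := e / 3 / (Cmod (g x) + Cmod l + 2).
have he1 : 0 < e1 by rewrite /e1; repeat apply: Rdiv_lt_0_compat; lra.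
pose e2 := e / 3 / (Cmod (f x) + 1).
have he2 : 0 < e2 by rewrite /e2; repeat apply: Rdiv_lt_0_compat; lra.
have [d1 [hd1 h1]] := hf _ he1; have [d2 [hd2 h2]] := hg _ he2.
have [d3 [hd3 h3]] := cderiv_cont _ _ _ hf.
pose e3 := Rmin 1 (e / 3 / (Cmod l + 1)).
have he3 : 0 < e3 by apply: Rmin_pos; [lra | repeat apply: Rdiv_lt_0_compat; lra].
have [d4 [hd4 h4]] := cderiv_continuous _ _ _ hg e3 he3.
exists (Rmin (Rmin d1 d2) (Rmin d3 d4)); split; first by repeat apply: Rmin_pos.
move=> w hw.
have k1 := h1 w (Rlt_le_trans _ _ _ hw (Rle_trans _ _ _ (Rmin_l _ _) (Rmin_l _ _))).
have k2 := h2 w (Rlt_le_trans _ _ _ hw (Rle_trans _ _ _ (Rmin_l _ _) (Rmin_r _ _))).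
have k3 := h3 w (Rlt_le_trans _ _ _ hw (Rle_trans _ _ _ (Rmin_r _ _) (Rmin_l _ _))).
have k4 := h4 w (Rlt_le_trans _ _ _ hw (Rle_trans _ _ _ (Rmin_r _ _) (Rmin_r _ _))).
move: k1 k2 k3 k4; set D := Cminus w x.
set r1 := Cminus _ (Cmult l _); set r2 := Cminus _ (Cmult m _) => k1 k2 k3 k4.
have D0 := Cmod_ge_0 D.
(* Two first-order remainders with bounded factors, and the product of the two increments, which is
   of second order. *)
have -> : Cminus (Cminus (Cmult (f w) (g w)) (Cmult (f x) (g x)))
   (Cmult (Cplus (Cmult l (g x)) (Cmult (f x) m)) D) =
   Cplus (Cplus (Cmult r1 (g x)) (Cmult (f x) r2))
     (Cmult (Cminus (f w) (f x)) (Cminus (g w) (g x))) by rewrite /r1 /r2; ring.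
apply: Rle_trans (Cmod_triangle _ _) _.
apply: Rle_trans (Rplus_le_compat_r _ _ _ (Cmod_triangle _ _)) _.
rewrite !Cmod_mult.
have a1 : Cmod r1 * Cmod (g x) <= e / 3 * Cmod D.
  have : Cmod r1 * Cmod (g x) <= e1 * Cmod D * (Cmod (g x) + Cmod l + 2).
    by apply: Rmult_le_compat => //; [exact: Cmod_ge_0 | lra].
  by rewrite /e1; have -> : e / 3 / (Cmod (g x) + Cmod l + 2) * Cmod D * (Cmod (g x) + Cmod l + 2) = e / 3 * Cmod D by field; lra.
have a2 : Cmod (f x) * Cmod r2 <= e / 3 * Cmod D.
  have : Cmod (f x) * Cmod r2 <= (Cmod (f x) + 1) * (e2 * Cmod D).
    by apply: Rmult_le_compat => //; [exact: Cmod_ge_0 | lra].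
  by rewrite /e2; have -> : (Cmod (f x) + 1) * (e / 3 / (Cmod (f x) + 1) * Cmod D) = e / 3 * Cmod D by field; lra.
have a3 : Cmod (Cminus (f w) (f x)) * Cmod (Cminus (g w) (g x)) <= e / 3 * Cmod D.
  have : Cmod (Cminus (f w) (f x)) * Cmod (Cminus (g w) (g x)) <= (Cmod l + 1) * Cmod D * (e / 3 / (Cmod l + 1)).
    apply: Rmult_le_compat => //; try exact: Cmod_ge_0.
    apply: Rle_trans (Rlt_le _ _ k4) _; exact: Rmin_r.
  by have -> : (Cmod l + 1) * Cmod D * (e / 3 / (Cmod l + 1)) = e / 3 * Cmod D by field; lra.
lra.
Qed.

Lemma cderiv_inv f x l : cderiv f x l -> f x <> RtoC 0 ->
  cderiv (fun w => Cinv (f w)) x (Copp (Cdiv l (Cmult (f x) (f x)))).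
Proof.
move=> hf fx0 e he.
have F0 : 0 < Cmod (f x) := proj1 (Cmod_gt_0 _) fx0.
set F := Cmod (f x) in F0.
have l0 := Cmod_ge_0 l.
pose e1 := e / 2 * (F * F) / 2.
have he1 : 0 < e1 by have FF : 0 < F * F by [nra]; rewrite /e1; apply: Rdiv_lt_0_compat; nra.
have [d1 [hd1 h1]] := hf _ he1.
have [d3 [hd3 h3]] := cderiv_cont _ _ _ hf.
pose e3 := Rmin (F / 2) (e / 2 * (F * F * F) / 2 / (Cmod l + 1)).
have FFF : 0 < F * F * F by apply: Rmult_lt_0_compat => //; nra.
have he3 : 0 < e3.
  by apply: Rmin_pos; [lra | apply: Rdiv_lt_0_compat; [nra | lra]].
have [d4 [hd4 h4]] := cderiv_continuous _ _ _ hf e3 he3.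
exists (Rmin d1 (Rmin d3 d4)); split; first by repeat apply: Rmin_pos.
move=> w hw.
have k1 := h1 w (Rlt_le_trans _ _ _ hw (Rmin_l _ _)).
have k3 := h3 w (Rlt_le_trans _ _ _ hw (Rle_trans _ _ _ (Rmin_r _ _) (Rmin_l _ _))).
have k4 := h4 w (Rlt_le_trans _ _ _ hw (Rle_trans _ _ _ (Rmin_r _ _) (Rmin_r _ _))).
have k5 : Cmod (Cminus (f w) (f x)) < F / 2 := Rlt_le_trans _ _ _ k4 (Rmin_l _ _).
have k6 : Cmod (Cminus (f w) (f x)) < e / 2 * (F * F * F) / 2 / (Cmod l + 1) := Rlt_le_trans _ _ _ k4 (Rmin_r _ _).
have fw : F / 2 <= Cmod (f w).
  have := Cmod_minus_ge (f x) (f w); rewrite Cmod_minus_sym -/F; lra.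
have fw0 : f w <> RtoC 0 by move=> h; move: fw; rewrite h Cmod_0; lra.
set D := Cminus w x in k1 k3 *; have D0 := Cmod_ge_0 D.
set dl := Cminus (f w) (f x) in k1 k3 k5 k6.
(* Over the denominator [(f x)^2 f w], bounded below through [|f w| >= F / 2], the numerator is the
   squared increment of [f] minus its remainder times [f w]. *)
have -> : Cminus (Cminus (Cinv (f w)) (Cinv (f x))) (Cmult (Copp (Cdiv l (Cmult (f x) (f x)))) D)
  = Cdiv (Cminus (Cmult dl dl) (Cmult (Cminus dl (Cmult l D)) (f w))) (Cmult (Cmult (f x) (f x)) (f w)).
  by rewrite /dl; field; split.
rewrite Cmod_div; last by repeat apply: Cmult_neq_0.
rewrite !Cmod_mult -/F.
have P0 : 0 < F * F * Cmod (f w) by apply: Rmult_lt_0_compat; [nra | lra].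
apply: (Rmult_le_reg_r (F * F * Cmod (f w))) => //.
rewrite /Rdiv Rmult_assoc Rinv_l ?Rmult_1_r; last lra.
apply: Rle_trans (Cmod_minus_le _ _) _; rewrite !Cmod_mult.
have b1 : Cmod dl * Cmod dl <= e / 2 * Cmod D * (F * F * (F / 2)).
  have : Cmod dl * Cmod dl <= (Cmod l + 1) * Cmod D * (e / 2 * (F * F * F) / 2 / (Cmod l + 1)).
    by apply: Rmult_le_compat; try exact: Cmod_ge_0; lra.
  have -> : (Cmod l + 1) * Cmod D * (e / 2 * (F * F * F) / 2 / (Cmod l + 1)) =
    e / 2 * Cmod D * (F * F * (F / 2)) by field; lra.
  done.
have b2 : e / 2 * Cmod D * (F * F * (F / 2)) <= e / 2 * Cmod D * (F * F * Cmod (f w)).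
  apply: Rmult_le_compat_l; first nra.
  by apply: Rmult_le_compat_l; nra.
have b3 : Cmod (Cminus dl (Cmult l D)) * Cmod (f w) <= e1 * Cmod D * Cmod (f w).
  by apply: Rmult_le_compat_r => //; exact: Cmod_ge_0.
have b4 : e1 * Cmod D * Cmod (f w) <= e / 2 * Cmod D * (F * F * Cmod (f w)).
  have -> : e1 * Cmod D * Cmod (f w) = e / 2 * Cmod D * (F * F * Cmod (f w)) / 2 by rewrite /e1; field.
  have : 0 <= e / 2 * Cmod D * (F * F * Cmod (f w)) by apply: Rmult_le_pos; [nra | lra].
  lra.
lra.
Qed.

Lemma cderiv_comp_scal f (a x l : C) :
  cderiv f (Cmult a x) l -> cderiv (fun w => f (Cmult a w)) x (Cmult l a).
Proof.
move=> hf e he; have a0 := Cmod_ge_0 a.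
have he1 : 0 < e / (Cmod a + 1) by apply: Rdiv_lt_0_compat; lra.
have [d [hd h]] := hf _ he1.
exists (d / (Cmod a + 1)); split; first by apply: Rdiv_lt_0_compat; lra.
move=> w hw; have D0 := Cmod_ge_0 (Cminus w x).
have e1 : Cminus (Cmult a w) (Cmult a x) = Cmult a (Cminus w x) by ring.
have k : Cmod (Cmult a (Cminus w x)) <= (Cmod a + 1) * Cmod (Cminus w x) by rewrite Cmod_mult; nra.
have h1 : Cmod (Cminus (Cmult a w) (Cmult a x)) < d.
  rewrite e1; apply: Rle_lt_trans k _.
  have -> : d = (Cmod a + 1) * (d / (Cmod a + 1)) by field; lra.
  by apply: Rmult_lt_compat_l; lra.
have := h _ h1; rewrite e1.
have -> : Cmult (Cmult l a) (Cminus w x) = Cmult l (Cmult a (Cminus w x)) by ring.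
move=> h2; apply: Rle_trans h2 _.
have -> : e * Cmod (Cminus w x) = e / (Cmod a + 1) * ((Cmod a + 1) * Cmod (Cminus w x)) by field; lra.
by apply: Rmult_le_compat_l; lra.
Qed.

(** Used for the remainders of [hol_normal], [shear] and [unshear]: being of second order at the
    base point, they leave the derivative of a disc unchanged. *)
Lemma cderiv_quadratic f x M d :
  0 < d -> f x = RtoC 0 ->
  (forall w, Cmod (Cminus w x) < d -> Cmod (f w) <= M * (Cmod (Cminus w x) * Cmod (Cminus w x))) ->
  cderiv f x (RtoC 0).
Proof.
move=> hd fx h e he; have M0 := Rabs_pos M.
exists (Rmin d (e / (Rabs M + 1))); split.
  by apply: Rmin_pos => //; apply: Rdiv_lt_0_compat; lra.
move=> w hw; have D0 := Cmod_ge_0 (Cminus w x).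
have h1 := h w (Rlt_le_trans _ _ _ hw (Rmin_l _ _)).
have h2 := Rlt_le_trans _ _ _ hw (Rmin_r _ _).
rewrite fx (_ : Cminus (Cminus (f w) (RtoC 0)) (Cmult (RtoC 0) (Cminus w x)) = f w); last by ring.
apply: Rle_trans h1 _; rewrite -Rmult_assoc; apply: Rmult_le_compat_r => //.
have : (Rabs M + 1) * Cmod (Cminus w x) <= (Rabs M + 1) * (e / (Rabs M + 1)) by apply: Rmult_le_compat_l; lra.
have -> : (Rabs M + 1) * (e / (Rabs M + 1)) = e by field; lra.
by have := Rle_abs M; nra.
Qed.

Lemma cderiv_csum (T : finType) (f : T -> C -> C) x (l : T -> C) :
  (forall i, cderiv (f i) x (l i)) -> cderiv (fun w => csum (fun i => f i w)) x (csum l).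
Proof.
move=> h; rewrite /csum; elim: (index_enum T) => [|i s IH].
  rewrite big_nil; apply: cderiv_ext (cderiv_const (RtoC 0) x) => w.
  by rewrite big_nil.
rewrite big_cons; apply: cderiv_ext (cderiv_plus _ _ _ _ _ (h i) IH) => w.
by rewrite big_cons.
Qed.

Lemma cdiff_ext f g x : (forall w, f w = g w) -> cdiff f x -> cdiff g x.
Proof. by move=> h [l hl]; exists l; apply: cderiv_ext hl. Qed.
Lemma cdiff_const a x : cdiff (fun _ => a) x.
Proof. by exists (RtoC 0); exact: cderiv_const. Qed.
Lemma cdiff_id x : cdiff (fun w => w) x.
Proof. by exists (RtoC 1); exact: cderiv_id. Qed.
Lemma cdiff_plus f g x : cdiff f x -> cdiff g x -> cdiff (fun w => Cplus (f w) (g w)) x.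
Proof. by move=> [l hl] [m hm]; exists (Cplus l m); exact: cderiv_plus. Qed.
Lemma cdiff_mult f g x : cdiff f x -> cdiff g x -> cdiff (fun w => Cmult (f w) (g w)) x.
Proof. by move=> [l hl] [m hm]; eexists; apply: cderiv_mult; eassumption. Qed.
Lemma cdiff_opp f x : cdiff f x -> cdiff (fun w => Copp (f w)) x.
Proof.
move=> h; apply: (cdiff_ext (fun w => Cmult (RtoC (-1)) (f w))) => [w|].
  by apply: C_eq; rewrite !CE; ring.
by apply: cdiff_mult => //; exact: cdiff_const.
Qed.
Lemma cdiff_minus f g x : cdiff f x -> cdiff g x -> cdiff (fun w => Cminus (f w) (g w)) x.
Proof. by move=> hf hg; apply: cdiff_plus => //; exact: cdiff_opp. Qed.
Lemma cdiff_inv f x : cdiff f x -> f x <> RtoC 0 -> cdiff (fun w => Cinv (f w)) x.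
Proof. by move=> [l hl] h; eexists; apply: cderiv_inv; eassumption. Qed.
Lemma cdiff_div f g x : cdiff f x -> cdiff g x -> g x <> RtoC 0 ->
  cdiff (fun w => Cdiv (f w) (g w)) x.
Proof. by move=> hf hg h; apply: cdiff_mult => //; exact: cdiff_inv. Qed.
Lemma cdiff_comp_scal f (a x : C) : cdiff f (Cmult a x) -> cdiff (fun w => f (Cmult a w)) x.
Proof. by move=> [l hl]; exists (Cmult l a); exact: cderiv_comp_scal. Qed.
Lemma cdiff_csum (T : finType) (f : T -> C -> C) x :
  (forall i, cdiff (f i) x) -> cdiff (fun w => csum (fun i => f i w)) x.
Proof.
move=> h; have [l hl] := choice (fun i l => cderiv (f i) x l) h.
by exists (csum l); exact: cderiv_csum.
Qed.

Definition vdiff (n : nat) (c : C -> Cn n) (x : C) : Prop := forall j, cdiff (fun w => c w j) x.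
Arguments vdiff {n}.

(** * Holomorphic curves in several variables *)

Section Curves.
Variable n : nat.
Implicit Types (c : C -> Cn n) (x : C).

Lemma vdiff_add c1 c2 x : vdiff c1 x -> vdiff c2 x -> vdiff (fun w => vadd (c1 w) (c2 w)) x.
Proof. by move=> h1 h2 j; apply: cdiff_plus. Qed.
Lemma vdiff_sub c1 c2 x : vdiff c1 x -> vdiff c2 x -> vdiff (fun w => vsub (c1 w) (c2 w)) x.
Proof. by move=> h1 h2 j; apply: cdiff_minus. Qed.
Lemma vdiff_scal f c x : cdiff f x -> vdiff c x -> vdiff (fun w => vscal (f w) (c w)) x.
Proof. by move=> h1 h2 j; apply: cdiff_mult. Qed.
Lemma vdiff_const (u : Cn n) x : vdiff (fun _ => u) x.
Proof. by move=> j; exact: cdiff_const. Qed.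
Lemma cdiff_lin a c x : vdiff c x -> cdiff (fun w => lin a (c w)) x.
Proof. by move=> h; apply: cdiff_csum => j; apply: cdiff_mult => //; exact: cdiff_const. Qed.
Lemma cdiff_bil S c1 c2 x : vdiff c1 x -> vdiff c2 x -> cdiff (fun w => bil S (c1 w) (c2 w)) x.
Proof. by move=> h1 h2; apply: cdiff_csum => j; apply: cdiff_mult => //; exact: cdiff_lin. Qed.
Lemma cdiff_tri A c1 c2 c3 x : vdiff c1 x -> vdiff c2 x -> vdiff c3 x ->
  cdiff (fun w => tri A (c1 w) (c2 w) (c3 w)) x.
Proof. by move=> h1 h2 h3; apply: cdiff_csum => j; apply: cdiff_mult => //; exact: cdiff_bil. Qed.
Lemma cderiv_lin a c x (v : Cn n) :
  (forall j, cderiv (fun w => c w j) x (v j)) -> cderiv (fun w => lin a (c w)) x (lin a v).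
Proof.
move=> h; apply: cderiv_csum => j.
have -> : Cmult (a j) (v j) = Cplus (Cmult (RtoC 0) (c x j)) (Cmult (a j) (v j)) by ring.
by apply: (cderiv_mult (fun _ => a j)) => //; exact: cderiv_const.
Qed.

Lemma vderiv_lipschitz c x (v : Cn n) :
  (forall j, cderiv (fun w => c w j) x (v j)) ->
  exists d M, 0 < d /\ 0 <= M /\ forall w, Cmod (Cminus w x) < d ->
    vdist (c w) (c x) <= M * Cmod (Cminus w x).
Proof.
move=> h.
have : exists d, 0 < d /\ forall j w, Cmod (Cminus w x) < d ->
    Cmod (Cminus (c w j) (c x j)) <= (Cmod (v j) + 1) * Cmod (Cminus w x).
  have hj j := cderiv_cont _ _ _ (h j).
  have [d hd] := choice _ hj.
  have [m [hm hmj]] := fin_lower _ d (fun j => proj1 (hd j)).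
  exists m; split=> // j w hw; apply: (proj2 (hd j)); exact: Rlt_le_trans hw (hmj j).
move=> [d [hd hw]]; exists d, (rsum (fun j => Cmod (v j) + 1)); split=> //; split.
  by apply: rsum_ge0 => j; have := Cmod_ge_0 (v j); lra.
move=> w hwd; apply: Rle_trans (vnorm_le_sum _ _) _.
rewrite Rmult_comm -rsumZ; apply: rsum_le => j; rewrite Rmult_comm.
exact: hw.
Qed.

End Curves.
(** * Goursat's theorem for circles *)

Lemma is_derive_eps (f : R -> R) x l : is_derive f x l ->
  forall e, 0 < e -> exists d, 0 < d /\ forall y, Rabs (y - x) < d ->
    Rabs (f y - f x - l * (y - x)) <= e * Rabs (y - x).
Proof.
move=> /is_derive_Reals h e he; have [d hd] := h e he.
exists d; split; first exact: cond_pos.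
move=> y hy; case: (Req_dec y x) => [->|hn].
  by rewrite !Rminus_diag Rmult_0_r Rminus_diag Rabs_R0; lra.
have hn' : y - x <> 0 by lra.
have := hd (y - x) hn' hy; rewrite (_ : x + (y - x) = y); last by ring.
move=> h1.
have -> : f y - f x - l * (y - x) = ((f y - f x) / (y - x) - l) * (y - x) by field.
rewrite Rabs_mult; apply: Rmult_le_compat_r; [exact: Rabs_pos | lra].
Qed.

(** Total differentiability with partial derivatives [a] and [b]. Nothing is asked of their
    continuity, which is the point of Goursat's argument. *)
Definition rdiff2 (P : R -> R -> R) (x y a b : R) : Prop :=
  forall e, 0 < e -> exists d, 0 < d /\ forall x' y', Rabs (x' - x) < d -> Rabs (y' - y) < d ->
    Rabs (P x' y' - P x y - a * (x' - x) - b * (y' - y)) <= e * (Rabs (x' - x) + Rabs (y' - y)).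

Lemma rdiff2_continuous_l P x y a b : rdiff2 P x y a b -> continuous (fun t => P t y) x.
Proof.
move=> h; apply: (ex_derive_continuous (fun t => P t y)); exists a.
apply/is_derive_Reals => e he; have [d [hd h1]] := h (e / 2) ltac:(lra).
exists (mkposreal d hd) => t ht0 /= ht.
have := h1 (x + t) y; rewrite (_ : x + t - x = t); last by ring.
rewrite Rminus_diag Rabs_R0 => h2; have := h2 ht hd.
have -> : P (x + t) y - P x y - a * t - b * 0 = ((P (x + t) y - P x y) / t - a) * t by field.
have tp : 0 < Rabs t by apply: Rabs_pos_lt.
rewrite Rabs_mult => h3.
by apply: (Rmult_lt_reg_r (Rabs t)) => //; nra.
Qed.

Lemma rdiff2_continuous_r P x y a b : rdiff2 P x y a b -> continuous (P x) y.
Proof.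
move=> h; apply: (rdiff2_continuous_l (fun s t => P t s) y x b a) => e he.
have [d [hd h1]] := h e he; exists d; split=> // x' y' hx hy.
have -> : P y' x' - P x y - b * (x' - y) - a * (y' - x) =
  P y' x' - P x y - a * (y' - x) - b * (x' - y) by ring.
by rewrite Rplus_comm; exact: h1.
Qed.

Lemma RInt_near_const (f : R -> R) a b c M : a <= b -> ex_RInt f a b ->
  (forall t, a <= t <= b -> Rabs (f t - c) <= M) ->
  Rabs (RInt f a b - (b - a) * c) <= (b - a) * M.
Proof.
move=> hab hf h.
have hc : ex_RInt (fun _ => c) a b by exact: ex_RInt_const.
have -> : RInt f a b - (b - a) * c = RInt (fun t => minus (f t) c) a b.
  by rewrite RInt_minus // RInt_const.
apply: abs_RInt_le_const => //; exact: ex_RInt_minus.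
Qed.

(** * Vanishing flux through rectangles by repeated bisection *)

Section Green.
Variables (P Q : R -> R -> R) (X Y w v : R).
Hypothesis w_gt0 : 0 < w.
Hypothesis v_gt0 : 0 < v.
Hypothesis hPQ : forall x y, X <= x <= X + w -> Y <= y <= Y + v ->
  exists a b c, rdiff2 P x y a b /\ rdiff2 Q x y c a.

(** The boundary integral whose Green density is [dP/dx - dQ/dy]; [hPQ] gives these two partial
    derivatives the same value [a]. *)
Definition flux x w' y v' := RInt (fun t => Q t y - Q t (y + v')) x (x + w') +
  RInt (fun t => P (x + w') t - P x t) y (y + v').

Let exQ y a b : Y <= y <= Y + v -> X <= a <= X + w -> X <= b <= X + w ->
  ex_RInt (fun t => Q t y) a b.
Proof.
move=> hy ha hb; apply: ex_RInt_continuous => z hz.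
have hz' : X <= z <= X + w.
  by move: hz; rewrite /Rmin /Rmax; case: Rle_dec => _; lra.
have [? [? [? [_ h]]]] := hPQ z y hz' hy; exact: rdiff2_continuous_l h.
Qed.

Let exP x a b : X <= x <= X + w -> Y <= a <= Y + v -> Y <= b <= Y + v ->
  ex_RInt (fun t => P x t) a b.
Proof.
move=> hx ha hb; apply: ex_RInt_continuous => z hz.
have hz' : Y <= z <= Y + v.
  by move: hz; rewrite /Rmin /Rmax; case: Rle_dec => _; lra.
have [? [? [? [h _]]]] := hPQ x z hx hz'; exact: rdiff2_continuous_r h.
Qed.

Let fluxE x w' y v' : 0 <= w' -> 0 <= v' -> X <= x -> x + w' <= X + w -> Y <= y -> y + v' <= Y + v ->
  flux x w' y v' = RInt (fun t => Q t y) x (x + w') - RInt (fun t => Q t (y + v')) x (x + w')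
     + (RInt (fun t => P (x + w') t) y (y + v') - RInt (fun t => P x t) y (y + v')).
Proof.
move=> *; rewrite /flux.
rewrite (RInt_minus (V := R_CompleteNormedModule) (fun t => Q t y) (fun t => Q t (y + v')));
  try (apply: exQ; lra).
rewrite (RInt_minus (V := R_CompleteNormedModule) (fun t => P (x + w') t) (fun t => P x t));
  try (apply: exP; lra).
by [].
Qed.

Let chaslesQ y a b c : Y <= y <= Y + v -> X <= a <= X + w -> X <= b <= X + w -> X <= c <= X + w ->
  RInt (fun t => Q t y) a c = RInt (fun t => Q t y) a b + RInt (fun t => Q t y) b c.
Proof. by move=> *; rewrite -(RInt_Chasles (fun t => Q t y) a b c) //; apply: exQ. Qed.

Let chaslesP x a b c : X <= x <= X + w -> Y <= a <= Y + v -> Y <= b <= Y + v -> Y <= c <= Y + v ->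
  RInt (fun t => P x t) a c = RInt (fun t => P x t) a b + RInt (fun t => P x t) b c.
Proof. by move=> *; rewrite -(RInt_Chasles (fun t => P x t) a b c) //; apply: exP. Qed.

Let flux_split x w' y v' : 0 <= w' -> 0 <= v' -> X <= x -> x + (w' + w') <= X + w ->
  Y <= y -> y + (v' + v') <= Y + v ->
  flux x (w' + w') y (v' + v') = flux x w' y v' + flux (x + w') w' y v' +
    (flux x w' (y + v') v' + flux (x + w') w' (y + v') v').
Proof.
move=> *; rewrite !fluxE; try lra.
have -> : x + w' + w' = x + (w' + w') by ring.
have -> : y + v' + v' = y + (v' + v') by ring.
rewrite (chaslesQ y x (x + w') (x + (w' + w'))); try lra.
rewrite (chaslesQ (y + (v' + v')) x (x + w') (x + (w' + w'))); try lra.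
rewrite (chaslesP x y (y + v') (y + (v' + v'))); try lra.
rewrite (chaslesP (x + (w' + w')) y (y + v') (y + (v' + v'))); try lra.
Qed.

(** The linear part of [Q] contributes [- a v' w'] along the horizontal sides and that of [P]
    contributes [a w' v'] along the vertical ones. They cancel, and only the first-order remainders
    are left. *)
Let flux_small x y w' v' x0 y0 a b c e d : rdiff2 P x0 y0 a b -> rdiff2 Q x0 y0 c a ->
  (forall x' y', Rabs (x' - x0) < d -> Rabs (y' - y0) < d ->
    Rabs (P x' y' - P x0 y0 - a * (x' - x0) - b * (y' - y0)) <= e * (Rabs (x' - x0) + Rabs (y' - y0))) ->
  (forall x' y', Rabs (x' - x0) < d -> Rabs (y' - y0) < d ->
    Rabs (Q x' y' - Q x0 y0 - c * (x' - x0) - a * (y' - y0)) <= e * (Rabs (x' - x0) + Rabs (y' - y0))) ->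
  0 < e -> 0 <= w' < d -> 0 <= v' < d -> X <= x -> x + w' <= X + w -> Y <= y -> y + v' <= Y + v ->
  x <= x0 <= x + w' -> y <= y0 <= y + v' ->
  Rabs (flux x w' y v') <= 2 * e * ((w' + v') * (w' + v')).
Proof.
move=> _ _ hP hQ he hw' hv' hx1 hx2 hy1 hy2 hx0 hy0.
have abs_in s s0 r u : s0 <= r <= s0 + u -> s0 <= s <= s0 + u -> Rabs (s - r) <= u.
  by move=> *; apply: Rabs_le; lra.
have mP x' y' : x <= x' <= x + w' -> y <= y' <= y + v' ->
    Rabs (P x' y' - P x0 y0 - a * (x' - x0) - b * (y' - y0)) <= e * (w' + v').
  move=> h1 h2; have a1 := abs_in x' x x0 w' hx0 h1; have a2 := abs_in y' y y0 v' hy0 h2.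
  by apply: Rle_trans (hP x' y' ltac:(lra) ltac:(lra)) _; apply: Rmult_le_compat_l; lra.
have mQ x' y' : x <= x' <= x + w' -> y <= y' <= y + v' ->
    Rabs (Q x' y' - Q x0 y0 - c * (x' - x0) - a * (y' - y0)) <= e * (w' + v').
  move=> h1 h2; have a1 := abs_in x' x x0 w' hx0 h1; have a2 := abs_in y' y y0 v' hy0 h2.
  by apply: Rle_trans (hQ x' y' ltac:(lra) ltac:(lra)) _; apply: Rmult_le_compat_l; lra.
have e1 : Rabs (RInt (fun t => Q t y - Q t (y + v')) x (x + w') - (x + w' - x) * (- a * v'))
    <= (x + w' - x) * (2 * (e * (w' + v'))).
  apply: RInt_near_const; first lra.
    by apply: (ex_RInt_minus (V := R_CompleteNormedModule) (fun t => Q t y) (fun t => Q t (y + v'))); apply: exQ; lra.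
  move=> t ht; have m1 := mQ t y ht ltac:(lra); have m2 := mQ t (y + v') ht ltac:(lra).
  set r1 := (X in Rabs X) in m1; set r2 := (X in Rabs X) in m2.
  have -> : Q t y - Q t (y + v') - - a * v' = r1 - r2 by rewrite /r1 /r2; ring.
  move/Rabs_le_between: m1; move/Rabs_le_between: m2 => m2 m1; apply: Rabs_le; lra.
have e2 : Rabs (RInt (fun t => P (x + w') t - P x t) y (y + v') - (y + v' - y) * (a * w'))
    <= (y + v' - y) * (2 * (e * (w' + v'))).
  apply: RInt_near_const; first lra.
    by apply: (ex_RInt_minus (V := R_CompleteNormedModule) (fun t => P (x + w') t) (fun t => P x t)); apply: exP; lra.
  move=> t ht; have m1 := mP (x + w') t ltac:(lra) ht; have m2 := mP x t ltac:(lra) ht.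
  set r1 := (X in Rabs X) in m1; set r2 := (X in Rabs X) in m2.
  have -> : P (x + w') t - P x t - a * w' = r1 - r2 by rewrite /r1 /r2; ring.
  move/Rabs_le_between: m1; move/Rabs_le_between: m2 => m2 m1; apply: Rabs_le; lra.
rewrite /flux.
move/Rabs_le_between: e1; move/Rabs_le_between: e2 => e2 e1.
apply: Rabs_le.
set A := RInt _ _ _ in e1 *; set B := RInt _ _ _ in e2 *.
have k1 : x + w' - x = w' by ring.
have k2 : y + v' - y = v' by ring.
rewrite k1 in e1; rewrite k2 in e2.
split; nra.
Qed.

(* One of the four quarters of a rectangle keeps a quarter of the flux; differentiability at the
   limit point of the nested rectangles makes the flux smaller than that. *)
Lemma flux_eq0 : flux X w Y v = 0.
Proof.
case: (Req_dec (flux X w Y v) 0) => // hn; exfalso.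
pose s k := / 2 ^ k.
have s_gt0 k : 0 < s k by apply: Rinv_0_lt_compat; apply: pow_lt; lra.
have s_S k : s k = s k.+1 + s k.+1.
  by rewrite /s /=; field; apply: pow_nonzero; lra.
pose eta := Rabs (flux X w Y v); have eta_gt0 : 0 < eta by apply: Rabs_pos_lt.
pose good k (p : R * R) := X <= p.1 /\ p.1 + w * s k <= X + w /\ Y <= p.2 /\ p.2 + v * s k <= Y + v /\
  eta * (s k * s k) <= Rabs (flux p.1 (w * s k) p.2 (v * s k)).
(* The goodness of the rectangle is a premise inside the existential, so that [choice] yields a
   total successor function; a bad rectangle keeps its corner. *)
have step : forall (kp : nat * (R * R)), exists p', good kp.1 kp.2 -> good kp.1.+1 p' /\
    kp.2.1 <= p'.1 /\ p'.1 + w * s kp.1.+1 <= kp.2.1 + w * s kp.1 /\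
    kp.2.2 <= p'.2 /\ p'.2 + v * s kp.1.+1 <= kp.2.2 + v * s kp.1.
  move=> [k [x y]] /=.
  case: (classic (good k (x, y))) => [[/= h1 [h2 [h3 [h4 h5]]]]|hng]; last by exists (x, y).
  have sk := s_S k; have sp := s_gt0 k.+1.
  set w' := w * s k.+1; set v' := v * s k.+1.
  have w'0 : 0 < w' by apply: Rmult_lt_0_compat.
  have v'0 : 0 < v' by apply: Rmult_lt_0_compat.
  have ew : w * s k = w' + w' by rewrite sk /w'; ring.
  have ev : v * s k = v' + v' by rewrite sk /v'; ring.
  rewrite ew ev in h2 h4 h5 *.
  rewrite flux_split in h5; try lra.
  have e4 : eta * (s k * s k) = 4 * (eta * (s k.+1 * s k.+1)) by rewrite sk; ring.
  have key : exists x' y', (x' = x \/ x' = x + w') /\ (y' = y \/ y' = y + v') /\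
      eta * (s k.+1 * s k.+1) <= Rabs (flux x' w' y' v').
    apply: NNPP => hno.
    have no x' y' : (x' = x \/ x' = x + w') -> (y' = y \/ y' = y + v') ->
        Rabs (flux x' w' y' v') < eta * (s k.+1 * s k.+1).
      move=> hx' hy'; apply: Rnot_le_lt => hle; apply: hno; exists x', y'; tauto.
    have n1 := no x y ltac:(tauto) ltac:(tauto).
    have n2 := no (x + w') y ltac:(tauto) ltac:(tauto).
    have n3 := no x (y + v') ltac:(tauto) ltac:(tauto).
    have n4 := no (x + w') (y + v') ltac:(tauto) ltac:(tauto).
    have := Rabs_triang (flux x w' y v' + flux (x + w') w' y v') (flux x w' (y + v') v' + flux (x + w') w' (y + v') v').
    have := Rabs_triang (flux x w' y v') (flux (x + w') w' y v').
    have := Rabs_triang (flux x w' (y + v') v') (flux (x + w') w' (y + v') v').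
    lra.
  have [x' [y' [hx' [hy' hb]]]] := key.
  exists (x', y') => _; rewrite /good /=.
  by rewrite -/w' -/v'; case: hx' hb => ->; case: hy' => -> hb; repeat split; lra.
have [nxt hnxt] := choice _ step.
pose p := fix p k := if k is k'.+1 then nxt (k', p k') else (X, Y).
have hp k : good k (p k).
  elim: k => [|k IH] /=; last by have := hnxt (k, p k) IH => -[].
  rewrite /good /s /= Rinv_1 !Rmult_1_r; repeat split; try lra; exact: Rle_refl.
have hstep k : (p k).1 <= (p k.+1).1 /\ (p k.+1).1 + w * s k.+1 <= (p k).1 + w * s k /\
    (p k).2 <= (p k.+1).2 /\ (p k.+1).2 + v * s k.+1 <= (p k).2 + v * s k.
  by have := hnxt (k, p k) (hp k) => -[].
have nested (f : nat -> R) (u : R) : 0 < u -> (forall k, f k <= f k.+1 /\ f k.+1 + u * s k.+1 <= f k + u * s k) ->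
    exists x0, forall k, f k <= x0 <= f k + u * s k.
  move=> u0 hf.
  have inc k j : f k <= f (k + j)%N.
    elim: j => [|j IH]; first by rewrite addn0; lra.
    by rewrite addnS; have := hf (k + j)%N; lra.
  have dec k j : f (k + j)%N + u * s (k + j)%N <= f k + u * s k.
    elim: j => [|j IH]; first by rewrite addn0; lra.
    by rewrite addnS; have := hf (k + j)%N; lra.
  have ub k j : f j <= f k + u * s k.
    have su i : 0 < u * s i by apply: Rmult_lt_0_compat.
    case/orP: (leq_total k j) => hkj.
      by have := dec k (j - k)%N; rewrite subnKC //; have := su j; lra.
    by have := inc j (k - j)%N; rewrite subnKC //; have := su k; lra.
  have bd : bound (fun x => exists k, x = f k).
    by exists (f 0%N + u * s 0%N) => x [k ->]; exact: ub.
  have [x0 [hx1 hx2]] := completeness _ bd (ex_intro _ (f 0%N) (ex_intro _ 0%N erefl)).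
  exists x0 => k; split; first by apply: hx1; exists k.
  by apply: hx2 => x [j ->]; exact: ub.
have [x0 hx0] := nested (fun k => (p k).1) w w_gt0 (fun k => ltac:(have := hstep k; tauto)).
have [y0 hy0] := nested (fun k => (p k).2) v v_gt0 (fun k => ltac:(have := hstep k; tauto)).
have s0 : s 0%N = 1 by rewrite /s /= Rinv_1.
have hxr : X <= x0 <= X + w by have := hx0 0%N; rewrite s0 /=; lra.
have hyr : Y <= y0 <= Y + v by have := hy0 0%N; rewrite s0 /=; lra.
have [a [b [c [hP hQ]]]] := hPQ x0 y0 hxr hyr.
(* With this [e], [flux_small] bounds the flux of the [k]-th rectangle by [eta s_k^2 / 2], half of
   the lower bound kept by the bisection. *)
pose e := eta / (4 * ((w + v) * (w + v))).
have wv : 0 < (w + v) * (w + v) by nra.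
have he : 0 < e by apply: Rdiv_lt_0_compat; lra.
have [d1 [hd1 h1]] := hP e he; have [d2 [hd2 h2]] := hQ e he.
pose d := Rmin d1 d2; have hd : 0 < d by apply: Rmin_pos.
have [k hk] : exists k, (w + v) * s k < d.
  have hd' : 0 < d / (w + v) by apply: Rdiv_lt_0_compat; lra.
  have [N hN] := pow_lt_1_zero (/ 2) ltac:(rewrite Rabs_pos_eq; lra) (d / (w + v)) hd'.
  exists N; have := hN N (le_n _); rewrite pow_inv -/(s N) Rabs_pos_eq; last exact: Rlt_le.
  move=> h; have : (w + v) * s N < (w + v) * (d / (w + v)) by apply: Rmult_lt_compat_l; lra.
  by have -> : (w + v) * (d / (w + v)) = d by field; lra.
have sp := s_gt0 k.
have [g1 [g2 [g3 [g4 g5]]]] := hp k.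
have w'0 : 0 < w * s k by apply: Rmult_lt_0_compat.
have v'0 : 0 < v * s k by apply: Rmult_lt_0_compat.
have := flux_small (p k).1 (p k).2 (w * s k) (v * s k) x0 y0 a b c e d hP hQ.
have L1 := Rmin_l d1 d2; have L2 := Rmin_r d1 d2; rewrite -/d in L1 L2.
move=> /(_ (fun x' y' hx hy => h1 x' y' ltac:(lra) ltac:(lra))).
move=> /(_ (fun x' y' hx hy => h2 x' y' ltac:(lra) ltac:(lra)) he).
have ds : (w + v) * s k = w * s k + v * s k by ring.
move=> /(_ ltac:(lra) ltac:(lra) g1 g2 g3 g4 (hx0 k) (hy0 k)).
have -> : 2 * e * ((w * s k + v * s k) * (w * s k + v * s k)) = eta * (s k * s k) / 2.
  by rewrite /e; field; lra.
have : 0 < eta * (s k * s k) by apply: Rmult_lt_0_compat => //; nra.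
lra.
Qed.
End Green.

(** * Logarithmic polar coordinates and mean values over circles *)

Definition cexp (x y : R) : C := (exp x * cos y, exp x * sin y).

Lemma cexp_add x y h k : cexp (x + h) (y + k) = Cmult (cexp x y) (cexp h k).
Proof.
by apply: C_eq; rewrite !CE /cexp /Re /Im /= exp_plus ?cos_plus ?sin_plus; ring.
Qed.

Lemma Cmod_cexp x y : Cmod (cexp x y) = exp x.
Proof.
rewrite /Cmod /cexp /= -[RHS]sqrt_square; last by apply: Rlt_le; exact: exp_pos.
by congr sqrt; have := sin2_cos2 y; rewrite /Rsqr => h; nra.
Qed.

Lemma cexp_neq0 x y : cexp x y <> RtoC 0.
Proof. by move=> h; have := exp_pos x; rewrite -(Cmod_cexp x y) h Cmod_0; lra. Qed.

Lemma cexp_first_order e : 0 < e -> exists d, 0 < d /\ forall h k, Rabs h < d -> Rabs k < d ->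
  Cmod (Cminus (Cminus (cexp h k) (RtoC 1)) (h, k)) <= e * (Rabs h + Rabs k).
Proof.
move=> he.
have [d1 [hd1 h1]] := is_derive_eps exp 0 1 ltac:(rewrite -exp_0; exact: is_derive_exp) (e / 4) ltac:(lra).
have [d2 [hd2 h2]] := is_derive_eps cos 0 0 ltac:(have := is_derive_cos 0; by rewrite sin_0 Ropp_0) (e / 12) ltac:(lra).
have [d3 [hd3 h3]] := is_derive_eps sin 0 1 ltac:(rewrite -cos_0; exact: is_derive_sin) (e / 12) ltac:(lra).
have [d4 [hd4 h4]] := is_derive_eps exp 0 1 ltac:(rewrite -exp_0; exact: is_derive_exp) 1 ltac:(lra).
pose d := Rmin (Rmin (Rmin d1 d2) (Rmin d3 d4)) (Rmin 1 (e / 8)).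
have hd : 0 < d by repeat apply: Rmin_pos; lra.
have ld : d <= d1 /\ d <= d2 /\ d <= d3 /\ d <= d4 /\ d <= 1 /\ d <= e / 8.
  rewrite /d; have := Rmin_l (Rmin (Rmin d1 d2) (Rmin d3 d4)) (Rmin 1 (e / 8)).
  have := Rmin_r (Rmin (Rmin d1 d2) (Rmin d3 d4)) (Rmin 1 (e / 8)).
  have := Rmin_l (Rmin d1 d2) (Rmin d3 d4); have := Rmin_r (Rmin d1 d2) (Rmin d3 d4).
  have := Rmin_l d1 d2; have := Rmin_r d1 d2; have := Rmin_l d3 d4; have := Rmin_r d3 d4.
  have := Rmin_l 1 (e / 8); have := Rmin_r 1 (e / 8); lra.
exists d; split=> // h k hh hk.
have {h1} := h1 h; have {h2} := h2 k; have {h3} := h3 k; have {h4} := h4 h.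
rewrite !Rminus_0_r exp_0 cos_0 sin_0 !Rminus_0_r !Rmult_1_l Rmult_0_l Rminus_0_r.
move=> /(_ ltac:(lra)) h4 /(_ ltac:(lra)) h3 /(_ ltac:(lra)) h2 /(_ ltac:(lra)) h1.
have a0 := Rabs_pos h; have b0 := Rabs_pos k.
have eh : Rabs (exp h) <= 3.
  have -> : exp h = (exp h - 1 - h) + (1 + h) by ring.
  apply: Rle_trans (Rabs_triang _ _) _; have := Rabs_triang 1 h; rewrite Rabs_R1; lra.
have em : Rabs (exp h - 1) <= e / 4.
  have -> : exp h - 1 = (exp h - 1 - h) + h by ring.
  apply: Rle_trans (Rabs_triang _ _) _; lra.
apply: Rle_trans (Cmod_le_ReIm _) _.
have -> : Re (Cminus (Cminus (cexp h k) (RtoC 1)) (h, k)) = (exp h - 1 - h) + exp h * (cos k - 1).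
  by rewrite !CE /cexp /Re /=; ring.
have -> : Im (Cminus (Cminus (cexp h k) (RtoC 1)) (h, k)) = exp h * (sin k - k) + (exp h - 1) * k.
  by rewrite !CE /cexp /Im /=; ring.
have t1 := Rabs_triang (exp h - 1 - h) (exp h * (cos k - 1)).
have t2 := Rabs_triang (exp h * (sin k - k)) ((exp h - 1) * k).
rewrite !Rabs_mult in t1 t2.
have u1 : Rabs (exp h) * Rabs (cos k - 1) <= 3 * (e / 12 * Rabs k).
  by apply: Rmult_le_compat => //; exact: Rabs_pos.
have u2 : Rabs (exp h) * Rabs (sin k - k) <= 3 * (e / 12 * Rabs k).
  by apply: Rmult_le_compat => //; exact: Rabs_pos.
have u3 : Rabs (exp h - 1) * Rabs k <= e / 4 * Rabs k by apply: Rmult_le_compat_r.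
nra.
Qed.

Lemma cderiv_cexp (U : C -> C) a x y g :
  cderiv U (Cplus a (cexp x y)) g ->
  forall e, 0 < e -> exists d, 0 < d /\ forall x' y', Rabs (x' - x) < d -> Rabs (y' - y) < d ->
  Cmod (Cminus (Cminus (U (Cplus a (cexp x' y'))) (U (Cplus a (cexp x y))))
     (Cmult (Cmult g (cexp x y)) (x' - x, y' - y))) <= e * (Rabs (x' - x) + Rabs (y' - y)).
Proof.
move=> hU e he; have g0 := Cmod_ge_0 g.
set M := exp x; have M0 : 0 < M by exact: exp_pos.
pose e2 := e / (4 * M); have he2 : 0 < e2 by apply: Rdiv_lt_0_compat; lra.
pose e1 := Rmin 1 (e / (2 * (M * (Cmod g + 1)))).
have Mg : 0 < M * (Cmod g + 1) by apply: Rmult_lt_0_compat; lra.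
have he1 : 0 < e1 by apply: Rmin_pos; [lra | apply: Rdiv_lt_0_compat; lra].
have [d1 [hd1 h1]] := cexp_first_order _ he1.
have [d2 [hd2 h2]] := hU _ he2.
exists (Rmin d1 (d2 / (4 * M) / 1)); split.
  by apply: Rmin_pos => //; rewrite Rdiv_1_r; apply: Rdiv_lt_0_compat; lra.
rewrite Rdiv_1_r => x' y' hx hy.
set h := x' - x in hx *; set k := y' - y in hy *.
have {h1} := h1 h k (Rlt_le_trans _ _ _ hx (Rmin_l _ _)) (Rlt_le_trans _ _ _ hy (Rmin_l _ _)).
set r1 := Cminus _ (h, k) => h1.
have hx2 := Rlt_le_trans _ _ _ hx (Rmin_r _ _); have hy2 := Rlt_le_trans _ _ _ hy (Rmin_r _ _).
have eE : cexp x' y' = Cmult (cexp x y) (cexp h k) by rewrite -cexp_add /h /k; congr cexp; ring.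
set D := Cminus (Cplus a (cexp x' y')) (Cplus a (cexp x y)).
have eD : D = Cmult (cexp x y) (Cplus r1 (h, k)) by rewrite /D eE /r1; ring.
set s := Rabs h + Rabs k in h1 *.
have s0 : 0 <= s by rewrite /s; have := Rabs_pos h; have := Rabs_pos k; lra.
have mhk : Cmod (h, k) <= s by exact: Cmod_le_ReIm (h, k).
have e11 : e1 <= 1 := Rmin_l _ _.
have DM : Cmod D <= M * (2 * s).
  rewrite eD Cmod_mult Cmod_cexp -/M; apply: Rmult_le_compat_l; first lra.
  by apply: Rle_trans (Cmod_triangle _ _) _; nra.
have Dd : Cmod D < d2.
  apply: Rle_lt_trans DM _.
  have : s < 2 * (d2 / (4 * M)) by rewrite /s; lra.
  move=> hs; have : M * (2 * s) < M * (2 * (2 * (d2 / (4 * M)))) by apply: Rmult_lt_compat_l; lra.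
  by have -> : M * (2 * (2 * (d2 / (4 * M)))) = d2 by field; lra.
have {h2} := h2 _ Dd; rewrite -/D; set r2 := Cminus _ (Cmult g D) => h2.
have -> : Cminus (Cminus (U (Cplus a (cexp x' y'))) (U (Cplus a (cexp x y))))
     (Cmult (Cmult g (cexp x y)) (h, k)) = Cplus r2 (Cmult (Cmult g (cexp x y)) r1).
  by rewrite /r2 eD; ring.
apply: Rle_trans (Cmod_triangle _ _) _; rewrite !Cmod_mult Cmod_cexp -/M.
have b1 : e2 * Cmod D <= e / 2 * s.
  have : e2 * Cmod D <= e2 * (M * (2 * s)) by apply: Rmult_le_compat_l; lra.
  by have -> : e2 * (M * (2 * s)) = e / 2 * s by rewrite /e2; field; lra.
have b2 : Cmod g * M * Cmod r1 <= e / 2 * s.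
  have e12 : e1 <= e / (2 * (M * (Cmod g + 1))) := Rmin_r _ _.
  have : Cmod g * M * Cmod r1 <= (M * (Cmod g + 1)) * (e / (2 * (M * (Cmod g + 1))) * s).
    apply: Rmult_le_compat; [nra | exact: Cmod_ge_0 | nra |].
    by apply: Rle_trans h1 _; apply: Rmult_le_compat_r.
  by have -> : (M * (Cmod g + 1)) * (e / (2 * (M * (Cmod g + 1))) * s) = e / 2 * s by field; lra.
lra.
Qed.

(** The Cauchy-Riemann equations in the coordinate [x + i y]: the common entry is the [x]-derivative
    of the real part and the [y]-derivative of the imaginary part, as [flux_eq0] requires. *)
Lemma rdiff2_cexp (U : C -> C) a x y g :
  cderiv U (Cplus a (cexp x y)) g ->
  rdiff2 (fun x y => Re (U (Cplus a (cexp x y)))) x y (Re (Cmult g (cexp x y))) (- Im (Cmult g (cexp x y))) /\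
  rdiff2 (fun x y => Im (U (Cplus a (cexp x y)))) x y (Im (Cmult g (cexp x y))) (Re (Cmult g (cexp x y))).
Proof.
move=> hU; set G := Cmult g (cexp x y).
have H := cderiv_cexp U a x y g hU; rewrite -/G in H.
split=> e he; have [d [hd h]] := H e he; exists d; split=> // x' y' hx hy;
  refine (Rle_trans _ _ _ _ (h x' y' hx hy)).
- refine (Rle_trans _ _ _ _ (Cmod_Re _)); apply: Req_le; congr Rabs.
  by rewrite !CE [Re (_, _)]/= [Im (_, _)]/=; ring.
- refine (Rle_trans _ _ _ _ (Cmod_Im _)); apply: Req_le; congr Rabs.
  by rewrite !CE [Re (_, _)]/= [Im (_, _)]/=; ring.
Qed.

(* Goursat's theorem in the logarithmic coordinate [zeta = a + exp (x + i y)]: by periodicity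
   the mean of [U] over the circles centred at [a] does not depend on the radius. *)
Lemma circle_mean_const (U : C -> C) a x1 x2 : x1 < x2 ->
  (forall x y, x1 <= x <= x2 -> cdiff U (Cplus a (cexp x y))) ->
  RInt (fun t => Re (U (Cplus a (cexp x1 t)))) 0 (2 * PI) =
  RInt (fun t => Re (U (Cplus a (cexp x2 t)))) 0 (2 * PI).
Proof.
move=> hx hU; have hpi := PI_RGT_0.
pose P x y := Re (U (Cplus a (cexp x y))); pose Q x y := Im (U (Cplus a (cexp x y))).
have hPQ x y : x1 <= x <= x1 + (x2 - x1) -> 0 <= y <= 0 + 2 * PI ->
    exists a b c, rdiff2 P x y a b /\ rdiff2 Q x y c a.
  move=> hx' hy; have [g hg] := hU x y ltac:(lra).
  have [hP hQ] := rdiff2_cexp U a x y g hg.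
  by do 3 eexists; split; [exact: hP | exact: hQ].
have := flux_eq0 P Q x1 0 (x2 - x1) (2 * PI) ltac:(lra) ltac:(lra) hPQ.
rewrite /flux Rplus_0_l (_ : x1 + (x2 - x1) = x2); last by ring.
have -> : RInt (fun t => Q t 0 - Q t (2 * PI)) x1 x2 = 0.
  rewrite (RInt_ext _ (fun _ => 0)); first by rewrite RInt_const /scal /= /mult /=; ring.
  move=> t _; by rewrite /Q /cexp cos_2PI sin_2PI cos_0 sin_0 Rminus_diag.
rewrite Rplus_0_l.
have ex x : x1 <= x <= x2 -> ex_RInt (P x) 0 (2 * PI).
  move=> hxx; apply: ex_RInt_continuous => z hz.
  have hz' : 0 <= z <= 0 + 2 * PI by move: hz; rewrite /Rmin /Rmax; case: Rle_dec => _; lra.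
  have [? [? [? [h _]]]] := hPQ x z ltac:(lra) hz'; exact: rdiff2_continuous_r h.
rewrite (RInt_minus (V := R_CompleteNormedModule) (P x2) (P x1)); try (apply: ex; lra).
by rewrite /minus /plus /opp /= -/(P x1) -/(P x2) => h; have : RInt (P x2) 0 (2 * PI) = RInt (P x1) 0 (2 * PI); [lra | move=> ->].
Qed.

(** The mean of [Re (F z / (z - a))] over circles about [a] does not depend on the radius. It is at
    most [m] on the circle of radius [r] and tends to [Re l] as the radius shrinks, so the
    singularity at [a] need not be removed. *)
Lemma circle_derivative_bound (F : C -> C) a l r m : 0 < r -> F a = RtoC 0 -> cderiv F a l ->
  (forall z, Cmod (Cminus z a) <= r -> cdiff F z) ->
  (forall z, Cmod (Cminus z a) = r -> Re (Cdiv (F z) (Cminus z a)) <= m) ->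
  Re l <= m.
Proof.
move=> hr Fa hl hF hm; have hpi := PI_RGT_0.
pose U z := Cdiv (F z) (Cminus z a).
apply: le_epsilon => e he.
have [d [hd h]] := hl e he.
pose x2 := ln r; have ex2 : exp x2 = r by exact: exp_ln.
pose r1 := Rmin (d / 2) (r / 2); have r1p : 0 < r1 by apply: Rmin_pos; lra.
pose x1 := ln r1; have ex1 : exp x1 = r1 by exact: exp_ln.
have r1d := Rmin_l (d / 2) (r / 2); have r1r := Rmin_r (d / 2) (r / 2); rewrite -/r1 in r1d r1r.
have h12 : x1 < x2 by apply: ln_increasing; lra.
have eza x y : Cminus (Cplus a (cexp x y)) a = cexp x y by ring.
have hU x y : x1 <= x <= x2 -> cdiff U (Cplus a (cexp x y)).
  move=> hx; apply: cdiff_div; last by rewrite eza; exact: cexp_neq0.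
    apply: hF; rewrite eza Cmod_cexp -ex2; case: (proj2 hx) => [hlt|->]; last exact: Rle_refl.
    by apply: Rlt_le; exact: exp_increasing.
  by apply: cdiff_minus; [exact: cdiff_id | exact: cdiff_const].
have ex x : x1 <= x <= x2 -> ex_RInt (fun t => Re (U (Cplus a (cexp x t)))) 0 (2 * PI).
  move=> hx; apply: ex_RInt_continuous => t _.
  have [g hg] := hU x t hx; have [h1 _] := rdiff2_cexp U a x t g hg.
  exact: rdiff2_continuous_r h1.
have E := circle_mean_const U a x1 x2 h12 hU.
have low : 2 * PI * (Re l - e) <= RInt (fun t => Re (U (Cplus a (cexp x1 t)))) 0 (2 * PI).
  have -> : 2 * PI * (Re l - e) = RInt (fun _ => Re l - e) 0 (2 * PI).
    by rewrite RInt_const /scal /= /mult /=; ring.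
  apply: RInt_le; [lra | exact: ex_RInt_const | apply: ex; lra |].
  move=> t _; have hz : Cmod (Cminus (Cplus a (cexp x1 t)) a) < d by rewrite eza Cmod_cexp ex1; lra.
  have := h _ hz; rewrite Fa /U eza Cmod_cexp.
  set w := F _; set E1 := cexp x1 t => h1.
  have E10 : E1 <> RtoC 0 by exact: cexp_neq0.
  have -> : Re (Cdiv w E1) = Re l + Re (Cdiv (Cminus (Cminus w (RtoC 0)) (Cmult l E1)) E1).
    by rewrite -Re_plus; congr Re; field.
  have : Cmod (Cdiv (Cminus (Cminus w (RtoC 0)) (Cmult l E1)) E1) <= e.
    rewrite Cmod_div // /E1 Cmod_cexp -/E1; apply: (Rmult_le_reg_r (exp x1)); first exact: exp_pos.
    have -> : Cmod (Cminus (Cminus w (RtoC 0)) (Cmult l E1)) / exp x1 * exp x1 =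
      Cmod (Cminus (Cminus w (RtoC 0)) (Cmult l E1)) by field; have := exp_pos x1; lra.
    done.
  move=> h2; have := Rle_trans _ _ _ (Cmod_Re _) h2; move/Rabs_le_between; lra.
have up : RInt (fun t => Re (U (Cplus a (cexp x2 t)))) 0 (2 * PI) <= 2 * PI * m.
  have -> : 2 * PI * m = RInt (fun _ => m) 0 (2 * PI).
    by rewrite RInt_const /scal /= /mult /=; ring.
  apply: RInt_le; [lra | apply: ex; lra | exact: ex_RInt_const |].
  by move=> t _; apply: hm; rewrite eza Cmod_cexp.
have : 2 * PI * (Re l - e) <= 2 * PI * m by lra.
by move=> h1; have := Rmult_le_reg_l (2 * PI) _ _ ltac:(lra) h1; lra.
Qed.
(** * Compactness and a Schwarz lemma for glued functions *)

(** [phi] need not be increasing: [k <= phi k] is enough to transport any statement valid for large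
    indices. *)
Lemma bounded_subseq (u : nat -> R) M : (forall k, Rabs (u k) <= M) ->
  exists (phi : nat -> nat) l, (forall k, (k <= phi k)%N) /\
    forall e, 0 < e -> exists N, forall k, (N <= k)%N -> Rabs (u (phi k) - l) < e.
Proof.
move=> hM.
have hc : compact (fun x => - M <= x <= M) by exact: compact_P3.
have [l hl] := Bolzano_Weierstrass u _ hc (fun k => proj1 (Rabs_le_between _ _) (hM k)).
have hk k : exists p, (k <= p)%N /\ Rabs (u p - l) < / (INR k + 1).
  have hp : 0 < / (INR k + 1) by apply: Rinv_0_lt_compat; have := pos_INR k; lra.
  have hV : neighbourhood (fun x => Rabs (x - l) < / (INR k + 1)) l.
    by exists (mkposreal _ hp) => x.
  by have [p [/leP h1 h2]] := hl _ k hV; exists p.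
have [phi hphi] := choice _ hk.
exists phi, l; split=> [k|e he]; first exact: (proj1 (hphi k)).
have [N [hN1 hN2]] := archimed_cor1 e he.
exists N => k hNk; apply: Rlt_trans (proj2 (hphi k)) _; apply: Rle_lt_trans hN1.
apply: Rinv_le_contravar; first by apply: lt_0_INR.
by have := le_INR _ _ (leP hNk); lra.
Qed.

Lemma bounded_subseq_fin (T : finType) (u : nat -> T -> R) M : (forall k i, Rabs (u k i) <= M) ->
  exists (phi : nat -> nat) (l : T -> R), (forall k, (k <= phi k)%N) /\
    forall e, 0 < e -> exists N, forall k, (N <= k)%N -> forall i, Rabs (u (phi k) i - l i) < e.
Proof.
move=> hM.
have : exists (phi : nat -> nat) (l : T -> R), (forall k, (k <= phi k)%N) /\
    forall e, 0 < e -> exists N, forall k, (N <= k)%N -> forall i, i \in enum T -> Rabs (u (phi k) i - l i) < e.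
  elim: (enum T) => [|i s [phi [l [h1 h2]]]].
    by exists id, (fun _ => 0); split=> // e he; exists 0%N.
  have [psi [m [h3 h4]]] := bounded_subseq (fun k => u (phi k) i) M (fun k => hM _ _).
  exists (fun k => phi (psi k)), (fun j => if j == i then m else l j); split.
    by move=> k; apply: leq_trans (h3 k) (h1 _).
  move=> e he; have [N1 hN1] := h2 e he; have [N2 hN2] := h4 e he.
  exists (maxn N1 N2) => k; rewrite geq_max => /andP[k1 k2] j.
  rewrite inE; case: eqP => [-> _|_ /= hj]; first exact: hN2.
  by apply: hN1 => //; apply: leq_trans k1 (h3 k).
move=> [phi [l [h1 h2]]]; exists phi, l; split=> // e he.
by have [N hN] := h2 e he; exists N => k hk i; apply: hN => //; rewrite mem_enum.
Qed.

Lemma bounded_subseq_Cn (n : nat) (u : nat -> Cn n) M : (forall k, vnorm (u k) <= M) ->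
  exists (phi : nat -> nat) (l : Cn n), (forall k, (k <= phi k)%N) /\
    forall e, 0 < e -> exists N, forall k, (N <= k)%N -> vdist (u (phi k)) l < e.
Proof.
move=> hM.
pose c (z : Cn n) (d : 'I_n * bool) := if d.2 then Im (z d.1) else Re (z d.1).
have hc k d : Rabs (c (u k) d) <= M.
  apply: Rle_trans (hM k); apply: Rle_trans (Cmod_le_vnorm _ _ d.1).
  by rewrite /c; case: d.2; [exact: Cmod_Im | exact: Cmod_Re].
have [phi [l [h1 h2]]] := bounded_subseq_fin _ (fun k => c (u k)) M hc.
exists phi, (fun j => (l (j, false), l (j, true))); split=> // e he.
pose e' := e / 2 / (INR n + 1).
have n0 := pos_INR n.
have he' : 0 < e' by apply: Rdiv_lt_0_compat; lra.
have [N hN] := h2 e' he'; exists N => k hk.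
apply: Rle_lt_trans (vnorm_le_sum _ _) _.
have hj j : Cmod (vsub (u (phi k)) (fun j => (l (j, false), l (j, true))) j) <= 2 * e'.
  apply: Rle_trans (Cmod_le_ReIm _) _; rewrite /vsub !CE [Re (_, _)]/= [Im (_, _)]/=.
  by have /= := hN k hk (j, false); have /= := hN k hk (j, true); rewrite /c /=; lra.
have := rsum_le_const _ _ _ hj; rewrite card_ord => h3; apply: Rle_lt_trans h3 _.
have -> : e = (INR n + 1) * (2 * e') by rewrite /e'; field; lra.
by apply: Rmult_lt_compat_r; lra.
Qed.

Lemma bounded_subseq_C (u : nat -> C) M : (forall k, Cmod (u k) <= M) ->
  exists (phi : nat -> nat) (l : C), (forall k, (k <= phi k)%N) /\
    forall e, 0 < e -> exists N, forall k, (N <= k)%N -> Cmod (Cminus (u (phi k)) l) < e.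
Proof.
move=> hM.
have e1 (w : C) : vnorm (fun _ : 'I_1 => w) = Cmod w.
  by rewrite /vnorm big_ord_recl big_ord0 Rplus_0_r sqrt_square //; exact: Cmod_ge_0.
have [phi [l [h1 h2]]] := bounded_subseq_Cn 1 (fun k _ => u k) M (fun k => ltac:(rewrite e1; exact: hM)).
exists phi, (l ord0); split=> // e he; have [N hN] := h2 e he; exists N => k hk.
have := hN k hk; apply: Rle_lt_trans.
exact: (Cmod_le_vnorm _ (vsub (fun=> u (phi k)) l) ord0).
Qed.

Lemma le_of_lt_eps (x y : R) : (forall e, 0 < e -> x < y + e) -> x <= y.
Proof. by move=> h; apply: le_epsilon => e he; apply: Rlt_le; exact: h. Qed.

Lemma usc_attains_max (T : C -> R) R0 B : 0 < R0 ->
  (forall z, Cmod z <= R0 -> T z <= B) ->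
  (forall z e, Cmod z <= R0 -> 0 < e ->
     exists d, 0 < d /\ forall w, Cmod w <= R0 -> Cmod (Cminus w z) < d -> T w <= T z + e) ->
  exists z0, Cmod z0 <= R0 /\ forall z, Cmod z <= R0 -> T z <= T z0.
Proof.
move=> hR hB husc.
pose E x := exists z, Cmod z <= R0 /\ x = T z.
have bE : bound E by exists B => x [z [hz ->]]; exact: hB.
have nE : exists x, E x.
  by exists (T (RtoC 0)), (RtoC 0); rewrite Cmod_0; split=> //; lra.
have [m [hm1 hm2]] := completeness E bE nE.
have hk k : exists z, Cmod z <= R0 /\ m - / (INR k + 1) < T z.
  apply: NNPP => hno.
  have hp : 0 < / (INR k + 1) by apply: Rinv_0_lt_compat; have := pos_INR k; lra.
  have : m <= m - / (INR k + 1).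
    apply: hm2 => x [z [hz ->]]; apply: Rnot_lt_le => hlt; apply: hno; by exists z.
  lra.
have [u hu] := choice _ hk.
have [phi [z0 [h1 h2]]] := bounded_subseq_C u R0 (fun k => proj1 (hu k)).
have hz0 : Cmod z0 <= R0.
  apply: le_of_lt_eps => e he; have [N hN] := h2 e he.
  have := hN N (leqnn N) => h3; have h4 := proj1 (hu (phi N)).
  have := Cmod_minus_ge z0 (u (phi N)); rewrite Cmod_minus_sym; lra.
exists z0; split=> // z hz; apply: Rle_trans (hm1 _ (ex_intro _ z (conj hz erefl))) _.
apply: le_epsilon => e he.
have [d [hd hw]] := husc z0 (e / 2) hz0 ltac:(lra).
have [N1 hN1] := h2 d hd.
have [N2 [hN2 hN2']] := archimed_cor1 (e / 2) ltac:(lra).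
pose k := maxn N1 N2.
have h3 := hw _ (proj1 (hu (phi k))) (hN1 k (leq_maxl _ _)).
have h4 := proj2 (hu (phi k)).
have h5 : / (INR (phi k) + 1) <= / INR N2.
  apply: Rinv_le_contravar; first by apply: lt_0_INR.
  have := le_INR _ _ (leP (leq_trans (leq_maxr N1 N2) (h1 k))); lra.
lra.
Qed.

Section GluedSchwarz.
Variables (Lam : C -> R) (B mu : R).
Hypothesis Lam_ge0 : forall z, Cmod z < 1 -> 0 <= Lam z.
Hypothesis Lam_le : forall z, Cmod z < 1 -> Lam z <= B.
Hypothesis Lam_usc : forall z e, Cmod z < 1 -> 0 < e ->
  exists d, 0 < d /\ forall w, Cmod w < 1 -> Cmod (Cminus w z) < d -> Lam w <= Lam z + e.
(** A weak form of subharmonicity. Either a holomorphic function touches [Lam] from below at [z], or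
    [z] is a local minimum of height at least 1; in the latter case [Lam / |z|] grows when [z] moves
    towards 0, so that no maximum can sit there. *)
Hypothesis Lam_support : forall z, Cmod z < 1 -> z <> RtoC 0 ->
  (1 <= Lam z /\ exists d, 0 < d /\ forall w, Cmod w < 1 -> Cmod (Cminus w z) < d -> Lam z <= Lam w) \/
  (exists d G, 0 < d /\ G z = RtoC (Lam z) /\
     forall w, Cmod w < 1 -> Cmod (Cminus w z) < d -> cdiff G w /\ Cmod (G w) <= Lam w).
Hypothesis Lam_zero : exists d G, 0 < d /\ G (RtoC 0) = RtoC 0 /\ cderiv G (RtoC 0) (RtoC mu) /\
     forall w, Cmod w < 1 -> Cmod w < d -> cdiff G w /\ Cmod (G w) <= Lam w.
Hypothesis Lam_zero_le : forall e, 0 < e -> exists d, 0 < d /\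
  forall w, Cmod w < 1 -> Cmod w < d -> Lam w <= (mu + e) * Cmod w.

Let B_ge0 : 0 <= B.
Proof.
have h : Cmod (RtoC 0) < 1 by rewrite Cmod_0; lra.
exact: Rle_trans (Lam_ge0 _ h) (Lam_le _ h).
Qed.

(* The perturbation [tau |z|^2] makes interior maxima of [T tau] impossible: there the holomorphic
   minorant [G] of [Lam] would contradict [circle_derivative_bound]. *)
Let T (tau : R) (z : C) : R :=
  if excluded_middle_informative (z = RtoC 0) then mu else Lam z / Cmod z + tau * (Cmod z * Cmod z).

Let T0 tau : T tau (RtoC 0) = mu.
Proof. by rewrite /T; case: excluded_middle_informative. Qed.

Let TN tau z : z <> RtoC 0 -> T tau z = Lam z / Cmod z + tau * (Cmod z * Cmod z).
Proof. by rewrite /T; case: excluded_middle_informative. Qed.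

Let T_near0 tau e : 0 < tau -> 0 < e -> exists d, 0 < d /\ forall w, Cmod w < 1 -> Cmod w < d ->
  T tau w <= mu + e.
Proof.
move=> ht he; have [d [hd h]] := Lam_zero_le (e / 2) ltac:(lra).
exists (Rmin d (Rmin 1 (e / (2 * tau)))); split.
  by repeat apply: Rmin_pos => //; try lra; apply: Rdiv_lt_0_compat; lra.
move=> w hw1 hw; case: (classic (w = RtoC 0)) => [->|hw0]; first by rewrite T0; lra.
have wp : 0 < Cmod w := proj1 (Cmod_gt_0 _) hw0.
have l1 := Rmin_l d (Rmin 1 (e / (2 * tau))); have l2 := Rmin_r d (Rmin 1 (e / (2 * tau))).
have l3 := Rmin_l 1 (e / (2 * tau)); have l4 := Rmin_r 1 (e / (2 * tau)).
rewrite TN //; have h1 := h w hw1 ltac:(lra).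
have : Lam w / Cmod w <= mu + e / 2.
  apply: (Rmult_le_reg_r (Cmod w)) => //.
  by have -> : Lam w / Cmod w * Cmod w = Lam w by field; lra.
have : tau * (Cmod w * Cmod w) <= tau * (e / (2 * tau) * 1).
  by apply: Rmult_le_compat_l; [lra | apply: Rmult_le_compat; lra].
have -> : tau * (e / (2 * tau) * 1) = e / 2 by field; lra.
lra.
Qed.

Let T_usc tau z e : 0 < tau -> Cmod z < 1 -> 0 < e ->
  exists d, 0 < d /\ forall w, Cmod w < 1 -> Cmod (Cminus w z) < d -> T tau w <= T tau z + e.
Proof.
move=> ht hz he; case: (classic (z = RtoC 0)) => [->|hz0].
  have [d [hd h]] := T_near0 tau e ht he; exists d; split=> // w hw.
  by rewrite T0 (_ : Cminus w (RtoC 0) = w); [exact: h | ring].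
have zp : 0 < Cmod z := proj1 (Cmod_gt_0 _) hz0.
set x := Cmod z in zp hz.
have L0 := Lam_ge0 z hz.
pose e1 := e / 4 * x.
have he1 : 0 < e1 by rewrite /e1; nra.
have [d [hd h]] := Lam_usc z e1 hz he1.
(* [A] adds up the rates at which [(Lam z + e1) / |w|] and [tau |w|^2] vary while [|w| >= x / 2]. *)
pose A := (Lam z + e1) / (x * x) * 2 + 2 * tau + 1.
have A0 : 0 < A.
  have : 0 <= (Lam z + e1) / (x * x) by apply: Rlt_le; apply: Rdiv_lt_0_compat; [lra | nra].
  rewrite /A; lra.
exists (Rmin d (Rmin (x / 2) (e / 4 / A))); split.
  by repeat apply: Rmin_pos => //; try lra; repeat apply: Rdiv_lt_0_compat; lra.
move=> w hw1 hw.
have l1 := Rmin_l d (Rmin (x / 2) (e / 4 / A)); have l2 := Rmin_r d (Rmin (x / 2) (e / 4 / A)).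
have l3 := Rmin_l (x / 2) (e / 4 / A); have l4 := Rmin_r (x / 2) (e / 4 / A).
set dl := Cmod (Cminus w z) in hw.
have k1 : x - dl <= Cmod w.
  by have := Cmod_minus_ge z w; rewrite Cmod_minus_sym -/dl -/x; lra.
have k2 : Cmod w <= x + dl.
  by have := Cmod_minus_ge w z; rewrite -/dl -/x; lra.
have wp : 0 < Cmod w by lra.
have hw0 : w <> RtoC 0 by move=> e0; move: wp; rewrite e0 Cmod_0; lra.
rewrite !TN // -/x; have h1 := h w hw1 ltac:(rewrite -/dl; lra).
have d0 : 0 <= dl by exact: Cmod_ge_0.
have dA : dl * A <= e / 4.
  have : dl * A <= e / 4 / A * A by apply: Rmult_le_compat_r; lra.
  by have -> : e / 4 / A * A = e / 4 by field; lra.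
have b1 : Lam w / Cmod w <= (Lam z + e1) / x + dl * ((Lam z + e1) / (x * x) * 2).
  have : Lam w / Cmod w <= (Lam z + e1) / Cmod w.
    by apply: Rmult_le_compat_r => //; apply: Rlt_le; apply: Rinv_0_lt_compat.
  have -> : (Lam z + e1) / x + dl * ((Lam z + e1) / (x * x) * 2) =
     (Lam z + e1) * (/ x + dl * (/ (x * x) * 2)) by field; lra.
  suff : / Cmod w <= / x + dl * (/ (x * x) * 2).
    move=> hs; have : (Lam z + e1) * / Cmod w <= (Lam z + e1) * (/ x + dl * (/ (x * x) * 2)).
      by apply: Rmult_le_compat_l; lra.
    by rewrite /Rdiv; lra.
  apply: (Rmult_le_reg_r (Cmod w * (x * x))); first by apply: Rmult_lt_0_compat; [lra | nra].
  have -> : / Cmod w * (Cmod w * (x * x)) = x * x by field; lra.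
  have -> : (/ x + dl * (/ (x * x) * 2)) * (Cmod w * (x * x)) = Cmod w * x + 2 * dl * Cmod w by field; lra.
  nra.
have b2 : (Lam z + e1) / x = Lam z / x + e / 4 by rewrite /e1; field; lra.
have b3 : tau * (Cmod w * Cmod w) <= tau * (x * x) + dl * (2 * tau).
  have : Cmod w * Cmod w <= x * x + 2 * dl.
    case: (Rle_dec (Cmod w) x) => hle; first by nra.
    have : (Cmod w - x) * (Cmod w + x) <= dl * 2 by apply: Rmult_le_compat; lra.
    lra.
  nra.
have : dl * A = dl * ((Lam z + e1) / (x * x) * 2) + dl * (2 * tau) + dl by rewrite /A; ring.
lra.
Qed.

(** The maximum of [T tau] on the closed disc of radius [R0] is at least its value [mu] at 0. Once
    every interior position of the maximum is excluded, the bound follows from [Lam <= B] on the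
    circle. *)
Let mu_le_circle R0 tau : 0 < R0 < 1 -> 0 < tau < / 4 -> mu <= B / R0 + tau.
Proof.
move=> hR ht.
have [d0 [hd0 h0]] := T_near0 tau 1 ltac:(lra) ltac:(lra).
have bd z : Cmod z <= R0 -> T tau z <= Rabs mu + 1 + B / d0 + tau.
  move=> hz; have B0 := B_ge0; have Bd : 0 <= B / d0.
    by apply: Rmult_le_pos => //; apply: Rlt_le; apply: Rinv_0_lt_compat.
  have am := Rle_abs mu; have am0 := Rabs_pos mu.
  case: (Rlt_le_dec (Cmod z) d0) => hzd.
    by have := h0 z ltac:(lra) hzd; lra.
  have hz0 : z <> RtoC 0 by move=> e0; move: hzd; rewrite e0 Cmod_0; lra.
  rewrite TN //.
  have : Lam z / Cmod z <= B / d0.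
    apply: Rmult_le_compat; [apply: Lam_ge0; lra | | apply: Lam_le; lra |].
      by apply: Rlt_le; apply: Rinv_0_lt_compat; lra.
    by apply: Rinv_le_contravar; lra.
  have : tau * (Cmod z * Cmod z) <= tau * 1 by apply: Rmult_le_compat_l; [lra | have := Cmod_ge_0 z; nra].
  lra.
have usc z e : Cmod z <= R0 -> 0 < e ->
     exists d, 0 < d /\ forall w, Cmod w <= R0 -> Cmod (Cminus w z) < d -> T tau w <= T tau z + e.
  move=> hz he; have [d [hd h]] := T_usc tau z e ltac:(lra) ltac:(lra) he.
  by exists d; split=> // w hw; apply: h; lra.
have [z0 [hz0 hmax]] := usc_attains_max (T tau) R0 _ ltac:(lra) bd usc.
have hmu : mu <= T tau z0.
  by rewrite -(T0 tau); apply: hmax; rewrite Cmod_0; lra.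
case: (classic (z0 = RtoC 0)) => [e0|n0].
  exfalso; have [d [G [hd [G0 [hG h]]]]] := Lam_zero.
  pose r := Rmin d R0 / 2.
  have hm : 0 < Rmin d R0 by apply: Rmin_pos; lra.
  have l1 := Rmin_l d R0; have l2 := Rmin_r d R0.
  have hr : 0 < r by rewrite /r; lra.
  (* A maximum at 0 would make [Re (G z / z)] at most [mu - tau r^2] on a small circle, while its
     mean there is [mu]. *)
  have := circle_derivative_bound G (RtoC 0) (RtoC mu) r (mu - tau * (r * r)) hr G0 hG.
  rewrite Re_RtoC => h1.
  have tr : 0 < tau * (r * r) by apply: Rmult_lt_0_compat; [lra | nra].
  suff : mu <= mu - tau * (r * r) by lra.
  apply: h1 => z; rewrite (_ : Cminus z (RtoC 0) = z); try by ring.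
    by move=> hz; apply: (proj1 (h z _ _)); rewrite /r in hz; lra.
  move=> hz.
  have zn : z <> RtoC 0 by move=> e1; move: hz; rewrite e1 Cmod_0; lra.
  have := hmax z ltac:(rewrite hz /r; lra); rewrite e0 T0 TN // hz => h2.
  apply: Rle_trans (Re_le_Cmod _) _; rewrite Cmod_div // hz.
  have : Cmod (G z) / r <= Lam z / r.
    apply: Rmult_le_compat_r; first by apply: Rlt_le; apply: Rinv_0_lt_compat.
    by apply: (proj2 (h z _ _)); rewrite hz /r; lra.
  lra.
have xp : 0 < Cmod z0 := proj1 (Cmod_gt_0 _) n0.
set x := Cmod z0 in xp hz0.
have e0 := TN tau z0 n0; rewrite -/x in e0.
have L0 := Lam_ge0 z0 ltac:(rewrite -/x; lra).
case: (Req_dec x R0) => hxR.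
  rewrite e0 hxR in hmu; apply: Rle_trans hmu _.
  have : Lam z0 / R0 <= B / R0.
    apply: Rmult_le_compat_r; first by apply: Rlt_le; apply: Rinv_0_lt_compat; lra.
    by apply: Lam_le; rewrite -/x; lra.
  have : tau * (R0 * R0) <= tau * 1 by apply: Rmult_le_compat_l; nra.
  lra.
exfalso.
case: (Lam_support z0 ltac:(rewrite -/x; lra) n0) => [[L1 [d [hd h]]]|[d [G [hd [Gz h]]]]].
  (* At a local minimum of height at least 1, replacing [z0] by [(1 - s) z0] raises [Lam / |z|] by
     at least [s], whereas the loss in [tau |z|^2] is at most [s / 2] because [tau < 1/4]. *)
  pose s := Rmin d 1 / 2.
  have hm : 0 < Rmin d 1 by apply: Rmin_pos; lra.
  have l1 := Rmin_l d 1; have l2 := Rmin_r d 1.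
  have hs : 0 < s <= / 2 by rewrite /s; lra.
  pose w := Cmult (RtoC (1 - s)) z0.
  have hw : Cmod w = (1 - s) * x by rewrite /w Cmod_mult Cmod_R Rabs_pos_eq //; lra.
  have wp : 0 < Cmod w by rewrite hw; apply: Rmult_lt_0_compat; lra.
  have wn : w <> RtoC 0 by move=> e1; move: wp; rewrite e1 Cmod_0; lra.
  have hwx : Cmod w <= x by rewrite hw; nra.
  have hwd : Cmod (Cminus w z0) < d.
    have -> : Cminus w z0 = Cmult (RtoC (- s)) z0.
      by rewrite /w; apply: C_eq; rewrite !CE; ring.
    rewrite Cmod_mult Cmod_R Rabs_Ropp Rabs_pos_eq -/x; last lra.
    have : s * x <= s * 1 by apply: Rmult_le_compat_l; lra.
    rewrite /s; lra.
  have := hmax w ltac:(lra); rewrite e0 TN // hw => h2.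
  have h3 := h w ltac:(lra) hwd.
  have h4 : Lam z0 / ((1 - s) * x) <= Lam w / ((1 - s) * x).
    by apply: Rmult_le_compat_r => //; rewrite -hw; apply: Rlt_le; apply: Rinv_0_lt_compat.
  have h5 : Lam z0 / x + s <= Lam z0 / ((1 - s) * x).
    apply: (Rmult_le_reg_r ((1 - s) * x)); first by rewrite -hw.
    have -> : Lam z0 / ((1 - s) * x) * ((1 - s) * x) = Lam z0 by field; lra.
    have -> : (Lam z0 / x + s) * ((1 - s) * x) = Lam z0 - s * Lam z0 + s * ((1 - s) * x) by field; lra.
    have : s * ((1 - s) * x) <= s * 1 by apply: Rmult_le_compat_l; nra.
    have : s * 1 <= s * Lam z0 by apply: Rmult_le_compat_l; lra.
    lra.
  have : tau * (x * x) - tau * ((1 - s) * x * ((1 - s) * x)) <= / 4 * (2 * s).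
    have -> : tau * (x * x) - tau * ((1 - s) * x * ((1 - s) * x)) = tau * ((x * x) * (2 * s - s * s)) by ring.
    have xx : x * x <= 1 by nra.
    apply: Rmult_le_compat; try lra; first by apply: Rmult_le_pos; nra.
    have : x * x * (2 * s - s * s) <= 1 * (2 * s - s * s) by apply: Rmult_le_compat_r; nra.
    nra.
  lra.
pose r := Rmin d (Rmin x (R0 - x)) / 2.
have hm : 0 < Rmin d (Rmin x (R0 - x)) by repeat apply: Rmin_pos; lra.
have l1 := Rmin_l d (Rmin x (R0 - x)); have l2 := Rmin_r d (Rmin x (R0 - x)).
have l3 := Rmin_l x (R0 - x); have l4 := Rmin_r x (R0 - x).
have hr : 0 < r by rewrite /r; lra.
(* [Re (2 tau conj(z0) (w - z0)) = tau (|w|^2 - |z0|^2 - |w - z0|^2)]: the increment of the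
   perturbation is replaced by a holomorphic term, smaller by exactly [tau r^2] on the circle
   [|w - z0| = r]. The phase [z0 / x] makes [g z0] real. *)
pose g w := Cplus (Cmult (Cdiv z0 (RtoC x)) (Cdiv (G w) w))
   (Cmult (Cmult (RtoC (2 * tau)) (Cconj z0)) (Cminus w z0)).
have zw w : Cmod (Cminus w z0) <= r -> w <> RtoC 0 /\ Cmod w <= x + r.
  move=> hw; have := Cmod_minus_ge z0 w; have := Cmod_minus_ge w z0.
  rewrite (Cmod_minus_sym z0) -/x => k1 k2; split; last lra.
  by move=> e1; rewrite e1 Cmod_0 in k2; rewrite e1 in hw; rewrite /r in hr hw; lra.
have hg w : Cmod (Cminus w z0) <= r -> cdiff g w.
  move=> hw; have [wn wx] := zw w hw.
  apply: cdiff_plus; apply: cdiff_mult; try exact: cdiff_const.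
    apply: cdiff_div => //; last exact: cdiff_id.
    by apply: (proj1 (h w _ _)); rewrite /r in hw wx; lra.
  by apply: cdiff_minus; [exact: cdiff_id | exact: cdiff_const].
have xn : RtoC x <> RtoC 0 by apply: RtoC_neq0; lra.
have gz0 : g z0 = RtoC (Lam z0 / x).
  rewrite /g Gz (_ : Cminus z0 z0 = RtoC 0); last by ring.
  rewrite RtoC_div; last lra.
  by field; split.
have z00 : Cminus z0 z0 = RtoC 0 by ring.
have [gl hgl] := hg z0 ltac:(rewrite z00 Cmod_0; lra).
have hF : cderiv (fun w => Cmult (Cminus w z0) (g w)) z0 (RtoC (Lam z0 / x)).
  have hid : cderiv (fun w => Cminus w z0) z0 (Cplus (RtoC 1) (RtoC 0)).
    by apply: cderiv_plus; [exact: cderiv_id | exact: cderiv_const].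
  have := cderiv_mult _ _ _ _ _ hid hgl.
  rewrite gz0 z00; congr cderiv; ring.
have := circle_derivative_bound _ z0 _ r (Lam z0 / x - tau * (r * r)) hr _ hF.
rewrite Re_RtoC z00 Cmult_0_l => /(_ erefl) h1.
have tr : 0 < tau * (r * r) by apply: Rmult_lt_0_compat; [lra | nra].
suff : Lam z0 / x <= Lam z0 / x - tau * (r * r) by lra.
apply: h1 => w hw.
  by apply: cdiff_mult; [apply: cdiff_minus; [exact: cdiff_id | exact: cdiff_const] | exact: hg].
have [wn wx] := zw w ltac:(lra).
have wd : Cminus w z0 <> RtoC 0 by move=> e1; move: hw; rewrite e1 Cmod_0; lra.
have -> : Cdiv (Cmult (Cminus w z0) (g w)) (Cminus w z0) = g w by field.
have wp : 0 < Cmod w := proj1 (Cmod_gt_0 _) wn.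
have := hmax w ltac:(rewrite /r in wx; lra); rewrite e0 TN // => h2.
rewrite /g Re_plus.
have k1 : Re (Cmult (Cdiv z0 (RtoC x)) (Cdiv (G w) w)) <= Lam w / Cmod w.
  apply: Rle_trans (Re_le_Cmod _) _; rewrite Cmod_mult !Cmod_div // Cmod_R (Rabs_pos_eq x) -/x; last lra.
  have -> : x / x * (Cmod (G w) / Cmod w) = Cmod (G w) / Cmod w by field; lra.
  apply: Rmult_le_compat_r; first by apply: Rlt_le; apply: Rinv_0_lt_compat.
  by apply: (proj2 (h w _ _)); rewrite /r in wx hw; lra.
have k2 : Re (Cmult (Cmult (RtoC (2 * tau)) (Cconj z0)) (Cminus w z0)) =
   tau * (Cmod w * Cmod w - x * x - r * r).
  have r2 : r * r = Cmod (Cminus w z0) * Cmod (Cminus w z0) by rewrite hw.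
  rewrite r2 /x !Cmod_sq !CE; ring.
lra.
Qed.

Lemma glued_schwarz : mu <= B.
Proof.
have B0 := B_ge0.
apply: le_epsilon => e he.
pose t := Rmin (/ 8) (e / 2); have ht : 0 < t by apply: Rmin_pos; lra.
have t1 := Rmin_l (/ 8) (e / 2); have t2 := Rmin_r (/ 8) (e / 2); rewrite -/t in t1 t2.
pose s := e / 2 / (B + 1); have hs : 0 < s by apply: Rdiv_lt_0_compat; lra.
have hR : 0 < / (1 + s) < 1.
  split; first by apply: Rinv_0_lt_compat; lra.
  by rewrite -[X in _ < X]Rinv_1; apply: Rinv_lt_contravar; lra.
have := mu_le_circle (/ (1 + s)) t hR ltac:(lra).
have -> : B / / (1 + s) = B + B * s by field; lra.
have : B * s <= (B + 1) * s by apply: Rmult_le_compat_r; lra.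
have -> : (B + 1) * s = e / 2 by rewrite /s; field; lra.
lra.
Qed.
End GluedSchwarz.
(** * Quadratic equations for a coercive form *)

Section Solver.
Variable n : nat.
Implicit Types (u v w x g : Cn n).

(** The transpose of [L], so that a statement about the form [bil L x] becomes a linear equation for
    the vector [x]. *)
Definition row_act (L : 'I_n -> 'I_n -> C) x : Cn n := fun l => csum (fun j => Cmult (x j) (L j l)).

Lemma bil_row_act L x w : bil L x w = lin (row_act L x) w.
Proof.
transitivity (csum (fun j => csum (fun l => Cmult (Cmult (x j) (L j l)) (w l)))).
  by apply: csum_ext => j; rewrite -csumZ; apply: csum_ext => l; ring.
rewrite csum_exchange; apply: csum_ext => l.
by rewrite (Cmult_comm (row_act L x l)) -csumZ; apply: csum_ext => j; ring.
Qed.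

Lemma row_actD L u v : row_act L (vadd u v) = vadd (row_act L u) (row_act L v).
Proof.
by apply: vext => l; rewrite /row_act /vadd -csumD; apply: csum_ext => j; ring.
Qed.

Lemma row_actZ L a u : row_act L (vscal a u) = vscal a (row_act L u).
Proof.
by apply: vext => l; rewrite /row_act /vscal -csumZ; apply: csum_ext => j; ring.
Qed.

Lemma Re_lin_conj u v : Re (lin u (vconj v)) = rdot u v.
Proof. by rewrite /lin Re_csum; apply: rsum_ext => j; rewrite /vconj !CE; ring. Qed.

(** Multiplying [v] by the conjugate of the value [z] makes the pairing equal to [|z|^2]; the real
    inequality applies to it, and one factor [|z|] is cancelled. *)
Lemma lin_CS u v : Cmod (lin u v) <= vnorm u * vnorm v.
Proof.
set z := lin u v; have z0 := Cmod_ge_0 z.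
have h : Cmod z * Cmod z <= (vnorm u * vnorm v) * Cmod z.
  have -> : Cmod z * Cmod z = Re (lin u (vconj (vscal z (vconj v)))).
    have -> : vconj (vscal z (vconj v)) = vscal (Cconj z) v.
      by rewrite vconjZ; congr vscal; apply: vext => j; rewrite /vconj Cconj_invol.
    by rewrite linZ -/z Cmult_comm Cmod_Cmult_conj Re_RtoC.
  rewrite Re_lin_conj; apply: Rle_trans (Rle_abs _) _; apply: Rle_trans (rdot_CS _ _ _) _.
  by rewrite vnorm_scal vnorm_conj; lra.
case: (Req_dec (Cmod z) 0) => [->|hn].
  by have := vnorm_ge0 _ u; have := vnorm_ge0 _ v; nra.
by apply: (Rmult_le_reg_r (Cmod z)); lra.
Qed.

Lemma row_act_bound L M x : (forall j l, Cmod (L j l) <= M) ->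
  vnorm (row_act L x) <= INR n * (INR n * M) * vnorm x.
Proof.
move=> hM.
have h l : Cmod (row_act L x l) <= INR n * M * vnorm x.
  rewrite (_ : row_act L x l = lin (fun j => L j l) x); first by apply: lin_bound => j.
  by apply: csum_ext => j; ring.
by have := vnorm_le_const _ _ _ h; lra.
Qed.

Variables (L : 'I_n -> 'I_n -> C) (c B : R).
Hypothesis c_gt0 : 0 < c.
Hypothesis L_bound : forall j l, Cmod (L j l) <= B.
Hypothesis L_coercive : forall u, c * (vnorm u * vnorm u) <= Re (bil L u (vconj u)).

(** The maximum with [c] keeps the contraction factor [1 - c^2 / M^2] nonnegative. *)
Let M := Rmax c (INR n * (INR n * B)).

Let row_act_M x : vnorm (row_act L x) <= M * vnorm x.
Proof.
apply: Rle_trans (row_act_bound L B x L_bound) _.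
by apply: Rmult_le_compat_r; [exact: vnorm_ge0 | exact: Rmax_r].
Qed.

(* Richardson iteration contracts the residual because the form is coercive. *)
Lemma approx_solve g eta : 0 < eta <= 1 ->
  exists x, vnorm x <= 2 / c * vnorm g /\ vnorm (vsub g (row_act L x)) <= eta * vnorm g.
Proof.
move=> he; have Mc : c <= M := Rmax_l _ _.
have g0 := vnorm_ge0 _ g.
(* The step length minimizing [1 - 2 theta c + theta^2 M^2], the bound for the squared contraction;
   [rho] is the minimum. *)
pose theta := c / (M * M).
pose rho := 1 - c * c / (M * M).
have MM : 0 < M * M by nra.
have cM : 0 < c * c / (M * M) <= 1.
  split; first by apply: Rdiv_lt_0_compat; nra.
  apply: (Rmult_le_reg_r (M * M)) => //.
  have -> : c * c / (M * M) * (M * M) = c * c by field; lra.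
  nra.
have contr r : let r' := vsub r (vscal (RtoC theta) (row_act L r)) in
    vnorm r' * vnorm r' <= rho * (vnorm r * vnorm r).
  rewrite /= vnorm_sq rdotBl !rdotBr !rdotZl !rdotZr -!vnorm_sq (rdotC _ r (row_act L r)).
  have h1 := L_coercive r; rewrite bil_row_act Re_lin_conj in h1.
  have h2 := row_act_M r; have h3 := vnorm_ge0 _ (row_act L r); have h4 := vnorm_ge0 _ r.
  have t0 : 0 < theta by apply: Rdiv_lt_0_compat; lra.
  have h5 : vnorm (row_act L r) * vnorm (row_act L r) <= (M * M) * (vnorm r * vnorm r).
    have -> : (M * M) * (vnorm r * vnorm r) = (M * vnorm r) * (M * vnorm r) by ring.
    by apply: Rmult_le_compat.
  have h6 : theta * (theta * (vnorm (row_act L r) * vnorm (row_act L r))) <=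
     theta * (theta * ((M * M) * (vnorm r * vnorm r))).
    by apply: Rmult_le_compat_l; [lra | apply: Rmult_le_compat_l; lra].
  have h7 : theta * (theta * ((M * M) * (vnorm r * vnorm r))) = theta * (c * (vnorm r * vnorm r)).
    by rewrite /theta; field; lra.
  have h8 : theta * (c * (vnorm r * vnorm r)) <= theta * rdot (row_act L r) r.
    by apply: Rmult_le_compat_l; lra.
  have -> : rho * (vnorm r * vnorm r) = vnorm r * vnorm r - theta * (c * (vnorm r * vnorm r)).
    by rewrite /rho /theta; field; lra.
  lra.
have iter k : exists x, vnorm (vsub g (row_act L x)) * vnorm (vsub g (row_act L x)) <=
    rho ^ k * (vnorm g * vnorm g).
  elim: k => [|k [x IH]].
    exists vzero; have -> : vsub g (row_act L vzero) = g.
      apply: vext => j; rewrite /vsub /row_act.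
      rewrite (csum_ext _ _ (fun _ => RtoC 0)); first by rewrite csum0; ring.
      by move=> i; rewrite /vzero; ring.
    by rewrite /=; lra.
  exists (vadd x (vscal (RtoC theta) (vsub g (row_act L x)))).
  set r := vsub g (row_act L x) in IH *.
  have -> : vsub g (row_act L (vadd x (vscal (RtoC theta) r))) =
     vsub r (vscal (RtoC theta) (row_act L r)).
    by rewrite row_actD row_actZ; apply: vext => j; rewrite /r /vsub /vadd; ring.
  apply: Rle_trans (contr r) _; rewrite /= Rmult_assoc.
  by apply: Rmult_le_compat_l => //; rewrite /rho; lra.
have [k hk] : exists k, rho ^ k <= eta * eta.
  have hr : Rabs rho < 1 by rewrite Rabs_pos_eq /rho; lra.
  have [N hN] := pow_lt_1_zero rho hr (eta * eta) ltac:(nra).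
  exists N; have := hN N (le_n _); have := Rle_abs (rho ^ N); lra.
have [x hx] := iter k.
have res : vnorm (vsub g (row_act L x)) <= eta * vnorm g.
  have r0 := vnorm_ge0 _ (vsub g (row_act L x)).
  have : rho ^ k * (vnorm g * vnorm g) <= eta * eta * (vnorm g * vnorm g).
    by apply: Rmult_le_compat_r => //; nra.
  have : 0 <= eta * vnorm g by nra.
  nra.
exists x; split=> //.
have x0 := vnorm_ge0 _ x.
have h1 := L_coercive x; rewrite bil_row_act Re_lin_conj in h1.
have h2 : vnorm (row_act L x) <= 2 * vnorm g.
  have -> : row_act L x = vsub g (vsub g (row_act L x)).
    by apply: vext => j; rewrite /vsub; ring.
  by apply: Rle_trans (vnorm_sub_le _ _ _) _; nra.
have h3 := Rle_trans _ _ _ (Rle_abs _) (rdot_CS _ (row_act L x) x).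
have h4 : c * (vnorm x * vnorm x) <= 2 * vnorm g * vnorm x.
  by apply: Rle_trans h1 _; apply: Rle_trans h3 _; apply: Rmult_le_compat_r.
have h5 : c * vnorm x <= 2 * vnorm g.
  case: (Req_dec (vnorm x) 0) => [->|hn]; first by lra.
  by apply: (Rmult_le_reg_r (vnorm x)); lra.
apply: (Rmult_le_reg_l c) => //.
by have -> : c * (2 / c * vnorm g) = 2 * vnorm g by field; lra.
Qed.

Definition quad (Q : 'I_n -> 'I_n -> Cn n) u v : Cn n := fun m => bil (fun j l => Q j l m) u v.

Lemma quad_bound Q K u v : (forall j l m, Cmod (Q j l m) <= K) ->
  vnorm (quad Q u v) <= INR n * (INR n * (INR n * K)) * vnorm u * vnorm v.
Proof.
move=> hK.
have h m : Cmod (quad Q u v m) <= INR n * (INR n * K) * vnorm u * vnorm v.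
  by apply: bil_bound => j l.
by have := vnorm_le_const _ _ _ h; lra.
Qed.

Lemma bil_csum (T : finType) (f : T -> Cn n) (a : T -> C) w :
  bil L (fun m => csum (fun i => Cmult (a i) (f i m))) w = csum (fun i => Cmult (a i) (bil L (f i) w)).
Proof.
transitivity (csum (fun m => csum (fun i => Cmult (a i) (Cmult (f i m) (lin (L m) w))))).
  apply: csum_ext => m; rewrite Cmult_comm -csumZ; apply: csum_ext => i; ring.
by rewrite csum_exchange; apply: csum_ext => i; rewrite -csumZ.
Qed.

(** One linear system per pair of basis vectors, extended bilinearly. Nothing is lost by solving
    only approximately: the error is of third order in the vectors, and its factor [eta] is at the
    caller's disposal while the bound on [Q] does not depend on it. *)
Lemma quad_solve (T : 'I_n -> 'I_n -> 'I_n -> C) K eta : 0 < eta <= 1 ->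
  (forall j l m, Cmod (T j l m) <= K) ->
  exists Q : 'I_n -> 'I_n -> Cn n,
    (forall j l m, Cmod (Q j l m) <= 2 / c * (INR n * K)) /\
    forall u w, Cmod (Cminus (bil L (quad Q u u) w) (tri T u u w)) <=
      INR n * (INR n * (eta * (INR n * K))) * vnorm u * vnorm u * vnorm w.
Proof.
move=> he hK.
have hT j l : vnorm (T j l) <= INR n * K.
  by apply: vnorm_le_const => m.
have [Q hQ] : exists Q : 'I_n * 'I_n -> Cn n, forall jl,
    vnorm (Q jl) <= 2 / c * (INR n * K) /\
    vnorm (vsub (T jl.1 jl.2) (row_act L (Q jl))) <= eta * (INR n * K).
  apply: (choice (fun (jl : 'I_n * 'I_n) (q : Cn n) => vnorm q <= 2 / c * (INR n * K) /\
    vnorm (vsub (T jl.1 jl.2) (row_act L q)) <= eta * (INR n * K))) => -[j l] /=.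
  have [x [h1 h2]] := approx_solve (T j l) eta he.
  have c2 : 0 < 2 / c by apply: Rdiv_lt_0_compat; lra.
  exists x; split; [apply: Rle_trans h1 _ | apply: Rle_trans h2 _];
    apply: Rmult_le_compat_l => //; lra.
exists (fun j l => Q (j, l)); split.
  by move=> j l m; apply: Rle_trans (Cmod_le_vnorm _ _ m) (proj1 (hQ (j, l))).
move=> u w.
pose E j l := vsub (row_act L (Q (j, l))) (T j l).
have -> : Cminus (bil L (quad (fun j l => Q (j, l)) u u) w) (tri T u u w) =
    bil (fun j l => lin (E j l) w) u u.
  have -> : bil L (quad (fun j l => Q (j, l)) u u) w =
      csum (fun j => Cmult (u j) (csum (fun l => Cmult (u l) (bil L (Q (j, l)) w)))).
    transitivity (bil L (fun m => csum (fun j => Cmult (u j) (csum (fun l => Cmult (u l) (Q (j, l) m))))) w).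
      congr bil; apply: vext => m; rewrite /quad /bil; apply: csum_ext => j; congr Cmult.
      by apply: csum_ext => l; exact: Cmult_comm.
    rewrite (bil_csum _ (fun j m => csum (fun l => Cmult (u l) (Q (j, l) m)))).
    by apply: csum_ext => j; rewrite (bil_csum _ (fun l => Q (j, l))).
  rewrite /tri /Cminus (_ : Copp (csum _) = csum (fun j => Copp (Cmult (u j) (bil (T j) u w)))); last first.
    by rewrite (_ : Copp _ = Cmult (RtoC (-1)) (csum (fun j => Cmult (u j) (bil (T j) u w)))); [rewrite -csumZ; apply: csum_ext => j; apply: C_eq; rewrite !CE; ring | apply: C_eq; rewrite !CE; ring].
  rewrite -csumD; apply: csum_ext => j.
  have -> : Cplus (Cmult (u j) (csum (fun l => Cmult (u l) (bil L (Q (j, l)) w)))) (Copp (Cmult (u j) (bil (T j) u w)))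
    = Cmult (u j) (Cplus (csum (fun l => Cmult (u l) (bil L (Q (j, l)) w))) (Cmult (RtoC (-1)) (bil (T j) u w))).
    by apply: C_eq; rewrite !CE; ring.
  congr Cmult; rewrite /bil -csumZ -csumD; apply: csum_ext => l.
  rewrite -/(bil L (Q (j, l)) w) bil_row_act /E.
  have -> : lin (vsub (row_act L (Q (j, l))) (T j l)) w =
      Cminus (lin (row_act L (Q (j, l))) w) (lin (T j l) w).
    rewrite /lin (_ : Cminus _ _ = Cplus (csum (fun i => Cmult (row_act L (Q (j, l)) i) (w i))) (Cmult (RtoC (-1)) (csum (fun i => Cmult (T j l i) (w i))))); last by apply: C_eq; rewrite !CE; ring.
    by rewrite -csumZ -csumD; apply: csum_ext => i; rewrite /vsub; apply: C_eq; rewrite !CE; ring.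
  by apply: C_eq; rewrite !CE; ring.
have h j l : Cmod (lin (E j l) w) <= eta * (INR n * K) * vnorm w.
  apply: Rle_trans (lin_CS _ _) _; apply: Rmult_le_compat_r; first exact: vnorm_ge0.
  by rewrite /E vnorm_opp; exact: (proj2 (hQ (j, l))).
by have := bil_bound _ _ _ u u h; lra.
Qed.

(** If [row_act L x] is nearly [conj a], then [L(x, v)] is nearly the conjugate of [lin a v], so [x]
    is almost [L]-orthogonal to the kernel of [a]. Coercivity keeps [lin a x] away from 0, and [nu]
    is [x] divided by it. *)
Lemma normal_solve (a : Cn n) c0 : 0 < c0 -> c0 <= vnorm a ->
  forall eta, 0 < eta -> exists nu kappa,
    lin a nu = RtoC 1 /\
    vnorm nu <= 16 * (M * M) / (c * c * c0) /\ Cmod kappa <= 8 * (M * M) / (c * (c0 * c0)) /\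
    forall v, Cmod (Cminus (bil L nu (vconj v)) (Cmult kappa (Cconj (lin a v)))) <= eta * vnorm v.
Proof.
move=> hc0 ha eta he; have Mc : c <= M := Rmax_l _ _.
set A := vnorm a in ha *.
have Ap : 0 < A by lra.
have MM : 0 < M * M by nra.
(* The three bounds serve, in this order, to keep [|x| >= A / (2 M)], to spend at most half of the
   coercivity on the residual in [lxb], and to reach the accuracy [eta]. *)
pose e1 := Rmin (/ 2) (Rmin (c / (4 * M)) (eta * (c * (A * A) / (8 * (M * M))) / A)).
have he1 : 0 < e1.
  repeat apply: Rmin_pos; first lra.
    by apply: Rdiv_lt_0_compat; lra.
  apply: Rdiv_lt_0_compat => //; apply: Rmult_lt_0_compat => //.
  by apply: Rdiv_lt_0_compat; [apply: Rmult_lt_0_compat => //; nra | lra].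
have e11 : e1 <= / 2 := Rmin_l _ _.
have e12 : e1 <= c / (4 * M) := Rle_trans _ _ _ (Rmin_r _ _) (Rmin_l _ _).
have e13 : e1 <= eta * (c * (A * A) / (8 * (M * M))) / A := Rle_trans _ _ _ (Rmin_r _ _) (Rmin_r _ _).
have [x [hx hr]] := approx_solve (vconj a) e1 ltac:(lra).
rewrite vnorm_conj -/A in hx hr.
have hl v : Cmod (Cminus (bil L x (vconj v)) (Cconj (lin a v))) <= e1 * A * vnorm v.
  have -> : Cminus (bil L x (vconj v)) (Cconj (lin a v)) =
     Copp (lin (vsub (vconj a) (row_act L x)) (vconj v)).
    rewrite bil_row_act /lin Cconj_csum.
    have -> : csum (fun j => Cmult (vsub (vconj a) (row_act L x) j) (vconj v j)) =
       Cplus (csum (fun i => Cconj (Cmult (a i) (v i)))) (Cmult (RtoC (-1)) (csum (fun j => Cmult (row_act L x j) (vconj v j)))).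
      by rewrite -csumZ -csumD; apply: csum_ext => i; rewrite /vsub /vconj Cconj_mult; apply: C_eq; rewrite !CE; ring.
    by apply: C_eq; rewrite !CE; ring.
  rewrite Cmod_opp; apply: Rle_trans (lin_CS _ _) _; rewrite vnorm_conj.
  by apply: Rmult_le_compat_r => //; exact: vnorm_ge0.
have x0 := vnorm_ge0 _ x.
have bx v : Cmod (bil L x v) <= M * vnorm x * vnorm v.
  rewrite bil_row_act; apply: Rle_trans (lin_CS _ _) _.
  by apply: Rmult_le_compat_r; [exact: vnorm_ge0 | exact: row_act_M].
have laa : lin a (vconj a) = RtoC (A * A).
  apply: C_eq; first by rewrite Re_lin_conj Re_RtoC /A vnorm_sq.
  rewrite /lin Im_csum Im_RtoC -(rsum0 'I_n); apply: rsum_ext => j.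
  by rewrite /vconj !CE; ring.
have x1 : A / (2 * M) <= vnorm x.
  have h1 := hl (vconj a); rewrite laa vnorm_conj -/A in h1.
  have h2 := bx (vconj (vconj a)); rewrite !vnorm_conj -/A in h2.
  have h3 := Cmod_minus_ge (Cconj (RtoC (A * A))) (bil L x (vconj (vconj a))).
  rewrite Cmod_minus_sym Cmod_conj Cmod_R Rabs_pos_eq in h3; last by nra.
  have h4 : A * A <= M * vnorm x * A + e1 * A * A by lra.
  have h5 : e1 * A * A <= / 2 * (A * A) by nra.
  have h6 : / 2 * A <= M * vnorm x by apply: (Rmult_le_reg_r A); lra.
  apply: (Rmult_le_reg_l M); first lra.
  by have -> : M * (A / (2 * M)) = / 2 * A by field; lra.
set lx := lin a x.
have lxb : c * (A * A) / (8 * (M * M)) <= Cmod lx.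
  have h1 := hl x; have h2 := L_coercive x.
  have h3 := Re_le_Cmod (bil L x (vconj x)).
  have h4 := Cmod_minus_ge (bil L x (vconj x)) (Cconj lx); rewrite Cmod_conj in h4.
  have h5 : e1 * A * vnorm x <= c / 2 * (vnorm x * vnorm x).
    have -> : c / 2 * (vnorm x * vnorm x) = (c / 2 * vnorm x) * vnorm x by ring.
    apply: Rmult_le_compat_r => //.
    have : e1 * A <= c / (4 * M) * A by apply: Rmult_le_compat_r; lra.
    have -> : c / (4 * M) * A = c / 2 * (A / (2 * M)) by field; lra.
    have : c / 2 * (A / (2 * M)) <= c / 2 * vnorm x by apply: Rmult_le_compat_l; lra.
    lra.
  have h6 : c / 2 * (A / (2 * M) * (A / (2 * M))) <= c / 2 * (vnorm x * vnorm x).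
    have ap : 0 <= A / (2 * M) by apply: Rlt_le; apply: Rdiv_lt_0_compat; lra.
    by apply: Rmult_le_compat_l; [lra | apply: Rmult_le_compat].
  have -> : c * (A * A) / (8 * (M * M)) = c / 2 * (A / (2 * M) * (A / (2 * M))) by field; lra.
  by rewrite -/lx in h1; lra.
set D := c * (A * A) / (8 * (M * M)) in lxb e13.
have Dp : 0 < D by apply: Rdiv_lt_0_compat; [apply: Rmult_lt_0_compat => //; nra | lra].
have lx0 : lx <> RtoC 0 by move=> e0; move: lxb; rewrite e0 Cmod_0; lra.
have ilx : / Cmod lx <= / D by apply: Rinv_le_contravar; lra.
exists (vscal (Cinv lx) x), (Cinv lx); split; first by rewrite linZ -/lx; field.
have ilx0 : 0 < / Cmod lx by apply: Rinv_0_lt_compat; lra.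
split.
  rewrite vnorm_scal Cmod_inv //.
  have : / Cmod lx * vnorm x <= / D * (2 / c * A) by apply: Rmult_le_compat; lra.
  have -> : / D * (2 / c * A) = 16 * (M * M) / (c * c) * / A by rewrite /D; field; lra.
  move=> h; apply: Rle_trans h _.
  have -> : 16 * (M * M) / (c * c * c0) = 16 * (M * M) / (c * c) * / c0 by field; lra.
  apply: Rmult_le_compat_l; last by apply: Rinv_le_contravar.
  by apply: Rlt_le; apply: Rdiv_lt_0_compat; nra.
split.
  rewrite Cmod_inv //; apply: Rle_trans ilx _.
  have -> : / D = 8 * (M * M) / c * / (A * A) by rewrite /D; field; lra.
  have -> : 8 * (M * M) / (c * (c0 * c0)) = 8 * (M * M) / c * / (c0 * c0) by field; lra.
  apply: Rmult_le_compat_l; first by apply: Rlt_le; apply: Rdiv_lt_0_compat; lra.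
  by apply: Rinv_le_contravar; nra.
move=> v; rewrite bilZl.
have -> : Cminus (Cmult (Cinv lx) (bil L x (vconj v))) (Cmult (Cinv lx) (Cconj (lin a v))) =
   Cmult (Cinv lx) (Cminus (bil L x (vconj v)) (Cconj (lin a v))) by ring.
rewrite Cmod_mult Cmod_inv //.
have v0 := vnorm_ge0 _ v.
have : / Cmod lx * Cmod (Cminus (bil L x (vconj v)) (Cconj (lin a v))) <= / D * (e1 * A * vnorm v).
  by apply: Rmult_le_compat; [lra | exact: Cmod_ge_0 | lra | exact: hl].
move=> h; apply: Rle_trans h _.
have : / D * (e1 * A * vnorm v) <= / D * (eta * D / A * A * vnorm v).
  apply: Rmult_le_compat_l; first by apply: Rlt_le; apply: Rinv_0_lt_compat.
  by apply: Rmult_le_compat_r => //; apply: Rmult_le_compat_r; lra.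
by have -> : / D * (eta * D / A * A * vnorm v) = eta * vnorm v by field; lra.
Qed.
End Solver.
Arguments quad {n}.
Arguments row_act {n}.
(** * Taylor data of a domain *)

Lemma Rpower_pos x a : 0 < Rpower x a.
Proof. exact: exp_pos. Qed.

Lemma Rpower_succ x e : 0 < x -> Rpower x (1 + e) = x * Rpower x e.
Proof. by move=> hx; rewrite Rpower_plus Rpower_1. Qed.

Lemma Rpower_le_exponent x a b : 0 < x <= 1 -> a <= b -> Rpower x b <= Rpower x a.
Proof.
move=> hx hab; rewrite /Rpower.
have : b * ln x <= a * ln x.
  have : ln x <= 0 by rewrite -ln_1; apply: ln_le; lra.
  by move=> h; nra.
by case=> [h|->]; [apply: Rlt_le; exact: exp_increasing | lra].
Qed.

(** Quartic errors are of order [(|h|^2 + s)^2]; as [e <= 1], they disappear in the Taylor remainder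
    of order [1 + e]. *)
Lemma sq_le_Rpower x e : 0 < x <= 1 -> e <= 1 -> x * x <= Rpower x (1 + e).
Proof.
move=> hx he; have -> : x * x = Rpower x (1 + 1) by rewrite Rpower_plus Rpower_1; lra.
by apply: Rpower_le_exponent; lra.
Qed.

Lemma Rpower_scale k x e : 1 <= k -> 0 < x -> e <= 1 -> Rpower (k * x) (1 + e) <= k * k * Rpower x (1 + e).
Proof.
move=> hk hx he; rewrite -Rpower_mult_distr; try lra.
apply: Rmult_le_compat_r; first by apply: Rlt_le; exact: Rpower_pos.
have -> : k * k = Rpower k (1 + 1) by rewrite Rpower_plus Rpower_1; lra.
by apply: Rle_Rpower; lra.
Qed.

Lemma Rpower_small e tau : 0 < e -> 0 < tau ->
  exists x0, 0 < x0 /\ forall x, 0 < x <= x0 -> Rpower x e <= tau.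
Proof.
move=> he ht; exists (Rpower tau (/ e)); split; first exact: Rpower_pos.
move=> x hx; have -> : tau = Rpower (Rpower tau (/ e)) e.
  by rewrite Rpower_mult Rinv_l ?Rpower_1 //; lra.
by apply: Rle_Rpower_l; lra.
Qed.

(** [t^(e - 1)] is nonincreasing since [e <= 1]. This turns an error [sg^(1 + e)] at a point of
    scale [sg >= s] into the relative error [s^e], uniformly along a disc. *)
Lemma Rpower_quotient_le s sg e : 0 < s <= sg -> e <= 1 -> s * Rpower sg e <= sg * Rpower s e.
Proof.
move=> hs he.
have h : Rpower (s * / sg) 1 <= Rpower (s * / sg) e.
  apply: Rpower_le_exponent => //; split.
    by apply: Rmult_lt_0_compat; [lra | apply: Rinv_0_lt_compat; lra].
  by apply: (Rmult_le_reg_r sg); [lra | rewrite Rmult_assoc Rinv_l; lra].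
rewrite Rpower_1 in h; last by apply: Rmult_lt_0_compat; [lra | apply: Rinv_0_lt_compat; lra].
have e1 : Rpower s e = Rpower (s * / sg) e * Rpower sg e.
  rewrite Rpower_mult_distr; try lra; first by congr Rpower; field; lra.
  by apply: Rmult_lt_0_compat; [lra | apply: Rinv_0_lt_compat; lra].
rewrite e1; have p := Rpower_pos sg e.
have : sg * (s * / sg) * Rpower sg e <= sg * Rpower (s * / sg) e * Rpower sg e.
  by apply: Rmult_le_compat_r; [lra | apply: Rmult_le_compat_l; lra].
have -> : sg * (s * / sg) = s by field; lra.
lra.
Qed.

(** [f = O(g)] on [P]. The index will be a pair of a chart and a vector, so that one constant serves
    all charts with the same [M] and [c]. *)
Definition dom (I : Type) (P : I -> Prop) (f g : I -> R) : Prop :=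
  exists C, 0 <= C /\ forall i, P i -> f i <= C * g i.

Section Dom.
Variables (I : Type) (P : I -> Prop).
Implicit Types f g : I -> R.

Lemma dom_refl f : dom I P f f.
Proof. by exists 1; split; [lra | move=> i _; lra]. Qed.
Lemma dom_le f g : (forall i, P i -> f i <= g i) -> dom I P f g.
Proof. by move=> h; exists 1; split; [lra | move=> i hi; have := h i hi; lra]. Qed.
Lemma dom_trans f g h : dom I P f g -> dom I P g h -> dom I P f h.
Proof.
move=> [C [hC h1]] [D [hD h2]]; exists (C * D); split; first nra.
move=> i hi; apply: Rle_trans (h1 i hi) _; rewrite Rmult_assoc.
by apply: Rmult_le_compat_l => //; exact: h2.
Qed.
Lemma dom_weaken f g h : dom I P f g -> (forall i, P i -> g i <= h i) -> dom I P f h.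
Proof. by move=> h1 h2; apply: dom_trans h1 (dom_le _ _ h2). Qed.
Lemma dom_below f f' g : (forall i, P i -> f i <= f' i) -> dom I P f' g -> dom I P f g.
Proof. by move=> h1 h2; apply: dom_trans (dom_le _ _ h1) h2. Qed.
Lemma dom_add f f' g : dom I P f g -> dom I P f' g -> dom I P (fun i => f i + f' i) g.
Proof.
move=> [C [hC h1]] [D [hD h2]]; exists (C + D); split; first lra.
by move=> i hi; have := h1 i hi; have := h2 i hi; lra.
Qed.
Lemma dom_mul f f' g g' : (forall i, P i -> 0 <= f i) -> (forall i, P i -> 0 <= f' i) ->
  dom I P f g -> dom I P f' g' -> dom I P (fun i => f i * f' i) (fun i => g i * g' i).
Proof.
move=> p1 p2 [C [hC h1]] [D [hD h2]]; exists (C * D); split; first nra.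
move=> i hi; have -> : C * D * (g i * g' i) = (C * g i) * (D * g' i) by ring.
by apply: Rmult_le_compat; [exact: p1 | exact: p2 | exact: h1 | exact: h2].
Qed.
Lemma dom_scal k f g : 0 <= k -> dom I P f g -> dom I P (fun i => k * f i) g.
Proof.
move=> hk [C [hC h1]]; exists (k * C); split; first nra.
by move=> i hi; rewrite Rmult_assoc; apply: Rmult_le_compat_l => //; exact: h1.
Qed.
Lemma dom_Cplus (x y : I -> C) g : dom I P (fun i => Cmod (x i)) g ->
  dom I P (fun i => Cmod (y i)) g -> dom I P (fun i => Cmod (Cplus (x i) (y i))) g.
Proof.
move=> h1 h2; apply: dom_below (dom_add _ _ _ h1 h2) => i _; exact: Cmod_triangle.
Qed.
Lemma dom_Cmult (x y : I -> C) g g' : dom I P (fun i => Cmod (x i)) g ->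
  dom I P (fun i => Cmod (y i)) g' -> dom I P (fun i => Cmod (Cmult (x i) (y i))) (fun i => g i * g' i).
Proof.
move=> h1 h2; apply: (dom_below _ (fun i => Cmod (x i) * Cmod (y i))).
  by move=> i _; rewrite Cmod_mult; lra.
by apply: dom_mul => // i _; exact: Cmod_ge_0.
Qed.
Lemma dom_vadd n (x y : I -> Cn n) g : dom I P (fun i => vnorm (x i)) g ->
  dom I P (fun i => vnorm (y i)) g -> dom I P (fun i => vnorm (vadd (x i) (y i))) g.
Proof.
move=> h1 h2; apply: dom_below (dom_add _ _ _ h1 h2) => i _; exact: vnorm_triangle.
Qed.
Lemma dom_vscal n (a : I -> C) (x : I -> Cn n) g g' : dom I P (fun i => Cmod (a i)) g ->
  dom I P (fun i => vnorm (x i)) g' ->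
  dom I P (fun i => vnorm (vscal (a i) (x i))) (fun i => g i * g' i).
Proof.
move=> h1 h2; apply: (dom_below _ (fun i => Cmod (a i) * vnorm (x i))).
  by move=> i _; rewrite vnorm_scal; lra.
by apply: dom_mul => // i _; [exact: Cmod_ge_0 | exact: vnorm_ge0].
Qed.
Lemma dom_form2 (n : nat) (F : I -> Cn n -> Cn n -> C) M (x y : I -> Cn n) g g' : 0 <= M ->
  (forall i u v, P i -> Cmod (F i u v) <= M * vnorm u * vnorm v) ->
  dom I P (fun i => vnorm (x i)) g -> dom I P (fun i => vnorm (y i)) g' ->
  dom I P (fun i => Cmod (F i (x i) (y i))) (fun i => g i * g' i).
Proof.
move=> hM hF h1 h2; apply: (dom_below _ (fun i => M * (vnorm (x i) * vnorm (y i)))).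
  by move=> i hi; rewrite -Rmult_assoc; exact: hF.
by apply: dom_scal => //; apply: dom_mul => // i _; exact: vnorm_ge0.
Qed.
Lemma dom_form3 (n : nat) (F : I -> Cn n -> Cn n -> Cn n -> C) M (x y w : I -> Cn n) g g' g'' : 0 <= M ->
  (forall i u v z, P i -> Cmod (F i u v z) <= M * vnorm u * vnorm v * vnorm z) ->
  dom I P (fun i => vnorm (x i)) g -> dom I P (fun i => vnorm (y i)) g' ->
  dom I P (fun i => vnorm (w i)) g'' ->
  dom I P (fun i => Cmod (F i (x i) (y i) (w i))) (fun i => g i * g' i * g'' i).
Proof.
move=> hM hF h1 h2 h3; apply: (dom_below _ (fun i => M * (vnorm (x i) * vnorm (y i) * vnorm (w i)))).
  by move=> i hi; rewrite -!Rmult_assoc; exact: hF.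
apply: dom_scal => //; apply: dom_mul => //.
- by move=> i _; apply: Rmult_le_pos; exact: vnorm_ge0.
- by move=> i _; exact: vnorm_ge0.
by apply: dom_mul => // i _; exact: vnorm_ge0.
Qed.
End Dom.

(* The Taylor data of a defining function at a point at depth [ch_s]: [ch_a] is its complex
   gradient, [ch_S] and [ch_A] the holomorphic quadratic and cubic parts, [ch_L] the Levi form,
   [ch_T] the mixed cubic part; the quadratic map [ch_Q] and the vector [ch_nu] (almost
   [ch_L]-orthogonal to the complex tangent space) serve to remove [ch_T]. *)
Record chart (n : nat) (M c : R) := Chart {
  ch_s : R;
  ch_a : Cn n;
  ch_S : 'I_n -> 'I_n -> C;
  ch_L : 'I_n -> 'I_n -> C;
  ch_A : 'I_n -> 'I_n -> 'I_n -> C;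
  ch_T : 'I_n -> 'I_n -> 'I_n -> C;
  ch_Q : 'I_n -> 'I_n -> Cn n;
  ch_nu : Cn n;
  ch_kappa : C;
  ch_s_range : 0 < ch_s <= 1;
  ch_a_le : forall u, Cmod (lin ch_a u) <= M * vnorm u;
  ch_S_le : forall u v, Cmod (bil ch_S u v) <= M * vnorm u * vnorm v;
  ch_L_le : forall u v, Cmod (bil ch_L u v) <= M * vnorm u * vnorm v;
  ch_A_le : forall u v w, Cmod (tri ch_A u v w) <= M * vnorm u * vnorm v * vnorm w;
  ch_T_le : forall u v w, Cmod (tri ch_T u v w) <= M * vnorm u * vnorm v * vnorm w;
  ch_Q_le : forall u v, vnorm (quad ch_Q u v) <= M * vnorm u * vnorm v;
  ch_nu_le : vnorm ch_nu <= M;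
  ch_kappa_le : Cmod ch_kappa <= M;
  ch_herm : forall u v, bil ch_L v (vconj u) = Cconj (bil ch_L u (vconj v));
  ch_coercive : forall u, c * (vnorm u * vnorm u) <= Re (bil ch_L u (vconj u));
  ch_solve : forall u w, Cmod (Cminus (bil ch_L (quad ch_Q u u) w) (Cmult (RtoC (/ 2)) (tri ch_T u u w)))
     <= ch_s * vnorm u * vnorm u * vnorm w;
  ch_nu1 : lin ch_a ch_nu = RtoC 1;
  ch_nu2 : forall v, Cmod (Cminus (bil ch_L ch_nu (vconj v)) (Cmult ch_kappa (Cconj (lin ch_a v))))
     <= ch_s * vnorm v }.
Arguments ch_s {n M c}. Arguments ch_a {n M c}. Arguments ch_S {n M c}. Arguments ch_L {n M c}.
Arguments ch_A {n M c}. Arguments ch_T {n M c}. Arguments ch_Q {n M c}. Arguments ch_nu {n M c}.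
Arguments ch_kappa {n M c}.

(** * Removal of the mixed cubic term *)

Section ChartEstimates.
Variables (n : nat) (M c : R).
Hypothesis M_ge0 : 0 <= M.
Implicit Types (ch : chart n M c) (y h : Cn n).

(** Its real part is the pluriharmonic part of the Taylor polynomial without the constant term; it
    serves as the normal coordinate. The factor 2 is there because the real differential is twice
    the real part of the complex one. *)
Definition hol_normal ch h : C :=
  Cplus (Cplus (Cmult (RtoC 2) (lin (ch_a ch) h)) (bil (ch_S ch) h h)) (tri (ch_A ch) h h h).
Definition levi_norm ch h : R := Re (bil (ch_L ch) h (vconj h)).
Definition mixed_cubic ch h : R := Re (tri (ch_T ch) h h (vconj h)).
Definition shear ch h : Cn n := vadd h (quad (ch_Q ch) h h).

Let I : Type := (chart n M c * Cn n)%type.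
Let small (i : I) : Prop := vnorm i.2 <= 1.
Let t (i : I) : R := vnorm i.2.

Let t_ge0 i : 0 <= t i. Proof. exact: vnorm_ge0. Qed.
Let dt : dom I small (fun i => vnorm i.2) t. Proof. exact: dom_refl. Qed.

Let levi_le (i : I) u v : small i -> Cmod (bil (ch_L i.1) u (vconj v)) <= M * vnorm u * vnorm v.
Proof. by move=> _; rewrite -(vnorm_conj _ v); exact: ch_L_le. Qed.

Lemma levi_norm_add ch u v : levi_norm ch (vadd u v) =
  levi_norm ch u + 2 * Re (bil (ch_L ch) v (vconj u)) + levi_norm ch v.
Proof.
rewrite /levi_norm vconjD !bilDl !bilDr !CE (ch_herm _ _ _ ch v u) !CE; ring.
Qed.

Let quad_dom (u v : I -> Cn n) g g' : dom I small (fun i => vnorm (u i)) g ->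
  dom I small (fun i => vnorm (v i)) g' ->
  dom I small (fun i => vnorm (quad (ch_Q i.1) (u i) (v i))) (fun i => g i * g' i).
Proof.
move=> h1 h2; apply: (dom_below _ _ _ (fun i => M * (vnorm (u i) * vnorm (v i)))).
  by move=> i _; rewrite -Rmult_assoc; exact: ch_Q_le.
by apply: dom_scal => //; apply: dom_mul => // i _; exact: vnorm_ge0.
Qed.

Lemma hol_normal_le : exists C, 0 <= C /\ forall ch h, vnorm h <= 1 ->
  Cmod (hol_normal ch h) <= C * vnorm h /\
  Cmod (Cminus (hol_normal ch h) (Cmult (RtoC 2) (lin (ch_a ch) h))) <= C * (vnorm h * vnorm h).
Proof.
have d1 : dom I small (fun i => Cmod (Cminus (hol_normal i.1 i.2) (Cmult (RtoC 2) (lin (ch_a i.1) i.2))))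
    (fun i => t i * t i).
  apply: (dom_below _ _ _ (fun i => Cmod (Cplus (bil (ch_S i.1) i.2 i.2) (tri (ch_A i.1) i.2 i.2 i.2)))).
    by move=> i _; apply: Req_le; congr Cmod; rewrite /hol_normal; ring.
  apply: dom_Cplus.
    by apply: (dom_form2 _ _ _ (fun i => bil (ch_S i.1)) M) => // i u v _; exact: ch_S_le.
  apply: (dom_weaken _ _ _ (fun i => t i * t i * t i)).
    by apply: (dom_form3 _ _ _ (fun i => tri (ch_A i.1)) M) => // i u v w _; exact: ch_A_le.
  by move=> i hi; have := t_ge0 i; rewrite /small -/(t i) in hi; nra.
have d2 : dom I small (fun i => Cmod (hol_normal i.1 i.2)) t.
  apply: (dom_below _ _ _ (fun i => Cmod (Cplus (Cminus (hol_normal i.1 i.2) (Cmult (RtoC 2) (lin (ch_a i.1) i.2)))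
     (Cmult (RtoC 2) (lin (ch_a i.1) i.2))))).
    by move=> i _; apply: Req_le; congr Cmod; ring.
  apply: dom_Cplus.
    by apply: dom_weaken d1 _ => i hi; have := t_ge0 i; rewrite /small -/(t i) in hi; nra.
  exists (2 * M); split; first lra.
  move=> i _; rewrite Cmod_mult Cmod_R Rabs_pos_eq; last lra.
  by have := ch_a_le _ _ _ i.1 i.2; rewrite /t; lra.
have [C1 [hC1 h1]] := d1; have [C2 [hC2 h2]] := d2.
exists (C1 + C2); split; first lra.
move=> ch h hh; have := h1 (ch, h) hh; have := h2 (ch, h) hh; rewrite /t /= => k2 k1.
have := vnorm_ge0 _ h => v0; split; first by nra.
by have : 0 <= C2 * (vnorm h * vnorm h) by [nra]; lra.
Qed.

(** In [L(h + Q(h, h))] the cross term [2 Re L(Q(h, h), h)] is the mixed cubic term up to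
    [2 s |h|^3] by [ch_solve], and [L(Q(h, h), Q(h, h))] is quartic. *)
Lemma shear_le : exists C, 0 <= C /\ forall ch h, vnorm h <= 1 ->
  vnorm (quad (ch_Q ch) h h) <= C * (vnorm h * vnorm h) /\
  Rabs (levi_norm ch (shear ch h) - levi_norm ch h - mixed_cubic ch h) <=
    C * (vnorm h * vnorm h * (vnorm h * vnorm h) + ch_s ch * (vnorm h * vnorm h * vnorm h)).
Proof.
have d1 : dom I small (fun i => vnorm (quad (ch_Q i.1) i.2 i.2)) (fun i => t i * t i) by exact: quad_dom.
have d2 : dom I small (fun i => Rabs (levi_norm i.1 (shear i.1 i.2) - levi_norm i.1 i.2 - mixed_cubic i.1 i.2))
   (fun i => t i * t i * (t i * t i) + ch_s i.1 * (t i * t i * t i)).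
  have d3 : dom I small (fun i => Cmod (bil (ch_L i.1) (quad (ch_Q i.1) i.2 i.2) (vconj (quad (ch_Q i.1) i.2 i.2))))
     (fun i => t i * t i * (t i * t i)).
    by apply: (dom_form2 _ _ _ (fun i u v => bil (ch_L i.1) u (vconj v)) M).
  apply: (dom_below _ _ _ (fun i => 2 * (ch_s i.1 * (t i * t i * t i)) +
      Cmod (bil (ch_L i.1) (quad (ch_Q i.1) i.2 i.2) (vconj (quad (ch_Q i.1) i.2 i.2))))).
    move=> [ch h] _ /=; rewrite /shear levi_norm_add.
    have h1 := ch_solve _ _ _ ch h (vconj h).
    rewrite vnorm_conj in h1; have h2 := Rle_trans _ _ _ (Cmod_Re _) h1.
    rewrite !CE in h2; rewrite /t /mixed_cubic.
    have h3 := Cmod_Re (bil (ch_L ch) (quad (ch_Q ch) h h) (vconj (quad (ch_Q ch) h h))).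
    rewrite /levi_norm /=.
    move/Rabs_le_between: h2; move/Rabs_le_between: h3 => h3 h2.
    apply: Rabs_le; lra.
  apply: dom_add.
    apply: dom_scal; first lra.
    apply: dom_le => i _; have := t_ge0 i; have : 0 <= t i * t i * (t i * t i) by have := t_ge0 i; nra.
    lra.
  apply: dom_weaken d3 _ => i _; have := t_ge0 i; have := ch_s_range _ _ _ i.1 => hs ti.
  have : 0 <= ch_s i.1 * (t i * t i * t i) by apply: Rmult_le_pos; [lra | apply: Rmult_le_pos; nra].
  lra.
have [C1 [hC1 h1]] := d1; have [C2 [hC2 h2]] := d2.
exists (C1 + C2); split; first lra.
move=> ch h hh; have := h1 (ch, h) hh; have := h2 (ch, h) hh; rewrite /t /= => k2 k1.
have v0 := vnorm_ge0 _ h; have hs := ch_s_range _ _ _ ch.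
split; first by have : 0 <= C2 * (vnorm h * vnorm h) by [nra]; lra.
have : 0 <= vnorm h * vnorm h * (vnorm h * vnorm h) + ch_s ch * (vnorm h * vnorm h * vnorm h).
  have : 0 <= vnorm h * vnorm h by nra.
  move=> v2; have : 0 <= vnorm h * vnorm h * vnorm h by nra.
  nra.
nra.
Qed.

(* [unshear] undoes [shear] and then moves along [ch_nu] so as to cancel the quadratic and cubic
   terms of [hol_normal]. *)
Definition unshear_b2 ch y : C :=
  Cminus (lin (ch_a ch) (quad (ch_Q ch) y y)) (Cmult (RtoC (/ 2)) (bil (ch_S ch) y y)).
Definition unshear_x ch y : Cn n :=
  vadd (vscal (RtoC (-1)) (quad (ch_Q ch) y y)) (vscal (unshear_b2 ch y) (ch_nu ch)).
Definition unshear_b3 ch y : C :=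
  Cmult (RtoC (- / 2)) (Cplus (Cplus (bil (ch_S ch) y (unshear_x ch y)) (bil (ch_S ch) (unshear_x ch y) y))
     (tri (ch_A ch) y y y)).
Definition unshear_rem ch y : Cn n := vadd (unshear_x ch y) (vscal (unshear_b3 ch y) (ch_nu ch)).
Definition unshear ch y : Cn n := vadd y (unshear_rem ch y).

(** [b2] is chosen so that [2 lin a x = - S(y, y)] for [x = unshear_x], and [b3] cancels the cubic
    part [S(y, x) + S(x, y) + A(y, y, y)] in the same way, both thanks to [lin a nu = 1]. Every term
    on the right is of order at least four in [y]. *)
Lemma unshear_normalE ch y : let R := unshear_rem ch y in
  Cminus (hol_normal ch (unshear ch y)) (Cmult (RtoC 2) (lin (ch_a ch) y)) =
  Cplus (Cplus (Cmult (unshear_b3 ch y) (Cplus (bil (ch_S ch) y (ch_nu ch)) (bil (ch_S ch) (ch_nu ch) y)))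
     (bil (ch_S ch) R R))
   (Cplus (Cplus (tri (ch_A ch) R (vadd y R) (vadd y R)) (tri (ch_A ch) y R (vadd y R)))
      (tri (ch_A ch) y y R)).
Proof.
set R := unshear_rem ch y; rewrite /= /hol_normal /unshear -/R.
have e1 : Cmult (RtoC 2) (lin (ch_a ch) R) = Copp (Cplus (bil (ch_S ch) y y)
   (Cplus (Cplus (bil (ch_S ch) y (unshear_x ch y)) (bil (ch_S ch) (unshear_x ch y) y)) (tri (ch_A ch) y y y))).
  rewrite /R /unshear_rem {1}/unshear_x !linD !linZ ch_nu1 /unshear_b3 /unshear_b2.
  set q := lin _ (quad _ _ _); set s1 := bil _ y y; set s2 := bil _ y _; set s3 := bil _ _ y; set s4 := tri _ _ _ _.
  by apply: C_eq; rewrite !CE; field.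
have e2 : bil (ch_S ch) y R = Cplus (bil (ch_S ch) y (unshear_x ch y)) (Cmult (unshear_b3 ch y) (bil (ch_S ch) y (ch_nu ch))).
  by rewrite /R /unshear_rem bilDr bilZr.
have e3 : bil (ch_S ch) R y = Cplus (bil (ch_S ch) (unshear_x ch y) y) (Cmult (unshear_b3 ch y) (bil (ch_S ch) (ch_nu ch) y)).
  by rewrite /R /unshear_rem bilDl bilZl.
clearbody R.
rewrite linD !bilDl !bilDr e2 e3 Cmult_plus_distr_l e1 !triDl !triDm !triDr; ring.
Qed.

Let S_form (u v : I -> Cn n) g g' := dom_form2 I small n (fun i => bil (ch_S i.1)) M u v g g' M_ge0
  (fun i u v _ => ch_S_le _ _ _ i.1 u v).
Let A_form (u v w : I -> Cn n) g g' g'' := dom_form3 I small n (fun i => tri (ch_A i.1)) M u v w g g' g'' M_ge0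
  (fun i u v w _ => ch_A_le _ _ _ i.1 u v w).
Let L_form (u v : I -> Cn n) g g' := dom_form2 I small n (fun i u v => bil (ch_L i.1) u (vconj v)) M u v g g' M_ge0
  levi_le.
Let T_le (i : I) u v w : small i -> Cmod (tri (ch_T i.1) u v (vconj w)) <= M * vnorm u * vnorm v * vnorm w.
Proof. by move=> _; rewrite -(vnorm_conj _ w); exact: ch_T_le. Qed.
Let T_form (u v w : I -> Cn n) g g' g'' := dom_form3 I small n (fun i u v w => tri (ch_T i.1) u v (vconj w)) M u v w g g' g'' M_ge0 T_le.

Let t2 (i : I) := t i * t i.
Let t3 (i : I) := t i * t i * t i.
Let t4 (i : I) := t i * t i * (t i * t i).
Let t_le1 i : small i -> t i <= 1. Proof. by []. Qed.
Let t3_t2 i : small i -> t3 i <= t2 i.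
Proof. by move=> /t_le1 h; have := t_ge0 i; rewrite /t3 /t2; nra. Qed.
Let t2_t i : small i -> t2 i <= t i.
Proof. by move=> /t_le1 h; have := t_ge0 i; rewrite /t2; nra. Qed.

Let nu_dom : dom I small (fun i => vnorm (ch_nu i.1)) (fun _ => 1).
Proof. by exists M; split=> // i _; have := ch_nu_le _ _ _ i.1; lra. Qed.

Let q_dom : dom I small (fun i => vnorm (quad (ch_Q i.1) i.2 i.2)) t2.
Proof. exact: quad_dom. Qed.

Let b2_dom : dom I small (fun i => Cmod (unshear_b2 i.1 i.2)) t2.
Proof.
apply: dom_Cplus.
  apply: dom_trans q_dom; exists M; split=> // i _; exact: ch_a_le.
apply: (dom_below _ _ _ (fun i => / 2 * Cmod (bil (ch_S i.1) i.2 i.2))).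
  by move=> i _; rewrite Cmod_opp Cmod_mult Cmod_R Rabs_pos_eq; lra.
apply: dom_scal; [lra | exact: S_form].
Qed.

Let x_dom : dom I small (fun i => vnorm (unshear_x i.1 i.2)) t2.
Proof.
apply: dom_vadd.
  apply: dom_below q_dom => i _; rewrite vnorm_scalR Rabs_Ropp Rabs_R1; lra.
apply: (dom_weaken _ _ _ (fun i => t2 i * 1)); first exact: dom_vscal b2_dom nu_dom.
by move=> i _; lra.
Qed.

Let b3_dom : dom I small (fun i => Cmod (unshear_b3 i.1 i.2)) t3.
Proof.
apply: (dom_below _ _ _ (fun i => / 2 * Cmod (Cplus (Cplus (bil (ch_S i.1) i.2 (unshear_x i.1 i.2))
   (bil (ch_S i.1) (unshear_x i.1 i.2) i.2)) (tri (ch_A i.1) i.2 i.2 i.2)))).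
  by move=> i _; rewrite Cmod_mult Cmod_R Rabs_Ropp Rabs_pos_eq; lra.
apply: dom_scal; first lra.
apply: dom_Cplus; last exact: A_form.
apply: dom_Cplus.
  by apply: dom_weaken (S_form _ _ _ _ dt x_dom) _ => i _; rewrite /t2 /t3; lra.
by apply: dom_weaken (S_form _ _ _ _ x_dom dt) _ => i _; rewrite /t2 /t3; lra.
Qed.

Let b3nu_dom : dom I small (fun i => vnorm (vscal (unshear_b3 i.1 i.2) (ch_nu i.1))) t3.
Proof. by apply: dom_weaken (dom_vscal _ _ _ _ _ _ _ b3_dom nu_dom) _ => i _; lra. Qed.

Let R_dom : dom I small (fun i => vnorm (unshear_rem i.1 i.2)) t2.
Proof. by apply: dom_vadd => //; apply: dom_weaken b3nu_dom t3_t2. Qed.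

Let yR_dom : dom I small (fun i => vnorm (vadd i.2 (unshear_rem i.1 i.2))) t.
Proof. by apply: dom_vadd => //; apply: dom_weaken R_dom t2_t. Qed.

Let normal_dom : dom I small
  (fun i => Cmod (Cminus (hol_normal i.1 (unshear i.1 i.2)) (Cmult (RtoC 2) (lin (ch_a i.1) i.2)))) t4.
Proof.
apply: (dom_below _ _ _ (fun i => let: (ch, y) := i in let R := unshear_rem ch y in Cmod (
  Cplus (Cplus (Cmult (unshear_b3 ch y) (Cplus (bil (ch_S ch) y (ch_nu ch)) (bil (ch_S ch) (ch_nu ch) y)))
     (bil (ch_S ch) R R))
   (Cplus (Cplus (tri (ch_A ch) R (vadd y R) (vadd y R)) (tri (ch_A ch) y R (vadd y R)))
      (tri (ch_A ch) y y R))))).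
  by move=> [ch y] _; rewrite unshear_normalE; exact: Rle_refl.
apply: (dom_below _ _ _ (fun i => Cmod (
  Cplus (Cplus (Cmult (unshear_b3 i.1 i.2) (Cplus (bil (ch_S i.1) i.2 (ch_nu i.1)) (bil (ch_S i.1) (ch_nu i.1) i.2)))
     (bil (ch_S i.1) (unshear_rem i.1 i.2) (unshear_rem i.1 i.2)))
   (Cplus (Cplus (tri (ch_A i.1) (unshear_rem i.1 i.2) (vadd i.2 (unshear_rem i.1 i.2)) (vadd i.2 (unshear_rem i.1 i.2)))
       (tri (ch_A i.1) i.2 (unshear_rem i.1 i.2) (vadd i.2 (unshear_rem i.1 i.2))))
      (tri (ch_A i.1) i.2 i.2 (unshear_rem i.1 i.2)))))).
  by move=> [ch y] _; exact: Rle_refl.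
apply: dom_Cplus; first apply: dom_Cplus.
- apply: (dom_weaken _ _ _ (fun i => t3 i * t i)); last by move=> i _; rewrite /t3 /t4; lra.
  apply: dom_Cmult => //; apply: dom_Cplus.
    by apply: dom_weaken (S_form _ _ _ _ dt nu_dom) _ => i _; lra.
  by apply: dom_weaken (S_form _ _ _ _ nu_dom dt) _ => i _; lra.
- exact: S_form R_dom R_dom.
apply: dom_Cplus; first apply: dom_Cplus.
- by apply: dom_weaken (A_form _ _ _ _ _ _ R_dom yR_dom yR_dom) _ => i _; rewrite /t2 /t4; lra.
- by apply: dom_weaken (A_form _ _ _ _ _ _ dt R_dom yR_dom) _ => i _; rewrite /t2 /t4; lra.
by apply: dom_weaken (A_form _ _ _ _ _ _ dt dt R_dom) _ => i _; rewrite /t2 /t4; lra.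
Qed.

(** The last summand comes from the displacement along [ch_nu]: [L(nu, y)] is a multiple of the
    conjugate of [lin a y] up to [s |y|]. It need not be quartic, but along the model disc [lin a y]
    and [|y|^2] are bounded by the same scale. *)
Let err (i : I) := t4 i + ch_s i.1 * t3 i + t2 i * Cmod (lin (ch_a i.1) i.2).
Let t4_ge0 i : 0 <= t4 i. Proof. by rewrite /t4; have := t_ge0 i; nra. Qed.
Let t3_ge0 i : 0 <= t3 i. Proof. by rewrite /t3; have := t_ge0 i => h; have : 0 <= t i * t i by [nra]; nra. Qed.
Let t2_ge0 i : 0 <= t2 i. Proof. by rewrite /t2; have := t_ge0 i; nra. Qed.
Let st3_ge0 i : 0 <= ch_s i.1 * t3 i.
Proof. by have := ch_s_range _ _ _ i.1; have := t3_ge0 i; nra. Qed.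
Let t2l_ge0 i : 0 <= t2 i * Cmod (lin (ch_a i.1) i.2).
Proof. by have := t2_ge0 i; have := Cmod_ge_0 (lin (ch_a i.1) i.2); nra. Qed.
Let t4_err i : t4 i <= err i. Proof. by rewrite /err; have := st3_ge0 i; have := t2l_ge0 i; lra. Qed.
Let st3_err i : ch_s i.1 * t3 i <= err i. Proof. by rewrite /err; have := t4_ge0 i; have := t2l_ge0 i; lra. Qed.
Let t2l_err i : t2 i * Cmod (lin (ch_a i.1) i.2) <= err i. Proof. by rewrite /err; have := t4_ge0 i; have := st3_ge0 i; lra. Qed.

Let levi_dom : dom I small (fun i => Rabs (levi_norm i.1 (unshear i.1 i.2) + mixed_cubic i.1 (unshear i.1 i.2)
   - levi_norm i.1 i.2)) err.
Proof.
have dR : dom I small (fun i => Cmod (bil (ch_L i.1) (unshear_rem i.1 i.2) (vconj (unshear_rem i.1 i.2)))) err.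
  by apply: dom_weaken (L_form _ _ _ _ R_dom R_dom) _ => i _; exact: t4_err.
have d3 : dom I small (fun i => Cmod (bil (ch_L i.1) (vscal (unshear_b3 i.1 i.2) (ch_nu i.1)) (vconj i.2))) err.
  apply: dom_weaken (L_form _ _ _ _ b3nu_dom dt) _ => i _; apply: Rle_trans (t4_err i).
  by rewrite /t3 /t4; lra.
have d2 : dom I small (fun i => Cmod (bil (ch_L i.1) (vscal (unshear_b2 i.1 i.2) (ch_nu i.1)) (vconj i.2))) err.
  apply: (dom_below _ _ _ (fun i => Cmod (unshear_b2 i.1 i.2) * (M * Cmod (lin (ch_a i.1) i.2) + ch_s i.1 * t i))).
    move=> i _; rewrite bilZl Cmod_mult; apply: Rmult_le_compat_l; first exact: Cmod_ge_0.
    have h1 := ch_nu2 _ _ _ i.1 i.2.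
    have h2 := Cmod_minus_ge (bil (ch_L i.1) (ch_nu i.1) (vconj i.2)) (Cmult (ch_kappa i.1) (Cconj (lin (ch_a i.1) i.2))).
    rewrite (Cmod_mult (ch_kappa _)) Cmod_conj in h2.
    have h3 : Cmod (ch_kappa i.1) * Cmod (lin (ch_a i.1) i.2) <= M * Cmod (lin (ch_a i.1) i.2).
      by apply: Rmult_le_compat_r; [exact: Cmod_ge_0 | exact: ch_kappa_le].
    by rewrite /t; lra.
  have nn i : 0 <= M * Cmod (lin (ch_a i.1) i.2) + ch_s i.1 * t i.
    have := ch_s_range _ _ _ i.1; have := t_ge0 i; have := Cmod_ge_0 (lin (ch_a i.1) i.2); nra.
  apply: (dom_trans _ _ _ (fun i => t2 i * (M * Cmod (lin (ch_a i.1) i.2) + ch_s i.1 * t i))).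
    apply: dom_mul => //; last exact: dom_refl.
    by move=> i _; exact: Cmod_ge_0.
  apply: (dom_below _ _ _ (fun i => M * (t2 i * Cmod (lin (ch_a i.1) i.2)) + ch_s i.1 * t3 i)).
    by move=> i _; rewrite /t2 /t3; lra.
  apply: dom_add; last by apply: dom_le => i _; exact: st3_err.
  by apply: dom_scal => //; apply: dom_le => i _; exact: t2l_err.
have dT : dom I small (fun i => Cmod (Cplus (Cplus (tri (ch_T i.1) (unshear_rem i.1 i.2) (vadd i.2 (unshear_rem i.1 i.2)) (vconj (vadd i.2 (unshear_rem i.1 i.2))))
       (tri (ch_T i.1) i.2 (unshear_rem i.1 i.2) (vconj (vadd i.2 (unshear_rem i.1 i.2)))))
      (tri (ch_T i.1) i.2 i.2 (vconj (unshear_rem i.1 i.2))))) err.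
  apply: dom_Cplus; first apply: dom_Cplus.
  - apply: dom_weaken (T_form _ _ _ _ _ _ R_dom yR_dom yR_dom) _ => i _; apply: Rle_trans (t4_err i).
    by rewrite /t2 /t4; lra.
  - apply: dom_weaken (T_form _ _ _ _ _ _ dt R_dom yR_dom) _ => i _; apply: Rle_trans (t4_err i).
    by rewrite /t2 /t4; lra.
  apply: dom_weaken (T_form _ _ _ _ _ _ dt dt R_dom) _ => i _; apply: Rle_trans (t4_err i).
  by rewrite /t2 /t4; lra.
have ds : dom I small (fun i => ch_s i.1 * t3 i) err by apply: dom_le => i _; exact: st3_err.
apply: (dom_below _ _ _ _ _ _ (dom_add _ _ _ _ _ (dom_add _ _ _ _ _ (dom_scal _ _ 2 _ _ ltac:(lra) ds)
   (dom_scal _ _ 2 _ _ ltac:(lra) (dom_add _ _ _ _ _ d2 d3))) (dom_add _ _ _ _ _ dR dT))) => -[ch y] _ /=.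
rewrite /unshear levi_norm_add.
set R := unshear_rem ch y.
have eT : mixed_cubic ch (vadd y R) = mixed_cubic ch y + Re (Cplus (Cplus (tri (ch_T ch) R (vadd y R) (vconj (vadd y R)))
   (tri (ch_T ch) y R (vconj (vadd y R)))) (tri (ch_T ch) y y (vconj R))).
  by rewrite /mixed_cubic vconjD !triDl !triDm !triDr !CE; ring.
(* The term [- Q(y, y)] of [unshear_x] produces [- L(Q(y, y), y)], whose double cancels the mixed
   cubic term by [ch_solve]. *)
have eL : Re (bil (ch_L ch) R (vconj y)) = - Re (bil (ch_L ch) (quad (ch_Q ch) y y) (vconj y)) +
   Re (bil (ch_L ch) (vscal (unshear_b2 ch y) (ch_nu ch)) (vconj y)) +
   Re (bil (ch_L ch) (vscal (unshear_b3 ch y) (ch_nu ch)) (vconj y)).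
  by rewrite /R /unshear_rem {1}/unshear_x !bilDl (bilZl _ _ (RtoC (-1))) !CE; ring.
rewrite eT eL.
have h1 := ch_solve _ _ _ ch y (vconj y); rewrite vnorm_conj in h1.
have k1 := Rle_trans _ _ _ (Cmod_Re _) h1; rewrite !CE in k1; move/Rabs_le_between: k1 => k1.
have /Rabs_le_between k2 := Cmod_Re (bil (ch_L ch) (vscal (unshear_b2 ch y) (ch_nu ch)) (vconj y)).
have /Rabs_le_between k3 := Cmod_Re (bil (ch_L ch) (vscal (unshear_b3 ch y) (ch_nu ch)) (vconj y)).
have /Rabs_le_between k4 := Cmod_Re (bil (ch_L ch) R (vconj R)).
have /Rabs_le_between k5 := Cmod_Re (Cplus (Cplus (tri (ch_T ch) R (vadd y R) (vconj (vadd y R)))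
   (tri (ch_T ch) y R (vconj (vadd y R)))) (tri (ch_T ch) y y (vconj R))).
move: k5; set a6 := Re (Cplus _ _); set m6 := Cmod (Cplus _ _) => k5.
rewrite /t3 /t /= /mixed_cubic /levi_norm; apply: Rabs_le.
move: k1 k2 k3 k4 k5.
set a1 := Re (bil _ (quad _ _ _) _); set a2 := Re (tri _ y y (vconj y)).
set a3 := Re (bil _ (vscal (unshear_b2 ch y) _) _); set a4 := Re (bil _ (vscal (unshear_b3 ch y) _) _).
set a5 := Re (bil _ R _); set a7 := Re (bil _ y _).
set m3 := Cmod (bil _ (vscal (unshear_b2 ch y) _) _); set m4 := Cmod (bil _ (vscal (unshear_b3 ch y) _) _).
set m5 := Cmod (bil _ R _); set ss := ch_s ch * vnorm y * vnorm y * vnorm y.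
have -> : ch_s ch * (vnorm y * vnorm y * vnorm y) = ss by rewrite /ss; ring.
lra.
Qed.

Lemma unshear_le : exists C, 0 <= C /\ forall ch y, vnorm y <= 1 ->
  vnorm (unshear_rem ch y) <= C * (vnorm y * vnorm y) /\
  Rabs (Re (hol_normal ch (unshear ch y)) + levi_norm ch (unshear ch y) + mixed_cubic ch (unshear ch y)
     - (2 * Re (lin (ch_a ch) y) + levi_norm ch y)) <=
   C * (vnorm y * vnorm y * (vnorm y * vnorm y) + ch_s ch * (vnorm y * vnorm y * vnorm y)
     + vnorm y * vnorm y * Cmod (lin (ch_a ch) y)).
Proof.
have [C1 [hC1 h1]] := R_dom; have [C2 [hC2 h2]] := levi_dom; have [C3 [hC3 h3]] := normal_dom.
exists (C1 + C2 + C3); split; first lra.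
move=> ch y hy.
have k1 := h1 (ch, y) hy; have k2 := h2 (ch, y) hy; have k3 := h3 (ch, y) hy.
have e4 := t4_err (ch, y); have e0 := t4_ge0 (ch, y); have e2 := t2_ge0 (ch, y).
have Ee : err (ch, y) = vnorm y * vnorm y * (vnorm y * vnorm y) + ch_s ch * (vnorm y * vnorm y * vnorm y)
     + vnorm y * vnorm y * Cmod (lin (ch_a ch) y) by [].
rewrite -Ee; have E2 : t2 (ch, y) = vnorm y * vnorm y by [].
rewrite -E2; move: k1 k2 k3; rewrite [(ch, y).1]/= [(ch, y).2]/= => k1 k2 k3.
split; first by nra.
move: (hol_normal ch (unshear ch y)) k3 => HN k3.
have k4 := Rle_trans _ _ _ (Cmod_Re _) k3; rewrite !CE in k4; move/Rabs_le_between: k4 => k4.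
move/Rabs_le_between: k2 => k2.
apply: Rabs_le.
have : C3 * t4 (ch, y) <= C3 * err (ch, y) by apply: Rmult_le_compat_l.
have : 0 <= C1 * err (ch, y) by nra.
lra.
Qed.
End ChartEstimates.
Arguments hol_normal {n M c}. Arguments levi_norm {n M c}. Arguments mixed_cubic {n M c}.
Arguments shear {n M c}. Arguments unshear {n M c}. Arguments unshear_rem {n M c}.
(** * The upper bound in a chart *)

(* The term [- 2 K (Re l)^2] is the price of having added [K |l|^2] to the Levi form, to make it
   positive definite, and [K l^2] to the holomorphic quadratic part. *)
Definition taylor_domain (n : nat) (M c K r e B : R) (ch : chart n M c) (Omega : Cn n -> Prop) (z : Cn n) : Prop :=
  exists rho : Cn n -> R, forall h, vnorm h < r ->
    (Omega (vadd z h) <-> rho h < 0) /\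
    Rabs (rho h - (- ch_s ch + Re (hol_normal ch h) + levi_norm ch h + mixed_cubic ch h
           - 2 * K * (Re (lin (ch_a ch) h) * Re (lin (ch_a ch) h)))) <=
      B * Rpower (vnorm h * vnorm h + ch_s ch) (1 + e).
Arguments taylor_domain {n M c}.

(* The Levi form of [- log (- rho)] for a function [rho] with the Taylor data [ch]. *)
Definition metric_form (n : nat) (M c : R) (ch : chart n M c) (X : Cn n) : R :=
  Cmod (lin (ch_a ch) X) * Cmod (lin (ch_a ch) X) / (ch_s ch * ch_s ch) + levi_norm ch X / ch_s ch.
Arguments metric_form {n M c}.

Section Discs.
Variables (n : nat) (M c : R).
Hypotheses (M_ge0 : 0 <= M) (c_gt0 : 0 < c).
Implicit Types (ch : chart n M c) (X y h z : Cn n).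

Lemma levi_norm_ge ch X : c * (vnorm X * vnorm X) <= levi_norm ch X.
Proof. exact: ch_coercive. Qed.

Lemma levi_norm_ge0 ch X : 0 <= levi_norm ch X.
Proof.
apply: Rle_trans (levi_norm_ge ch X); have := vnorm_ge0 _ X => h.
by apply: Rmult_le_pos; [lra | nra].
Qed.

Lemma metric_form_levi_le ch X : levi_norm ch X <= ch_s ch * metric_form ch X.
Proof.
have hs := ch_s_range _ _ _ ch; have h := levi_norm_ge0 ch X.
rewrite /metric_form; set q := Cmod _ * _.
have -> : ch_s ch * (q / (ch_s ch * ch_s ch) + levi_norm ch X / ch_s ch) = q / ch_s ch + levi_norm ch X.
  by field; lra.
have : 0 <= q / ch_s ch.
  apply: Rmult_le_pos; first by have := Cmod_ge_0 (lin (ch_a ch) X); rewrite /q; nra.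
  by apply: Rlt_le; apply: Rinv_0_lt_compat; lra.
lra.
Qed.

Lemma metric_form_lin_le ch X :
  Cmod (lin (ch_a ch) X) * Cmod (lin (ch_a ch) X) <= ch_s ch * ch_s ch * metric_form ch X.
Proof.
have hs := ch_s_range _ _ _ ch; have h := levi_norm_ge0 ch X.
rewrite /metric_form; set q := Cmod _ * _.
have -> : ch_s ch * ch_s ch * (q / (ch_s ch * ch_s ch) + levi_norm ch X / ch_s ch) = q + ch_s ch * levi_norm ch X.
  by field; lra.
by nra.
Qed.

Lemma metric_form_ge0 ch X : 0 <= metric_form ch X.
Proof.
have hs := ch_s_range _ _ _ ch; have h := Rle_trans _ _ _ (levi_norm_ge0 ch X) (metric_form_levi_le ch X).
by apply: (Rmult_le_reg_l (ch_s ch)); lra.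
Qed.

Lemma metric_form_gt0 ch X : X <> vzero -> 0 < metric_form ch X.
Proof.
move=> hX; have hs := ch_s_range _ _ _ ch.
have X0 : 0 < vnorm X.
  by case: (vnorm_ge0 _ X) => // e; exfalso; apply: hX; apply: vnorm_eq0.
have h := Rle_trans _ _ _ (levi_norm_ge ch X) (metric_form_levi_le ch X).
have h1 : 0 < c * (vnorm X * vnorm X) by apply: Rmult_lt_0_compat => //; nra.
by apply: (Rmult_lt_reg_l (ch_s ch)); lra.
Qed.

Lemma vdiff_quad (Q : 'I_n -> 'I_n -> Cn n) (f g : C -> Cn n) x :
  vdiff f x -> vdiff g x -> vdiff (fun w => quad Q (f w) (g w)) x.
Proof. by move=> hf hg m; apply: (cdiff_bil _ (fun j l => Q j l m)). Qed.

Lemma vdiff_unshear ch (f : C -> Cn n) x : vdiff f x -> vdiff (fun w => unshear ch (f w)) x.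
Proof.
move=> hf; have hq := vdiff_quad (ch_Q ch) f f x hf hf.
have hb2 : cdiff (fun w => unshear_b2 n M c ch (f w)) x.
  apply: cdiff_minus; first exact: cdiff_lin.
  by apply: cdiff_mult; [exact: cdiff_const | exact: cdiff_bil].
have hx : vdiff (fun w => unshear_x n M c ch (f w)) x.
  apply: vdiff_add; first by apply: vdiff_scal => //; exact: cdiff_const.
  by apply: vdiff_scal => //; exact: vdiff_const.
apply: vdiff_add => //; apply: vdiff_add => //; apply: vdiff_scal; last exact: vdiff_const.
apply: cdiff_mult; first exact: cdiff_const.
apply: cdiff_plus; last exact: cdiff_tri.
by apply: cdiff_plus; exact: cdiff_bil.
Qed.

Lemma kobayashi_le (Omega : Cn n -> Prop) z X (alpha : C) (phi : C -> Cn n) (v : Cn n) :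
  (forall w, Cmod w < 1 -> Omega (phi w) /\ vdiff phi w) -> phi (RtoC 0) = z ->
  (forall j, cderiv (fun w => phi w j) (RtoC 0) (v j)) -> (forall j, Cmult alpha (v j) = X j) ->
  Rbar_le (kobayashi Omega z X) (Rbar.Finite (Cmod alpha)).
Proof.
move=> h1 h2 h3 h4; apply: (proj1 (Glb_Rbar_correct _)).
exists alpha, phi, v; split.
  move=> w hw; have [ho hd] := h1 w hw; split=> // j; have [l hl] := hd j.
  by exists l; apply/is_derive_cderiv.
by split=> //; split=> // j; apply/is_derive_cderiv.
Qed.

(** The disc [zeta X / (lam (1 + u zeta))] parametrizes the slice of the model by the complex line
    through 0 in direction [X]. The left side is the model defining function along it, so the right
    side gives its exact margin inside the model. *)
Lemma model_disc_identity (s : R) (u zeta : C) : Cplus (RtoC 1) (Cmult u zeta) <> RtoC 0 ->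
  let d := Cplus (RtoC 1) (Cmult u zeta) in
  - s + 2 * Re (Cmult (RtoC s) (Cdiv (Cmult u zeta) d)) +
    s * (Cmod zeta * Cmod zeta) * (1 - Cmod u * Cmod u) / (Cmod d * Cmod d) =
  - (s * (1 - Cmod zeta * Cmod zeta) / (Cmod d * Cmod d)).
Proof.
move=> hd d; set w := Cmult u zeta in hd d *.
have dp : 0 < Cmod d := proj1 (Cmod_gt_0 _) hd.
have e1 : Cmult (Cdiv w d) (RtoC (Cmod d * Cmod d)) = Cmult w (Cconj d).
  by rewrite -Cmod_Cmult_conj; field.
have e2 : Re (Cdiv w d) * (Cmod d * Cmod d) = Re (Cmult w (Cconj d)).
  by rewrite -e1 !CE; ring.
have e3 : Re (Cmult w (Cconj d)) = Re w + Cmod w * Cmod w.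
  by rewrite Cmod_sq /d !CE; ring.
have e4 : Cmod d * Cmod d = 1 + 2 * Re w + Cmod w * Cmod w.
  by rewrite !Cmod_sq /d !CE; ring.
have e5 : Cmod w * Cmod w = Cmod u * Cmod u * (Cmod zeta * Cmod zeta).
  by rewrite /w Cmod_mult; ring.
have -> : Re (Cmult (RtoC s) (Cdiv w d)) = s * Re (Cdiv w d) by rewrite Re_mult Re_RtoC Im_RtoC; ring.
have e6 : Re (Cdiv w d) = (Re w + Cmod w * Cmod w) / (Cmod d * Cmod d).
  by rewrite -e3 -e2; field; lra.
rewrite e6; apply: (Rmult_eq_reg_r (Cmod d * Cmod d)); last by nra.
field_simplify; try lra.
have -> : Cmod d ^ 2 = 1 + 2 * Re w + Cmod u * Cmod u * (Cmod zeta * Cmod zeta) by rewrite -e5 -e4; ring.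
have -> : Cmod w ^ 2 = Cmod u * Cmod u * (Cmod zeta * Cmod zeta) by rewrite -e5; ring.
ring.
Qed.

(** * The extremal disc of the model inside the domain *)

Section Upper.
Variables (K r e B : R).
Hypotheses (K_ge0 : 0 <= K) (r_gt0 : 0 < r) (e_range : 0 < e <= 1) (B_ge0 : 0 <= B).

(** At a point of the disc the scale is [sg = s / |1 + u zeta|]: [|lin a y| <= sg] and
    [|y|^2 = O(sg)], so all errors are [O(sg^(1 + e))]. The margin of the model is
    [sg^2 (1 - |zeta|^2) / s], which wins as soon as [1 - |zeta|] exceeds a multiple of [s^e]. *)
Lemma model_disc_inside : exists C1 s0, 0 < C1 /\ 0 < s0 /\ forall ch Omega z, ch_s ch < s0 ->
  taylor_domain K r e B ch Omega z ->
  forall X lam u zeta, 0 < lam -> lam * lam = metric_form ch X ->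
    u = Cdiv (lin (ch_a ch) X) (RtoC (lam * ch_s ch)) ->
    C1 * Rpower (ch_s ch) e < 1 - Cmod zeta ->
    Cplus (RtoC 1) (Cmult u zeta) <> RtoC 0 /\
    Omega (vadd z (unshear ch (vscal (Cdiv zeta (Cmult (RtoC lam) (Cplus (RtoC 1) (Cmult u zeta)))) X))).
Proof.
have [Cu [hCu hun]] := unshear_le n M c M_ge0.
pose k := 2 / c; have k0 : 0 < k by apply: Rdiv_lt_0_compat; lra.
pose k2 := (1 + Cu) * (1 + Cu) * k + 2.
have k21 : 1 <= k2 by rewrite /k2; have : 0 <= (1 + Cu) * (1 + Cu) * k; [apply: Rmult_le_pos; nra | lra].
pose C3 := Cu * (k * k + 3 * k) + B * (k2 * k2).
have C30 : 0 <= C3.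
  have kk : 0 <= k * k + 3 * k by nra.
  have kk2 : 0 <= k2 * k2 by nra.
  have c1 := Rmult_le_pos _ _ hCu kk; have c2 := Rmult_le_pos _ _ B_ge0 kk2.
  rewrite /C3; lra.
pose rr := Rmin 1 r / (2 * (1 + Cu)).
have rr0 : 0 < rr by apply: Rdiv_lt_0_compat; [apply: Rmin_pos; lra | lra].
(* [sg <= tau] forces [|y| <= rr] and so keeps [unshear ch y] in the ball of radius [r] where the
   Taylor expansion holds. *)
pose tau := Rmin 1 (rr * rr / k).
have tau0 : 0 < tau by apply: Rmin_pos; [lra | apply: Rdiv_lt_0_compat; nra].
(* [2 C3] beats the error terms; [/ tau] gives [s / tau <= s^e / tau <= 1 - |zeta| <= |d|], that is
   [sg <= tau]. *)
pose C1 := 2 * C3 + / tau.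
have it0 : 0 < / tau by apply: Rinv_0_lt_compat.
exists C1, 1; split; first by rewrite /C1; lra.
split; first lra.
move=> ch Omega z hs0 [rho hrho] X lam u zeta hlam hlam2 hu hz.
have hs := ch_s_range _ _ _ ch; set s := ch_s ch in hs hs0 hz hu *.
have se := Rpower_pos s e.
have z0 := Cmod_ge_0 zeta.
have C1p : 0 < C1 by rewrite /C1; lra.
have z1 : Cmod zeta < 1 by have : 0 < C1 * Rpower s e; [apply: Rmult_lt_0_compat | lra].
have ls : 0 < lam * s by apply: Rmult_lt_0_compat; lra.
have hlC : RtoC (lam * s) <> RtoC 0 by apply: RtoC_neq0; lra.
have ul : Cmod u = Cmod (lin (ch_a ch) X) / (lam * s).
  by rewrite hu Cmod_div // Cmod_R Rabs_pos_eq; lra.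
have u1 : Cmod u <= 1.
  have h := metric_form_lin_le ch X; rewrite -hlam2 -/s in h.
  have lx := Cmod_ge_0 (lin (ch_a ch) X).
  have : Cmod (lin (ch_a ch) X) <= lam * s by nra.
  rewrite ul => h1; apply: (Rmult_le_reg_r (lam * s)) => //.
  have -> : Cmod (lin (ch_a ch) X) / (lam * s) * (lam * s) = Cmod (lin (ch_a ch) X) by field; split; lra.
  lra.
have u0 := Cmod_ge_0 u.
set d := Cplus (RtoC 1) (Cmult u zeta).
have d_ge : 1 - Cmod u * Cmod zeta <= Cmod d.
  have := Cmod_minus_ge (RtoC 1) (Copp (Cmult u zeta)).
  rewrite Cmod_opp Cmod_mult Cmod_R Rabs_R1.
  by have -> : Cminus (RtoC 1) (Copp (Cmult u zeta)) = d by rewrite /d; ring.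
have d_le : Cmod d <= 2.
  apply: Rle_trans (Cmod_triangle _ _) _; rewrite Cmod_R Rabs_R1 Cmod_mult; nra.
have d_gt : 1 - Cmod zeta <= Cmod d by nra.
have dp : 0 < Cmod d by lra.
have dn : d <> RtoC 0 by move=> ed; move: dp; rewrite ed Cmod_0; lra.
split=> //.
set psi := Cdiv zeta (Cmult (RtoC lam) d).
set y := vscal psi X.
pose sg := s / Cmod d; have sg0 : 0 < sg by apply: Rdiv_lt_0_compat; lra.
have sgd : sg * Cmod d = s by rewrite /sg; field; lra.
have lamn : RtoC lam <> RtoC 0 by apply: RtoC_neq0; lra.
have ly : lin (ch_a ch) y = Cmult (RtoC s) (Cdiv (Cmult u zeta) d).
  rewrite /y linZ hu /psi RtoC_mult; field; repeat split=> //; apply: RtoC_neq0; lra.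
have lyb : Cmod (lin (ch_a ch) y) <= sg.
  rewrite ly Cmod_mult Cmod_div // Cmod_mult Cmod_R Rabs_pos_eq; last lra.
  have -> : s * (Cmod u * Cmod zeta / Cmod d) = sg * (Cmod u * Cmod zeta) by rewrite /sg; field; lra.
  by have : Cmod u * Cmod zeta <= 1 by [nra]; nra.
have Ly : levi_norm ch y = s * (Cmod zeta * Cmod zeta) * (1 - Cmod u * Cmod u) / (Cmod d * Cmod d).
  have -> : levi_norm ch y = Cmod psi * Cmod psi * levi_norm ch X.
    rewrite /levi_norm /y vconjZ bilZl bilZr.
    have -> : Cmult psi (Cmult (Cconj psi) (bil (ch_L ch) X (vconj X))) =
       Cmult (Cmult psi (Cconj psi)) (bil (ch_L ch) X (vconj X)) by ring.
    by rewrite Cmod_Cmult_conj !CE; ring.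
  have -> : levi_norm ch X = s * (lam * lam) * (1 - Cmod u * Cmod u).
    rewrite ul hlam2.
    have -> : s * metric_form ch X * (1 - Cmod (lin (ch_a ch) X) / (lam * s) * (Cmod (lin (ch_a ch) X) / (lam * s))) =
      s * metric_form ch X - Cmod (lin (ch_a ch) X) * Cmod (lin (ch_a ch) X) * (metric_form ch X / (lam * lam)) / s.
      by field; split; lra.
    rewrite hlam2 (_ : metric_form ch X / metric_form ch X = 1); last by field; rewrite -hlam2; nra.
    by rewrite /metric_form -/s; field; lra.
  rewrite /psi Cmod_div ?Cmod_mult; last by apply: Cmult_neq_0.
  by rewrite Cmod_R Rabs_pos_eq; [field; split; lra | lra].
have tb : c * (vnorm y * vnorm y) <= 2 * sg.
  apply: Rle_trans (levi_norm_ge ch y) _; rewrite Ly.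
  have -> : s * (Cmod zeta * Cmod zeta) * (1 - Cmod u * Cmod u) / (Cmod d * Cmod d) =
    sg * ((Cmod zeta * Cmod zeta) * ((1 - Cmod u * Cmod u) / Cmod d)) by rewrite /sg; field; lra.
  have a1 : (1 - Cmod u * Cmod u) / Cmod d <= 2.
    apply: (Rmult_le_reg_r (Cmod d)) => //.
    have -> : (1 - Cmod u * Cmod u) / Cmod d * Cmod d = 1 - Cmod u * Cmod u by field; lra.
    nra.
  have a2 : 0 <= (1 - Cmod u * Cmod u) / Cmod d.
    by apply: Rmult_le_pos; [nra | apply: Rlt_le; apply: Rinv_0_lt_compat].
  have : Cmod zeta * Cmod zeta * ((1 - Cmod u * Cmod u) / Cmod d) <= 1 * 2.
    by apply: Rmult_le_compat => //; nra.
  by move=> a3; nra.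
have t2 : vnorm y * vnorm y <= k * sg.
  apply: (Rmult_le_reg_l c) => //.
  by have -> : c * (k * sg) = 2 * sg by rewrite /k; field; lra.
have v0 := vnorm_ge0 _ y.
have sgtau : sg <= tau.
  have h1 : / tau * Rpower s e <= 1 - Cmod zeta.
    have : / tau * Rpower s e <= C1 * Rpower s e by apply: Rmult_le_compat_r; rewrite /C1; lra.
    lra.
  have h2 : s <= Rpower s e.
    by rewrite -{1}(Rpower_1 s); [apply: Rpower_le_exponent; lra | lra].
  have h3 : / tau * s <= Cmod d.
    apply: Rle_trans d_gt; apply: Rle_trans h1; apply: Rmult_le_compat_l; lra.
  have h4 : s <= tau * Cmod d.
    have : tau * (/ tau * s) <= tau * Cmod d by apply: Rmult_le_compat_l; lra.
    by have -> : tau * (/ tau * s) = s by field; lra.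
  apply: (Rmult_le_reg_r (Cmod d)) => //; rewrite sgd; lra.
have sg1 : sg <= 1 by apply: Rle_trans sgtau (Rmin_l _ _).
have sgs : s / 2 <= sg.
  by apply: (Rmult_le_reg_r (Cmod d)) => //; rewrite sgd; nra.
have yrr : vnorm y <= rr.
  have h1 : k * sg <= rr * rr.
    have h2 : sg <= rr * rr / k := Rle_trans _ _ _ sgtau (Rmin_r _ _).
    have : k * sg <= k * (rr * rr / k) by apply: Rmult_le_compat_l; lra.
    by have -> : k * (rr * rr / k) = rr * rr by field; lra.
  nra.
have rre : rr * (1 + Cu) = Rmin 1 r / 2 by rewrite /rr; field; lra.
have rm1 := Rmin_l 1 r; have rm2 := Rmin_r 1 r; have rm0 : 0 < Rmin 1 r by apply: Rmin_pos; lra.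
have y1 : vnorm y <= 1.
  have : rr * 1 <= rr * (1 + Cu) by apply: Rmult_le_compat_l; lra.
  lra.
have [hrem herr] := hun ch y y1.
have hP : vnorm (unshear ch y) <= (1 + Cu) * vnorm y.
  apply: Rle_trans (vnorm_triangle _ _ _) _.
  have : Cu * (vnorm y * vnorm y) <= Cu * (vnorm y * 1).
    by apply: Rmult_le_compat_l => //; apply: Rmult_le_compat_l.
  lra.
have hPr : vnorm (unshear ch y) < r.
  have : (1 + Cu) * vnorm y <= (1 + Cu) * rr by apply: Rmult_le_compat_l; lra.
  lra.
have [hO hT] := hrho _ hPr.
apply/hO.
have P0 := vnorm_ge0 _ (unshear ch y).
have hPsq : vnorm (unshear ch y) * vnorm (unshear ch y) + s <= k2 * sg.
  have h1 : vnorm (unshear ch y) * vnorm (unshear ch y) <= (1 + Cu) * (1 + Cu) * (vnorm y * vnorm y).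
    have -> : (1 + Cu) * (1 + Cu) * (vnorm y * vnorm y) = ((1 + Cu) * vnorm y) * ((1 + Cu) * vnorm y) by ring.
    by apply: Rmult_le_compat.
  have h2 : (1 + Cu) * (1 + Cu) * (vnorm y * vnorm y) <= (1 + Cu) * (1 + Cu) * (k * sg).
    by apply: Rmult_le_compat_l => //; nra.
  by rewrite /k2; lra.
have E0 := Rpower_pos sg (1 + e).
have tay : B * Rpower (vnorm (unshear ch y) * vnorm (unshear ch y) + s) (1 + e) <= B * (k2 * k2) * Rpower sg (1 + e).
  rewrite Rmult_assoc; apply: Rmult_le_compat_l => //.
  apply: Rle_trans (Rpower_scale k2 sg e k21 sg0 ltac:(lra)).
  by apply: Rle_Rpower_l; [lra | split; [nra | exact: hPsq]].
have errb : Cu * (vnorm y * vnorm y * (vnorm y * vnorm y) + s * (vnorm y * vnorm y * vnorm y) +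
    vnorm y * vnorm y * Cmod (lin (ch_a ch) y)) <= Cu * (k * k + 3 * k) * Rpower sg (1 + e).
  rewrite (Rmult_assoc Cu (k * k + 3 * k)); apply: Rmult_le_compat_l => //.
  have vv : 0 <= vnorm y * vnorm y by nra.
  have q1 : vnorm y * vnorm y * (vnorm y * vnorm y) <= k * sg * (k * sg) by apply: Rmult_le_compat.
  have q2 : s * (vnorm y * vnorm y * vnorm y) <= 2 * sg * (k * sg * 1).
    by apply: Rmult_le_compat; try lra; [nra | apply: Rmult_le_compat].
  have q3 : vnorm y * vnorm y * Cmod (lin (ch_a ch) y) <= k * sg * sg.
    by apply: Rmult_le_compat => //; exact: Cmod_ge_0.
  have q4 : (k * k + 3 * k) * (sg * sg) <= (k * k + 3 * k) * Rpower sg (1 + e).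
    by apply: Rmult_le_compat_l; [nra | apply: sq_le_Rpower; lra].
  lra.
have main : - s + 2 * Re (lin (ch_a ch) y) + levi_norm ch y =
    - (s * (1 - Cmod zeta * Cmod zeta) / (Cmod d * Cmod d)).
  by rewrite ly Ly; exact: model_disc_identity s u zeta dn.
move/Rabs_le_between: herr => [_ herr]; move/Rabs_le_between: hT => [_ hT].
rewrite -/s in hT herr.
(* The term [- 2 K (Re l)^2] only helps the disc to stay inside, so it is dropped. *)
have sqK : 0 <= 2 * K * (Re (lin (ch_a ch) (unshear ch y)) * Re (lin (ch_a ch) (unshear ch y))).
  by apply: Rmult_le_pos; [lra | nra].
have tot : rho (unshear ch y) <= - (s * (1 - Cmod zeta * Cmod zeta) / (Cmod d * Cmod d)) + C3 * Rpower sg (1 + e).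
  by rewrite /C3; lra.
suff : C3 * Rpower sg (1 + e) < s * (1 - Cmod zeta * Cmod zeta) / (Cmod d * Cmod d) by lra.
apply: (Rmult_lt_reg_l s); first lra.
have -> : s * (s * (1 - Cmod zeta * Cmod zeta) / (Cmod d * Cmod d)) = sg * sg * (1 - Cmod zeta * Cmod zeta).
  by rewrite /sg; field; lra.
(* [|d| <= 2] gives only [s / 2 <= sg], hence the comparison of scales at [s / 2] and the factor
   2. *)
have w1 : s * Rpower sg e <= 2 * (sg * Rpower s e).
  have h1 := Rpower_quotient_le (s / 2) sg e ltac:(lra) ltac:(lra).
  have h2 : Rpower (s / 2) e <= Rpower s e by apply: Rle_Rpower_l; lra.
  have : sg * Rpower (s / 2) e <= sg * Rpower s e by apply: Rmult_le_compat_l; lra.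
  lra.
have w2 : s * (C3 * Rpower sg (1 + e)) <= 2 * C3 * (sg * sg * Rpower s e).
  rewrite Rpower_succ //.
  have : (C3 * sg) * (s * Rpower sg e) <= (C3 * sg) * (2 * (sg * Rpower s e)).
    by apply: Rmult_le_compat_l => //; nra.
  lra.
have ss : 0 < sg * sg by nra.
have w3 : sg * sg * (C1 * Rpower s e) < sg * sg * (1 - Cmod zeta * Cmod zeta).
  by apply: Rmult_lt_compat_l => //; nra.
have w4 : 0 < sg * sg * (/ tau * Rpower s e) by apply: Rmult_lt_0_compat => //; nra.
have : sg * sg * (C1 * Rpower s e) = 2 * C3 * (sg * sg * Rpower s e) + sg * sg * (/ tau * Rpower s e).
  by rewrite /C1; ring.
lra.
Qed.

(** The disc of [model_disc_inside], restricted to radius [1 - C1 s^e] and reparametrized by the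
    unit disc. Since the remainder of [unshear] is quadratic, its derivative at 0 is still a
    multiple of [X]. *)
Lemma kobayashi_upper_model : exists C s0, 0 < C /\ 0 < s0 /\ forall ch Omega z, ch_s ch < s0 ->
  taylor_domain K r e B ch Omega z -> forall X,
  Rbar_le (kobayashi Omega z X) (Rbar.Finite ((1 + C * Rpower (ch_s ch) e) * sqrt (metric_form ch X))).
Proof.
have [C1 [s1 [hC1 [hs1 hin]]]] := model_disc_inside.
have [Cu [hCu hun]] := unshear_le n M c M_ge0.
have [s2 [hs2 hsm]] := Rpower_small e (/ 2 / C1) ltac:(lra) ltac:(apply: Rdiv_lt_0_compat; lra).
have [s3 [hs3 hsm3]] := Rpower_small e (/ 2 / (B + 1)) ltac:(lra) ltac:(apply: Rdiv_lt_0_compat; lra).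
(* [1 / (1 - x) <= 1 + 2 x] for [x = C1 s^e <= 1/2], which [s2] ensures. *)
exists (2 * C1), (Rmin s1 (Rmin s2 s3)); split; first lra.
split; first by repeat apply: Rmin_pos.
move=> ch Omega z hs hT X.
have l1 := Rmin_l s1 (Rmin s2 s3); have l2 := Rmin_r s1 (Rmin s2 s3).
have l3 := Rmin_l s2 s3; have l4 := Rmin_r s2 s3.
have sr := ch_s_range _ _ _ ch.
set s := ch_s ch in hs sr *; have se := Rpower_pos s e.
(* For [X = 0] the parameter [lam] would vanish. The constant disc is used instead; [z] lies in
   [Omega] by the Taylor bound at [h = 0], where [s3] makes the error at most [s / 2]. *)
case: (classic (X = vzero)) => [->|hX].
  have -> : sqrt (metric_form ch vzero) = 0.
    have z0 : lin (ch_a ch) vzero = RtoC 0.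
      have -> : (vzero : Cn n) = vscal (RtoC 0) vzero by apply: vext => j; rewrite /vscal /vzero; ring.
      by rewrite linZ; ring.
    have z1 : levi_norm ch vzero = 0.
      rewrite /levi_norm; have -> : (vzero : Cn n) = vscal (RtoC 0) vzero by apply: vext => j; rewrite /vscal /vzero; ring.
      by rewrite bilZl !CE; ring.
    rewrite /metric_form z0 z1 Cmod_0 -/s (_ : 0 * 0 / (s * s) + 0 / s = 0) ?sqrt_0 //; field; lra.
  rewrite Rmult_0_r -Cmod_0.
  apply: (kobayashi_le Omega z vzero (RtoC 0) (fun _ => z) vzero) => //.
  - move=> w _; split; last exact: vdiff_const.
    have [rho hrho] := hT.
    have [hO hT0] := hrho vzero ltac:(rewrite vnorm_zero; lra).
    have ez : vadd z vzero = z by apply: vext => j; rewrite /vadd /vzero; ring.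
    rewrite ez in hO; apply/hO.
    have L0 : levi_norm ch vzero = 0 /\ Re (hol_normal ch vzero) = 0 /\ mixed_cubic ch vzero = 0.
      have e0 : (vzero : Cn n) = vscal (RtoC 0) vzero by apply: vext => j; rewrite /vscal /vzero; ring.
      have l0 : lin (ch_a ch) vzero = RtoC 0 by rewrite e0 linZ; ring.
      have b0 S v : bil S (vzero : Cn n) v = RtoC 0 by rewrite e0 bilZl; ring.
      have t0 A u v : tri A (vzero : Cn n) u v = RtoC 0.
        rewrite /tri -(csum0 'I_n); apply: csum_ext => j; rewrite /vzero; ring.
      by rewrite /levi_norm /hol_normal /mixed_cubic !b0 !t0 l0 !CE; split; [lra | split; lra].
    move: hT0; have [-> [-> ->]] := L0; rewrite vnorm_zero Rmult_0_l Rplus_0_l -/s.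
    move=> /Rabs_le_between [_ hT0].
    have sq : 0 <= 2 * K * (Re (lin (ch_a ch) vzero) * Re (lin (ch_a ch) vzero)).
      by apply: Rmult_le_pos; [lra | nra].
    have : B * Rpower s (1 + e) <= / 2 * s.
      rewrite Rpower_succ; last lra.
      have h1 : Rpower s e <= / 2 / (B + 1) by apply: hsm3; lra.
      have h2 : (B + 1) * Rpower s e <= (B + 1) * (/ 2 / (B + 1)) by apply: Rmult_le_compat_l; lra.
      have h3 : (B + 1) * (/ 2 / (B + 1)) = / 2 by field; lra.
      have h4 : B * Rpower s e <= / 2 by nra.
      nra.
    lra.
  - by move=> j; rewrite /vzero; exact: cderiv_const.
  by move=> j; rewrite /vzero; ring.
have Q0 := metric_form_gt0 ch X hX.
pose lam := sqrt (metric_form ch X).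
have lam0 : 0 < lam by exact: sqrt_lt_R0.
have lam2 : lam * lam = metric_form ch X by apply: sqrt_sqrt; lra.
pose x := C1 * Rpower s e.
have x0 : 0 < x by apply: Rmult_lt_0_compat.
have x2 : x <= / 2.
  have h1 : Rpower s e <= / 2 / C1 by apply: hsm; lra.
  have h2 : C1 * Rpower s e <= C1 * (/ 2 / C1) by apply: Rmult_le_compat_l; lra.
  by have -> : / 2 = C1 * (/ 2 / C1) by field; lra.
pose rad := 1 - x; have rad0 : 0 < rad by rewrite /rad; lra.
pose u := Cdiv (lin (ch_a ch) X) (RtoC (lam * s)).
have hIn zeta := hin ch Omega z ltac:(rewrite -/s; lra) hT X lam u zeta lam0 lam2 erefl.
pose psi zeta := Cdiv zeta (Cmult (RtoC lam) (Cplus (RtoC 1) (Cmult u zeta))).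
pose y w := vscal (psi (Cmult (RtoC rad) w)) X.
have lamn : RtoC lam <> RtoC 0 by apply: RtoC_neq0; lra.
have radw w : Cmod w < 1 -> C1 * Rpower s e < 1 - Cmod (Cmult (RtoC rad) w).
  move=> hw; rewrite Cmod_mult Cmod_R Rabs_pos_eq; last lra.
  by rewrite -/x; have : rad * Cmod w < rad * 1; [apply: Rmult_lt_compat_l | rewrite /rad; lra].
have psi_diff w : Cmod w < 1 -> cdiff (fun w => psi (Cmult (RtoC rad) w)) w.
  move=> hw; apply: (cdiff_comp_scal psi); have [hn _] := hIn _ (radw w hw).
  apply: cdiff_div; first exact: cdiff_id.
    apply: cdiff_mult; first exact: cdiff_const.
    apply: cdiff_plus; first exact: cdiff_const.
    by apply: cdiff_mult; [exact: cdiff_const | exact: cdiff_id].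
  by apply: Cmult_neq_0.
have y_diff w : Cmod w < 1 -> vdiff y w.
  by move=> hw; apply: vdiff_scal; [exact: psi_diff | exact: vdiff_const].
have psi0 : cderiv (fun w => psi (Cmult (RtoC rad) w)) (RtoC 0) (RtoC (rad / lam)).
  have hw0 : Cmod (RtoC 0) < 1 by rewrite Cmod_0; lra.
  have h0 : cderiv psi (Cmult (RtoC rad) (RtoC 0)) (RtoC (/ lam)).
    rewrite Cmult_0_r.
    have hd : cdiff (fun zeta => Cinv (Cmult (RtoC lam) (Cplus (RtoC 1) (Cmult u zeta)))) (RtoC 0).
      apply: cdiff_inv.
        apply: cdiff_mult; first exact: cdiff_const.
        apply: cdiff_plus; first exact: cdiff_const.
        by apply: cdiff_mult; [exact: cdiff_const | exact: cdiff_id].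
      rewrite Cmult_0_r Cplus_0_r Cmult_1_r; exact: lamn.
    have [l hl] := hd; have := cderiv_mult _ _ _ _ _ (cderiv_id (RtoC 0)) hl.
    rewrite Cmult_0_r Cplus_0_r Cmult_1_r Cmult_0_l Cplus_0_r Cmult_1_l -RtoC_inv //; lra.
  have := cderiv_comp_scal psi (RtoC rad) (RtoC 0) _ h0.
  by rewrite -RtoC_mult (_ : / lam * rad = rad / lam); [| rewrite /Rdiv; ring].
have psiz : psi (Cmult (RtoC rad) (RtoC 0)) = RtoC 0.
  by rewrite /psi Cmult_0_r /Cdiv Cmult_0_l.
have y0 : y (RtoC 0) = vzero.
  by rewrite /y psiz; apply: vext => j; rewrite /vscal /vzero; ring.
have dy j : cderiv (fun w => y w j) (RtoC 0) (vscal (RtoC (rad / lam)) X j).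
  have := cderiv_mult _ (fun _ => X j) _ _ _ psi0 (cderiv_const (X j) (RtoC 0)).
  rewrite psiz (_ : Cplus (Cmult (RtoC (rad / lam)) (X j)) (Cmult (RtoC 0) (RtoC 0)) = vscal (RtoC (rad / lam)) X j) //.
  by rewrite /vscal; ring.
have [dl [Ly [hdl [hLy lip]]]] := vderiv_lipschitz _ _ _ _ dy.
have lipy w : Cmod w < dl -> vnorm (y w) <= Ly * Cmod w.
  have ew : Cminus w (RtoC 0) = w by ring.
  move=> hw; have := lip w; rewrite ew => /(_ hw); rewrite y0.
  by have -> : vdist (y w) vzero = vnorm (y w) by rewrite /vdist; congr vnorm; apply: vext => j; rewrite /vsub /vzero; ring.
apply: (Rbar_le_trans _ (Rbar.Finite (Cmod (RtoC (lam / rad))))); last first.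
  rewrite /= Cmod_R Rabs_pos_eq; last by apply: Rlt_le; apply: Rdiv_lt_0_compat.
  apply: (Rmult_le_reg_r rad) => //.
  have -> : lam / rad * rad = lam by field; lra.
  rewrite -/lam; have -> : (1 + 2 * C1 * Rpower s e) * lam * rad = lam * ((1 + 2 * x) * (1 - x)) by rewrite /rad /x; ring.
  have : 1 <= (1 + 2 * x) * (1 - x) by nra.
  by nra.
apply: (kobayashi_le Omega z X (RtoC (lam / rad)) (fun w => vadd z (unshear ch (y w))) (vscal (RtoC (rad / lam)) X)).
- move=> w hw; split; first by have [_] := hIn _ (radw w hw).
  by apply: vdiff_add; [exact: vdiff_const | apply: vdiff_unshear; exact: y_diff].
- have [hr0 _] := hun ch vzero ltac:(rewrite vnorm_zero; lra).
  have er : unshear_rem ch vzero = vzero.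
    by apply: vnorm_eq0; rewrite vnorm_zero in hr0; have := vnorm_ge0 _ (unshear_rem ch vzero); lra.
  by rewrite y0 /unshear er; apply: vext => j; rewrite /vadd /vzero; ring.
- move=> j.
  have -> : vscal (RtoC (rad / lam)) X j = Cplus (RtoC 0) (Cplus (vscal (RtoC (rad / lam)) X j) (RtoC 0)) by ring.
  apply: cderiv_plus; first exact: cderiv_const.
  apply: cderiv_plus; first exact: dy.
  have d0 : 0 < Rmin dl (/ (Ly + 1)) by apply: Rmin_pos => //; apply: Rinv_0_lt_compat; lra.
  have bnd w : Cmod w < Rmin dl (/ (Ly + 1)) -> vnorm (unshear_rem ch (y w)) <= Cu * (Ly * Ly) * (Cmod w * Cmod w).
    move=> hw; have h1 := lipy w (Rlt_le_trans _ _ _ hw (Rmin_l _ _)).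
    have h2 := Rlt_le_trans _ _ _ hw (Rmin_r _ _).
    have w0 := Cmod_ge_0 w; have v0 := vnorm_ge0 _ (y w).
    have h3 : vnorm (y w) <= 1.
      have : (Ly + 1) * Cmod w <= (Ly + 1) * / (Ly + 1) by apply: Rmult_le_compat_l; lra.
      by rewrite Rinv_r; lra.
    apply: Rle_trans (proj1 (hun ch (y w) h3)) _; rewrite Rmult_assoc; apply: Rmult_le_compat_l => //.
    have -> : Ly * Ly * (Cmod w * Cmod w) = (Ly * Cmod w) * (Ly * Cmod w) by ring.
    by apply: Rmult_le_compat.
  apply: (cderiv_quadratic _ _ (Cu * (Ly * Ly)) _ d0).
    have := bnd (RtoC 0) ltac:(rewrite Cmod_0; lra); rewrite Cmod_0 Rmult_0_l Rmult_0_r => hz.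
    apply: Cmod_eq_0; have := Cmod_le_vnorm _ (unshear_rem ch (y (RtoC 0))) j.
    by have := Cmod_ge_0 (unshear_rem ch (y (RtoC 0)) j); lra.
  move=> w; rewrite (_ : Cminus w (RtoC 0) = w); last by ring.
  move=> hw; apply: Rle_trans (bnd w hw); exact: (Cmod_le_vnorm _ (unshear_rem ch (y w)) j).
move=> j; rewrite /vscal Cmult_assoc -RtoC_mult.
have -> : lam / rad * (rad / lam) = 1 by field; lra.
by rewrite Cmult_1_l.
Qed.
End Upper.
End Discs.
(** * The lower bound in a chart *)

Lemma double_le_of_sq (X Y Z : R) : 0 <= X -> 0 <= Y -> 0 <= Z -> Z * Z <= X * Y -> 2 * Z <= X + Y.
Proof.
move=> hX hY hZ h; have := Rle_0_sqr (X - Y); rewrite /Rsqr => h1.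
by apply: Rnot_lt_le => h2; nra.
Qed.

(** * A Hermitian norm and its supporting functionals *)

Section ProductNorm.
Variables (n : nat) (M c : R).
Hypotheses (M_ge0 : 0 <= M) (c_gt0 : 0 < c).
Variable ch : chart n M c.
Implicit Types (a : C) (u v b : Cn n).

(** The norm whose unit ball is the image of the model domain under the Cayley transform. *)
Definition block_norm a b : R := sqrt (Cmod a * Cmod a + levi_norm ch b).

Let levi0 b : 0 <= levi_norm ch b := levi_norm_ge0 n M c c_gt0 ch b.

Lemma levi_norm_le b : levi_norm ch b <= M * (vnorm b * vnorm b).
Proof.
apply: Rle_trans (Re_le_Cmod _) _; apply: Rle_trans (ch_L_le _ _ _ ch b (vconj b)) _.
by rewrite vnorm_conj; lra.
Qed.

Lemma levi_norm_scal (k : C) b : levi_norm ch (vscal k b) = Cmod k * Cmod k * levi_norm ch b.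
Proof.
rewrite /levi_norm vconjZ bilZl bilZr.
have -> : Cmult k (Cmult (Cconj k) (bil (ch_L ch) b (vconj b))) =
  Cmult (Cmult k (Cconj k)) (bil (ch_L ch) b (vconj b)) by ring.
by rewrite Cmod_Cmult_conj !CE; ring.
Qed.

Lemma levi_CS u v : Cmod (bil (ch_L ch) u (vconj v)) * Cmod (bil (ch_L ch) u (vconj v)) <=
  levi_norm ch u * levi_norm ch v.
Proof.
set z := bil _ _ _; set p := levi_norm ch u; set q := levi_norm ch v.
have key t : 0 <= p - 2 * t * (Cmod z * Cmod z) + t * t * (Cmod z * Cmod z) * q.
  have := levi0 (vadd u (vscal (Cmult (RtoC (- t)) z) v)).
  rewrite levi_norm_add levi_norm_scal bilZl (ch_herm _ _ _ ch u v) -/z -/p -/q.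
  rewrite -Cmult_assoc Cmod_Cmult_conj Cmod_mult Cmod_R Rabs_Ropp !CE.
  have -> : Rabs t * Cmod z * (Rabs t * Cmod z) = (Rabs t * Rabs t) * (Cmod z * Cmod z) by ring.
  have -> : Rabs t * Rabs t = t * t by rewrite -Rabs_mult Rabs_pos_eq //; nra.
  lra.
case: (levi0 v) => hq; rewrite -/q in hq.
  have := key (/ q); have iq : 0 < / q by apply: Rinv_0_lt_compat.
  have -> : p - 2 * / q * (Cmod z * Cmod z) + / q * / q * (Cmod z * Cmod z) * q = p - Cmod z * Cmod z * / q.
    by field; lra.
  move=> h; have : (Cmod z * Cmod z * / q) * q <= p * q by apply: Rmult_le_compat_r; lra.
  by have -> : (Cmod z * Cmod z * / q) * q = Cmod z * Cmod z by field; lra.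
have h := levi_norm_ge n M c ch v; rewrite -/q -hq in h.
have v0 : vnorm v = 0.
  have := vnorm_ge0 _ v => vp; have : vnorm v * vnorm v <= 0 by apply: (Rmult_le_reg_l c); lra.
  by nra.
have := ch_L_le _ _ _ ch u (vconj v); rewrite -/z vnorm_conj v0 Rmult_0_r => hz.
by have := Cmod_ge_0 z; rewrite -hq; nra.
Qed.

Lemma block_norm_ge0 a b : 0 <= block_norm a b.
Proof. exact: sqrt_pos. Qed.

Lemma block_norm_sq a b : block_norm a b * block_norm a b = Cmod a * Cmod a + levi_norm ch b.
Proof. by apply: sqrt_sqrt; have := levi0 b; have := Cmod_ge_0 a; nra. Qed.

Lemma block_norm_CS a b a' b' :
  Cmod (Cplus (Cmult a (Cconj a')) (bil (ch_L ch) b (vconj b'))) <= block_norm a b * block_norm a' b'.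
Proof.
apply: Rle_trans (Cmod_triangle _ _) _; rewrite Cmod_mult Cmod_conj.
have h := levi_CS b b'; set z := Cmod (bil _ _ _) in h *.
have z0 : 0 <= z by exact: Cmod_ge_0.
have a0 := Cmod_ge_0 a; have a0' := Cmod_ge_0 a'; have l0 := levi0 b; have l0' := levi0 b'.
have p0 := block_norm_ge0 a b; have p0' := block_norm_ge0 a' b'.
have e1 := block_norm_sq a b; have e2 := block_norm_sq a' b'.
have sq : (block_norm a b * block_norm a' b') * (block_norm a b * block_norm a' b') =
  (Cmod a * Cmod a + levi_norm ch b) * (Cmod a' * Cmod a' + levi_norm ch b').
  by rewrite -e1 -e2; ring.
have pp : 0 <= block_norm a b * block_norm a' b' by nra.
set p := Cmod a in a0 e1 sq *; set p' := Cmod a' in a0' e2 sq *.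
set l := levi_norm ch b in h l0 sq *; set l' := levi_norm ch b' in h l0' sq *.
have cross : 2 * (p * p') * z <= p * p * l' + p' * p' * l.
  have h1 : (p * p' * z) * (p * p' * z) <= (p * p * l') * (p' * p' * l).
    have -> : (p * p' * z) * (p * p' * z) = (p * p') * (p * p') * (z * z) by ring.
    have -> : (p * p * l') * (p' * p' * l) = (p * p') * (p * p') * (l * l') by ring.
    by apply: Rmult_le_compat_l => //; nra.
  have X0 : 0 <= p * p * l' by apply: Rmult_le_pos; nra.
  have Y0 : 0 <= p' * p' * l by apply: Rmult_le_pos; nra.
  have Z0 : 0 <= p * p' * z by apply: Rmult_le_pos; nra.
  have -> : 2 * (p * p') * z = 2 * (p * p' * z) by ring.
  exact: double_le_of_sq.
have : (p * p' + z) * (p * p' + z) <= (block_norm a b * block_norm a' b') * (block_norm a b * block_norm a' b').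
  by rewrite sq; nra.
have : 0 <= p * p' by nra.
nra.
Qed.

Lemma block_norm_triangle a b a' b' :
  block_norm (Cplus a a') (vadd b b') <= block_norm a b + block_norm a' b'.
Proof.
have p0 := block_norm_ge0 a b; have p0' := block_norm_ge0 a' b'.
have p0'' := block_norm_ge0 (Cplus a a') (vadd b b').
have e := block_norm_sq (Cplus a a') (vadd b b').
have e1 := block_norm_sq a b; have e2 := block_norm_sq a' b'.
have h := Rle_trans _ _ _ (Re_le_Cmod _) (block_norm_CS a' b' a b).
rewrite Re_plus in h.
have ea : Cmod (Cplus a a') * Cmod (Cplus a a') = Cmod a * Cmod a + 2 * Re (Cmult a' (Cconj a)) + Cmod a' * Cmod a'.
  by rewrite !Cmod_sq !CE; ring.
rewrite ea levi_norm_add in e.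
nra.
Qed.

Lemma block_norm_scal (k : C) a b : block_norm (Cmult k a) (vscal k b) = Cmod k * block_norm a b.
Proof.
rewrite /block_norm levi_norm_scal Cmod_mult.
have -> : Cmod k * Cmod a * (Cmod k * Cmod a) + Cmod k * Cmod k * levi_norm ch b =
  (Cmod k * Cmod k) * (Cmod a * Cmod a + levi_norm ch b) by ring.
rewrite sqrt_mult_alt; last by have := Cmod_ge_0 k; nra.
by rewrite sqrt_square //; exact: Cmod_ge_0.
Qed.

Lemma block_norm_le a b : block_norm a b <= (1 + M) * (Cmod a + vnorm b).
Proof.
have p0 := block_norm_ge0 a b; have e1 := block_norm_sq a b.
have a0 := Cmod_ge_0 a; have b0 := vnorm_ge0 _ b; have l := levi_norm_le b.
have : 0 <= (1 + M) * (Cmod a + vnorm b) by nra.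
have : block_norm a b * block_norm a b <= ((1 + M) * (Cmod a + vnorm b)) * ((1 + M) * (Cmod a + vnorm b)).
  rewrite e1; have : M * (vnorm b * vnorm b) <= (1 + M) * (1 + M) * (vnorm b * vnorm b).
    by apply: Rmult_le_compat_r; nra.
  have : 1 * (Cmod a * Cmod a) <= (1 + M) * (1 + M) * (Cmod a * Cmod a) by apply: Rmult_le_compat_r; nra.
  have : 0 <= 2 * ((1 + M) * (1 + M)) * (Cmod a * vnorm b).
    by apply: Rmult_le_pos; nra.
  lra.
nra.
Qed.

Lemma block_norm_lipschitz a b a' b' :
  Rabs (block_norm a b - block_norm a' b') <= (1 + M) * (Cmod (Cminus a a') + vdist b b').
Proof.
have ea : a = Cplus a' (Cminus a a') by ring.
have eb : b = vadd b' (vsub b b') by rewrite vadd_sub.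
have ea' : a' = Cplus a (Cminus a' a) by ring.
have eb' : b' = vadd b (vsub b' b) by rewrite vadd_sub.
have h1 := block_norm_triangle a' b' (Cminus a a') (vsub b b'); rewrite -ea -eb in h1.
have h2 := block_norm_triangle a b (Cminus a' a) (vsub b' b); rewrite -ea' -eb' in h2.
have h3 := block_norm_le (Cminus a a') (vsub b b').
have h4 := block_norm_le (Cminus a' a) (vsub b' b).
rewrite Cmod_minus_sym vnorm_opp in h4; rewrite /vdist.
by apply: Rabs_le; lra.
Qed.

(** The norming functional of [(a0, b0)], namely the Hermitian product with it divided by its norm.
    Being complex linear, it turns a holomorphic map into a holomorphic minorant of the norm of that
    map, as the glued Schwarz lemma demands. *)
Lemma block_norm_support a0 b0 : exists (p : C) (q : 'I_n -> C),
  (forall a b, Cmod (Cplus (Cmult p a) (lin q b)) <= block_norm a b) /\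
  Cplus (Cmult p a0) (lin q b0) = RtoC (block_norm a0 b0).
Proof.
case: (block_norm_ge0 a0 b0) => hp; last first.
  exists (RtoC 0), (fun _ => RtoC 0).
  have l0 b : lin (fun _ : 'I_n => RtoC 0) b = RtoC 0.
    by rewrite /lin (csum_ext _ _ (fun _ => RtoC 0)) ?csum0 // => j; exact: Cmult_0_l.
  split=> [a b|]; rewrite l0; last by rewrite -hp; ring.
  have -> : Cplus (Cmult (RtoC 0) a) (RtoC 0) = RtoC 0 by ring.
  by rewrite Cmod_0; exact: block_norm_ge0.
set N := block_norm a0 b0 in hp *.
have Nn : RtoC N <> RtoC 0 by apply: RtoC_neq0; lra.
pose q j := Cdiv (lin (ch_L ch j) (vconj b0)) (RtoC N).
have lq b : lin q b = Cdiv (bil (ch_L ch) b (vconj b0)) (RtoC N).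
  by rewrite /Cdiv (Cmult_comm (bil _ _ _)) /bil -csumZ; apply: csum_ext => j; rewrite /q /Cdiv; ring.
exists (Cdiv (Cconj a0) (RtoC N)), q; split=> [a b|]; rewrite lq.
  have -> : Cplus (Cmult (Cdiv (Cconj a0) (RtoC N)) a) (Cdiv (bil (ch_L ch) b (vconj b0)) (RtoC N)) =
    Cdiv (Cplus (Cmult a (Cconj a0)) (bil (ch_L ch) b (vconj b0))) (RtoC N) by field.
  rewrite Cmod_div // Cmod_R Rabs_pos_eq; last lra.
  apply: (Rmult_le_reg_r N) => //.
  have := block_norm_CS a b a0 b0; rewrite -/N.
  by set w := Cmod _; have -> : w / N * N = w by field; lra.
have -> : bil (ch_L ch) b0 (vconj b0) = RtoC (levi_norm ch b0).
  apply: C_eq => //; rewrite Im_RtoC.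
  have h : Im (bil (ch_L ch) b0 (vconj b0)) = Im (Cconj (bil (ch_L ch) b0 (vconj b0))).
    by rewrite -(ch_herm _ _ _ ch b0 b0).
  by rewrite Im_conj in h; lra.
have e1 : Cmult (Cconj a0) a0 = RtoC (Cmod a0 * Cmod a0) by rewrite -Cmod_Cmult_conj; ring.
have -> : Cplus (Cmult (Cdiv (Cconj a0) (RtoC N)) a0) (Cdiv (RtoC (levi_norm ch b0)) (RtoC N)) =
  Cdiv (Cplus (Cmult (Cconj a0) a0) (RtoC (levi_norm ch b0))) (RtoC N) by field.
by rewrite e1 -RtoC_plus -block_norm_sq -/N RtoC_mult; field.
Qed.

(** * Gluing the norm of a disc with the constant 1 *)

Section Glue.
Variables (A : C -> C) (b : C -> Cn n) (x : C -> R) (V : C -> Prop) (s1 s2 B0 : R).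
Let m zeta := block_norm (A zeta) (b zeta).
Hypotheses (hs : 0 < s1 < s2) (B0_ge1 : 1 <= B0).
Hypothesis V_open : forall zeta, Cmod zeta < 1 -> V zeta ->
  exists d, 0 < d /\ forall w, Cmod w < 1 -> Cmod (Cminus w zeta) < d -> V w.
Hypothesis V_diff : forall zeta, Cmod zeta < 1 -> V zeta -> cdiff A zeta /\ vdiff b zeta.
Hypothesis x_cont : forall zeta e, Cmod zeta < 1 -> V zeta -> 0 < e ->
  exists d, 0 < d /\ forall w, Cmod w < 1 -> Cmod (Cminus w zeta) < d -> Rabs (x w - x zeta) < e.
(** The disc leaves [V] only after [x] has fallen to [- s2] or below, where the glued function is
    already 1; hence the edge of [V] creates no discontinuity. *)
Hypothesis V_sep : forall zeta, Cmod zeta < 1 -> ~ V zeta ->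
  exists d, 0 < d /\ forall w, Cmod w < 1 -> Cmod (Cminus w zeta) < d -> V w -> x w <= - s2.
Hypothesis m_le : forall zeta, Cmod zeta < 1 -> V zeta -> - s2 < x zeta -> m zeta <= B0.
Hypothesis m_inner : forall zeta, Cmod zeta < 1 -> V zeta -> x zeta = - s1 -> 1 <= m zeta.
Hypothesis m_outer : forall zeta, Cmod zeta < 1 -> V zeta -> x zeta = - s2 -> m zeta <= 1.
Variables (A' : C) (b' : Cn n).
Hypotheses (V0 : V (RtoC 0)) (x0 : - s1 < x (RtoC 0)) (A0 : A (RtoC 0) = RtoC 0) (b0 : b (RtoC 0) = vzero).
Hypothesis A_deriv : cderiv A (RtoC 0) A'.
Hypothesis b_deriv : forall j, cderiv (fun w => b w j) (RtoC 0) (b' j).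

(* The model norm [m] controls the disc only while it stays near the boundary point ([V]); cutting
   it off by 1 further away localizes the problem, and [m_inner], [m_outer] make the pieces fit. *)
Let Lam zeta : R :=
  if excluded_middle_informative (V zeta /\ - s2 < x zeta) then
    if Rle_dec (- s1) (x zeta) then m zeta else Rmax (m zeta) 1
  else 1.

Let Lam_in zeta : V zeta -> - s1 <= x zeta -> Lam zeta = m zeta.
Proof.
move=> h1 h2; rewrite /Lam; case: (excluded_middle_informative (V zeta /\ - s2 < x zeta)) => [hy|hn]; last by case: hn; split=> //; lra.
by case: Rle_dec.
Qed.
Let Lam_mid zeta : V zeta -> - s2 < x zeta < - s1 -> Lam zeta = Rmax (m zeta) 1.
Proof.
move=> h1 h2; rewrite /Lam; case: (excluded_middle_informative (V zeta /\ - s2 < x zeta)) => [hy|hn]; last by case: hn; split=> //; lra.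
by case: Rle_dec => // h; lra.
Qed.
Let Lam_out zeta : ~ (V zeta /\ - s2 < x zeta) -> Lam zeta = 1.
Proof. by rewrite /Lam; case: excluded_middle_informative. Qed.
Let Lam_max zeta : Lam zeta <= Rmax (m zeta) 1.
Proof.
rewrite /Lam; case: (excluded_middle_informative (V zeta /\ - s2 < x zeta)) => ? /=; last exact: Rmax_r.
by case: Rle_dec => ? /=; [exact: Rmax_l | lra].
Qed.
Let Lam_ge_m zeta : V zeta -> - s2 < x zeta -> m zeta <= Lam zeta.
Proof.
move=> h1 h2; case: (Rle_lt_dec (- s1) (x zeta)) => h; first by rewrite Lam_in //; lra.
by rewrite Lam_mid //; exact: Rmax_l.
Qed.
Let Lam_ge1 zeta : x zeta < - s1 \/ ~ (V zeta /\ - s2 < x zeta) -> 1 <= Lam zeta.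
Proof.
case: (classic (V zeta /\ - s2 < x zeta)) => [[h1 h2]|h]; last by rewrite Lam_out //; lra.
by move=> [h3|h3]; [rewrite Lam_mid //; exact: Rmax_r | exfalso; apply: h3].
Qed.

Let m_cont zeta e : Cmod zeta < 1 -> V zeta -> 0 < e ->
  exists d, 0 < d /\ forall w, Cmod w < 1 -> Cmod (Cminus w zeta) < d -> Rabs (m w - m zeta) <= e.
Proof.
move=> hz hV he; have [[l hl] hb] := V_diff zeta hz hV.
have [v hv] := choice _ hb.
have [d1 [hd1 h1]] := cderiv_cont _ _ _ hl.
have [d2 [L2 [hd2 [hL2 h2]]]] := vderiv_lipschitz _ _ _ _ hv.
have l0 := Cmod_ge_0 l.
pose K := (1 + M) * (Cmod l + 1 + L2).
have K0 : 0 <= K by apply: Rmult_le_pos; lra.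
exists (Rmin (Rmin d1 d2) (e / (K + 1))); split.
  by repeat apply: Rmin_pos => //; apply: Rdiv_lt_0_compat; lra.
move=> w _ hw; have w0 := Cmod_ge_0 (Cminus w zeta).
have k1 := h1 w (Rlt_le_trans _ _ _ hw (Rle_trans _ _ _ (Rmin_l _ _) (Rmin_l _ _))).
have k2 := h2 w (Rlt_le_trans _ _ _ hw (Rle_trans _ _ _ (Rmin_l _ _) (Rmin_r _ _))).
have k3 := Rlt_le_trans _ _ _ hw (Rmin_r _ _).
apply: Rle_trans (block_norm_lipschitz _ _ _ _) _.
have : (1 + M) * (Cmod (Cminus (A w) (A zeta)) + vdist (b w) (b zeta)) <= K * Cmod (Cminus w zeta).
  by rewrite /K Rmult_assoc; apply: Rmult_le_compat_l; lra.
have : (K + 1) * Cmod (Cminus w zeta) <= (K + 1) * (e / (K + 1)) by apply: Rmult_le_compat_l; lra.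
have -> : (K + 1) * (e / (K + 1)) = e by field; lra.
lra.
Qed.

Let near_out zeta : Cmod zeta < 1 -> (V zeta -> x zeta <= - s2) ->
  exists d, 0 < d /\ forall w, Cmod w < 1 -> Cmod (Cminus w zeta) < d ->
    x w < - s1 \/ ~ (V w /\ - s2 < x w).
Proof.
move=> hz hx; case: (classic (V zeta)) => hV.
  have [d [hd h]] := x_cont zeta (s2 - s1) hz hV ltac:(lra).
  exists d; split=> // w h1 h2; left; have := h w h1 h2; have := hx hV => k /Rabs_def2; lra.
have [d [hd h]] := V_sep zeta hz hV.
by exists d; split=> // w h1 h2; right=> -[h3 h4]; have := h w h1 h2 h3; lra.
Qed.

(** Inside [V], jumps can occur only where [x] equals [- s1] or [- s2]. There [m_inner] and
    [m_outer] say that the value is [max(m, 1)], a continuous function that bounds [Lam]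
    everywhere. *)
Let Lam_usc zeta e : Cmod zeta < 1 -> 0 < e ->
  exists d, 0 < d /\ forall w, Cmod w < 1 -> Cmod (Cminus w zeta) < d -> Lam w <= Lam zeta + e.
Proof.
move=> hz he; case: (classic (V zeta)) => hV; last first.
  have [d [hd h]] := V_sep zeta hz hV.
  exists d; split=> // w h1 h2; rewrite !Lam_out; [lra | by move=> [] |].
  by move=> [h3 h4]; have := h w h1 h2 h3; lra.
have [d1 [hd1 h1]] := m_cont zeta e hz hV he.
case: (Rle_lt_dec (x zeta) (- s2)) => hx2.
  rewrite (Lam_out zeta); last by lra.
  case: hx2 => hx2.
    have [d2 [hd2 h2]] := x_cont zeta (- s2 - x zeta) hz hV ltac:(lra).
    exists d2; split=> // w k1 k2; have := h2 w k1 k2 => /Rabs_def2 k3.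
    by rewrite Lam_out; [lra | move=> []; lra].
  exists d1; split=> // w k1 k2; apply: Rle_trans (Lam_max w) _.
  have k3 := m_outer zeta hz hV hx2; have /Rabs_le_between := h1 w k1 k2.
  by move=> k4; apply: Rmax_lub; lra.
case: (Rle_lt_dec (- s1) (x zeta)) => hx1.
  rewrite (Lam_in zeta) //; case: hx1 => hx1.
    have [d2 [hd2 h2]] := x_cont zeta (x zeta + s1) hz hV ltac:(lra).
    have [d3 [hd3 h3]] := V_open zeta hz hV.
    exists (Rmin d1 (Rmin d2 d3)); split; first by repeat apply: Rmin_pos.
    move=> w k1 k2.
    have k3 := h1 w k1 (Rlt_le_trans _ _ _ k2 (Rmin_l _ _)).
    have k4 := h2 w k1 (Rlt_le_trans _ _ _ k2 (Rle_trans _ _ _ (Rmin_r _ _) (Rmin_l _ _))).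
    have k5 := h3 w k1 (Rlt_le_trans _ _ _ k2 (Rle_trans _ _ _ (Rmin_r _ _) (Rmin_r _ _))).
    move/Rabs_def2: k4 => k4; rewrite Lam_in //; last lra.
    by move/Rabs_le_between: k3; lra.
  exists d1; split=> // w k1 k2; apply: Rle_trans (Lam_max w) _.
  have k3 := m_inner zeta hz hV (esym hx1); have /Rabs_le_between := h1 w k1 k2.
  by move=> k4; apply: Rmax_lub; lra.
rewrite (Lam_mid zeta) //.
exists d1; split=> // w k1 k2; apply: Rle_trans (Lam_max w) _.
have := Rmax_l (m zeta) 1; have := Rmax_r (m zeta) 1; have /Rabs_le_between := h1 w k1 k2.
by move=> k4 k5 k6; apply: Rmax_lub; lra.
Qed.

Let support_m zeta : Cmod zeta < 1 -> V zeta -> - s2 < x zeta -> Lam zeta = m zeta ->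
  exists d G, 0 < d /\ G zeta = RtoC (Lam zeta) /\
     forall w, Cmod w < 1 -> Cmod (Cminus w zeta) < d -> cdiff G w /\ Cmod (G w) <= Lam w.
Proof.
move=> hz hV hx hL.
have [d2 [hd2 h2]] := x_cont zeta (x zeta + s2) hz hV ltac:(lra).
have [d3 [hd3 h3]] := V_open zeta hz hV.
have [p [q [hpq hpq0]]] := block_norm_support (A zeta) (b zeta).
exists (Rmin d2 d3), (fun w => Cplus (Cmult p (A w)) (lin q (b w))); split; first exact: Rmin_pos.
split; first by rewrite hpq0 hL.
move=> w k1 k2.
have k4 := h2 w k1 (Rlt_le_trans _ _ _ k2 (Rmin_l _ _)).
have k5 := h3 w k1 (Rlt_le_trans _ _ _ k2 (Rmin_r _ _)).
move/Rabs_def2: k4 => k4; have [dA db] := V_diff w k1 k5.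
split.
  by apply: cdiff_plus; [apply: cdiff_mult => //; exact: cdiff_const | exact: cdiff_lin].
by apply: Rle_trans (hpq _ _) _; apply: Lam_ge_m => //; lra.
Qed.

Lemma glued_block_norm_deriv : block_norm A' b' <= B0.
Proof.
have z01 : Cmod (RtoC 0) < 1 by rewrite Cmod_0; lra.
have w0 w : Cminus w (RtoC 0) = w by ring.
apply: (glued_schwarz Lam B0 (block_norm A' b')).
- move=> zeta hz; rewrite /Lam; case: (excluded_middle_informative (V zeta /\ - s2 < x zeta)) => ? /=; last lra.
  case: Rle_dec => ? /=; first exact: block_norm_ge0.
  by have := Rmax_r (m zeta) 1; lra.
- move=> zeta hz; rewrite /Lam; case: (excluded_middle_informative (V zeta /\ - s2 < x zeta)) => [[h1 h2]|?] //.
  have h := m_le zeta hz h1 h2; case: Rle_dec => ? //=; exact: Rmax_lub.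
- exact: Lam_usc.
- move=> zeta hz _; case: (classic (V zeta /\ - s2 < x zeta)) => [[hV hx]|hno].
    case: (Rle_lt_dec (- s1) (x zeta)) => hx1; first by right; apply: support_m => //; rewrite Lam_in.
    case: (Rle_lt_dec 1 (m zeta)) => hm.
      by right; apply: support_m => //; rewrite Lam_mid // Rmax_left.
    left; rewrite Lam_mid // Rmax_right; last lra.
    split; first lra.
    have [d [hd h]] := x_cont zeta (- s1 - x zeta) hz hV ltac:(lra).
    exists d; split=> // w k1 k2; apply: Lam_ge1; left.
    by have := h w k1 k2 => /Rabs_def2; lra.
  left; rewrite Lam_out //; split; first lra.
  have [d [hd h]] := near_out zeta hz ltac:(move=> hV; apply: Rnot_lt_le => hx; exact: hno).
  by exists d; split=> // w k1 k2; apply: Lam_ge1; exact: h.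
- have [d2 [hd2 h2]] := x_cont (RtoC 0) (x (RtoC 0) + s1) z01 V0 ltac:(lra).
  have [d3 [hd3 h3]] := V_open (RtoC 0) z01 V0.
  have [p [q [hpq hpq0]]] := block_norm_support A' b'.
  exists (Rmin d2 d3), (fun w => Cplus (Cmult p (A w)) (lin q (b w))); split; first exact: Rmin_pos.
  split.
    rewrite A0 b0 (_ : lin q vzero = RtoC 0); first by ring.
    by rewrite /lin -(csum0 'I_n); apply: csum_ext => j; rewrite /vzero; ring.
  split.
    rewrite -hpq0; apply: cderiv_plus; last exact: cderiv_lin.
    have -> : Cmult p A' = Cplus (Cmult (RtoC 0) (A (RtoC 0))) (Cmult p A') by ring.
    by apply: (cderiv_mult (fun _ => p)) => //; exact: cderiv_const.
  move=> w k1 k2.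
  have k4 := h2 w k1 ltac:(rewrite w0; exact: (Rlt_le_trans _ _ _ k2 (Rmin_l _ _))).
  have k5 := h3 w k1 ltac:(rewrite w0; exact: (Rlt_le_trans _ _ _ k2 (Rmin_r _ _))).
  move/Rabs_def2: k4 => k4; have [dA db] := V_diff w k1 k5.
  split.
    by apply: cdiff_plus; [apply: cdiff_mult => //; exact: cdiff_const | exact: cdiff_lin].
  by apply: Rle_trans (hpq _ _) _; apply: Lam_ge_m => //; lra.
move=> e he.
have [d2 [hd2 h2]] := x_cont (RtoC 0) (x (RtoC 0) + s1) z01 V0 ltac:(lra).
have [d3 [hd3 h3]] := V_open (RtoC 0) z01 V0.
pose e1 := e / ((1 + M) * (1 + INR n)).
have n0 := pos_INR n.
have Mn : 0 < (1 + M) * (1 + INR n) by apply: Rmult_lt_0_compat; lra.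
have he1 : 0 < e1 by apply: Rdiv_lt_0_compat.
have [d4 [hd4 h4]] := A_deriv e1 he1.
have hb j := b_deriv j e1 he1.
have [d5 hd5] := choice _ hb.
have [d6 [hd6 h6]] := fin_lower _ d5 (fun j => proj1 (hd5 j)).
exists (Rmin (Rmin d2 d3) (Rmin d4 d6)); split; first by repeat apply: Rmin_pos.
move=> w k1 k2.
have k3 := h2 w k1 ltac:(rewrite w0; exact: (Rlt_le_trans _ _ _ k2 (Rle_trans _ _ _ (Rmin_l _ _) (Rmin_l _ _)))).
have k4 := h3 w k1 ltac:(rewrite w0; exact: (Rlt_le_trans _ _ _ k2 (Rle_trans _ _ _ (Rmin_l _ _) (Rmin_r _ _)))).
have k5 := h4 w ltac:(rewrite w0; exact: (Rlt_le_trans _ _ _ k2 (Rle_trans _ _ _ (Rmin_r _ _) (Rmin_l _ _)))).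
have k6 j : Cmod (Cminus (b w j) (Cmult (b' j) w)) <= e1 * Cmod w.
  have := proj2 (hd5 j) w; rewrite w0 b0 => k.
  have -> : Cminus (b w j) (Cmult (b' j) w) = Cminus (Cminus (b w j) (vzero j)) (Cmult (b' j) w).
    by rewrite /vzero; ring.
  apply: k; apply: Rlt_le_trans k2 _; apply: Rle_trans (h6 j).
  exact: Rle_trans (Rmin_r _ _) (Rmin_r _ _).
move/Rabs_def2: k3 => k3; rewrite Lam_in //; last lra.
rewrite w0 A0 in k5; rewrite /m.
have eA : A w = Cplus (Cmult w A') (Cminus (Cminus (A w) (RtoC 0)) (Cmult A' w)) by ring.
have eb : b w = vadd (vscal w b') (fun j => Cminus (b w j) (Cmult (b' j) w)).
  by apply: vext => j; rewrite /vadd /vscal; ring.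
rewrite eA eb; apply: Rle_trans (block_norm_triangle _ _ _ _) _; rewrite block_norm_scal.
have := block_norm_le (Cminus (Cminus (A w) (RtoC 0)) (Cmult A' w)) (fun j => Cminus (b w j) (Cmult (b' j) w)).
have k7 := vnorm_le_const _ (fun j => Cminus (b w j) (Cmult (b' j) w)) _ k6.
set r := block_norm _ _; set r1 := Cmod (Cminus _ _) in k5 *; set r2 := vnorm _ in k7 * => k8.
have : (1 + M) * (r1 + r2) <= (1 + M) * ((1 + INR n) * (e1 * Cmod w)) by apply: Rmult_le_compat_l; lra.
have -> : (1 + M) * ((1 + INR n) * (e1 * Cmod w)) = e * Cmod w by rewrite /e1; field; lra.
lra.
Qed.
End Glue.
End ProductNorm.
Arguments block_norm {n M c}.

Lemma sqrt_le_1_plus a : 0 <= a -> sqrt (1 + a) <= 1 + a.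
Proof.
move=> h; rewrite -[X in _ <= X]sqrt_square; last lra.
by apply: sqrt_le_1_alt; nra.
Qed.

(** A modulus bound that is linear in [Re z]: a negative real part of order [s] prevails over
    [|z|^2], which is of order [s^2]. *)
Lemma Cmod_1_plus_le (z : C) : Cmod (Cplus (RtoC 1) z) <= 1 + Re z + Cmod z * Cmod z.
Proof.
have h := Cmod_sq (Cplus (RtoC 1) z); rewrite !CE in h.
have h0 := Cmod_ge_0 (Cplus (RtoC 1) z); have h1 := Cmod_sq z.
have pos : 0 <= 1 + Re z + Cmod z * Cmod z by nra.
have : Cmod (Cplus (RtoC 1) z) * Cmod (Cplus (RtoC 1) z) <=
  (1 + Re z + Cmod z * Cmod z) * (1 + Re z + Cmod z * Cmod z) by nra.
nra.
Qed.

(** * The Cayley transform along a disc *)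

Section LowerModel.
Variables (n : nat) (M c : R).
Hypotheses (M_ge0 : 0 <= M) (c_gt0 : 0 < c).
Variables (K r e B : R).
Hypotheses (K_ge0 : 0 <= K) (r_gt0 : 0 < r) (e_range : 0 < e <= 1) (B_ge0 : 0 <= B).
Implicit Types (ch : chart n M c) (X h z : Cn n).

(** In the domain the depth controls [|h|^2], so that errors in [|h|^2 + s] can be expressed through
    [|x| + s], the quantity seen by the Cayley transform. Now [- 2 K (Re l)^2] has the unfavourable
    sign; but [2 Re l] equals [x + s] up to [O(|h|^2)], and the square is absorbed in the error. *)
Lemma lower_geometry : exists r1 C1 s0, 0 < r1 <= 1 /\ 0 <= C1 /\ 0 < s0 /\
  forall ch Omega z, ch_s ch < s0 -> taylor_domain K r e B ch Omega z ->
  forall h, vnorm h < r1 -> Omega (vadd z h) ->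
  let x := Re (hol_normal ch h) - ch_s ch in
  c / 8 * (vnorm h * vnorm h) <= - x + / 4 * (Rabs x + ch_s ch) /\
  x + levi_norm ch (shear ch h) <= C1 * Rpower (Rabs x + ch_s ch) (1 + e) /\
  Rabs x + ch_s ch <= 1.
Proof.
have [Ch [hCh hhol]] := hol_normal_le n M c M_ge0.
have [Cs [hCs hsh]] := shear_le n M c M_ge0.
pose tau := Rmin (c / 8) (/ 8); have tau0 : 0 < tau by apply: Rmin_pos; lra.
have tau1 := Rmin_l (c / 8) (/ 8); have tau2 := Rmin_r (c / 8) (/ 8); rewrite -/tau in tau1 tau2.
pose C2 := B + 2 * Cs + K * (Ch * Ch).
have C20 : 0 <= C2.
  have : 0 <= K * (Ch * Ch) by apply: Rmult_le_pos => //; nra.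
  by rewrite /C2; lra.
have [x0 [hx0 hsm]] := Rpower_small e (tau / (C2 + 1)) ltac:(lra) ltac:(apply: Rdiv_lt_0_compat; lra).
pose k1 := / (2 * (Cs + 1)); have k10 : 0 < k1 by apply: Rinv_0_lt_compat; lra.
have KC : 0 < 8 * ((K + 1) * (Ch + 1)).
  by apply: Rmult_lt_0_compat; [lra | apply: Rmult_lt_0_compat; lra].
pose k2 := / (8 * ((K + 1) * (Ch + 1))); have k20 : 0 < k2 by apply: Rinv_0_lt_compat.
(* [k1] keeps [|shear h| >= |h| / 2], [k2] gives [K (x + s)^2 <= (|x| + s) / 8], and [x0] gives
   [C2 om^(1 + e) <= tau om]; together they yield the first claim. *)
pose r1 := Rmin (Rmin r (/ 2)) (Rmin k1 (Rmin k2 (x0 / 2))).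
have r10 : 0 < r1 by repeat apply: Rmin_pos; lra.
have rl : r1 <= r /\ r1 <= / 2 /\ r1 <= k1 /\ r1 <= k2 /\ r1 <= x0 / 2.
  have := Rmin_l (Rmin r (/ 2)) (Rmin k1 (Rmin k2 (x0 / 2))).
  have := Rmin_r (Rmin r (/ 2)) (Rmin k1 (Rmin k2 (x0 / 2))).
  have := Rmin_l r (/ 2); have := Rmin_r r (/ 2).
  have := Rmin_l k1 (Rmin k2 (x0 / 2)); have := Rmin_r k1 (Rmin k2 (x0 / 2)).
  have := Rmin_l k2 (x0 / 2); have := Rmin_r k2 (x0 / 2); rewrite -/r1; lra.
pose k := 10 / c + 1.
have k0 : 1 <= k by rewrite /k; have : 0 < 10 / c; [apply: Rdiv_lt_0_compat; lra | lra].
exists r1, (K + C2 * (k * k)), (Rmin (/ 4) (x0 / 2)); split; first lra.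
split; first by have : 0 <= C2 * (k * k) by [apply: Rmult_le_pos => //; nra]; lra.
split; first by apply: Rmin_pos; lra.
move=> ch Omega z hs0 [rho hrho] h hr hO x.
have hs := ch_s_range _ _ _ ch; set s := ch_s ch in hs hs0 x *.
have sl1 := Rmin_l (/ 4) (x0 / 2); have sl2 := Rmin_r (/ 4) (x0 / 2).
have h0 := vnorm_ge0 _ h; set t := vnorm h in hr h0 *.
have t1 : t <= 1 by lra.
pose om := t * t + s.
have om0 : 0 < om by rewrite /om; nra.
have om1 : om <= 1 by rewrite /om; nra.
have omx : om <= x0 by rewrite /om; nra.
have [hW1 hW2] := hhol ch h t1; rewrite -/t in hW1 hW2.
have [hq hL] := hsh ch h t1; rewrite -/t -/s in hq hL.
have [hO' hT] := hrho h ltac:(rewrite -/t; lra).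
move/hO': hO => hO; rewrite -/t -/s -/om in hT.
have P0 := Rpower_pos om (1 + e).
have omsq : om * om <= Rpower om (1 + e) by apply: sq_le_Rpower; lra.
have reW : Re (hol_normal ch h) = x + s by rewrite /x; ring.
have err : Cs * (t * t * (t * t) + s * (t * t * t)) <= 2 * Cs * Rpower om (1 + e).
  have a1 : t * t * (t * t) <= om * om by apply: Rmult_le_compat; rewrite /om; nra.
  have a2 : s * (t * t * t) <= om * om.
    by apply: Rmult_le_compat; try (rewrite /om; nra); nra.
  have -> : 2 * Cs * Rpower om (1 + e) = Cs * (2 * Rpower om (1 + e)) by ring.
  by apply: Rmult_le_compat_l => //; lra.
have lre : 2 * K * (Re (lin (ch_a ch) h) * Re (lin (ch_a ch) h)) <=
    K * ((x + s) * (x + s)) + K * (Ch * Ch) * Rpower om (1 + e).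
  have := Rle_trans _ _ _ (Cmod_Re _) hW2; rewrite Re_minus Re_mult Re_RtoC Im_RtoC reW Rmult_0_l Rminus_0_r.
  set l := Re (lin (ch_a ch) h) => /Rabs_le_between hl.
  have dl : (2 * l - (x + s)) * (2 * l - (x + s)) <= Ch * Ch * (om * om).
    have -> : Ch * Ch * (om * om) = (Ch * om) * (Ch * om) by ring.
    have : Ch * (t * t) <= Ch * om by apply: Rmult_le_compat_l; rewrite /om; lra.
    by move=> hh; apply: neg_pos_Rsqr_le; lra.
  have dl2 : 2 * (l * l) <= (x + s) * (x + s) + Ch * Ch * (om * om).
    by have := Rle_0_sqr ((x + s) - (2 * l - (x + s))); rewrite /Rsqr; lra.
  have dl3 : Ch * Ch * (om * om) <= Ch * Ch * Rpower om (1 + e) by apply: Rmult_le_compat_l; nra.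
  have := Rmult_le_compat_l K _ _ K_ge0 (Rle_trans _ _ _ dl2 (Rplus_le_compat_l _ _ _ dl3)).
  lra.
have F1 : x + levi_norm ch (shear ch h) <= K * ((x + s) * (x + s)) + C2 * Rpower om (1 + e).
  move/Rabs_le_between: hL => hL; move/Rabs_le_between: hT => hT.
  by rewrite reW in hT; rewrite /C2; lra.
have xs : Rabs (x + s) <= Ch * t.
  by rewrite -reW; exact: Rle_trans (Cmod_Re _) hW1.
have ax : Rabs (x + s) <= Rabs x + s.
  by apply: Rle_trans (Rabs_triang _ _) _; rewrite (Rabs_pos_eq s); lra.
have Ct : Ch * t <= / 8 /\ K * (Ch * t) <= / 8.
  have kk : k2 * ((K + 1) * (Ch + 1)) = / 8 by rewrite /k2; field; lra.
  have b1 : t * ((K + 1) * (Ch + 1)) <= / 8 by rewrite -kk; apply: Rmult_le_compat_r; nra.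
  have b2 : 0 <= t * K by nra.
  have b3 : 0 <= t * Ch by nra.
  have b4 : 0 <= t * Ch * K by nra.
  by split; lra.
have sg1 : Rabs x + s <= 1.
  have : Rabs x <= Rabs (x + s) + s.
    have -> : Rabs x = Rabs ((x + s) + - s) by congr Rabs; ring.
    by apply: Rle_trans (Rabs_triang _ _) _; rewrite Rabs_Ropp (Rabs_pos_eq s); lra.
  lra.
have xsq : (x + s) * (x + s) = Rabs (x + s) * Rabs (x + s).
  by rewrite -Rabs_mult Rabs_pos_eq //; exact: Rle_0_sqr.
have K1 : K * ((x + s) * (x + s)) <= / 8 * (Rabs x + s).
  rewrite xsq; have a0 := Rabs_pos (x + s).
  have : K * (Rabs (x + s) * Rabs (x + s)) <= K * (Ch * t * Rabs (x + s)).
    by apply: Rmult_le_compat_l => //; apply: Rmult_le_compat_r.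
  have : (K * (Ch * t)) * Rabs (x + s) <= / 8 * Rabs (x + s) by apply: Rmult_le_compat_r => //; lra.
  lra.
have C2om : C2 * Rpower om (1 + e) <= tau * om.
  rewrite Rpower_succ //.
  have h1 := hsm om (conj om0 omx); have p0 := Rpower_pos om e.
  have h2 : (C2 + 1) * Rpower om e <= (C2 + 1) * (tau / (C2 + 1)) by apply: Rmult_le_compat_l; lra.
  have h3 : (C2 + 1) * (tau / (C2 + 1)) = tau by field; lra.
  have h4 : C2 * Rpower om e <= tau by nra.
  have : om * (C2 * Rpower om e) <= om * tau by apply: Rmult_le_compat_l; lra.
  lra.
have levi_low : c / 4 * (t * t) <= levi_norm ch (shear ch h).
  apply: Rle_trans (levi_norm_ge n M c ch _).
  have sh : t / 2 <= vnorm (shear ch h).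
    have : t <= vnorm (shear ch h) + vnorm (quad (ch_Q ch) h h).
      have -> : t = vnorm (vsub (shear ch h) (quad (ch_Q ch) h h)).
        by rewrite /t; congr vnorm; apply: vext => j; rewrite /shear /vsub /vadd; ring.
      exact: vnorm_sub_le.
    have : Cs * t <= / 2.
      have : (Cs + 1) * t <= (Cs + 1) * k1 by apply: Rmult_le_compat_l; lra.
      have -> : (Cs + 1) * k1 = / 2 by rewrite /k1; field; lra.
      nra.
    have : Cs * (t * t) = (Cs * t) * t by ring.
    nra.
  have -> : c / 4 * (t * t) = c * (t / 2 * (t / 2)) by field.
  by apply: Rmult_le_compat_l; [lra | apply: Rmult_le_compat; lra].
have star : c / 8 * (t * t) <= - x + / 4 * (Rabs x + s).
  have tom : tau * om <= c / 8 * (t * t) + / 8 * s.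
    rewrite /om; have : tau * (t * t) <= c / 8 * (t * t) by apply: Rmult_le_compat_r; nra.
    have : tau * s <= / 8 * s by apply: Rmult_le_compat_r; lra.
    lra.
  have := Rabs_pos x; lra.
split=> //; split=> //.
have sg0 : 0 < Rabs x + s by have := Rabs_pos x; lra.
have omk : om <= k * (Rabs x + s).
  have : t * t <= 10 / c * (Rabs x + s).
    apply: (Rmult_le_reg_l (c / 8)); first lra.
    have -> : c / 8 * (10 / c * (Rabs x + s)) = 5 / 4 * (Rabs x + s) by field; lra.
    have := Rle_abs (- x); rewrite Rabs_Ropp; lra.
  by rewrite /om /k; have := Rabs_pos x; lra.
have pw : Rpower om (1 + e) <= k * k * Rpower (Rabs x + s) (1 + e).
  apply: Rle_trans (Rpower_scale k _ e k0 sg0 ltac:(lra)).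
  by apply: Rle_Rpower_l; lra.
have sqp : (x + s) * (x + s) <= Rpower (Rabs x + s) (1 + e).
  apply: (Rle_trans _ ((Rabs x + s) * (Rabs x + s))); last by apply: sq_le_Rpower; lra.
  by rewrite xsq; apply: Rmult_le_compat => //; exact: Rabs_pos.
have : K * ((x + s) * (x + s)) <= K * Rpower (Rabs x + s) (1 + e) by apply: Rmult_le_compat_l.
have : C2 * Rpower om (1 + e) <= C2 * (k * k * Rpower (Rabs x + s) (1 + e)) by apply: Rmult_le_compat_l.
lra.
Qed.

(* With [w = hol_normal - s], the model domain [Re w + L(y, y) < 0] is mapped to the unit ball by
   [(w, y) -> ((w + s) / (s - w), 2 sqrt s y / (s - w))]; this is the squared norm of the image. *)
Definition cayley_norm_sq ch h : R :=
  1 + 4 * ch_s ch * (Re (hol_normal ch h) - ch_s ch + levi_norm ch (shear ch h)) /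
    (Cmod (Cminus (RtoC (2 * ch_s ch)) (hol_normal ch h)) * Cmod (Cminus (RtoC (2 * ch_s ch)) (hol_normal ch h))).

Lemma cayley_normE ch h (E : C) : Cminus (RtoC (2 * ch_s ch)) (hol_normal ch h) <> RtoC 0 ->
  let D := Cminus (RtoC (2 * ch_s ch)) (hol_normal ch h) in
  block_norm ch (Cmult E (Cdiv (hol_normal ch h) D))
     (vscal (Cmult E (Cdiv (RtoC (2 * sqrt (ch_s ch))) D)) (shear ch h)) =
  Cmod E * sqrt (cayley_norm_sq ch h).
Proof.
move=> hD D; have hs := ch_s_range _ _ _ ch.
have Dp : 0 < Cmod D := proj1 (Cmod_gt_0 _) hD.
have -> : vscal (Cmult E (Cdiv (RtoC (2 * sqrt (ch_s ch))) D)) (shear ch h) =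
   vscal E (vscal (Cdiv (RtoC (2 * sqrt (ch_s ch))) D) (shear ch h)).
  by apply: vext => j; rewrite /vscal; ring.
rewrite block_norm_scal /block_norm; congr (_ * sqrt _).
rewrite levi_norm_scal !Cmod_div // Cmod_R /cayley_norm_sq -/D.
have sq : sqrt (ch_s ch) * sqrt (ch_s ch) = ch_s ch by apply: sqrt_sqrt; lra.
rewrite Rabs_pos_eq; last by have := sqrt_pos (ch_s ch); lra.
have e1 : Cmod D * Cmod D = 4 * (ch_s ch * ch_s ch) - 4 * ch_s ch * Re (hol_normal ch h) +
   Cmod (hol_normal ch h) * Cmod (hol_normal ch h).
  rewrite /D !Cmod_sq; move: (hol_normal ch h) => W; rewrite !CE; ring.
have -> : Cmod (hol_normal ch h) / Cmod D * (Cmod (hol_normal ch h) / Cmod D) +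
  2 * sqrt (ch_s ch) / Cmod D * (2 * sqrt (ch_s ch) / Cmod D) * levi_norm ch (shear ch h) =
  (Cmod (hol_normal ch h) * Cmod (hol_normal ch h) + 4 * (sqrt (ch_s ch) * sqrt (ch_s ch)) * levi_norm ch (shear ch h)) / (Cmod D * Cmod D).
  by field; lra.
have -> : Cmod (hol_normal ch h) * Cmod (hol_normal ch h) = Cmod D * Cmod D - 4 * (ch_s ch * ch_s ch) + 4 * ch_s ch * Re (hol_normal ch h).
  by rewrite e1; ring.
by rewrite sq; field; lra.
Qed.

Lemma vdiff_shear ch (f : C -> Cn n) x : vdiff f x -> vdiff (fun w => shear ch (f w)) x.
Proof. by move=> hf; apply: vdiff_add => //; exact: vdiff_quad. Qed.

Lemma cdiff_hol_normal ch (f : C -> Cn n) x : vdiff f x -> cdiff (fun w => hol_normal ch (f w)) x.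
Proof.
move=> hf; apply: cdiff_plus; last exact: cdiff_tri.
apply: cdiff_plus; last exact: cdiff_bil.
by apply: cdiff_mult; [exact: cdiff_const | exact: cdiff_lin].
Qed.

Lemma metric_form_scal ch (a : C) X : metric_form ch (vscal a X) = Cmod a * Cmod a * metric_form ch X.
Proof.
have hs := ch_s_range _ _ _ ch.
by rewrite /metric_form levi_norm_scal linZ Cmod_mult; field; lra.
Qed.

(** The derivative of the Cayley map at the base point sends [X] to [(l X / s, X / sqrt s)], so this
    identifies the model metric with the pullback of the norm. *)
Lemma block_norm_metric ch X : let s := ch_s ch in
  block_norm ch (Cdiv (lin (ch_a ch) X) (RtoC s)) (vscal (RtoC (/ sqrt s)) X) = sqrt (metric_form ch X).
Proof.
move=> s; have hs : 0 < s <= 1 := ch_s_range _ _ _ ch.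
rewrite /block_norm levi_norm_scal Cmod_div; last by apply: RtoC_neq0; lra.
have q0 := sqrt_lt_R0 s ltac:(lra).
rewrite !Cmod_R !Rabs_pos_eq; try lra; last by apply: Rlt_le; apply: Rinv_0_lt_compat.
congr sqrt; rewrite /metric_form -/s.
have hq : sqrt s * sqrt s = s by apply: sqrt_sqrt; lra.
have -> : / sqrt s * / sqrt s = / s by rewrite -{3}hq; field; lra.
by field; lra.
Qed.

(** The Cayley image of a disc, multiplied by a holomorphic factor [E] close to 1, satisfies the
    hypotheses of the gluing with bound [1 + C s^e]. Hence [sqrt (metric_form v) <= 1 + C s^e] for
    the derivative [v] of every competing disc. *)
Lemma kobayashi_lower_model : exists C s0, 0 < C /\ 0 < s0 /\ forall ch Omega z, ch_s ch < s0 ->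
  taylor_domain K r e B ch Omega z -> forall X,
  Rbar_le (Rbar.Finite ((1 - C * Rpower (ch_s ch) e) * sqrt (metric_form ch X))) (kobayashi Omega z X).
Proof.
have [r1 [C1 [s00 [hr1 [hC1 [hs00 hgeo]]]]]] := lower_geometry.
have [Ch [hCh hhol]] := hol_normal_le n M c M_ge0.
have [Cs [hCs hsh]] := shear_le n M c M_ge0.
(* Chosen so that [x > - s2] forces [|h| <= r1 / 2]; thus the cutoff takes place well inside [V]. *)
pose s2 := Rmin 1 (c * (r1 * r1) / 64).
have s20 : 0 < s2 by apply: Rmin_pos; [lra | apply: Rdiv_lt_0_compat; [apply: Rmult_lt_0_compat; nra | lra]].
have s21 : s2 <= 1 := Rmin_l _ _.
have s22 : s2 <= c * (r1 * r1) / 64 := Rmin_r _ _.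
pose s1 := s2 / 2.
(* Uncorrected, the norm is at least [1 - A s] where [x = - s1] and at most [1 + A' s] where
   [x = - s2]. The factor [E] gains, respectively loses, [E0 s] to first order, enough to reverse
   both defects. *)
pose A := 4 / s1; have A0 : 0 < A by apply: Rdiv_lt_0_compat; rewrite /s1; lra.
pose A' := 4 * C1 / (s2 * s2); have A'0 : 0 <= A'.
  by apply: Rmult_le_pos; [lra | apply: Rlt_le; apply: Rinv_0_lt_compat; nra].
pose E0 := 2 * A + A' + 1.
pose kap := 4 * E0 / s2; have kap0 : 0 < kap by apply: Rdiv_lt_0_compat; rewrite /E0; lra.
(* [D] bounds [|W + sb - s|] on [V], and [G s^2] bounds [|E - 1|^2], the second-order cost of
   estimating [|E|] through its real part. *)
pose D := Ch + 2.
pose G := kap * kap * (D * D); have G0 : 0 <= G by rewrite /G; have : 0 <= kap * kap by [nra]; have : 0 <= D * D by [nra]; nra.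
pose C := 16 * C1 + kap * D + 16 * C1 * (kap * D) + 1.
have kD : 0 <= kap * D by rewrite /D; nra.
have C0 : 0 < C by rewrite /C; have : 0 <= 16 * C1 * (kap * D) by [apply: Rmult_le_pos; lra]; lra.
pose s0 := Rmin (Rmin s00 (s1 / 2)) (Rmin (/ (2 * A)) (/ (G + A' * G + 1))).
have AG : 0 <= A' * G by apply: Rmult_le_pos.
have hs0 : 0 < s0.
  by repeat apply: Rmin_pos => //; try (rewrite /s1; lra); apply: Rinv_0_lt_compat; lra.
have sl : s0 <= s00 /\ s0 <= s1 / 2 /\ s0 <= / (2 * A) /\ s0 <= / (G + A' * G + 1).
  have := Rmin_l (Rmin s00 (s1 / 2)) (Rmin (/ (2 * A)) (/ (G + A' * G + 1))).
  have := Rmin_r (Rmin s00 (s1 / 2)) (Rmin (/ (2 * A)) (/ (G + A' * G + 1))).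
  have := Rmin_l s00 (s1 / 2); have := Rmin_r s00 (s1 / 2).
  have := Rmin_l (/ (2 * A)) (/ (G + A' * G + 1)); have := Rmin_r (/ (2 * A)) (/ (G + A' * G + 1)).
  by rewrite -/s0; lra.
exists C, s0; split=> //; split=> //.
move=> ch Omega z hss hT X.
have hs := ch_s_range _ _ _ ch; have geo := hgeo ch Omega z ltac:(lra) hT.
set s := ch_s ch in hss hs geo *.
have se := Rpower_pos s e.
have sse : s <= Rpower s e by rewrite -{1}(Rpower_1 s); [apply: Rpower_le_exponent; lra | lra].
have se1 : Rpower s e <= 1.
  have -> : 1 = Rpower s 0 by rewrite Rpower_O; lra.
  by apply: Rpower_le_exponent; lra.
have As : A * s <= / 2.
  have : A * s <= A * (/ (2 * A)) by apply: Rmult_le_compat_l; lra.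
  by have -> : A * / (2 * A) = / 2 by field; lra.
have Gs : (G + A' * G) * s <= 1.
  have : (G + A' * G + 1) * s <= (G + A' * G + 1) * (/ (G + A' * G + 1)) by apply: Rmult_le_compat_l; lra.
  by rewrite Rinv_r; lra.
have sss1 : s < s1 by lra.
have s12 : s1 = s2 / 2 by [].
apply: (proj2 (Glb_Rbar_correct _)) => al [alpha [phi [v [hdisc [phi0 [dphi [hal ->]]]]]]].
have pd zeta : Cmod zeta < 1 -> vdiff phi zeta.
  by move=> hz j; have [l hl] := proj2 (hdisc zeta hz) j; exists l; apply/is_derive_cderiv.
have dv j : cderiv (fun u => phi u j) (RtoC 0) (v j) by apply/is_derive_cderiv.
pose h zeta := vsub (phi zeta) z.
have hd zeta : Cmod zeta < 1 -> vdiff h zeta.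
  by move=> hz; apply: vdiff_sub; [exact: pd | exact: vdiff_const].
have hO zeta : Cmod zeta < 1 -> Omega (vadd z (h zeta)).
  by move=> hz; rewrite /h vadd_sub; exact: (proj1 (hdisc zeta hz)).
pose W zeta := hol_normal ch (h zeta).
pose x zeta := Re (W zeta) - s.
pose den zeta := Cminus (RtoC (2 * s)) (W zeta).
(* The midpoint of [s1] and [s2]: [Re (cc) = kap s (x + sb)] is [E0 s] at [x = - s1] and [- E0 s] at
   [x = - s2], because [kap s2 / 4 = E0]. *)
pose sb := 3 / 4 * s2.
pose cc zeta := Cmult (RtoC (kap * s)) (Cplus (W zeta) (RtoC (sb - s))).
pose E zeta := Cplus (RtoC 1) (cc zeta).
pose Af zeta := Cmult (E zeta) (Cdiv (W zeta) (den zeta)).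
pose bf zeta := vscal (Cmult (E zeta) (Cdiv (RtoC (2 * sqrt s)) (den zeta))) (shear ch (h zeta)).
pose V zeta := vnorm (h zeta) < r1.
have Vgeo zeta : Cmod zeta < 1 -> V zeta ->
    c / 8 * (vnorm (h zeta) * vnorm (h zeta)) <= - x zeta + / 4 * (Rabs (x zeta) + s) /\
    x zeta + levi_norm ch (shear ch (h zeta)) <= C1 * Rpower (Rabs (x zeta) + s) (1 + e) /\
    Rabs (x zeta) + s <= 1.
  by move=> hz hV; exact: geo (h zeta) hV (hO zeta hz).
have Reden zeta : Re (den zeta) = s - x zeta by rewrite /den /x Re_minus Re_RtoC; ring.
(* The first estimate of [lower_geometry] lets [x] be positive only up to [s / 3], so the pole
   [W = 2 s] of the Cayley transform stays away. *)
have den_ge zeta : Cmod zeta < 1 -> V zeta -> (Rabs (x zeta) + s) / 2 <= Cmod (den zeta) /\ s - x zeta <= Cmod (den zeta).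
  move=> hz hV; have [g1 _] := Vgeo zeta hz hV.
  have d1 := Re_le_Cmod (den zeta); rewrite Reden in d1; split=> //.
  have hh : 0 <= c / 8 * (vnorm (h zeta) * vnorm (h zeta)).
    by have := vnorm_ge0 _ (h zeta) => v0; apply: Rmult_le_pos; nra.
  move: g1; rewrite /Rabs; case: Rcase_abs => hx; lra.
have denp zeta : Cmod zeta < 1 -> V zeta -> 0 < Cmod (den zeta).
  by move=> hz hV; have [g _] := den_ge zeta hz hV; have := Rabs_pos (x zeta); lra.
have den0 zeta : Cmod zeta < 1 -> V zeta -> den zeta <> RtoC 0.
  by move=> hz hV e0; have := denp zeta hz hV; rewrite e0 Cmod_0; lra.
have mE zeta : Cmod zeta < 1 -> V zeta ->
    block_norm ch (Af zeta) (bf zeta) = Cmod (E zeta) * sqrt (cayley_norm_sq ch (h zeta)).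
  by move=> hz hV; apply: cayley_normE; exact: den0.
have Nle zeta : Cmod zeta < 1 -> V zeta -> sqrt (cayley_norm_sq ch (h zeta)) <= 1 + 16 * C1 * Rpower s e.
  move=> hz hV; have [_ [g2 _]] := Vgeo zeta hz hV; have [g4 _] := den_ge zeta hz hV.
  have dp := denp zeta hz hV.
  set sg := Rabs (x zeta) + s in g2 g4.
  have sg0 : 0 < sg by rewrite /sg; have := Rabs_pos (x zeta); lra.
  have nn : 0 <= 16 * C1 * Rpower s e by apply: Rmult_le_pos; lra.
  apply: Rle_trans (sqrt_le_1_plus _ nn); apply: sqrt_le_1_alt.
  rewrite /cayley_norm_sq -/s -/(W zeta) -/(x zeta) -/(den zeta); apply: Rplus_le_compat_l.
  apply: (Rmult_le_reg_r (Cmod (den zeta) * Cmod (den zeta))); first by nra.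
  set F := x zeta + _ in g2 *.
  have -> : 4 * s * F / (Cmod (den zeta) * Cmod (den zeta)) * (Cmod (den zeta) * Cmod (den zeta)) = 4 * s * F by field; lra.
  have q1 : 4 * s * F <= 4 * s * (C1 * (sg * Rpower sg e)).
    by rewrite -Rpower_succ //; apply: Rmult_le_compat_l; lra.
  have q2 : s * Rpower sg e <= sg * Rpower s e.
    by apply: Rpower_quotient_le; rewrite /sg; have := Rabs_pos (x zeta); lra.
  have q3 : 4 * C1 * sg * (s * Rpower sg e) <= 4 * C1 * sg * (sg * Rpower s e).
    by apply: Rmult_le_compat_l => //; apply: Rmult_le_pos; lra.
  have q4 : sg / 2 * (sg / 2) <= Cmod (den zeta) * Cmod (den zeta) by apply: Rmult_le_compat; lra.
  have q5 : 16 * C1 * Rpower s e * (sg / 2 * (sg / 2)) <= 16 * C1 * Rpower s e * (Cmod (den zeta) * Cmod (den zeta)).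
    exact: Rmult_le_compat_l.
  lra.
have Wle zeta : V zeta -> Cmod (W zeta) <= Ch.
  move=> hV; have [hw _] := hhol ch (h zeta) ltac:(rewrite /V in hV; lra).
  apply: Rle_trans hw _; have : Ch * vnorm (h zeta) <= Ch * 1 by apply: Rmult_le_compat_l; rewrite /V in hV; lra.
  lra.
have ccle zeta : V zeta -> Cmod (cc zeta) <= kap * s * D.
  move=> hV; rewrite /cc Cmod_mult Cmod_R Rabs_pos_eq; last by nra.
  apply: Rmult_le_compat_l; first by nra.
  apply: Rle_trans (Cmod_triangle _ _) _; rewrite Cmod_R; have := Wle zeta hV.
  by rewrite /D Rabs_pos_eq /sb; lra.
have Recc zeta : Re (cc zeta) = kap * s * (x zeta + sb).
  by rewrite /cc /x; move: (W zeta) => wz; rewrite !CE; ring.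
have kE0 : kap * (s2 / 4) = E0 by rewrite /kap; field; lra.
have z01 : Cmod (RtoC 0) < 1 by rewrite Cmod_0; lra.
have h0 : h (RtoC 0) = vzero by rewrite /h phi0; apply: vext => j; rewrite /vsub /vzero; ring.
have V0 : V (RtoC 0) by rewrite /V h0 vnorm_zero; lra.
have W0 : W (RtoC 0) = RtoC 0.
  apply: Cmod_eq_0; have [hw _] := hhol ch vzero ltac:(rewrite vnorm_zero; lra).
  by rewrite vnorm_zero Rmult_0_r in hw; rewrite /W h0; have := Cmod_ge_0 (hol_normal ch vzero); lra.
have hcont zeta : Cmod zeta < 1 -> exists d L, 0 < d /\ 0 <= L /\ forall w, Cmod (Cminus w zeta) < d ->
    vdist (h w) (h zeta) <= L * Cmod (Cminus w zeta).
  by move=> hz; have [l hl] := choice _ (hd zeta hz); exact: vderiv_lipschitz hl.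
have hball zeta t : Cmod zeta < 1 -> 0 < t -> exists d, 0 < d /\ forall w, Cmod w < 1 -> Cmod (Cminus w zeta) < d ->
    vdist (h w) (h zeta) < t.
  move=> hz ht; have [d [L [hd0 [hL hw]]]] := hcont zeta hz.
  exists (Rmin d (t / (L + 1))); split; first by apply: Rmin_pos => //; apply: Rdiv_lt_0_compat; lra.
  move=> w _ hwd; apply: Rle_lt_trans (hw w (Rlt_le_trans _ _ _ hwd (Rmin_l _ _))) _.
  have k2 := Rlt_le_trans _ _ _ hwd (Rmin_r _ _); have k0 := Cmod_ge_0 (Cminus w zeta).
  have : (L + 1) * Cmod (Cminus w zeta) < (L + 1) * (t / (L + 1)) by apply: Rmult_lt_compat_l; lra.
  have -> : (L + 1) * (t / (L + 1)) = t by field; lra.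
  lra.
have hnear w zeta : Rabs (vnorm (h w) - vnorm (h zeta)) <= vdist (h w) (h zeta).
  have a1 := vnorm_sub_ge _ (h w) (h zeta); have a2 := vnorm_sub_ge _ (h zeta) (h w).
  by rewrite vnorm_opp in a2; rewrite /vdist; apply: Rabs_le; lra.
have V_open zeta : Cmod zeta < 1 -> V zeta ->
    exists d, 0 < d /\ forall w, Cmod w < 1 -> Cmod (Cminus w zeta) < d -> V w.
  move=> hz hV; have [d [hd0 hw]] := hball zeta (r1 - vnorm (h zeta)) hz ltac:(rewrite /V in hV; lra).
  exists d; split=> // w k1 k2; have := hw w k1 k2; have /Rabs_le_between := hnear w zeta.
  by rewrite /V in hV *; lra.
have Wd zeta : Cmod zeta < 1 -> cdiff W zeta.
  by move=> hz; apply: cdiff_hol_normal; exact: hd.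
have Ed zeta : Cmod zeta < 1 -> cdiff E zeta.
  move=> hz; apply: cdiff_plus; first exact: cdiff_const.
  apply: cdiff_mult; first exact: cdiff_const.
  by apply: cdiff_plus; [exact: Wd | exact: cdiff_const].
have dend zeta : Cmod zeta < 1 -> cdiff den zeta.
  by move=> hz; apply: cdiff_minus; [exact: cdiff_const | exact: Wd].
have V_diff zeta : Cmod zeta < 1 -> V zeta -> cdiff Af zeta /\ vdiff bf zeta.
  move=> hz hV; split.
    apply: cdiff_mult; first exact: Ed.
    by apply: cdiff_div; [exact: Wd | exact: dend | exact: den0].
  apply: vdiff_scal; last by apply: vdiff_shear; exact: hd.
  apply: cdiff_mult; first exact: Ed.
  by apply: cdiff_div; [exact: cdiff_const | exact: dend | exact: den0].
have x_cont zeta t : Cmod zeta < 1 -> V zeta -> 0 < t ->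
    exists d, 0 < d /\ forall w, Cmod w < 1 -> Cmod (Cminus w zeta) < d -> Rabs (x w - x zeta) < t.
  move=> hz hV ht; have [l hl] := Wd zeta hz; have [d [hd0 hw]] := cderiv_continuous _ _ _ hl t ht.
  exists d; split=> // w _ k2; apply: Rle_lt_trans (hw w k2).
  by have := Cmod_Re (Cminus (W w) (W zeta)); rewrite Re_minus /x; have -> : Re (W w) - s - (Re (W zeta) - s) = Re (W w) - Re (W zeta) by ring.
have V_sep zeta : Cmod zeta < 1 -> ~ V zeta ->
    exists d, 0 < d /\ forall w, Cmod w < 1 -> Cmod (Cminus w zeta) < d -> V w -> x w <= - s2.
  move=> hz hV; have hV' : r1 <= vnorm (h zeta) by apply: Rnot_lt_le.
  have [d [hd0 hw]] := hball zeta (r1 / 2) hz ltac:(lra).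
  exists d; split=> // w k1 k2 hVw; apply: Rnot_lt_le => hx.
  have [g1 _] := Vgeo w k1 hVw; have := hw w k1 k2; have /Rabs_le_between := hnear w zeta => k3 k4.
  have k5 : r1 / 2 < vnorm (h w) by lra.
  have k6 : c / 8 * (vnorm (h w) * vnorm (h w)) <= 2 * s2.
    by apply: Rle_trans g1 _; rewrite /Rabs; case: Rcase_abs => hx0; lra.
  have k7 : c / 8 * (r1 / 2 * (r1 / 2)) < c / 8 * (vnorm (h w) * vnorm (h w)).
    by apply: Rmult_lt_compat_l; nra.
  lra.
have x0E : x (RtoC 0) = - s by rewrite /x W0 Re_RtoC; ring.
have E00 : E (RtoC 0) = RtoC (1 + kap * s * (sb - s)).
  by rewrite /E /cc W0; apply: C_eq; rewrite !CE; ring.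
have E0ge : 1 <= 1 + kap * s * (sb - s).
  by have : 0 <= kap * s * (sb - s) by [apply: Rmult_le_pos; rewrite /sb; nra]; lra.
have den00 : den (RtoC 0) = RtoC (2 * s) by rewrite /den W0; ring.
have y0 : shear ch (h (RtoC 0)) = vzero.
  have [hq _] := hsh ch vzero ltac:(rewrite vnorm_zero; lra); rewrite vnorm_zero Rmult_0_l Rmult_0_r in hq.
  have hq0 : quad (ch_Q ch) vzero vzero = vzero.
    by apply: vnorm_eq0; have := vnorm_ge0 _ (quad (ch_Q ch) vzero vzero); lra.
  by rewrite h0 /shear hq0; apply: vext => j; rewrite /vadd /vzero; ring.
have dh j : cderiv (fun w => h w j) (RtoC 0) (v j).
  have -> : v j = Cplus (v j) (RtoC 0) by ring.
  apply: (cderiv_plus (fun w => phi w j) (fun _ => Copp (z j))); first exact: dv.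
  exact: cderiv_const.
have [dq [Lh [hdq [hLh lip]]]] := vderiv_lipschitz _ _ _ _ dh.
have w0 w : Cminus w (RtoC 0) = w by ring.
have lip1 : exists d, 0 < d /\ forall w, Cmod w < d -> vnorm (h w) <= 1 /\ vnorm (h w) <= Lh * Cmod w.
  exists (Rmin dq (/ (Lh + 1))); split; first by apply: Rmin_pos => //; apply: Rinv_0_lt_compat; lra.
  move=> w hw; have := lip w; rewrite w0 h0 => k; have := k (Rlt_le_trans _ _ _ hw (Rmin_l _ _)).
  have -> : vdist (h w) vzero = vnorm (h w) by rewrite /vdist; congr vnorm; apply: vext => j; rewrite /vsub /vzero; ring.
  move=> k1; split=> //; apply: Rle_trans k1 _.
  have k2 := Rlt_le_trans _ _ _ hw (Rmin_r _ _); have k0 := Cmod_ge_0 w.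
  have : (Lh + 1) * Cmod w <= (Lh + 1) * / (Lh + 1) by apply: Rmult_le_compat_l; lra.
  by rewrite Rinv_r; lra.
have [d1 [hd1 hl1]] := lip1.
have sqb w : Cmod w < d1 -> vnorm (h w) * vnorm (h w) <= Lh * Lh * (Cmod w * Cmod w).
  move=> hw; have [_ k] := hl1 w hw; have k0 := vnorm_ge0 _ (h w).
  have -> : Lh * Lh * (Cmod w * Cmod w) = (Lh * Cmod w) * (Lh * Cmod w) by ring.
  exact: Rmult_le_compat.
have dW : cderiv W (RtoC 0) (Cmult (RtoC 2) (lin (ch_a ch) v)).
  have dlin := cderiv_lin _ (ch_a ch) _ _ _ dh.
  have d2 := cderiv_mult (fun _ => RtoC 2) _ _ _ _ (cderiv_const (RtoC 2) _) dlin.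
  have d3 : cderiv (fun w => Cminus (W w) (Cmult (RtoC 2) (lin (ch_a ch) (h w)))) (RtoC 0) (RtoC 0).
    apply: (cderiv_quadratic _ _ (Ch * (Lh * Lh)) d1 hd1).
      have [_ hw] := hhol ch vzero ltac:(rewrite vnorm_zero; lra).
      by apply: Cmod_eq_0; rewrite vnorm_zero !Rmult_0_r -h0 in hw; have := Cmod_ge_0 (Cminus (W (RtoC 0)) (Cmult (RtoC 2) (lin (ch_a ch) (h (RtoC 0))))); rewrite /W; lra.
    move=> w; rewrite w0 => hw; have [k1 _] := hl1 w hw.
    apply: Rle_trans (proj2 (hhol ch (h w) k1)) _; rewrite Rmult_assoc.
    by apply: Rmult_le_compat_l => //; exact: sqb.
  have -> : Cmult (RtoC 2) (lin (ch_a ch) v) = Cplus (RtoC 0) (Cplus (Cmult (RtoC 0) (lin (ch_a ch) (h (RtoC 0)))) (Cmult (RtoC 2) (lin (ch_a ch) v))) by ring.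
  apply: (cderiv_ext (fun w => Cplus (Cminus (W w) (Cmult (RtoC 2) (lin (ch_a ch) (h w)))) (Cmult (RtoC 2) (lin (ch_a ch) (h w))))).
    by move=> w; ring.
  exact: cderiv_plus.
have dy j : cderiv (fun w => shear ch (h w) j) (RtoC 0) (v j).
  have -> : v j = Cplus (v j) (RtoC 0) by ring.
  apply: cderiv_plus => //.
  apply: (cderiv_quadratic _ _ (Cs * (Lh * Lh)) d1 hd1).
    have [hq _] := hsh ch vzero ltac:(rewrite vnorm_zero; lra); rewrite vnorm_zero Rmult_0_l Rmult_0_r -h0 in hq.
    apply: Cmod_eq_0; have := Cmod_le_vnorm _ (quad (ch_Q ch) (h (RtoC 0)) (h (RtoC 0))) j.
    by have := Cmod_ge_0 (quad (ch_Q ch) (h (RtoC 0)) (h (RtoC 0)) j); lra.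
  move=> w; rewrite w0 => hw; have [k1 _] := hl1 w hw.
  apply: Rle_trans (Cmod_le_vnorm _ (quad (ch_Q ch) (h w) (h w)) j) _.
  apply: Rle_trans (proj1 (hsh ch (h w) k1)) _; rewrite Rmult_assoc.
  by apply: Rmult_le_compat_l => //; exact: sqb.
set e0 := 1 + kap * s * (sb - s) in E00 E0ge.
have s2n : RtoC (2 * s) <> RtoC 0 by apply: RtoC_neq0; lra.
have sn : RtoC s <> RtoC 0 by apply: RtoC_neq0; lra.
have A_deriv : cderiv Af (RtoC 0) (Cmult (RtoC e0) (Cdiv (lin (ch_a ch) v) (RtoC s))).
  have [lE hE] := Ed _ z01; have [ld hld] := cdiff_inv den _ (dend _ z01) (den0 _ z01 V0).
  have k1 := cderiv_mult _ _ _ _ _ dW hld.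
  have k2 := cderiv_mult _ _ _ _ _ hE k1.
  move: k2; rewrite W0 E00 den00.
  have -> // : Cplus (Cmult lE (Cmult (RtoC 0) (Cinv (RtoC (2 * s)))))
     (Cmult (RtoC e0) (Cplus (Cmult (Cmult (RtoC 2) (lin (ch_a ch) v)) (Cinv (RtoC (2 * s)))) (Cmult (RtoC 0) ld))) =
     Cmult (RtoC e0) (Cdiv (lin (ch_a ch) v) (RtoC s)).
  rewrite RtoC_mult; field; exact: sn.
have q0 := sqrt_lt_R0 s ltac:(lra).
have b_deriv j : cderiv (fun w => bf w j) (RtoC 0) (vscal (RtoC e0) (vscal (RtoC (/ sqrt s)) v) j).
  have hg : cdiff (fun zeta => Cmult (E zeta) (Cdiv (RtoC (2 * sqrt s)) (den zeta))) (RtoC 0).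
    apply: cdiff_mult; first exact: Ed.
    by apply: cdiff_div; [exact: cdiff_const | exact: dend | exact: den0].
  have [lg hlg] := hg; have k1 := cderiv_mult _ _ _ _ _ hlg (dy j).
  move: k1; rewrite y0 E00 den00.
  have -> // : Cplus (Cmult lg (vzero j)) (Cmult (Cmult (RtoC e0) (Cdiv (RtoC (2 * sqrt s)) (RtoC (2 * s)))) (v j)) =
    vscal (RtoC e0) (vscal (RtoC (/ sqrt s)) v) j.
  rewrite /vscal /vzero.
  have -> : Cdiv (RtoC (2 * sqrt s)) (RtoC (2 * s)) = RtoC (/ sqrt s).
    rewrite -RtoC_div; last lra.
    congr RtoC; have {2}<- : sqrt s * sqrt s = s by apply: sqrt_sqrt; lra.
    by field; lra.
  ring.
have A00 : Af (RtoC 0) = RtoC 0 by rewrite /Af W0 /Cdiv Cmult_0_l Cmult_0_r.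
have b00 : bf (RtoC 0) = vzero by rewrite /bf y0; apply: vext => j; rewrite /vscal /vzero; ring.
have m_le zeta : Cmod zeta < 1 -> V zeta -> - s2 < x zeta -> block_norm ch (Af zeta) (bf zeta) <= 1 + C * Rpower s e.
  move=> hz hV _; rewrite mE //.
  have k1 : Cmod (E zeta) <= 1 + kap * D * Rpower s e.
    apply: Rle_trans (Cmod_triangle _ _) _; rewrite Cmod_R Rabs_R1; have := ccle zeta hV.
    have : kap * D * s <= kap * D * Rpower s e by apply: Rmult_le_compat_l.
    lra.
  have k2 := Nle zeta hz hV.
  have k3 : Cmod (E zeta) * sqrt (cayley_norm_sq ch (h zeta)) <= (1 + kap * D * Rpower s e) * (1 + 16 * C1 * Rpower s e).
    by apply: Rmult_le_compat => //; [exact: Cmod_ge_0 | exact: sqrt_pos].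
  apply: Rle_trans k3 _; rewrite /C.
  have k4 : 16 * C1 * (kap * D) * (Rpower s e * Rpower s e) <= 16 * C1 * (kap * D) * (1 * Rpower s e).
    apply: Rmult_le_compat_l; first by apply: Rmult_le_pos; lra.
    by apply: Rmult_le_compat_r; lra.
  lra.
have m_inner zeta : Cmod zeta < 1 -> V zeta -> x zeta = - s1 -> 1 <= block_norm ch (Af zeta) (bf zeta).
  move=> hz hV hx; rewrite mE //.
  have [_ g5] := den_ge zeta hz hV; have dp := denp zeta hz hV.
  have lv := levi_norm_ge0 n M c c_gt0 ch (shear ch (h zeta)).
  have k1 : 1 - A * s <= sqrt (cayley_norm_sq ch (h zeta)).
    have -> : 1 - A * s = sqrt ((1 - A * s) * (1 - A * s)) by rewrite sqrt_square; lra.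
    have As0 : 0 <= A * s by apply: Rmult_le_pos; lra.
    have As1 : 0 <= A * s * (1 - A * s) by apply: Rmult_le_pos; lra.
    apply: sqrt_le_1_alt; apply: (Rle_trans _ (1 - A * s)); first by lra.
    rewrite /cayley_norm_sq -/s -/(W zeta) -/(x zeta) -/(den zeta) hx.
    suff : - (A * s) <= 4 * s * (- s1 + levi_norm ch (shear ch (h zeta))) / (Cmod (den zeta) * Cmod (den zeta)) by lra.
    apply: (Rmult_le_reg_r (Cmod (den zeta) * Cmod (den zeta))); first by nra.
    set F := levi_norm _ _ in lv *.
    have -> : 4 * s * (- s1 + F) / (Cmod (den zeta) * Cmod (den zeta)) * (Cmod (den zeta) * Cmod (den zeta)) =
      4 * s * (- s1 + F) by field; lra.
    have k3 : s1 * s1 <= Cmod (den zeta) * Cmod (den zeta) by apply: Rmult_le_compat; lra.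
    have k4 : A * s * (s1 * s1) <= A * s * (Cmod (den zeta) * Cmod (den zeta)).
      by apply: Rmult_le_compat_l => //; nra.
    have k5 : A * s * (s1 * s1) = 4 * s * s1 by rewrite /A; field; lra.
    have k6 : 0 <= 4 * s * F by apply: Rmult_le_pos; lra.
    lra.
  have k2 : 1 + E0 * s <= Cmod (E zeta).
    apply: Rle_trans (Re_le_Cmod _); rewrite /E Re_plus Re_RtoC Recc hx.
    have -> : kap * s * (- s1 + sb) = (kap * (s2 / 4)) * s by rewrite s12 /sb; field.
    by rewrite kE0; lra.
  have k7 : (1 + E0 * s) * (1 - A * s) <= Cmod (E zeta) * sqrt (cayley_norm_sq ch (h zeta)).
    by apply: Rmult_le_compat; rewrite /E0 in k2 *; nra.
  apply: Rle_trans k7.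
  have k8 : A * s * (E0 * s) <= / 2 * (E0 * s) by apply: Rmult_le_compat_r; rewrite /E0; nra.
  have k9 : 2 * A * s <= E0 * s by apply: Rmult_le_compat_r; rewrite /E0; lra.
  lra.
have m_outer zeta : Cmod zeta < 1 -> V zeta -> x zeta = - s2 -> block_norm ch (Af zeta) (bf zeta) <= 1.
  move=> hz hV hx; rewrite mE //.
  have [_ g5] := den_ge zeta hz hV; have dp := denp zeta hz hV.
  have [_ [g2 g3]] := Vgeo zeta hz hV.
  have k1 : sqrt (cayley_norm_sq ch (h zeta)) <= 1 + A' * s.
    have nn : 0 <= A' * s by nra.
    apply: Rle_trans (sqrt_le_1_plus _ nn); apply: sqrt_le_1_alt.
    rewrite /cayley_norm_sq -/s -/(W zeta) -/(x zeta) -/(den zeta); apply: Rplus_le_compat_l.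
    apply: (Rmult_le_reg_r (Cmod (den zeta) * Cmod (den zeta))); first by nra.
    set F := x zeta + _ in g2 *.
    have -> : 4 * s * F / (Cmod (den zeta) * Cmod (den zeta)) * (Cmod (den zeta) * Cmod (den zeta)) = 4 * s * F by field; lra.
    have sg0 : 0 < Rabs (x zeta) + s by have := Rabs_pos (x zeta); lra.
    have p1 : Rpower (Rabs (x zeta) + s) (1 + e) <= 1.
      rewrite -{2}(Rpower_O _ sg0); apply: Rpower_le_exponent; lra.
    have FC : F <= C1 by apply: Rle_trans g2 _; nra.
    have k3 : s2 * s2 <= Cmod (den zeta) * Cmod (den zeta) by apply: Rmult_le_compat; lra.
    have k4 : A' * s * (s2 * s2) <= A' * s * (Cmod (den zeta) * Cmod (den zeta)).
      exact: Rmult_le_compat_l.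
    have k5 : A' * s * (s2 * s2) = 4 * s * C1 by rewrite /A'; field; lra.
    have k6 : 4 * s * F <= 4 * s * C1 by apply: Rmult_le_compat_l; lra.
    lra.
  have k2 : Cmod (E zeta) <= 1 - E0 * s + G * (s * s).
    apply: Rle_trans (Cmod_1_plus_le _) _; rewrite Recc hx.
    have -> : kap * s * (- s2 + sb) = - ((kap * (s2 / 4)) * s) by rewrite /sb; field.
    rewrite kE0; have k3 := ccle zeta hV; have k4 := Cmod_ge_0 (cc zeta).
    have : Cmod (cc zeta) * Cmod (cc zeta) <= (kap * s * D) * (kap * s * D) by apply: Rmult_le_compat.
    by rewrite /G; lra.
  have k3 : Cmod (E zeta) * sqrt (cayley_norm_sq ch (h zeta)) <= (1 - E0 * s + G * (s * s)) * (1 + A' * s).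
    by apply: Rmult_le_compat => //; [exact: Cmod_ge_0 | exact: sqrt_pos].
  apply: Rle_trans k3 _.
  have k4 : (G + A' * G) * s * s <= 1 * s by apply: Rmult_le_compat_r; lra.
  have k5 : A' * G * (s * s) * s <= A' * G * (s * s) * 1.
    by apply: Rmult_le_compat_l; [apply: Rmult_le_pos => //; nra | lra].
  have k6 : 0 <= A' * E0 * (s * s) by rewrite /E0; apply: Rmult_le_pos; [apply: Rmult_le_pos => //; lra | nra].
  have k7 : 0 <= 2 * A * s by nra.
  have k8 : E0 * s = 2 * A * s + A' * s + s by rewrite /E0; ring.
  have -> : (1 - E0 * s + G * (s * s)) * (1 + A' * s) =
    1 - E0 * s + A' * s + (G * (s * s) - A' * E0 * (s * s)) + A' * G * (s * s) * s by ring.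
  rewrite k8; lra.
have B0 : 1 <= 1 + C * Rpower s e by have : 0 <= C * Rpower s e by [apply: Rmult_le_pos; lra]; lra.
have fin := glued_block_norm_deriv n M c M_ge0 c_gt0 ch Af bf x V s1 s2 (1 + C * Rpower s e) ltac:(lra) B0
  V_open V_diff x_cont V_sep m_le m_inner m_outer _ _ V0 ltac:(rewrite x0E; lra) A00 b00 A_deriv b_deriv.
rewrite block_norm_scal block_norm_metric Cmod_R Rabs_pos_eq in fin; last lra.
have q1 := sqrt_pos (metric_form ch v).
have fin2 : sqrt (metric_form ch v) <= 1 + C * Rpower s e.
  have : 1 * sqrt (metric_form ch v) <= e0 * sqrt (metric_form ch v) by apply: Rmult_le_compat_r.
  lra.
have -> : X = vscal alpha v by apply: vext => j; rewrite -hal.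
rewrite metric_form_scal sqrt_mult_alt; last by have := Cmod_ge_0 alpha; nra.
have a0 := Cmod_ge_0 alpha; rewrite sqrt_square //=.
set y := C * Rpower s e in fin2 *; have y1 : 0 <= y by apply: Rmult_le_pos; lra.
(* [(1 - y) (1 + y) <= 1]; for [y > 1] the lower bound is not positive and holds trivially. *)
case: (Rle_lt_dec y 1) => hy.
  have : (1 - y) * (Cmod alpha * sqrt (metric_form ch v)) <= (1 - y) * (Cmod alpha * (1 + y)).
    by apply: Rmult_le_compat_l; [lra | apply: Rmult_le_compat_l].
  nra.
have : 0 <= Cmod alpha * sqrt (metric_form ch v) by apply: Rmult_le_pos.
nra.
Qed.
End LowerModel.
(** * Taylor expansion of defining functions *)

Section Coordinates.
Variable n : nat.
Implicit Types (u v h z : Cn n) (d : 'I_n * bool).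

Definition co u d : R := if d.2 then Im (u d.1) else Re (u d.1).

Lemma co_add u v d : co (vadd u v) d = co u d + co v d.
Proof. by rewrite /co; case: d.2. Qed.

Lemma co_sub u v d : co (vsub u v) d = co u d - co v d.
Proof. by rewrite /co /vsub; case: d.2; rewrite CE. Qed.

Lemma co_scal (t : R) u d : co (vscal (RtoC t) u) d = t * co u d.
Proof. by rewrite /co /vscal; case: d.2; rewrite !CE; ring. Qed.

Lemma co_eq u v : (forall d, co u d = co v d) -> u = v.
Proof.
move=> h; apply: vext => j; apply: C_eq; first exact: (h (j, false)).
exact: (h (j, true)).
Qed.

Lemma co_rdir d d' : co (rdir d) d' = if d' == d then 1 else 0.
Proof.
case: d d' => [i b] [j b']; rewrite /co /rdir /=.
have -> : ((j, b') == (i, b)) = (j == i) && (b' == b) by [].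
by case: (j == i); case: b; case: b'; rewrite ?CE /=; try ring; rewrite /Re /Im /=; ring.
Qed.

Lemma rdot_co u v : rdot u v = rsum (fun d => co u d * co v d).
Proof. by rewrite rsum_pair; apply: rsum_ext => j. Qed.

Lemma co_le u d : Rabs (co u d) <= vnorm u.
Proof.
apply: Rle_trans (Cmod_le_vnorm _ u d.1); rewrite /co.
by case: d.2; [exact: Cmod_Im | exact: Cmod_Re].
Qed.

Lemma vnorm_mono u v : (forall d, Rabs (co u d) <= Rabs (co v d)) -> vnorm u <= vnorm v.
Proof.
move=> h; have u0 := vnorm_ge0 _ u; have v0 := vnorm_ge0 _ v.
suff : vnorm u * vnorm u <= vnorm v * vnorm v by nra.
rewrite !vnorm_sq !rdot_co; apply: rsum_le => d.
have e x : x * x = Rabs x * Rabs x by rewrite -Rabs_mult Rabs_pos_eq //; exact: Rle_0_sqr.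
by rewrite (e (co u d)) (e (co v d)); apply: Rmult_le_compat => //; exact: Rabs_pos.
Qed.

(** The coordinates of [h] outside [s] are erased; letting [s] grow one direction at a time
    describes a path along the axes from 0 to [h]. *)
Definition part h (s : seq ('I_n * bool)) : Cn n :=
  fun j => ((if (j, false) \in s then Re (h j) else 0), (if (j, true) \in s then Im (h j) else 0)).

Lemma co_part h s d : co (part h s) d = if d \in s then co h d else 0.
Proof. by case: d => j [] ; rewrite /co /part. Qed.

Lemma is_derive_translate (f : Cn n -> R) u d t :
  has_pd f d (vadd u (vscal (RtoC t) (rdir d))) ->
  is_derive (fun t => f (vadd u (vscal (RtoC t) (rdir d)))) t (pd f d (vadd u (vscal (RtoC t) (rdir d)))).
Proof.
move=> /Derive_correct; rewrite -/(pd f d _).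
set l := pd f d _ => h.
have e s : f (vadd (vadd u (vscal (RtoC t) (rdir d))) (vscal (RtoC s) (rdir d))) =
   f (vadd u (vscal (RtoC (t + s)) (rdir d))).
  by congr f; apply: vext => j; rewrite /vadd /vscal RtoC_plus; ring.
have h1 := is_derive_ext _ _ _ _ e h.
have h2 : is_derive (fun s => s - t) t 1.
  apply: (is_derive_ext (fun s => plus s (- t))) => [s|]; first by [].
  have -> : 1 = plus 1 0 by rewrite /plus /=; ring.
  by apply: is_derive_plus; [exact: is_derive_id | exact: is_derive_const].
have h3 : is_derive (fun s => f (vadd u (vscal (RtoC (t + s)) (rdir d)))) (t - t) l by rewrite Rminus_diag.
have := is_derive_comp (fun s => f (vadd u (vscal (RtoC (t + s)) (rdir d)))) (fun s => s - t) t l 1 h3 h2; rewrite /scal /= /mult /= Rmult_1_l.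
by apply: is_derive_ext => s; congr (f (vadd u (vscal (RtoC _) _))); ring.
Qed.

(* The mean value theorem along the coordinate axes, one coordinate of [h] at a time. *)
Lemma coordinate_increment (f : Cn n -> R) z h :
  (forall d u, vdist u z <= vnorm h -> has_pd f d u) ->
  exists xi : 'I_n * bool -> Cn n, (forall d, vdist (xi d) z <= vnorm h) /\
    f (vadd z h) - f z = rsum (fun d => co h d * pd f d (xi d)).
Proof.
move=> hf.
have dist0 u : (forall d, Rabs (co u d) <= Rabs (co h d)) -> vdist (vadd z u) z <= vnorm h.
  by move=> hu; rewrite vdist_add; exact: vnorm_mono.
suff step : forall s, uniq s -> exists xi : 'I_n * bool -> Cn n, (forall d, vdist (xi d) z <= vnorm h) /\
    f (vadd z (part h s)) - f z = \big[Rplus/0]_(d <- s) (co h d * pd f d (xi d)).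
  have [xi [h1 h2]] := step (index_enum _) (index_enum_uniq _).
  exists xi; split=> //; rewrite /rsum -h2; congr (f _ - _); congr vadd.
  by apply: co_eq => d; rewrite co_part mem_index_enum.
elim=> [_|d s IH /= /andP[ds us]].
  exists (fun _ => z); split=> [d|]; first by rewrite vdist_self; exact: vnorm_ge0.
  rewrite big_nil; have -> : vadd z (part h [::]) = z.
    by apply: co_eq => d; rewrite co_add co_part in_nil; ring.
  by ring.
have [xi [h1 h2]] := IH us.
pose u := vadd z (part h s).
have inside t : Rmin 0 (co h d) <= t <= Rmax 0 (co h d) -> vdist (vadd u (vscal (RtoC t) (rdir d))) z <= vnorm h.
  move=> ht; have -> : vadd u (vscal (RtoC t) (rdir d)) = vadd z (vadd (part h s) (vscal (RtoC t) (rdir d))).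
    by rewrite /u; apply: vext => j; rewrite /vadd; ring.
  apply: dist0 => d'; rewrite co_add co_scal co_part co_rdir.
  case: eqP => [->|_]; last first.
    by rewrite Rmult_0_r Rplus_0_r; case: ifP => _; [lra | rewrite Rabs_R0; exact: Rabs_pos].
  rewrite (negbTE ds) Rmult_1_r Rplus_0_l.
  by move: ht; rewrite /Rmin /Rmax /Rabs; case: Rle_dec => ?; do 2 case: Rcase_abs => ?; lra.
have dg t : Rmin 0 (co h d) <= t <= Rmax 0 (co h d) ->
    is_derive (fun t => f (vadd u (vscal (RtoC t) (rdir d)))) t (pd f d (vadd u (vscal (RtoC t) (rdir d)))).
  by move=> ht; apply: is_derive_translate; apply: hf; exact: inside.
have [|t ht|t [ht1 ht2]] := MVT_gen (fun t => f (vadd u (vscal (RtoC t) (rdir d)))) 0 (co h d)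
    (fun t => pd f d (vadd u (vscal (RtoC t) (rdir d)))).
- by move=> t ht; apply: dg; lra.
- by apply/continuity_pt_filterlim; apply: (ex_derive_continuous (fun t => f (vadd u (vscal (RtoC t) (rdir d))))); eexists; exact: dg.
exists (fun d' => if d' == d then vadd u (vscal (RtoC t) (rdir d)) else xi d'); split.
  by move=> d'; case: eqP => _ //; exact: inside.
rewrite big_cons eqxx.
have -> : \big[Rplus/0]_(j <- s) (co h j * pd f j (if j == d then vadd u (vscal (RtoC t) (rdir d)) else xi j)) =
  \big[Rplus/0]_(j <- s) (co h j * pd f j (xi j)).
  by apply: eq_big_seq => j js; case: eqP => // e; move: ds; rewrite -e js.
rewrite -h2.
have e1 : vadd z (part h (d :: s)) = vadd u (vscal (RtoC (co h d)) (rdir d)).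
  apply: co_eq => d'; rewrite /u !co_add co_scal !co_part co_rdir in_cons.
  by case: eqP => [->|_] /=; rewrite ?(negbTE ds); ring.
have e0 : vadd u (vscal (RtoC 0) (rdir d)) = vadd z (part h s).
  by rewrite /u; apply: vext => j; rewrite /vadd /vscal; ring.
by rewrite e1; rewrite e0 Rminus_0_r in ht2; rewrite -/u in ht2 *; lra.
Qed.

Definition D1 (f : Cn n -> R) h u : R := rsum (fun d => co h d * pd f d u).
Definition D2 (f : Cn n -> R) h u : R := rsum (fun d => co h d * D1 (pd f d) h u).
Definition D3 (f : Cn n -> R) h u : R := rsum (fun d => co h d * D2 (pd f d) h u).

Lemma cont_at_uniform (F : 'I_n * bool -> Cn n -> R) z : (forall d, cont_at (F d) z) ->
  forall e, 0 < e -> exists r, 0 < r /\ forall d u, vdist u z < r -> Rabs (F d u - F d z) < e.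
Proof.
move=> hF e he.
have hd d : exists r, 0 < r /\ forall u, vdist u z < r -> Rabs (F d u - F d z) < e by exact: hF.
have [r hr] := choice _ hd.
have [m [hm hmr]] := fin_lower _ r (fun d => proj1 (hr d)).
exists m; split=> // d u hu; apply: (proj2 (hr d)); exact: Rlt_le_trans hu (hmr d).
Qed.

(** Continuity of the partial derivatives suffices: [coordinate_increment] expresses the increment
    through their values at nearby points [xi], which approach the values at [u]. *)
Lemma line_derivative (W : Cn n -> Prop) (f : Cn n -> R) z h t : is_open W -> Ck 1 W f ->
  W (vadd z (vscal (RtoC t) h)) ->
  is_derive (fun t => f (vadd z (vscal (RtoC t) h))) t (D1 f h (vadd z (vscal (RtoC t) h))).
Proof.
move=> hW [_ hf] hz; set u := vadd z _.
have [r0 [hr0 hb]] := hW u hz.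
apply/is_derive_Reals => e he.
pose S := rsum (fun d => Rabs (co h d)).
have S0 : 0 <= S by apply: rsum_ge0 => d; exact: Rabs_pos.
have he1 : 0 < e / (S + 1) by apply: Rdiv_lt_0_compat; lra.
have [r1 [hr1 hc]] := cont_at_uniform (pd f) u (fun d => proj1 (proj2 (hf d)) u hz) _ he1.
have h0 := vnorm_ge0 _ h.
pose r := Rmin r0 r1 / (vnorm h + 1).
have rm : 0 < Rmin r0 r1 by apply: Rmin_pos.
have hr : 0 < r by apply: Rdiv_lt_0_compat; lra.
exists (mkposreal r hr) => k hk0 /= hk.
pose h' := vscal (RtoC k) h.
have nh' : vnorm h' < Rmin r0 r1.
  rewrite /h' vnorm_scalR.
  have : Rabs k * (vnorm h + 1) < r * (vnorm h + 1) by apply: Rmult_lt_compat_r; lra.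
  have -> : r * (vnorm h + 1) = Rmin r0 r1 by rewrite /r; field; lra.
  by have := Rabs_pos k; lra.
have l0 := Rmin_l r0 r1; have l1 := Rmin_r r0 r1.
have [xi [hxi hinc]] := coordinate_increment f u h' (fun d v hv => proj1 (hf d) v (hb v ltac:(lra))).
have eu : vadd z (vscal (RtoC (t + k)) h) = vadd u h'.
  by rewrite /u /h'; apply: vext => j; rewrite /vadd /vscal RtoC_plus; ring.
rewrite eu hinc.
have kp : 0 < Rabs k by apply: Rabs_pos_lt.
have -> : rsum (fun d => co h' d * pd f d (xi d)) / k - D1 f h u =
   rsum (fun d => co h d * (pd f d (xi d) - pd f d u)).
  rewrite /D1 -[X in X - _](Rmult_1_l) /Rdiv Rmult_1_l Rmult_comm -rsumZ -rsumB; apply: rsum_ext => d.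
  by rewrite /h' co_scal; field.
apply: Rle_lt_trans (rsum_abs _ _) _.
apply: (Rle_lt_trans _ (S * (e / (S + 1)))).
  rewrite Rmult_comm /S -rsumZ; apply: rsum_le => d; rewrite Rabs_mult Rmult_comm.
  apply: Rmult_le_compat_r; first exact: Rabs_pos.
  by apply: Rlt_le; apply: hc; have := hxi d; lra.
have : S * (e / (S + 1)) < (S + 1) * (e / (S + 1)) by apply: Rmult_lt_compat_r; lra.
by have -> : (S + 1) * (e / (S + 1)) = e by field; lra.
Qed.

Lemma is_derive_rsum (T : finType) (F : T -> R -> R) (l : T -> R) t :
  (forall i, is_derive (F i) t (l i)) -> is_derive (fun t => rsum (fun i => F i t)) t (rsum l).
Proof.
move=> h; rewrite /rsum; elim: (index_enum T) => [|i s IH].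
  rewrite big_nil; apply: (is_derive_ext (fun _ => 0)) => [x|]; first by rewrite big_nil.
  exact: is_derive_const.
rewrite big_cons; apply: (is_derive_ext (fun t => plus (F i t) (\big[Rplus/0]_(i <- s) F i t))) => [x|].
  by rewrite big_cons.
exact: is_derive_plus.
Qed.

Lemma Ck_le m (W : Cn n -> Prop) f : Ck m.+1 W f -> Ck m W f.
Proof.
elim: m f => [|m IH] f; first by move=> [].
move=> [h1 h2]; split=> // d; have [h3 h4] := h2 d; split=> //; exact: IH.
Qed.

Lemma Ck_pd m (W : Cn n -> Prop) f d : Ck m.+1 W f -> Ck m W (pd f d).
Proof. by move=> [_ h]; exact: (proj2 (h d)). Qed.

Lemma line_derivative2 (W : Cn n -> Prop) (f : Cn n -> R) z h t : is_open W -> Ck 2 W f ->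
  W (vadd z (vscal (RtoC t) h)) ->
  is_derive (fun t => D1 f h (vadd z (vscal (RtoC t) h))) t (D2 f h (vadd z (vscal (RtoC t) h))).
Proof.
move=> hW hf hz; apply: is_derive_rsum => d.
apply: is_derive_scal; apply: (line_derivative W) => //; exact: Ck_pd.
Qed.

Lemma line_derivative3 (W : Cn n -> Prop) (f : Cn n -> R) z h t : is_open W -> Ck 3 W f ->
  W (vadd z (vscal (RtoC t) h)) ->
  is_derive (fun t => D2 f h (vadd z (vscal (RtoC t) h))) t (D3 f h (vadd z (vscal (RtoC t) h))).
Proof.
move=> hW hf hz; apply: is_derive_rsum => d.
apply: is_derive_scal; apply: (line_derivative2 W) => //; exact: Ck_pd.
Qed.
End Coordinates.

Lemma small_of_derivative (g g1 : R -> R) B : 0 <= B -> g 0 = 0 ->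
  (forall t, 0 <= t <= 1 -> is_derive g t (g1 t)) -> (forall t, 0 <= t <= 1 -> Rabs (g1 t) <= B) ->
  forall t, 0 <= t <= 1 -> Rabs (g t) <= B.
Proof.
move=> hB g0 hd hb t ht.
have ex : Rmin 0 t = 0 /\ Rmax 0 t = t by rewrite Rmin_left ?Rmax_right; lra.
have [|x hx|x [hx1 hx2]] := MVT_gen g 0 t g1.
- by move=> x hx; apply: hd; lra.
- by apply/continuity_pt_filterlim; apply: (ex_derive_continuous g); exists (g1 x); apply: hd; lra.
rewrite g0 !Rminus_0_r in hx2; rewrite hx2 Rabs_mult (Rabs_pos_eq t); last lra.
have := hb x ltac:(lra); have := Rabs_pos (g1 x); nra.
Qed.

(** The hypothesis concerns the oscillation of the last derivative, which is what Hölder continuity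
    controls; integrating back over an interval of length 1 does not enlarge the bound. *)
Lemma taylor2 (f f1 f2 : R -> R) B : 0 <= B ->
  (forall t, 0 <= t <= 1 -> is_derive f t (f1 t)) -> (forall t, 0 <= t <= 1 -> is_derive f1 t (f2 t)) ->
  (forall t, 0 <= t <= 1 -> Rabs (f2 t - f2 0) <= B) ->
  forall t, 0 <= t <= 1 -> Rabs (f t - (f 0 + f1 0 * t + f2 0 / 2 * (t * t))) <= B.
Proof.
move=> hB d1 d2 hb.
have b1 : forall t, 0 <= t <= 1 -> Rabs (f1 t - (f1 0 + f2 0 * t)) <= B.
  apply: (small_of_derivative _ (fun t => f2 t - f2 0)) => //; first by ring.
  move=> t ht; apply: (is_derive_minus f1) ; first exact: d2.
  by auto_derive => //; ring.
apply: (small_of_derivative _ (fun t => f1 t - (f1 0 + f2 0 * t))) => //; first by ring.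
move=> t ht; apply: (is_derive_minus f); first exact: d1.
by auto_derive => //; field.
Qed.

Lemma taylor3 (f f1 f2 f3 : R -> R) B : 0 <= B ->
  (forall t, 0 <= t <= 1 -> is_derive f t (f1 t)) -> (forall t, 0 <= t <= 1 -> is_derive f1 t (f2 t)) ->
  (forall t, 0 <= t <= 1 -> is_derive f2 t (f3 t)) ->
  (forall t, 0 <= t <= 1 -> Rabs (f3 t - f3 0) <= B) ->
  forall t, 0 <= t <= 1 -> Rabs (f t - (f 0 + f1 0 * t + f2 0 / 2 * (t * t) + f3 0 / 6 * (t * t * t))) <= B.
Proof.
move=> hB d1 d2 d3 hb.
have b1 := taylor2 f1 f2 f3 B hB d2 d3 hb.
apply: (small_of_derivative _ (fun t => f1 t - (f1 0 + f2 0 * t + f3 0 / 2 * (t * t)))) => //; first by field.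
move=> t ht; apply: (is_derive_minus f); first exact: d1.
by auto_derive => //; field.
Qed.
Arguments co {n}. Arguments D1 {n}. Arguments D2 {n}. Arguments D3 {n}.

(** * Splitting real forms into complex types *)

Section Complexify.
Variable n : nat.
Implicit Types (h u v w : Cn n).
Notation dir := ('I_n * bool)%type.

Lemma bilE (S : 'I_n -> 'I_n -> C) u v :
  bil S u v = csum (fun j => csum (fun l => Cmult (Cmult (u j) (v l)) (S j l))).
Proof.
by apply: csum_ext => j; rewrite /lin -csumZ; apply: csum_ext => l; ring.
Qed.

Lemma triE (A : 'I_n -> 'I_n -> 'I_n -> C) u v w :
  tri A u v w = csum (fun j => csum (fun l => csum (fun m => Cmult (Cmult (Cmult (u j) (v l)) (w m)) (A j l m)))).
Proof.
apply: csum_ext => j; rewrite bilE -csumZ; apply: csum_ext => l; rewrite -csumZ.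
by apply: csum_ext => m; ring.
Qed.

Lemma rsum_pair2 (F : dir -> dir -> R) : rsum (fun d => rsum (F d)) =
  rsum (fun j : 'I_n => rsum (fun l : 'I_n => F (j, false) (l, false) + F (j, false) (l, true) +
     (F (j, true) (l, false) + F (j, true) (l, true)))).
Proof.
rewrite rsum_pair; apply: rsum_ext => j; rewrite !rsum_pair -rsumD.
by apply: rsum_ext => l; ring.
Qed.

Lemma rsum_pair3 (F : dir -> dir -> dir -> R) : rsum (fun d => rsum (fun d' => rsum (F d d'))) =
  rsum (fun j : 'I_n => rsum (fun l : 'I_n => rsum (fun m : 'I_n =>
    F (j, false) (l, false) (m, false) + F (j, false) (l, false) (m, true) +
    (F (j, false) (l, true) (m, false) + F (j, false) (l, true) (m, true)) +
    (F (j, true) (l, false) (m, false) + F (j, true) (l, false) (m, true) +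
    (F (j, true) (l, true) (m, false) + F (j, true) (l, true) (m, true)))))).
Proof.
rewrite rsum_pair; apply: rsum_ext => j; rewrite !rsum_pair2 -rsumD.
apply: rsum_ext => l.
by rewrite -rsumD; apply: rsum_ext => m; ring.
Qed.

(* [d^2/dz_j dz_l] and [d^2/dz_j dzbar_l] in terms of the real Hessian. *)
Definition hess_hol (H : dir -> dir -> R) (j l : 'I_n) : C :=
  ((H (j, false) (l, false) - H (j, true) (l, true)) / 4,
   - (H (j, false) (l, true) + H (j, true) (l, false)) / 4).
Definition hess_levi (H : dir -> dir -> R) (j l : 'I_n) : C :=
  ((H (j, false) (l, false) + H (j, true) (l, true)) / 4,
   (H (j, false) (l, true) - H (j, true) (l, false)) / 4).

Lemma hess_split (H : dir -> dir -> R) h :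
  rsum (fun d => rsum (fun d' => co h d * co h d' * H d d')) / 2 =
  Re (bil (hess_hol H) h h) + Re (bil (hess_levi H) h (vconj h)).
Proof.
rewrite !bilE !Re_csum rsum_pair2 /Rdiv Rmult_comm -rsumZ -rsumD; apply: rsum_ext => j.
rewrite !Re_csum -rsumZ -rsumD; apply: rsum_ext => l.
rewrite /hess_hol /hess_levi /co /vconj !CE /= ; move: (h j) (h l) => [a b] [a' b'] /=.
rewrite /Re /Im /=; field.
Qed.

(** Writing each real slot through [h] and its conjugate gives eight types. Conjugate types have the
    same real part, which leaves [A] without conjugates and [T1], [T2], [T3] with one conjugate in
    the third, second or first slot; permuting indices moves it to the last slot. [c] is not assumed
    symmetric. *)
Lemma cubic_split (c : dir -> dir -> dir -> R) B : (forall d d' d'', Rabs (c d d' d'') <= B) ->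
  exists A T : 'I_n -> 'I_n -> 'I_n -> C,
    (forall j l m, Cmod (A j l m) <= 2 * B) /\ (forall j l m, Cmod (T j l m) <= 6 * B) /\
    forall h, rsum (fun d => rsum (fun d' => rsum (fun d'' => co h d * co h d' * co h d'' * c d d' d''))) =
      Re (tri A h h h) + Re (tri T h h (vconj h)).
Proof.
move=> hc.
pose x3 j l m (b b' b'' : bool) := c (j, b) (l, b') (m, b'').
pose A j l m : C := ((x3 j l m false false false - x3 j l m false true true - x3 j l m true false true - x3 j l m true true false) / 4,
  (- x3 j l m false false true - x3 j l m false true false - x3 j l m true false false + x3 j l m true true true) / 4).
pose T1 j l m : C := ((x3 j l m false false false + x3 j l m false true true + x3 j l m true false true - x3 j l m true true false) / 4,
  (x3 j l m false false true - x3 j l m false true false - x3 j l m true false false - x3 j l m true true true) / 4).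
pose T2 j l m : C := ((x3 j l m false false false + x3 j l m false true true - x3 j l m true false true + x3 j l m true true false) / 4,
  (- x3 j l m false false true + x3 j l m false true false - x3 j l m true false false - x3 j l m true true true) / 4).
pose T3 j l m : C := ((x3 j l m false false false - x3 j l m false true true + x3 j l m true false true + x3 j l m true true false) / 4,
  (- x3 j l m false false true - x3 j l m false true false + x3 j l m true false false - x3 j l m true true true) / 4).
have xb j l m b b' b'' : - B <= x3 j l m b b' b'' <= B by apply/Rabs_le_between; exact: hc.
have bound (p q : R) : - B <= p <= B -> - B <= q <= B -> Cmod ((p, q) : C) <= 2 * B.
  move=> hp hq; apply: Rle_trans (Cmod_le_ReIm _) _; rewrite /Re /Im /=.
  have : Rabs p <= B by apply: Rabs_le.
  have : Rabs q <= B by apply: Rabs_le.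
  lra.
have big j l m := (xb j l m false false false, xb j l m false false true, xb j l m false true false,
   xb j l m false true true, xb j l m true false false, xb j l m true false true, xb j l m true true false, xb j l m true true true).
have bA j l m : Cmod (A j l m) <= 2 * B by have := big j l m => -[[[[[[[? ?] ?] ?] ?] ?] ?] ?]; apply: bound; lra.
have b1 j l m : Cmod (T1 j l m) <= 2 * B by have := big j l m => -[[[[[[[? ?] ?] ?] ?] ?] ?] ?]; apply: bound; lra.
have b2 j l m : Cmod (T2 j l m) <= 2 * B by have := big j l m => -[[[[[[[? ?] ?] ?] ?] ?] ?] ?]; apply: bound; lra.
have b3 j l m : Cmod (T3 j l m) <= 2 * B by have := big j l m => -[[[[[[[? ?] ?] ?] ?] ?] ?] ?]; apply: bound; lra.
exists A, (fun j l m => Cplus (Cplus (T1 j l m) (T2 j m l)) (T3 m j l)); split=> //; split.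
  move=> j l m; apply: Rle_trans (Cmod_triangle _ _) _.
  have := Cmod_triangle (T1 j l m) (T2 j m l); have := b1 j l m; have := b2 j m l; have := b3 m j l; lra.
move=> h.
have eT : tri (fun j l m => Cplus (Cplus (T1 j l m) (T2 j m l)) (T3 m j l)) h h (vconj h) =
  csum (fun j => csum (fun l => csum (fun m => Cplus (Cplus
    (Cmult (Cmult (Cmult (h j) (h l)) (Cconj (h m))) (T1 j l m))
    (Cmult (Cmult (Cmult (h j) (Cconj (h l))) (h m)) (T2 j l m)))
    (Cmult (Cmult (Cmult (Cconj (h j)) (h l)) (h m)) (T3 j l m))))).
  rewrite triE.
  pose G1 j l m := Cmult (Cmult (Cmult (h j) (h l)) (Cconj (h m))) (T1 j l m).
  pose G2 j l m := Cmult (Cmult (Cmult (h j) (Cconj (h l))) (h m)) (T2 j l m).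
  pose G3 j l m := Cmult (Cmult (Cmult (Cconj (h j)) (h l)) (h m)) (T3 j l m).
  have s3 (F G K : 'I_n -> 'I_n -> 'I_n -> C) : csum (fun j => csum (fun l => csum (fun m => Cplus (Cplus (F j l m) (G j l m)) (K j l m)))) =
    Cplus (Cplus (csum (fun j => csum (fun l => csum (F j l)))) (csum (fun j => csum (fun l => csum (G j l)))))
      (csum (fun j => csum (fun l => csum (K j l)))).
    by rewrite -!csumD; apply: csum_ext => j; rewrite -!csumD; apply: csum_ext => l; rewrite -!csumD.
  transitivity (csum (fun j => csum (fun l => csum (fun m => Cplus (Cplus (G1 j l m) (G2 j m l)) (G3 m j l))))).
    apply: csum_ext => j; apply: csum_ext => l; apply: csum_ext => m; rewrite /G1 /G2 /G3 /vconj; ring.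
  rewrite (s3 G1 (fun j l m => G2 j m l) (fun j l m => G3 m j l)) (s3 G1 G2 G3); congr (Cplus (Cplus _ _) _).
    by apply: csum_ext => j; rewrite csum_exchange.
  transitivity (csum (fun j => csum (fun m => csum (fun l => G3 m j l)))).
    by apply: csum_ext => j; rewrite csum_exchange.
  by rewrite csum_exchange.
rewrite eT triE !Re_csum rsum_pair3 -rsumD; apply: rsum_ext => j.
rewrite !Re_csum -rsumD; apply: rsum_ext => l; rewrite !Re_csum -rsumD; apply: rsum_ext => m.
rewrite /A /T1 /T2 /T3 /x3 /co.
move: (h j) (h l) (h m) => [a1 b1'] [a2 b2'] [a3 b3'].
rewrite !CE /Re /Im /=; field.
Qed.
End Complexify.

(** * Symmetry of second derivatives *)

Section Symmetry.
Variable n : nat.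
Implicit Types (z u : Cn n) (d : 'I_n * bool).

Lemma Derive_translate (f : Cn n -> R) u d t :
  Derive (fun t => f (vadd u (vscal (RtoC t) (rdir d)))) t = pd f d (vadd u (vscal (RtoC t) (rdir d))).
Proof.
rewrite /pd /Derive; congr real; apply: Lim_ext => k; congr ((f _ - f _) / _);
  apply: vext => j; rewrite /vadd /vscal ?RtoC_plus; ring.
Qed.

Lemma pd_symmetric (W : Cn n -> Prop) (f : Cn n -> R) z d d' : is_open W -> Ck 2 W f -> W z ->
  pd (pd f d') d z = pd (pd f d) d' z.
Proof.
move=> hW hf hz.
pose P (x y : R) := vadd (vadd z (vscal (RtoC x) (rdir d))) (vscal (RtoC y) (rdir d')).
pose P' (x y : R) := vadd (vadd z (vscal (RtoC y) (rdir d'))) (vscal (RtoC x) (rdir d)).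
have PP x y : P x y = P' x y by apply: vext => j; rewrite /P /P' /vadd; ring.
have Pd x y : vdist (P x y) z <= Rabs x + Rabs y.
  have -> : vdist (P x y) z = vnorm (vadd (vscal (RtoC x) (rdir d)) (vscal (RtoC y) (rdir d'))).
    by rewrite -(vdist_add _ z); congr vdist; apply: vext => j; rewrite /P /vadd; ring.
  by apply: Rle_trans (vnorm_triangle _ _ _) _; rewrite !vnorm_scalR !vnorm_rdir; lra.
have D1e g x y : Derive (fun s => g (P s y)) x = pd g d (P x y).
  rewrite (Derive_ext _ (fun s => g (P' s y))); last by move=> s; rewrite PP.
  by rewrite PP; exact: Derive_translate.
have D2e g x y : Derive (fun s => g (P x s)) y = pd g d' (P x y) by exact: Derive_translate.
have e1 g x y : has_pd g d (P x y) -> ex_derive (fun s => g (P s y)) x.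
  rewrite PP => h; apply: (ex_derive_ext (fun s => g (P' s y))); first by move=> s; rewrite PP.
  by eexists; exact: is_derive_translate.
have e2 g x y : has_pd g d' (P x y) -> ex_derive (fun s => g (P x s)) y.
  by move=> h; eexists; exact: is_derive_translate.
have [r0 [hr0 hb]] := hW z hz.
have W2 x y : Rabs (x - 0) < r0 / 2 -> Rabs (y - 0) < r0 / 2 -> W (P x y).
  rewrite !Rminus_0_r => hx hy; apply: hb; have := Pd x y; lra.
have hd g c : Ck 1 W g -> forall u, W u -> has_pd g c u by move=> [_ h] u; exact: (proj1 (h c)).
have c2d g : cont_at g z -> continuity_2d_pt (fun x y => g (P x y)) 0 0.
  move=> hg ee; have [q [hq1 hq2]] := hg ee (cond_pos ee).
  have hq3 : 0 < q / 2 by lra.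
  have P00 : P 0 0 = z by apply: vext => j; rewrite /P /vadd /vscal; ring.
  exists (mkposreal _ hq3) => u v /=; rewrite !Rminus_0_r => hu hv; rewrite P00.
  by apply: hq2; have := Pd u v; lra.
have := Schwarz (fun x y => f (P x y)) 0 0.
have E1 : (fun x y => Derive (fun s => Derive (fun t => f (P s t)) y) x) = (fun x y => pd (pd f d') d (P x y)).
  apply: functional_extensionality => x; apply: functional_extensionality => y.
  by rewrite -D1e; apply: Derive_ext => s; exact: D2e.
have E2 : (fun x y => Derive (fun s => Derive (fun t => f (P t s)) x) y) = (fun x y => pd (pd f d) d' (P x y)).
  apply: functional_extensionality => x; apply: functional_extensionality => y.
  by rewrite -D2e; apply: Derive_ext => s; exact: D1e.
have E1' x y : Derive (fun s => Derive (fun t => f (P s t)) y) x = pd (pd f d') d (P x y).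
  by rewrite -D1e; apply: Derive_ext => s; exact: D2e.
have E2' x y : Derive (fun s => Derive (fun t => f (P t s)) x) y = pd (pd f d) d' (P x y).
  by rewrite -D2e; apply: Derive_ext => s; exact: D1e.
have P00 : P 0 0 = z by apply: vext => j; rewrite /P /vadd /vscal; ring.
rewrite E1' E2' P00; apply.
- have hr2 : 0 < r0 / 2 by lra.
  exists (mkposreal _ hr2) => u v /= hu hv; have hw := W2 u v hu hv.
  split; first by apply: e1; apply: (hd f) => //; exact: Ck_le.
  split; first by apply: e2; apply: (hd f) => //; exact: Ck_le.
  split.
    apply: (ex_derive_ext (fun s => pd f d' (P s v))) => [s|]; first by rewrite D2e.
    by apply: e1; apply: (hd (pd f d')) => //; exact: Ck_pd.
  apply: (ex_derive_ext (fun s => pd f d (P u s))) => [s|]; first by rewrite D1e.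
  by apply: e2; apply: (hd (pd f d)) => //; exact: Ck_pd.
- rewrite E1; apply: c2d; have := Ck_pd _ _ _ _ d (Ck_pd _ _ _ _ d' hf) => -[h _]; exact: h.
rewrite E2; apply: c2d; have := Ck_pd _ _ _ _ d' (Ck_pd _ _ _ _ d hf) => -[h _]; exact: h.
Qed.
End Symmetry.

(** * Taylor formulas from Hölder regularity *)

Section Regularity.
Variable n : nat.
Notation dir := ('I_n * bool)%type.
Implicit Types (z u h p : Cn n).

Lemma locally_bounded (T : finType) (F : T -> Cn n -> R) p : (forall i, cont_at (F i) p) ->
  exists r M, 0 < r /\ 0 <= M /\ forall i u, vdist u p < r -> Rabs (F i u) <= M.
Proof.
move=> hF.
have hi i : exists r, 0 < r /\ forall u, vdist u p < r -> Rabs (F i u - F i p) < 1 by apply: hF; lra.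
have [r hr] := choice _ hi.
have [m [hm hmr]] := fin_lower _ r (fun i => proj1 (hr i)).
have [M [hM hMi]] := fin_upper _ (fun i => Rabs (F i p)).
exists m, (M + 1); split=> //; split; first lra.
move=> i u hu; have := proj2 (hr i) u (Rlt_le_trans _ _ _ hu (hmr i)).
have := Rabs_triang (F i u - F i p) (F i p); rewrite (_ : F i u - F i p + F i p = F i u); last by ring.
by have := hMi i; lra.
Qed.

Lemma locally_holder (T : finType) (F : T -> Cn n -> R) (W : Cn n -> Prop) p a : W p ->
  (forall i, loc_holder a W (F i)) ->
  exists r M, 0 < r /\ 0 <= M /\ forall i x y, W x -> W y -> vdist x p < r -> vdist y p < r ->
    Rabs (F i x - F i y) <= M * Rpower (vdist x y) a.
Proof.
move=> hp hF.
have hi i : exists rK : R * R, 0 < rK.1 /\ forall x y, W x -> W y -> vdist x p < rK.1 -> vdist y p < rK.1 ->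
    Rabs (F i x - F i y) <= rK.2 * Rpower (vdist x y) a.
  by have [r [K [h1 h2]]] := hF i p hp; exists (r, K).
have [rK hrK] := choice _ hi.
have [m [hm hmr]] := fin_lower _ (fun i => (rK i).1) (fun i => proj1 (hrK i)).
have [M [hM hMi]] := fin_upper _ (fun i => (rK i).2).
exists m, M; split=> //; split=> // i x y wx wy hx hy.
apply: Rle_trans (proj2 (hrK i) x y wx wy (Rlt_le_trans _ _ _ hx (hmr i)) (Rlt_le_trans _ _ _ hy (hmr i))) _.
by apply: Rmult_le_compat_r; [apply: Rlt_le; exact: Rpower_pos | exact: hMi].
Qed.

(* The local facts about the defining function used in the sequel; the last clause is its Taylor
   formula with the cubic term (absent when only two derivatives are available) split into types. *)
Record regular_near (e : R) (rho : Cn n -> R) p (r M : R) : Prop := RegularNear {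
  reg_r : 0 < r <= 1;
  reg_M : 0 <= M;
  reg_pd : forall z d, vdist z p < r -> has_pd rho d z;
  reg_pd2 : forall z d d', vdist z p < r -> has_pd (pd rho d') d z;
  reg_b1 : forall z d, vdist z p < r -> Rabs (pd rho d z) <= M;
  reg_b2 : forall z d d', vdist z p < r -> Rabs (pd (pd rho d') d z) <= M;
  reg_holder : forall x y D d d', vdist x p < r -> vdist y p < r -> vdist x y <= D -> 0 < D <= 1 ->
    Rabs (pd (pd rho d') d x - pd (pd rho d') d y) <= M * Rpower D e;
  reg_sym : forall z d d', vdist z p < r -> pd (pd rho d') d z = pd (pd rho d) d' z;
  reg_taylor : forall z, vdist z p < r -> exists A T : 'I_n -> 'I_n -> 'I_n -> C,
    (forall j l m, Cmod (A j l m) <= M) /\ (forall j l m, Cmod (T j l m) <= M) /\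
    forall h s, 0 < s -> vnorm h <= 1 -> vdist (vadd z h) p < r ->
      Rabs (rho (vadd z h) - (rho z + D1 rho h z + D2 rho h z / 2 +
         Re (tri A h h h) + Re (tri T h h (vconj h)))) <= M * Rpower (vnorm h * vnorm h + s) (1 + e) }.

Lemma segment_in_ball p z h r t : 0 <= t <= 1 -> vdist z p < r -> vdist (vadd z h) p < r ->
  vdist (vadd z (vscal (RtoC t) h)) p < r.
Proof.
move=> ht hz hzh.
have e : vsub (vadd z (vscal (RtoC t) h)) p =
  vadd (vscal (RtoC (1 - t)) (vsub z p)) (vscal (RtoC t) (vsub (vadd z h) p)).
  by apply: vext => j; rewrite /vadd /vsub /vscal; apply: C_eq; rewrite !CE; ring.
rewrite /vdist e; apply: Rle_lt_trans (vnorm_triangle _ _ _) _.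
rewrite !vnorm_scalR !Rabs_pos_eq; try lra.
rewrite -!/(vdist _ _); set a := vdist z p in hz *; set b := vdist _ p in hzh *.
case: (Rle_lt_dec t (/ 2)) => h1.
  have : (1 - t) * a < (1 - t) * r by apply: Rmult_lt_compat_l; lra.
  have : t * b <= t * r by apply: Rmult_le_compat_l; lra.
  lra.
have : (1 - t) * a <= (1 - t) * r by apply: Rmult_le_compat_l; lra.
have : t * b < t * r by apply: Rmult_lt_compat_l; lra.
lra.
Qed.

Lemma D2E (f : Cn n -> R) h z : D2 f h z = rsum (fun d => rsum (fun d' => co h d * co h d' * pd (pd f d') d z)).
Proof.
rewrite rsum_exchange /D2; apply: rsum_ext => d; rewrite /D1 -rsumZ; apply: rsum_ext => d'; ring.
Qed.

Lemma D3E (f : Cn n -> R) h z : D3 f h z = rsum (fun d => rsum (fun d' => rsum (fun d'' =>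
   co h d * co h d' * co h d'' * pd (pd (pd f d) d') d'' z))).
Proof.
rewrite /D3; apply: rsum_ext => d; rewrite /D2 -rsumZ; apply: rsum_ext => d'; rewrite /D1 -!rsumZ.
by apply: rsum_ext => d''; ring.
Qed.

(** [|h|^2 |h|^a = (|h|^2)^(1 + a/2)]: measured by [|h|^2 + s], the exponent is halved. It is used
    with [a = eps] and [a = eps + 1], whence [e = (k + eps) / 2]. *)
Lemma holder_error h s a : 0 < s -> 0 < vnorm h <= 1 ->
  vnorm h ^ 2 * Rpower (vnorm h) a <= Rpower (vnorm h * vnorm h + s) (1 + a / 2) \/ a < 0.
Proof.
move=> hs hh; case: (Rlt_le_dec a 0) => ha; [by right | left].
have -> : vnorm h ^ 2 = Rpower (vnorm h) 2.
  by rewrite -(Rpower_pow 2) /=; [congr Rpower; ring | lra].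
rewrite -Rpower_plus.
have -> : Rpower (vnorm h) (2 + a) = Rpower (vnorm h * vnorm h) (1 + a / 2).
  rewrite -Rpower_mult_distr; try lra.
  by rewrite -Rpower_plus; congr Rpower; field.
by apply: Rle_Rpower_l; [lra | nra].
Qed.

Lemma weighted_sum_bound (T : finType) (w : T -> R) (g : T -> R) a b : 0 <= a -> (forall i, Rabs (w i) <= a) ->
  (forall i, Rabs (g i) <= b) -> Rabs (rsum (fun i => w i * g i)) <= INR #|T| * (a * b).
Proof.
move=> ha hw hg; apply: Rle_trans (rsum_abs _ _) _; apply: rsum_le_const => i.
by rewrite Rabs_mult; apply: Rmult_le_compat; [exact: Rabs_pos | exact: Rabs_pos | exact: hw | exact: hg].
Qed.

Lemma regular_of_C2 (W : Cn n -> Prop) rho p eps : is_open W -> W p -> 0 < eps <= 1 -> Cka 2 eps W rho ->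
  exists r M, (forall z, vdist z p < r -> W z) /\ regular_near (eps / 2) rho p r M.
Proof.
move=> hW hp heps [hC hH].
have c1 d : Ck 1 W (pd rho d) by exact: Ck_pd.
have c0 d d' : Ck 0 W (pd (pd rho d') d) by exact: Ck_pd.
have [r1 [M1 [hr1 [hM1 hb1]]]] := locally_bounded _ (pd rho) p (fun d => proj1 (c1 d) p hp).
have [r2 [M2 [hr2 [hM2 hb2]]]] := locally_bounded _ (fun dd : dir * dir => pd (pd rho dd.2) dd.1) p
   (fun dd => proj1 (c0 dd.1 dd.2) p hp).
have [r3 [M3 [hr3 [hM3 hb3]]]] := locally_holder _ (fun dd : dir * dir => pd (pd rho dd.2) dd.1) W p eps hp
   (fun dd => hH [:: dd.1; dd.2] erefl).
have [r4 [hr4 hb4]] := hW p hp.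
pose r := Rmin (Rmin 1 r4) (Rmin r1 (Rmin r2 r3)).
have hr : 0 < r by repeat apply: Rmin_pos => //; lra.
have rl : r <= 1 /\ r <= r4 /\ r <= r1 /\ r <= r2 /\ r <= r3.
  have := Rmin_l (Rmin 1 r4) (Rmin r1 (Rmin r2 r3)); have := Rmin_r (Rmin 1 r4) (Rmin r1 (Rmin r2 r3)).
  have := Rmin_l 1 r4; have := Rmin_r 1 r4; have := Rmin_l r1 (Rmin r2 r3); have := Rmin_r r1 (Rmin r2 r3).
  have := Rmin_l r2 r3; have := Rmin_r r2 r3; rewrite -/r; lra.
pose N := INR #|{: dir}|; have N0 : 0 <= N by exact: pos_INR.
pose M := M1 + M2 + M3 + N * (N * M3).
have hN3 : 0 <= N * (N * M3) by repeat apply: Rmult_le_pos.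
have WB z : vdist z p < r -> W z by move=> hz; apply: hb4; lra.
exists r, M; split=> //.
have hold x y D d d' : vdist x p < r -> vdist y p < r -> vdist x y <= D -> 0 < D ->
    Rabs (pd (pd rho d') d x - pd (pd rho d') d y) <= M3 * Rpower D eps.
  move=> hx hy hD D0.
  case: (vdist_ge0 _ x y) => hxy; last first.
    rewrite (vdist_eq0 _ x y (esym hxy)) Rminus_diag Rabs_R0.
    by apply: Rmult_le_pos => //; apply: Rlt_le; exact: Rpower_pos.
  apply: Rle_trans (hb3 (d, d') x y (WB x hx) (WB y hy) ltac:(lra) ltac:(lra)) _.
  by apply: Rmult_le_compat_l => //; apply: Rle_Rpower_l; lra.
split.
- lra.
- by rewrite /M; lra.
- by move=> z d hz; exact: (proj1 (proj2 hC d) z (WB z hz)).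
- by move=> z d d' hz; exact: (proj1 (proj2 (c1 d') d) z (WB z hz)).
- by move=> z d hz; apply: Rle_trans (hb1 d z ltac:(lra)) _; rewrite /M; lra.
- by move=> z d d' hz; apply: Rle_trans (hb2 (d, d') z ltac:(lra)) _; rewrite /M; lra.
- move=> x y D d d' hx hy hD hD1; apply: Rle_trans (hold x y D d d' hx hy hD (proj1 hD1)) _.
  have h1 : Rpower D eps <= Rpower D (eps / 2) by apply: Rpower_le_exponent; lra.
  have h2 := Rpower_pos D (eps / 2); have h3 := Rpower_pos D eps.
  by apply: Rmult_le_compat; rewrite /M; lra.
- by move=> z d d' hz; apply: (pd_symmetric _ W) => //; exact: WB.
move=> z hz; exists (fun _ _ _ => RtoC 0), (fun _ _ _ => RtoC 0).
have M0 : Cmod (RtoC 0) <= M by rewrite Cmod_0 /M; lra.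
split=> //; split=> // h s hs h1 hzh.
have t0 u v w : tri (fun _ _ _ : 'I_n => RtoC 0) u v w = RtoC 0.
  rewrite triE (csum_ext _ _ (fun _ => RtoC 0)) ?csum0 // => j.
  rewrite (csum_ext _ _ (fun _ => RtoC 0)) ?csum0 // => l.
  by rewrite (csum_ext _ _ (fun _ => RtoC 0)) ?csum0 // => m; exact: Cmult_0_r.
rewrite !t0 Re_RtoC !Rplus_0_r.
have seg t : 0 <= t <= 1 -> vdist (vadd z (vscal (RtoC t) h)) p < r by move=> ht; exact: segment_in_ball.
have z0 : vadd z (vscal (RtoC 0) h) = z by apply: vext => j; rewrite /vadd /vscal; ring.
have z1 : vadd z (vscal (RtoC 1) h) = vadd z h by apply: vext => j; rewrite /vadd /vscal; ring.
have E0 := Rpower_pos (vnorm h * vnorm h + s) (1 + eps / 2).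
have EM : 0 <= M * Rpower (vnorm h * vnorm h + s) (1 + eps / 2) by apply: Rmult_le_pos; rewrite ?/M; lra.
have := taylor2 (fun t => rho (vadd z (vscal (RtoC t) h))) (fun t => D1 rho h (vadd z (vscal (RtoC t) h)))
  (fun t => D2 rho h (vadd z (vscal (RtoC t) h))) _ EM.
rewrite z0; move=> /(_ _ _ _ 1); rewrite z1 !Rmult_1_r => H.
have -> : rho z + D1 rho h z + D2 rho h z / 2 = rho z + D1 rho h z + D2 rho h z / 2 * 1 by ring.
rewrite Rmult_1_r; apply: H; last lra.
- by move=> t ht; apply: (line_derivative n W) => //; [exact: Ck_le | apply: WB; exact: seg].
- by move=> t ht; apply: (line_derivative2 n W) => //; apply: WB; exact: seg.
move=> t ht; rewrite !D2E.
have h0 := vnorm_ge0 _ h.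
case: h0 => h0; last first.
  have cz d : co h d = 0.
    by have := co_le n h d; rewrite -h0 => hc; have := Rabs_pos (co h d) => hc'; apply: Rabs_eq_0; lra.
  have q0 u : rsum (fun d => rsum (fun d' => co h d * co h d' * pd (pd rho d') d u)) = 0.
    rewrite (rsum_ext _ _ (fun _ => 0)) ?rsum0 // => d.
    by rewrite (rsum_ext _ _ (fun _ => 0)) ?rsum0 // => d'; rewrite cz; ring.
  by rewrite !q0 Rminus_diag Rabs_R0.
rewrite -rsumB.
rewrite (rsum_ext _ _ (fun d => co h d * rsum (fun d' => co h d' * (pd (pd rho d') d (vadd z (vscal (RtoC t) h)) - pd (pd rho d') d z)))); last first.
  by move=> d; rewrite -rsumB -rsumZ; apply: rsum_ext => d'; ring.
have hinner d : Rabs (rsum (fun d' => co h d' * (pd (pd rho d') d (vadd z (vscal (RtoC t) h)) - pd (pd rho d') d z)))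
    <= N * (vnorm h * (M3 * Rpower (vnorm h) eps)).
  apply: weighted_sum_bound; [lra | by move=> d'; exact: co_le |].
  move=> d'; apply: hold => //; first exact: seg.
  by rewrite vdist_add vnorm_scalR Rabs_pos_eq; [nra | lra].
have := weighted_sum_bound _ (co h) _ (vnorm h) _ (Rlt_le _ _ h0) (co_le n h) hinner.
rewrite -/N => H1; apply: Rle_trans H1 _.
have [H2|] := holder_error h s eps hs (conj h0 h1); last lra.
have -> : N * (vnorm h * (N * (vnorm h * (M3 * Rpower (vnorm h) eps)))) =
   N * (N * M3) * (vnorm h ^ 2 * Rpower (vnorm h) eps) by ring.
apply: Rmult_le_compat => //; last by rewrite /M; lra.
by apply: Rmult_le_pos; [nra | apply: Rlt_le; exact: Rpower_pos].
Qed.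

Lemma regular_of_C3 (W : Cn n -> Prop) rho p eps : is_open W -> W p -> 0 < eps <= 1 -> Cka 3 eps W rho ->
  exists r M, (forall z, vdist z p < r -> W z) /\ regular_near ((1 + eps) / 2) rho p r M.
Proof.
move=> hW hp heps [hC hH].
have c2 d : Ck 2 W (pd rho d) by exact: Ck_pd.
have c1 d d' : Ck 1 W (pd (pd rho d') d) by exact: Ck_pd.
have c0 d d' d'' : Ck 0 W (pd (pd (pd rho d'') d') d) by exact: Ck_pd.
have [r1 [M1 [hr1 [hM1 hb1]]]] := locally_bounded _ (pd rho) p (fun d => proj1 (c2 d) p hp).
have [r2 [M2 [hr2 [hM2 hb2]]]] := locally_bounded _ (fun dd : dir * dir => pd (pd rho dd.2) dd.1) p
   (fun dd => proj1 (c1 dd.1 dd.2) p hp).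
have [r5 [M5 [hr5 [hM5 hb5]]]] := locally_bounded _ (fun dd : dir * dir * dir => pd (pd (pd rho dd.2) dd.1.2) dd.1.1) p
   (fun dd => proj1 (c0 dd.1.1 dd.1.2 dd.2) p hp).
have [r3 [M3 [hr3 [hM3 hb3]]]] := locally_holder _ (fun dd : dir * dir * dir => pd (pd (pd rho dd.2) dd.1.2) dd.1.1) W p eps hp
   (fun dd => hH [:: dd.1.1; dd.1.2; dd.2] erefl).
have [r4 [hr4 hb4]] := hW p hp.
(* The factor 4 leaves room for the intermediate points of [coordinate_increment], which lie within
   [3 r] of [p]. *)
pose r := Rmin (Rmin (/ 2) r4) (Rmin (Rmin r1 r5) (Rmin r2 r3)) / 4.
have hr' : 0 < Rmin (Rmin (/ 2) r4) (Rmin (Rmin r1 r5) (Rmin r2 r3)) by repeat apply: Rmin_pos => //; lra.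
have hr : 0 < r by rewrite /r; lra.
have rl : 4 * r <= / 2 /\ 4 * r <= r4 /\ 4 * r <= r1 /\ 4 * r <= r2 /\ 4 * r <= r3 /\ 4 * r <= r5.
  have := Rmin_l (Rmin (/ 2) r4) (Rmin (Rmin r1 r5) (Rmin r2 r3)); have := Rmin_r (Rmin (/ 2) r4) (Rmin (Rmin r1 r5) (Rmin r2 r3)).
  have := Rmin_l (/ 2) r4; have := Rmin_r (/ 2) r4.
  have := Rmin_l (Rmin r1 r5) (Rmin r2 r3); have := Rmin_r (Rmin r1 r5) (Rmin r2 r3).
  have := Rmin_l r2 r3; have := Rmin_r r2 r3; have := Rmin_l r1 r5; have := Rmin_r r1 r5; rewrite /r; lra.
pose N := INR #|{: dir}|; have N0 : 0 <= N by exact: pos_INR.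
pose M := M1 + M2 + M5 + N * M5 + N * (N * (N * M3)).
have hN5 : 0 <= N * M5 by apply: Rmult_le_pos.
have hN3 : 0 <= N * (N * (N * M3)) by repeat apply: Rmult_le_pos.
have WB z : vdist z p < 4 * r -> W z by move=> hz; apply: hb4; lra.
exists r, M; split; first by move=> z hz; apply: WB; lra.
split.
- lra.
- by rewrite /M; lra.
- by move=> z d hz; apply: (proj1 (proj2 hC d) z); apply: WB; lra.
- by move=> z d d' hz; apply: (proj1 (proj2 (c2 d') d) z); apply: WB; lra.
- by move=> z d hz; apply: Rle_trans (hb1 d z ltac:(lra)) _; rewrite /M; lra.
- by move=> z d d' hz; apply: Rle_trans (hb2 (d, d') z ltac:(lra)) _; rewrite /M; lra.
(* Bounded third derivatives make the second ones Lipschitz, and [D <= D^e] for [D <= 1]. *)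
- move=> x y D d d' hx hy hD hD1.
  have hxy : vdist x y < 2 * r by have := vdist_triangle _ x p y; rewrite (vdistC _ p y); lra.
  have [|xi [hxi hinc]] := coordinate_increment n (pd (pd rho d') d) y (vsub x y).
    move=> d'' u hu; apply: (proj1 (proj2 (c1 d d') d'') u); apply: WB.
    by rewrite -/(vdist x y) in hu; have := vdist_triangle _ u y p; lra.
  rewrite vadd_sub in hinc; rewrite hinc.
  have hxi2 d'' : Rabs (pd (pd (pd rho d') d) d'' (xi d'')) <= M5.
    apply: (hb5 (d'', d, d')); have := vdist_triangle _ (xi d'') y p.
    by have := hxi d''; rewrite -/(vdist x y); lra.
  have := weighted_sum_bound _ (co (vsub x y)) _ (vdist x y) _ (vdist_ge0 _ x y) (co_le n (vsub x y)) hxi2.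
  move=> H; apply: Rle_trans H _; rewrite -/N.
  have -> : N * (vdist x y * M5) = (N * M5) * vdist x y by ring.
  apply: Rmult_le_compat => //; [exact: vdist_ge0 | by rewrite /M; lra |].
  apply: Rle_trans hD _; rewrite -{1}(Rpower_1 D); last lra.
  by apply: Rpower_le_exponent; lra.
- by move=> z d d' hz; apply: (pd_symmetric _ W) => //; [exact: Ck_le | apply: WB; lra].
move=> z hz.
have [A [T [hA [hT hAT]]]] := cubic_split n (fun d d' d'' => / 6 * pd (pd (pd rho d) d') d'' z) (/ 6 * M5)
  ltac:(move=> d d' d''; rewrite Rabs_mult (Rabs_pos_eq (/ 6)); [apply: Rmult_le_compat_l; [lra | apply: (hb5 (d'', d', d)); lra] | lra]).
exists A, T; split; first by move=> j l m; apply: Rle_trans (hA j l m) _; rewrite /M; lra.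
split; first by move=> j l m; apply: Rle_trans (hT j l m) _; rewrite /M; lra.
move=> h s hs h1 hzh.
have seg t : 0 <= t <= 1 -> vdist (vadd z (vscal (RtoC t) h)) p < r by move=> ht; exact: segment_in_ball.
have WS t : 0 <= t <= 1 -> W (vadd z (vscal (RtoC t) h)) by move=> ht; apply: WB; have := seg t ht; lra.
have z0 : vadd z (vscal (RtoC 0) h) = z by apply: vext => j; rewrite /vadd /vscal; ring.
have z1 : vadd z (vscal (RtoC 1) h) = vadd z h by apply: vext => j; rewrite /vadd /vscal; ring.
have e2 : 1 + (1 + eps) / 2 = 1 + (eps + 1) / 2 by field.
rewrite e2; set EE := Rpower _ _.
have E0 : 0 < EE by exact: Rpower_pos.
have EM : 0 <= M * EE by apply: Rmult_le_pos; rewrite ?/M; lra.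
have cub : D3 rho h z / 6 = Re (tri A h h h) + Re (tri T h h (vconj h)).
  rewrite -hAT D3E /Rdiv Rmult_comm -rsumZ; apply: rsum_ext => d; rewrite -rsumZ; apply: rsum_ext => d'.
  by rewrite -rsumZ; apply: rsum_ext => d''; ring.
have := taylor3 (fun t => rho (vadd z (vscal (RtoC t) h))) (fun t => D1 rho h (vadd z (vscal (RtoC t) h)))
  (fun t => D2 rho h (vadd z (vscal (RtoC t) h))) (fun t => D3 rho h (vadd z (vscal (RtoC t) h))) _ EM.
rewrite z0; move=> /(_ _ _ _ _ 1); rewrite z1 !Rmult_1_r cub => H.
have -> : rho z + D1 rho h z + D2 rho h z / 2 + Re (tri A h h h) + Re (tri T h h (vconj h)) =
  rho z + D1 rho h z + D2 rho h z / 2 + (Re (tri A h h h) + Re (tri T h h (vconj h))) by ring.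
apply: H; last lra.
- by move=> t ht; apply: (line_derivative n W) => //; [do 2 apply: Ck_le | exact: WS].
- by move=> t ht; apply: (line_derivative2 n W) => //; [apply: Ck_le | exact: WS].
- by move=> t ht; apply: (line_derivative3 n W) => //; exact: WS.
move=> t ht; rewrite !D3E.
case: (vnorm_ge0 _ h) => h0; last first.
  have cz d : co h d = 0.
    by have := co_le n h d; rewrite -h0 => hc; have := Rabs_pos (co h d) => hc'; apply: Rabs_eq_0; lra.
  have q0 u : rsum (fun d => rsum (fun d' => rsum (fun d'' => co h d * co h d' * co h d'' * pd (pd (pd rho d) d') d'' u))) = 0.
    rewrite (rsum_ext _ _ (fun _ => 0)) ?rsum0 // => d.
    rewrite (rsum_ext _ _ (fun _ => 0)) ?rsum0 // => d'.
    by rewrite (rsum_ext _ _ (fun _ => 0)) ?rsum0 // => d''; rewrite cz; ring.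
  by rewrite !q0 Rminus_diag Rabs_R0.
rewrite -rsumB.
set zt := vadd z (vscal (RtoC t) h).
rewrite (rsum_ext _ _ (fun d => co h d * rsum (fun d' => co h d' * rsum (fun d'' => co h d'' *
   (pd (pd (pd rho d) d') d'' zt - pd (pd (pd rho d) d') d'' z))))); last first.
  move=> d; rewrite -rsumB -rsumZ; apply: rsum_ext => d'; rewrite -rsumB -!rsumZ; apply: rsum_ext => d''; ring.
have hold d d' d'' : Rabs (pd (pd (pd rho d) d') d'' zt - pd (pd (pd rho d) d') d'' z) <= M3 * Rpower (vnorm h) eps.
  have Dh : vdist zt z <= vnorm h by rewrite /zt vdist_add vnorm_scalR Rabs_pos_eq; [nra | lra].
  have hs' := seg t ht; rewrite -/zt in hs'.
  case: (vdist_ge0 _ zt z) => hd; last first.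
    rewrite (vdist_eq0 _ zt z (esym hd)) Rminus_diag Rabs_R0.
    by apply: Rmult_le_pos => //; apply: Rlt_le; exact: Rpower_pos.
  apply: Rle_trans (hb3 (d'', d', d) zt z (WS t ht) (WB z ltac:(lra)) ltac:(lra) ltac:(lra)) _.
  by apply: Rmult_le_compat_l => //; apply: Rle_Rpower_l; lra.
have i1 d d' := weighted_sum_bound _ (co h) _ (vnorm h) _ (Rlt_le _ _ h0) (co_le n h) (hold d d').
have i2 d := weighted_sum_bound _ (co h) _ (vnorm h) _ (Rlt_le _ _ h0) (co_le n h) (i1 d).
have i3 := weighted_sum_bound _ (co h) _ (vnorm h) _ (Rlt_le _ _ h0) (co_le n h) i2.
apply: Rle_trans i3 _; rewrite -/N.
have [H2|] := holder_error h s (eps + 1) hs (conj h0 h1); last lra.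
have -> : N * (vnorm h * (N * (vnorm h * (N * (vnorm h * (M3 * Rpower (vnorm h) eps)))))) =
   N * (N * (N * M3)) * (vnorm h ^ 2 * Rpower (vnorm h) (eps + 1)).
  by rewrite Rpower_plus Rpower_1 //; ring.
apply: Rmult_le_compat => //; last by rewrite /M; lra.
by apply: Rmult_le_pos; [nra | apply: Rlt_le; exact: Rpower_pos].
Qed.
End Regularity.
(** * Charts near a strictly pseudoconvex point *)

Section Forms.
Variable n : nat.
Implicit Types (X Y u v h z p : Cn n).

Lemma linB (a : 'I_n -> C) u v : lin a (vsub u v) = Cminus (lin a u) (lin a v).
Proof.
have -> : vsub u v = vadd u (vscal (RtoC (-1)) v).
  by apply: vext => j; rewrite /vsub /vadd /vscal; apply: C_eq; rewrite !CE; ring.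
by rewrite linD linZ; apply: C_eq; rewrite !CE; ring.
Qed.

Lemma bil_sesq_diff (S : 'I_n -> 'I_n -> C) B X Y : (forall j l, Cmod (S j l) <= B) ->
  Cmod (Cminus (bil S X (vconj X)) (bil S Y (vconj Y))) <=
  INR n * (INR n * B) * (vnorm X + vnorm Y) * vdist X Y.
Proof.
move=> hS.
have hX : X = vadd Y (vsub X Y) by rewrite vadd_sub.
set D := vsub X Y in hX.
have -> : Cminus (bil S X (vconj X)) (bil S Y (vconj Y)) =
  Cplus (bil S D (vconj X)) (bil S Y (vconj D)).
  have -> : bil S X (vconj X) = Cplus (bil S Y (vconj X)) (bil S D (vconj X)) by rewrite -bilDl -hX.
  have -> : bil S Y (vconj X) = Cplus (bil S Y (vconj Y)) (bil S Y (vconj D)) by rewrite -bilDr -vconjD -hX.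
  ring.
apply: Rle_trans (Cmod_triangle _ _) _.
have := bil_bound _ S B D (vconj X) hS; have := bil_bound _ S B Y (vconj D) hS.
rewrite !vnorm_conj -/(vdist X Y); lra.
Qed.

(** A version of Finsler's lemma, by compactness of the unit sphere. One integer [k] serves both
    constants; if every [k] failed, there would be unit vectors [u k] with [k |lin a (u k)|^2]
    bounded, and a limit of them would be a unit vector in the kernel of [a] on which the form is
    not positive. *)
Lemma positive_definite_completion (a : 'I_n -> C) (L : 'I_n -> 'I_n -> C) :
  (forall X, X <> vzero -> lin a X = RtoC 0 -> 0 < Re (bil L X (vconj X))) ->
  exists K c, 0 < K /\ 0 < c /\ forall X,
    c * (vnorm X * vnorm X) <= Re (bil L X (vconj X)) + K * (Cmod (lin a X) * Cmod (lin a X)).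
Proof.
move=> hpos.
have [A [hA hAj]] := fin_upper _ (fun j => Cmod (a j)).
have [B [hB hBj]] := fin_upper _ (fun jl : 'I_n * 'I_n => Cmod (L jl.1 jl.2)).
have hL j l : Cmod (L j l) <= B by exact: (hBj (j, l)).
have n0 := pos_INR n.
pose A1 := INR n * A; have A10 : 0 <= A1 by apply: Rmult_le_pos.
pose B1 := INR n * (INR n * B); have B10 : 0 <= B1 by repeat apply: Rmult_le_pos.
have lb X : Cmod (lin a X) <= A1 * vnorm X by exact: lin_bound.
have bb X : Cmod (bil L X (vconj X)) <= B1 * (vnorm X * vnorm X).
  by have := bil_bound _ L B X (vconj X) hL; rewrite vnorm_conj /B1; lra.
have unit : exists k : nat, forall X, vnorm X = 1 ->
    / (INR k + 1) <= Re (bil L X (vconj X)) + INR k * (Cmod (lin a X) * Cmod (lin a X)).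
  apply: NNPP => hno.
  have hk k : exists X, vnorm X = 1 /\ Re (bil L X (vconj X)) + INR k * (Cmod (lin a X) * Cmod (lin a X)) < / (INR k + 1).
    apply: NNPP => hk; apply: hno; exists k => X hX; apply: Rnot_lt_le => hlt; apply: hk; by exists X.
  have [u hu] := choice _ hk.
  have [phi [Y [h1 h2]]] := bounded_subseq_Cn n u 1 (fun k => Req_le _ _ (proj1 (hu k))).
  have nY : vnorm Y = 1.
    have a1 : forall e, 0 < e -> Rabs (vnorm Y - 1) <= e.
      move=> e he; have [N hN] := h2 e he; have hd := hN N (leqnn N).
      rewrite -(proj1 (hu (phi N))).
      have k1 := vnorm_sub_ge _ Y (u (phi N)); have k2 := vnorm_sub_ge _ (u (phi N)) Y.
      by rewrite vnorm_opp in k1; rewrite /vdist in hd; apply: Rabs_le; lra.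
    have : Rabs (vnorm Y - 1) <= 0 by apply: le_epsilon => e he; have := a1 e he; lra.
    by move=> k; have := Rabs_pos (vnorm Y - 1) => k'; have : vnorm Y - 1 = 0 by [apply: Rabs_eq_0; lra]; lra.
  have Lb k : - B1 <= Re (bil L (u k) (vconj (u k))).
    have := bb (u k); rewrite (proj1 (hu k)) => hb.
    by have := Rle_trans _ _ _ (Cmod_Re _) hb => /Rabs_le_between; lra.
  have ik k : 0 < / (INR k + 1) <= 1.
    have k0 := pos_INR k; split; first by apply: Rinv_0_lt_compat; lra.
    by rewrite -Rinv_1; apply: Rinv_le_contravar; lra.
  have lY : lin a Y = RtoC 0.
    apply: NNPP => hl; have t0 : 0 < Cmod (lin a Y) := proj1 (Cmod_gt_0 _) hl.
    set t := Cmod (lin a Y) in t0.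
    have [N1 hN1] := h2 (t / 2 / (A1 + 1)) ltac:(apply: Rdiv_lt_0_compat; lra).
    have hb0 : 0 < 4 * (1 + B1) / (t * t) by apply: Rdiv_lt_0_compat; nra.
    have [N2 hN2] := INR_unbounded (4 * (1 + B1) / (t * t)).
    pose k := maxn N1 N2.
    have hd := hN1 k (leq_maxl _ _).
    have hl2 : t / 2 <= Cmod (lin a (u (phi k))).
      have k1 := Cmod_minus_ge (lin a Y) (lin a (u (phi k))).
      rewrite -linB in k1; have k2 := lb (vsub Y (u (phi k))).
      have k3 : vnorm (vsub Y (u (phi k))) < t / 2 / (A1 + 1) by rewrite vnorm_opp.
      have k4 : A1 * vnorm (vsub Y (u (phi k))) <= (A1 + 1) * (t / 2 / (A1 + 1)).
        by apply: Rmult_le_compat; try lra; exact: vnorm_ge0.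
      have k5 : (A1 + 1) * (t / 2 / (A1 + 1)) = t / 2 by field; lra.
      by rewrite -/t in k1; lra.
    have hk1 := proj2 (hu (phi k)); have := Lb (phi k); have := ik (phi k).
    have hk2 : 4 * (1 + B1) / (t * t) < INR (phi k).
      apply: Rlt_le_trans hN2 _; apply: le_INR; apply/leP.
      exact: leq_trans (leq_maxr N1 N2) (h1 k).
    have hk3 : INR (phi k) * (t / 2 * (t / 2)) <= INR (phi k) * (Cmod (lin a (u (phi k))) * Cmod (lin a (u (phi k)))).
      by apply: Rmult_le_compat_l; [exact: pos_INR | apply: Rmult_le_compat; lra].
    have hk4 : 4 * (1 + B1) / (t * t) * (t / 2 * (t / 2)) < INR (phi k) * (t / 2 * (t / 2)).
      by apply: Rmult_lt_compat_r => //; nra.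
    have hk5 : 4 * (1 + B1) / (t * t) * (t / 2 * (t / 2)) = 1 + B1 by field; lra.
    lra.
  have Y0 : Y <> vzero by move=> e; move: nY; rewrite e vnorm_zero; lra.
  have LY := hpos Y Y0 lY; set t := Re _ in LY.
  have [N1 hN1] := h2 (t / 4 / (B1 + 1)) ltac:(apply: Rdiv_lt_0_compat; lra).
  have [N2 [hN2 hN2']] := archimed_cor1 (t / 2) ltac:(lra).
  pose k := maxn N1 N2; have hd := hN1 k (leq_maxl _ _).
  have k1 := bil_sesq_diff L B (u (phi k)) Y hL; rewrite nY (proj1 (hu (phi k))) -/B1 in k1.
  have k2 := Rle_trans _ _ _ (Cmod_Re _) k1; rewrite Re_minus -/t in k2.
  have k3 : B1 * (1 + 1) * vdist (u (phi k)) Y <= t / 2.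
    have : B1 * (1 + 1) * vdist (u (phi k)) Y <= (B1 + 1) * 2 * (t / 4 / (B1 + 1)).
      by apply: Rmult_le_compat; try lra; exact: vdist_ge0.
    by have -> : (B1 + 1) * 2 * (t / 4 / (B1 + 1)) = t / 2 by field; lra.
  have k4 := proj2 (hu (phi k)).
  have k5 : 0 <= INR (phi k) * (Cmod (lin a (u (phi k))) * Cmod (lin a (u (phi k)))).
    by apply: Rmult_le_pos; [exact: pos_INR | have := Cmod_ge_0 (lin a (u (phi k))); nra].
  have k6 : / (INR (phi k) + 1) <= / INR N2.
    apply: Rinv_le_contravar; first by apply: lt_0_INR.
    by have := le_INR _ _ (leP (leq_trans (leq_maxr N1 N2) (h1 k))); rewrite -/k; lra.
  by move/Rabs_le_between: k2; lra.
have [k hk] := unit.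
have k0 := pos_INR k.
exists (INR k + 1), (/ (INR k + 1)); split; first lra.
split; first by apply: Rinv_0_lt_compat; lra.
move=> X.
have q0 : 0 <= Cmod (lin a X) * Cmod (lin a X) by have := Cmod_ge_0 (lin a X); nra.
case: (vnorm_ge0 _ X) => hX; last first.
  have := bb X; rewrite -hX !Rmult_0_r => hb; have := Rle_trans _ _ _ (Cmod_Re _) hb => /Rabs_le_between; nra.
have Xn : RtoC (vnorm X) <> RtoC 0 by apply: RtoC_neq0; lra.
pose Y := vscal (RtoC (/ vnorm X)) X.
have XY : X = vscal (RtoC (vnorm X)) Y.
  apply: vext => j; rewrite /Y /vscal RtoC_inv; [by field | lra].
have nY : vnorm Y = 1 by rewrite /Y vnorm_scalR Rabs_pos_eq; [field; lra | apply: Rlt_le; apply: Rinv_0_lt_compat].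
have := hk Y nY.
have e1 : Re (bil L X (vconj X)) = vnorm X * vnorm X * Re (bil L Y (vconj Y)).
  by rewrite {1 2}XY vconjZ bilZl bilZr !CE; ring.
have e2 : Cmod (lin a X) = vnorm X * Cmod (lin a Y) by rewrite {1}XY linZ Cmod_mult Cmod_R Rabs_pos_eq; lra.
rewrite e1 e2 => h.
have vv : 0 < vnorm X * vnorm X by nra.
have q1 : 0 <= Cmod (lin a Y) * Cmod (lin a Y) by have := Cmod_ge_0 (lin a Y); nra.
have : vnorm X * vnorm X * / (INR k + 1) <= vnorm X * vnorm X * (Re (bil L Y (vconj Y)) + INR k * (Cmod (lin a Y) * Cmod (lin a Y))).
  by apply: Rmult_le_compat_l; lra.
nra.
Qed.
End Forms.

(** * Charts with uniform constants *)

Section Charts.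
Variable n : nat.
Notation dir := ('I_n * bool)%type.
Variables (e : R) (rho : Cn n -> R) (p : Cn n) (r0 M1 : R).
Hypothesis e_range : 0 < e <= 1.
Hypothesis reg : regular_near n e rho p r0 M1.
Hypothesis rho_p : rho p = 0.
Implicit Types (z h X u v : Cn n).

Definition grad_c z : 'I_n -> C := fun j => dz rho j z.
Definition hess z (d d' : dir) : R := pd (pd rho d') d z.

Let M1_ge0 := reg_M _ _ _ _ _ _ reg.
Let r0_range := reg_r _ _ _ _ _ _ reg.
Let N := INR #|{: dir}|.
Let N0 : 0 <= N. Proof. exact: pos_INR. Qed.

Lemma p_in_ball : vdist p p < r0.
Proof. by rewrite vdist_self; lra. Qed.

Lemma levi_hess z X : levi rho z X = Re (bil (hess_levi n (hess z)) X (vconj X)).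
Proof.
rewrite bilE /levi; congr Re; apply: csum_ext => j; apply: csum_ext => l.
have -> : dzdzb rho j l z = hess_levi n (hess z) j l by [].
rewrite /vconj; ring.
Qed.

Lemma dpair_grad z X : dpair rho z X = lin (grad_c z) X.
Proof. by []. Qed.

Lemma D1_grad z h : D1 rho h z = Re (Cmult (RtoC 2) (lin (grad_c z) h)).
Proof.
rewrite Re_mult Re_RtoC Im_RtoC Rmult_0_l Rminus_0_r /lin Re_csum -rsumZ /D1 rsum_pair.
apply: rsum_ext => j; rewrite /grad_c /dz /co !CE /Re /Im /=; field.
Qed.

Lemma gradient_lipschitz x y d : vdist x p < r0 / 3 -> vdist y p < r0 / 3 ->
  Rabs (pd rho d x - pd rho d y) <= N * M1 * vdist x y.
Proof.
move=> hx hy.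
have hxy : vdist x y < 2 * r0 / 3 by have := vdist_triangle _ x p y; rewrite (vdistC _ p y); lra.
have inb u : vdist u y <= vnorm (vsub x y) -> vdist u p < r0.
  by rewrite -/(vdist x y) => hu; have := vdist_triangle _ u y p; lra.
have [|xi [hxi hinc]] := coordinate_increment n (pd rho d) y (vsub x y).
  by move=> d' u hu; apply: (reg_pd2 _ _ _ _ _ _ reg); exact: inb.
rewrite vadd_sub in hinc; rewrite hinc.
have hb d' : Rabs (pd (pd rho d) d' (xi d')) <= M1.
  by apply: (reg_b2 _ _ _ _ _ _ reg); exact: inb.
apply: Rle_trans (weighted_sum_bound _ (co (vsub x y)) _ (vdist x y) _ (vdist_ge0 _ x y) (co_le n (vsub x y)) hb) _.
by rewrite -/N; apply: Req_le; ring.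
Qed.

Lemma rho_lipschitz x y : vdist x p < r0 / 3 -> vdist y p < r0 / 3 ->
  Rabs (rho x - rho y) <= N * M1 * vdist x y.
Proof.
move=> hx hy.
have hxy : vdist x y < 2 * r0 / 3 by have := vdist_triangle _ x p y; rewrite (vdistC _ p y); lra.
have inb u : vdist u y <= vnorm (vsub x y) -> vdist u p < r0.
  by rewrite -/(vdist x y) => hu; have := vdist_triangle _ u y p; lra.
have [|xi [hxi hinc]] := coordinate_increment n rho y (vsub x y).
  by move=> d' u hu; apply: (reg_pd _ _ _ _ _ _ reg); exact: inb.
rewrite vadd_sub in hinc; rewrite hinc.
have hb d' : Rabs (pd rho d' (xi d')) <= M1.
  by apply: (reg_b1 _ _ _ _ _ _ reg); exact: inb.
apply: Rle_trans (weighted_sum_bound _ (co (vsub x y)) _ (vdist x y) _ (vdist_ge0 _ x y) (co_le n (vsub x y)) hb) _.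
by rewrite -/N; apply: Req_le; ring.
Qed.

Lemma grad_c_bound z j : vdist z p < r0 -> Cmod (grad_c z j) <= M1.
Proof.
move=> hz; apply: Rle_trans (Cmod_le_ReIm _) _; rewrite /grad_c /dz /Re /Im /=.
have h1 := reg_b1 _ _ _ _ _ _ reg z (j, false) hz; have h2 := reg_b1 _ _ _ _ _ _ reg z (j, true) hz.
by rewrite /Rdiv !Rabs_mult Rabs_Ropp (Rabs_pos_eq (/ 2)); lra.
Qed.

Lemma grad_c_lipschitz z j : vdist z p < r0 / 3 -> Cmod (Cminus (grad_c z j) (grad_c p j)) <= N * M1 * vdist z p.
Proof.
move=> hz; have hp : vdist p p < r0 / 3 by rewrite vdist_self; lra.
apply: Rle_trans (Cmod_le_ReIm _) _; rewrite !CE /grad_c /dz /Re /Im /=.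
have h1 := gradient_lipschitz z p (j, false) hz hp; have h2 := gradient_lipschitz z p (j, true) hz hp.
have -> : pd rho (j, false) z / 2 - pd rho (j, false) p / 2 = (pd rho (j, false) z - pd rho (j, false) p) * / 2 by field.
have -> : - pd rho (j, true) z / 2 - - pd rho (j, true) p / 2 = - (pd rho (j, true) z - pd rho (j, true) p) * / 2 by field.
by rewrite !Rabs_mult Rabs_Ropp (Rabs_pos_eq (/ 2)); lra.
Qed.

Let quarter_bound (a b c d B : R) : Rabs a <= B -> Rabs b <= B -> Rabs c <= B -> Rabs d <= B ->
  Rabs ((a + b) / 4) + Rabs ((c - d) / 4) <= B.
Proof.
move=> /Rabs_le_between h1 /Rabs_le_between h2 /Rabs_le_between h3 /Rabs_le_between h4.
by rewrite /Rabs; do 2 case: Rcase_abs => ?; lra.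
Qed.

Lemma hess_levi_bound z j l : vdist z p < r0 -> Cmod (hess_levi n (hess z) j l) <= M1.
Proof.
move=> hz; apply: Rle_trans (Cmod_le_ReIm _) _; rewrite /Re /Im /=.
by apply: quarter_bound; exact: (reg_b2 _ _ _ _ _ _ reg).
Qed.

Lemma hess_hol_bound z j l : vdist z p < r0 -> Cmod (hess_hol n (hess z) j l) <= M1.
Proof.
move=> hz; apply: Rle_trans (Cmod_le_ReIm _) _; rewrite /Re /Im /=.
have b d d' := proj1 (Rabs_le_between _ _) (reg_b2 _ _ _ _ _ _ reg z d d' hz).
have := b (j, false) (l, false); have := b (j, true) (l, true); have := b (j, false) (l, true); have := b (j, true) (l, false).
rewrite /hess; set c1 := pd _ _ _; set c2 := pd _ _ _; set c3 := pd _ _ _; set c4 := pd _ _ _.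
by rewrite /Rabs; do 2 case: Rcase_abs => ?; lra.
Qed.

Lemma hess_levi_holder z j l D : vdist z p < r0 -> vdist z p <= D -> 0 < D <= 1 ->
  Cmod (Cminus (hess_levi n (hess z) j l) (hess_levi n (hess p) j l)) <= M1 * Rpower D e.
Proof.
move=> hz hD hD1; apply: Rle_trans (Cmod_le_ReIm _) _; rewrite !CE /Re /Im /=.
have b d d' := reg_holder _ _ _ _ _ _ reg z p D d d' hz p_in_ball hD hD1.
have -> : (hess z (j, false) (l, false) + hess z (j, true) (l, true)) / 4 - (hess p (j, false) (l, false) + hess p (j, true) (l, true)) / 4 =
  ((hess z (j, false) (l, false) - hess p (j, false) (l, false)) + (hess z (j, true) (l, true) - hess p (j, true) (l, true))) / 4 by field.
have -> : (hess z (j, false) (l, true) - hess z (j, true) (l, false)) / 4 - (hess p (j, false) (l, true) - hess p (j, true) (l, false)) / 4 =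
  ((hess z (j, false) (l, true) - hess p (j, false) (l, true)) - (hess z (j, true) (l, false) - hess p (j, true) (l, false))) / 4 by field.
by apply: quarter_bound; exact: b.
Qed.

(** [K |l|^2 + K Re (l^2) = 2 K (Re l)^2]: together with [hol_completed] the Taylor polynomial
    changes by this square only, whereas a change of the Levi form alone would alter it by
    [K |l|^2], which does not vanish for imaginary [l]. *)
Definition levi_completed K z : 'I_n -> 'I_n -> C :=
  fun j l => Cplus (hess_levi n (hess z) j l) (Cmult (RtoC K) (Cmult (grad_c z j) (Cconj (grad_c z l)))).
Definition hol_completed K z : 'I_n -> 'I_n -> C :=
  fun j l => Cplus (hess_hol n (hess z) j l) (Cmult (RtoC K) (Cmult (grad_c z j) (grad_c z l))).

Lemma bil_plus_rank1 (S : 'I_n -> 'I_n -> C) (a b : 'I_n -> C) K u v :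
  bil (fun j l => Cplus (S j l) (Cmult (RtoC K) (Cmult (a j) (b l)))) u v =
  Cplus (bil S u v) (Cmult (RtoC K) (Cmult (lin a u) (lin b v))).
Proof.
have -> : Cmult (RtoC K) (Cmult (lin a u) (lin b v)) = bil (fun j l => Cmult (RtoC K) (Cmult (a j) (b l))) u v.
  rewrite (Cmult_comm (lin a u)) Cmult_assoc /bil -csumZ; apply: csum_ext => j.
  have -> : lin (fun l => Cmult (RtoC K) (Cmult (a j) (b l))) v = Cmult (Cmult (RtoC K) (a j)) (lin b v).
    by rewrite /lin -csumZ; apply: csum_ext => l; ring.
  ring.
rewrite /bil -csumD; apply: csum_ext => j.
have -> : lin (fun l => Cplus (S j l) (Cmult (RtoC K) (Cmult (a j) (b l)))) v =
   Cplus (lin (S j) v) (lin (fun l => Cmult (RtoC K) (Cmult (a j) (b l))) v).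
  by rewrite /lin -csumD; apply: csum_ext => l; ring.
ring.
Qed.

Lemma lin_conj (a : 'I_n -> C) v : lin (fun l => Cconj (a l)) (vconj v) = Cconj (lin a v).
Proof. by rewrite /lin Cconj_csum; apply: csum_ext => l; rewrite Cconj_mult. Qed.

Lemma bil_levi_completed K z u v : bil (levi_completed K z) u (vconj v) =
  Cplus (bil (hess_levi n (hess z)) u (vconj v)) (Cmult (RtoC K) (Cmult (lin (grad_c z) u) (Cconj (lin (grad_c z) v)))).
Proof. by rewrite -lin_conj; exact: (bil_plus_rank1 _ (grad_c z) (fun l => Cconj (grad_c z l))). Qed.

Lemma bil_hol_completed K z u v : bil (hol_completed K z) u v =
  Cplus (bil (hess_hol n (hess z)) u v) (Cmult (RtoC K) (Cmult (lin (grad_c z) u) (lin (grad_c z) v))).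
Proof. exact: bil_plus_rank1. Qed.

Lemma Re_levi_completed K z X : Re (bil (levi_completed K z) X (vconj X)) =
  levi rho z X + K * (Cmod (lin (grad_c z) X) * Cmod (lin (grad_c z) X)).
Proof.
by rewrite bil_levi_completed Cmod_Cmult_conj levi_hess Re_plus Re_mult !Re_RtoC !Im_RtoC; ring.
Qed.

Lemma levi_completed_herm K z u v : vdist z p < r0 ->
  bil (levi_completed K z) v (vconj u) = Cconj (bil (levi_completed K z) u (vconj v)).
Proof.
move=> hz; rewrite !bil_levi_completed.
have e1 : bil (hess_levi n (hess z)) v (vconj u) = Cconj (bil (hess_levi n (hess z)) u (vconj v)).
  rewrite !bilE Cconj_csum csum_exchange; apply: csum_ext => l; rewrite Cconj_csum; apply: csum_ext => j.
  have -> : hess_levi n (hess z) j l = Cconj (hess_levi n (hess z) l j).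
    have sy d d' : hess z d d' = hess z d' d by exact: (reg_sym _ _ _ _ _ _ reg).
    rewrite /hess_levi (sy (j, false)) (sy (j, true)) (sy (j, false) (l, true)) (sy (j, true) (l, false)).
    by apply: C_eq; rewrite !CE /Re /Im /=; field.
  by rewrite /vconj !Cconj_mult !Cconj_invol; ring.
rewrite e1 Cconj_plus !Cconj_mult Cconj_invol; congr Cplus.
have -> : Cconj (RtoC K) = RtoC K by apply: C_eq; rewrite !CE; ring.
ring.
Qed.

Hypothesis grad_neq0 : exists d, pd rho d p <> 0.
Hypothesis levi_pos : forall X, (exists j, X j <> RtoC 0) -> dpair rho p X = RtoC 0 -> 0 < levi rho p X.

(** Positivity at [p] persists nearby: the Levi form varies by [O(|z - p|^e)], and replacing the
    gradient at [p] by that at [z] costs a factor 2 in [K], since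
    [|l_p|^2 <= 2 |l_z|^2 + 2 |l_p - l_z|^2]. *)
Lemma levi_completed_coercive : exists K c r, 0 < K /\ 0 < c /\ 0 < r <= r0 / 3 /\ forall z, vdist z p < r ->
  c <= vnorm (grad_c z) /\ forall X, c * (vnorm X * vnorm X) <= Re (bil (levi_completed K z) X (vconj X)).
Proof.
have [K0 [c0 [hK0 [hc0 h0]]]] : exists K c, 0 < K /\ 0 < c /\ forall X,
    c * (vnorm X * vnorm X) <= levi rho p X + K * (Cmod (lin (grad_c p) X) * Cmod (lin (grad_c p) X)).
  have [|K [c [hK [hc h]]]] := positive_definite_completion n (grad_c p) (hess_levi n (hess p)).
    move=> X hX hl; rewrite -levi_hess; apply: levi_pos => //.
    by apply: NNPP => hno; apply: hX; apply: vext => j; apply: NNPP => hj; apply: hno; exists j.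
  by exists K, c; split=> //; split=> // X; rewrite levi_hess.
have gp : 0 < vnorm (grad_c p).
  case: (vnorm_ge0 _ (grad_c p)) => // e0; exfalso; have [[j b] hd] := grad_neq0.
  have := vnorm_eq0 _ _ (esym e0); move/(congr1 (fun f => f j)); rewrite /grad_c /dz /vzero => -[h1 h2].
  by apply: hd; case: b; lra.
pose g0 := vnorm (grad_c p).
have n0 := pos_INR n.
pose L1 := INR n * (N * M1); have L10 : 0 <= L1 by repeat apply: Rmult_le_pos.
pose H1 := INR n * (INR n * M1); have H10 : 0 <= H1 by repeat apply: Rmult_le_pos.
have [x0 [hx0 hsm]] := Rpower_small e (c0 / 4 / (H1 + 1)) ltac:(lra) ltac:(apply: Rdiv_lt_0_compat; lra).
pose q := c0 / 8 / (K0 * (L1 * L1) + 1).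
have KL : 0 <= K0 * (L1 * L1) by apply: Rmult_le_pos; [lra | nra].
have q0 : 0 < q by apply: Rdiv_lt_0_compat; lra.
pose r := Rmin (Rmin (r0 / 3) (Rmin x0 1)) (Rmin (Rmin 1 q) (g0 / 2 / (L1 + 1))).
have hr : 0 < r by repeat apply: Rmin_pos; try lra; apply: Rdiv_lt_0_compat; rewrite /g0; lra.
have rl : r <= r0 / 3 /\ r <= x0 /\ r <= 1 /\ r <= q /\ r <= g0 / 2 / (L1 + 1).
  have := Rmin_l (Rmin (r0 / 3) (Rmin x0 1)) (Rmin (Rmin 1 q) (g0 / 2 / (L1 + 1))).
  have := Rmin_r (Rmin (r0 / 3) (Rmin x0 1)) (Rmin (Rmin 1 q) (g0 / 2 / (L1 + 1))).
  have := Rmin_l (r0 / 3) (Rmin x0 1); have := Rmin_r (r0 / 3) (Rmin x0 1).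
  have := Rmin_l x0 1; have := Rmin_r x0 1; have := Rmin_l (Rmin 1 q) (g0 / 2 / (L1 + 1)).
  have := Rmin_r (Rmin 1 q) (g0 / 2 / (L1 + 1)); have := Rmin_r 1 q; rewrite -/r; lra.
exists (2 * K0), (Rmin (c0 / 2) (g0 / 2)), r; split; first lra.
split; first by apply: Rmin_pos; rewrite ?/g0; lra.
split; first lra.
move=> z hz; have hz0 : vdist z p < r0 by lra.
have dz0 := vdist_ge0 _ z p.
have gd X : Cmod (Cminus (lin (grad_c z) X) (lin (grad_c p) X)) <= L1 * vdist z p * vnorm X.
  have -> : Cminus (lin (grad_c z) X) (lin (grad_c p) X) = lin (fun j => Cminus (grad_c z j) (grad_c p j)) X.
    have -> : Cminus (lin (grad_c z) X) (lin (grad_c p) X) = Cplus (lin (grad_c z) X) (Cmult (RtoC (-1)) (lin (grad_c p) X)).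
      by apply: C_eq; rewrite !CE; ring.
    by rewrite /lin -csumZ -csumD; apply: csum_ext => j; apply: C_eq; rewrite !CE; ring.
  have h j := grad_c_lipschitz z j ltac:(lra).
  by have := lin_bound _ _ _ X h; rewrite /L1; lra.
split.
  have h j : Cmod (vsub (grad_c p) (grad_c z) j) <= N * M1 * vdist z p.
    by rewrite /vsub Cmod_minus_sym; apply: grad_c_lipschitz; lra.
  have h1 := vnorm_le_const _ _ _ h; have h2 := vnorm_sub_ge _ (grad_c p) (grad_c z).
  have h3 : L1 * vdist z p <= g0 / 2.
    have : L1 * vdist z p <= (L1 + 1) * (g0 / 2 / (L1 + 1)) by apply: Rmult_le_compat; lra.
    by have -> : (L1 + 1) * (g0 / 2 / (L1 + 1)) = g0 / 2 by field; lra.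
  apply: Rle_trans (Rmin_r _ _) _; rewrite -/g0 in h2; rewrite /L1 in h3; lra.
move=> X; rewrite Re_levi_completed.
have hL : Rabs (levi rho z X - levi rho p X) <= c0 / 4 * (vnorm X * vnorm X).
  case: dz0 => dz0; last first.
    rewrite (vdist_eq0 _ z p (esym dz0)) Rminus_diag Rabs_R0; have := vnorm_ge0 _ X => v0.
    by apply: Rmult_le_pos; nra.
  rewrite !levi_hess -Re_minus; apply: Rle_trans (Cmod_Re _) _.
  have -> : Cminus (bil (hess_levi n (hess z)) X (vconj X)) (bil (hess_levi n (hess p)) X (vconj X)) =
     bil (fun j l => Cminus (hess_levi n (hess z) j l) (hess_levi n (hess p) j l)) X (vconj X).
    have -> : Cminus (bil (hess_levi n (hess z)) X (vconj X)) (bil (hess_levi n (hess p)) X (vconj X)) =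
       Cplus (bil (hess_levi n (hess z)) X (vconj X)) (Cmult (RtoC (-1)) (bil (hess_levi n (hess p)) X (vconj X))).
      by apply: C_eq; rewrite !CE; ring.
    rewrite !bilE -csumZ -csumD; apply: csum_ext => j; rewrite -csumZ -csumD; apply: csum_ext => l.
    by apply: C_eq; rewrite !CE; ring.
  have h j l := hess_levi_holder z j l (vdist z p) hz0 (Rle_refl _) ltac:(lra).
  have := bil_bound _ _ _ X (vconj X) h; rewrite vnorm_conj.
  have h1 : Rpower (vdist z p) e <= c0 / 4 / (H1 + 1) by apply: hsm; lra.
  have h2 := Rpower_pos (vdist z p) e; have v0 := vnorm_ge0 _ X.
  have h3 : H1 * Rpower (vdist z p) e <= (H1 + 1) * (c0 / 4 / (H1 + 1)) by apply: Rmult_le_compat; lra.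
  have h4 : (H1 + 1) * (c0 / 4 / (H1 + 1)) = c0 / 4 by field; lra.
  have h5 : H1 * Rpower (vdist z p) e * (vnorm X * vnorm X) <= c0 / 4 * (vnorm X * vnorm X).
    by apply: Rmult_le_compat_r; [nra | lra].
  by move=> h6; rewrite /H1 in h5; lra.
have hl := gd X.
have l1 : Cmod (lin (grad_c p) X) <= Cmod (lin (grad_c z) X) + L1 * vdist z p * vnorm X.
  have := Cmod_minus_ge (lin (grad_c p) X) (lin (grad_c z) X); rewrite Cmod_minus_sym; lra.
have h := h0 X; have v0 := vnorm_ge0 _ X.
set P := Cmod (lin (grad_c p) X) in l1 h; set Z := Cmod (lin (grad_c z) X) in l1 *.
set w := L1 * vdist z p * vnorm X in l1.
have P0 : 0 <= P by exact: Cmod_ge_0.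
have Z0 : 0 <= Z by exact: Cmod_ge_0.
have w0 : 0 <= w by rewrite /w; apply: Rmult_le_pos => //; apply: Rmult_le_pos.
have PP : P * P <= 2 * (Z * Z) + 2 * (w * w) by have := Rle_0_sqr (Z - w); rewrite /Rsqr; nra.
have ww : K0 * (w * w) <= c0 / 8 * (vnorm X * vnorm X).
  have -> : K0 * (w * w) = K0 * (L1 * L1) * (vdist z p * vdist z p) * (vnorm X * vnorm X) by rewrite /w; ring.
  apply: Rmult_le_compat_r; first nra.
  have dd : vdist z p * vdist z p <= q by nra.
  have : K0 * (L1 * L1) * (vdist z p * vdist z p) <= (K0 * (L1 * L1) + 1) * q.
    by apply: Rmult_le_compat; try lra; nra.
  by have -> : (K0 * (L1 * L1) + 1) * q = c0 / 8 by rewrite /q; field; lra.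
have KP : K0 * (P * P) <= K0 * (2 * (Z * Z) + 2 * (w * w)) by apply: Rmult_le_compat_l; lra.
move/Rabs_le_between: hL => hL.
have cm : Rmin (c0 / 2) (g0 / 2) * (vnorm X * vnorm X) <= c0 / 2 * (vnorm X * vnorm X).
  by apply: Rmult_le_compat_r; [nra | exact: Rmin_l].
lra.
Qed.

Variable Omega : Cn n -> Prop.
Hypothesis Omega_rho : forall z, vdist z p < r0 -> (Omega z <-> rho z < 0).

Lemma charts_near : exists M c K r B r1, 0 <= M /\ 0 < c /\ 0 <= K /\ 0 < r /\ 0 <= B /\ 0 < r1 <= r0 / 3 /\
  forall z, vdist z p < r1 -> Omega z -> exists ch : chart n M c,
    ch_s ch = - rho z /\ ch_a ch = grad_c z /\
    (forall X, levi_norm ch X = levi rho z X + K * (Cmod (lin (grad_c z) X) * Cmod (lin (grad_c z) X))) /\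
    taylor_domain K r e B ch Omega z.
Proof.
have [K [c [r2 [hK [hc [hr2 hco]]]]]] := levi_completed_coercive.
have n0 := pos_INR n.
pose B1 := M1 + K * (M1 * M1).
have B10 : 0 <= B1 by have : 0 <= K * (M1 * M1); [apply: Rmult_le_pos; nra | rewrite /B1; lra].
pose m := Rmax c (INR n * (INR n * B1)).
have m0 : c <= m := Rmax_l _ _.
pose n2 := INR n * (INR n * B1); have n20 : 0 <= n2 by repeat apply: Rmult_le_pos.
pose n3 := INR n * (INR n * (INR n * M1)); have n30 : 0 <= n3 by repeat apply: Rmult_le_pos.
pose qb := 2 / c * (INR n * (/ 2 * M1)).
have c2 : 0 < 2 / c by apply: Rdiv_lt_0_compat; lra.
have qb0 : 0 <= qb by apply: Rmult_le_pos; [lra | apply: Rmult_le_pos; lra].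
pose n3q := INR n * (INR n * (INR n * qb)); have n3q0 : 0 <= n3q by do 3 (apply: Rmult_le_pos => //).
pose v1 := 16 * (m * m) / (c * c * c); pose v2 := 8 * (m * m) / (c * (c * c)).
have ccc : 0 < c * c * c by apply: Rmult_lt_0_compat => //; nra.
have v10 : 0 <= v1 by apply: Rmult_le_pos; [nra | apply: Rlt_le; apply: Rinv_0_lt_compat].
have v20 : 0 <= v2 by apply: Rmult_le_pos; [nra | apply: Rlt_le; apply: Rinv_0_lt_compat; rewrite -Rmult_assoc].
pose M := INR n * M1 + n2 + n3 + n3q + v1 + v2.
have nM : 0 <= INR n * M1 by apply: Rmult_le_pos.
pose NM := N * M1; have NM0 : 0 <= NM by apply: Rmult_le_pos.
pose r1 := Rmin r2 (/ (NM + 1)).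
have hr1 : 0 < r1 by apply: Rmin_pos; [lra | apply: Rinv_0_lt_compat; lra].
have r1l := Rmin_l r2 (/ (NM + 1)); have r1r := Rmin_r r2 (/ (NM + 1)); rewrite -/r1 in r1l r1r.
exists M, c, K, (r0 / 2), M1, r1; split; first by rewrite /M; lra.
do 4 (split; first lra); split; first lra.
move=> z hz hO; have hz0 : vdist z p < r0 by lra.
have rz := proj1 (Omega_rho z hz0) hO.
have s1 : - rho z <= 1.
  have hp : vdist p p < r0 / 3 by rewrite vdist_self; lra.
  have h1 := rho_lipschitz z p ltac:(lra) hp; rewrite rho_p Rminus_0_r -/NM in h1.
  have d0 := vdist_ge0 _ z p.
  have : NM * vdist z p <= (NM + 1) * / (NM + 1) by apply: Rmult_le_compat; lra.
  by rewrite Rinv_r; [have := Rle_abs (- rho z); rewrite Rabs_Ropp; lra | lra].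
pose s := - rho z; have hs : 0 < s <= 1 by rewrite /s; lra.
have [A [T [hA [hT htay]]]] := reg_taylor _ _ _ _ _ _ reg z hz0.
have [hg hcoer] := hco z ltac:(lra).
have gb j := grad_c_bound z j hz0.
have gg j l : Cmod (Cmult (RtoC K) (Cmult (grad_c z j) (grad_c z l))) <= K * (M1 * M1).
  rewrite !Cmod_mult Cmod_R Rabs_pos_eq; last lra.
  by apply: Rmult_le_compat_l; [lra | apply: Rmult_le_compat => //; exact: Cmod_ge_0].
have Lb j l : Cmod (levi_completed K z j l) <= B1.
  apply: Rle_trans (Cmod_triangle _ _) _; have := hess_levi_bound z j l hz0.
  have : Cmod (Cmult (RtoC K) (Cmult (grad_c z j) (Cconj (grad_c z l)))) <= K * (M1 * M1).
    by have := gg j l; rewrite !Cmod_mult Cmod_conj.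
  by rewrite /B1; lra.
have Sb j l : Cmod (hol_completed K z j l) <= B1.
  by apply: Rle_trans (Cmod_triangle _ _) _; have := hess_hol_bound z j l hz0; have := gg j l; rewrite /B1; lra.
(* Turns the residual of [quad_solve], at most [eta n3], into the bound [s] demanded by
   [ch_solve]. *)
pose eta := Rmin 1 (s / (n3 + 1)).
have heta : 0 < eta <= 1 by split; [apply: Rmin_pos; [lra | apply: Rdiv_lt_0_compat; lra] | exact: Rmin_l].
have hT2 j l k : Cmod (Cmult (RtoC (/ 2)) (T j l k)) <= / 2 * M1.
  by rewrite Cmod_mult Cmod_R Rabs_pos_eq; [apply: Rmult_le_compat_l => //; lra | lra].
have [Q [hQb hQ]] := quad_solve n _ c B1 hc Lb hcoer _ (/ 2 * M1) eta heta hT2.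
have [nu [kappa [hnu1 [hnub [hkap hnu2]]]]] := normal_solve n _ c B1 hc Lb hcoer (grad_c z) c hc hg s (proj1 hs).
rewrite -/m in hnub hkap.
have a_le u : Cmod (lin (grad_c z) u) <= M * vnorm u.
  apply: Rle_trans (lin_bound _ _ _ u gb) _; apply: Rmult_le_compat_r; [exact: vnorm_ge0 | rewrite /M; lra].
have vv u v : 0 <= vnorm u * vnorm v by have := vnorm_ge0 _ u; have := vnorm_ge0 _ v; nra.
have S_le u v : Cmod (bil (hol_completed K z) u v) <= M * vnorm u * vnorm v.
  apply: Rle_trans (bil_bound _ _ _ u v Sb) _.
  have -> : INR n * (INR n * B1) * vnorm u * vnorm v = n2 * (vnorm u * vnorm v) by rewrite /n2; ring.
  by rewrite Rmult_assoc; apply: Rmult_le_compat_r => //; rewrite /M; lra.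
have L_le u v : Cmod (bil (levi_completed K z) u v) <= M * vnorm u * vnorm v.
  apply: Rle_trans (bil_bound _ _ _ u v Lb) _.
  have -> : INR n * (INR n * B1) * vnorm u * vnorm v = n2 * (vnorm u * vnorm v) by rewrite /n2; ring.
  by rewrite Rmult_assoc; apply: Rmult_le_compat_r => //; rewrite /M; lra.
have t_le (F : 'I_n -> 'I_n -> 'I_n -> C) u v w : (forall j l k, Cmod (F j l k) <= M1) ->
    Cmod (tri F u v w) <= M * vnorm u * vnorm v * vnorm w.
  move=> hF; apply: Rle_trans (tri_bound _ _ _ u v w hF) _.
  by rewrite -/n3; do 3 (apply: Rmult_le_compat_r; first exact: vnorm_ge0); rewrite /M; lra.
have Q_le u v : vnorm (quad Q u v) <= M * vnorm u * vnorm v.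
  apply: Rle_trans (quad_bound _ Q qb u v hQb) _; rewrite -/n3q.
  by do 2 (apply: Rmult_le_compat_r; first exact: vnorm_ge0); rewrite /M; lra.
have nu_le : vnorm nu <= M by apply: Rle_trans hnub _; rewrite -/v1 /M; lra.
have kap_le : Cmod kappa <= M by apply: Rle_trans hkap _; rewrite -/v2 /M; lra.
have solve u w : Cmod (Cminus (bil (levi_completed K z) (quad Q u u) w) (Cmult (RtoC (/ 2)) (tri T u u w))) <=
    s * vnorm u * vnorm u * vnorm w.
  have -> : Cmult (RtoC (/ 2)) (tri T u u w) = tri (fun j l k => Cmult (RtoC (/ 2)) (T j l k)) u u w.
    rewrite !triE -csumZ; apply: csum_ext => j; rewrite -csumZ; apply: csum_ext => l.
    by rewrite -csumZ; apply: csum_ext => k; ring.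
  apply: Rle_trans (hQ u w) _; do 3 (apply: Rmult_le_compat_r; first exact: vnorm_ge0).
  have -> : INR n * (INR n * (eta * (INR n * (/ 2 * M1)))) = / 2 * (eta * n3) by rewrite /n3; ring.
  have h1 : eta * n3 <= s / (n3 + 1) * (n3 + 1).
    by apply: Rmult_le_compat; try lra; exact: Rmin_r.
  have h2 : s / (n3 + 1) * (n3 + 1) = s by field; lra.
  have : 0 <= eta * n3 by nra.
  lra.
exists (Chart n M c s (grad_c z) (hol_completed K z) (levi_completed K z) A T Q nu kappa hs
  a_le S_le L_le (fun u v w => t_le A u v w hA) (fun u v w => t_le T u v w hT) Q_le nu_le kap_le
  (fun u v => levi_completed_herm K z u v hz0) hcoer solve hnu1 hnu2).
split=> //; split=> //; split; first by move=> X; exact: Re_levi_completed.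
exists (fun h => rho (vadd z h)) => h hh.
have hin : vdist (vadd z h) p < r0.
  by have := vdist_triangle _ (vadd z h) z p; rewrite vdist_add; lra.
split; first exact: Omega_rho.
rewrite /=; have ht := htay h s (proj1 hs) ltac:(lra) hin.
apply: Rle_trans _ ht; apply: Req_le; congr (Rabs (_ - _)).
rewrite /hol_normal /levi_norm /mixed_cubic /=.
have eD2 : D2 rho h z / 2 = Re (bil (hess_hol n (hess z)) h h) + Re (bil (hess_levi n (hess z)) h (vconj h)).
  by rewrite -hess_split D2E.
rewrite D1_grad eD2 bil_hol_completed bil_levi_completed Cmod_Cmult_conj.
move: (lin (grad_c z) h) (bil (hess_hol n (hess z)) h h) (tri A h h h) (tri T h h (vconj h)) => [l1 l2] [b1 b2] [a1 a2] [t1 t2].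
move: (bil (hess_levi n (hess z)) h (vconj h)) => [d1 d2].
rewrite !Re_plus !Re_mult !Re_RtoC !Im_RtoC Cmod_sq /Re /Im /= /s; ring.
Qed.
End Charts.
(** * The distance to the boundary *)

(* [Derive] is a total function defined by upper and lower limits, so that it is controlled by the
   difference quotients even when differentiability is unknown. *)
Lemma Derive_bounded_quotient (f : R -> R) x a eta t0 : 0 < t0 ->
  (forall t, 0 < Rabs t < t0 -> Rabs ((f (x + t) - f x) / t - a) <= eta) ->
  Rabs (Derive f x - a) <= eta.
Proof.
move=> ht0 h.
(* [Lim] at 0 is the [Lim_seq] along [Rbar_loc_seq 0], whose terms are [/ (k + 1)]; so only these
   difference quotients matter. *)
pose u k := (f (x + Rbar_loc_seq 0 k) - f x) / Rbar_loc_seq 0 k.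
have hu (k : nat) : Rbar_loc_seq (Rbar.Finite 0) k = (0 + / (INR k + 1))%R by [].
have [K [hK hK']] := archimed_cor1 t0 ht0.
have ev : Hierarchy.eventually (fun k => a - eta <= u k <= a + eta).
  exists K => k hk.
  have k0 := pos_INR k; have i0 : 0 < / (INR k + 1) by apply: Rinv_0_lt_compat; lra.
  have i1 : / (INR k + 1) < t0.
    apply: Rle_lt_trans _ hK; apply: Rinv_le_contravar; first exact: lt_0_INR.
    by have := le_INR _ _ hk; lra.
  have := h (0 + / (INR k + 1)); rewrite Rplus_0_l Rabs_pos_eq; last lra.
  move=> /(_ (conj i0 i1)) /Rabs_le_between.
  by rewrite /u hu Rplus_0_l; lra.
have l1 := Lim_seq_le_loc (fun _ => a - eta) u (filter_imp _ _ (fun k => @proj1 _ _) ev); have l2 := Lim_seq_le_loc u (fun _ => a + eta) (filter_imp _ _ (fun k => @proj2 _ _) ev).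
have ef : Filter Hierarchy.eventually by apply: filter_filter; exact: eventually_filter.
have {}l1 := l1 ef; have {}l2 := l2 ef; rewrite !Lim_seq_const in l1 l2.
rewrite /Derive /Lim -/u. case: (Lim_seq u) l1 l2 => [l||] //= l1 l2.
by apply: Rabs_le; lra.
Qed.

(** * Nearest boundary points *)

Section NearestPoint.
Variable n : nat.
Variable Omega : Cn n -> Prop.
Hypothesis Omega_open : is_open Omega.
Implicit Types (z w p q h : Cn n).

Lemma boundary_closed (u : nat -> Cn n) q : (forall k, boundary Omega (u k)) ->
  (forall e, 0 < e -> exists k, vdist (u k) q < e) -> boundary Omega q.
Proof.
move=> hu hl; split=> [hq|r hr].
  have [r [hr hb]] := Omega_open q hq; have [k hk] := hl r hr.
  exact: (proj1 (hu k)) (hb _ hk).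
have [k hk] := hl (r / 2) ltac:(lra); have [z [hz1 hz2]] := proj2 (hu k) (r / 2) ltac:(lra).
by exists z; split=> //; have := vdist_triangle _ z (u k) q; lra.
Qed.

Lemma dist_bdry_finite z p : boundary Omega p ->
  is_glb_Rbar (fun r => exists w, boundary Omega w /\ r = vdist z w) (Rbar.Finite (dist_bdry Omega z)).
Proof.
move=> hp; rewrite /dist_bdry; set E := fun r => _.
have [h1 h2] := Glb_Rbar_correct E.
have lb0 : is_lb_Rbar E (Rbar.Finite 0) by move=> r [w [_ ->]]; exact: vdist_ge0.
have := h2 _ lb0; have := h1 (vdist z p) (ex_intro _ p (conj hp erefl)).
by case: (Glb_Rbar E) h1 h2 => [l||].
Qed.

Lemma dist_bdry_le z p : boundary Omega p -> dist_bdry Omega z <= vdist z p.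
Proof. by move=> hp; apply: (proj1 (dist_bdry_finite z p hp)); exists p. Qed.

Lemma nearest_boundary_point z p : boundary Omega p ->
  exists q, boundary Omega q /\ dist_bdry Omega z = vdist z q.
Proof.
move=> hp; have [h1 h2] := dist_bdry_finite z p hp; set d := dist_bdry Omega z in h1 h2 *.
have hk (k : nat) : exists w, boundary Omega w /\ vdist z w < d + / (INR k + 1).
  apply: NNPP => hno.
  have k0 : 0 < / (INR k + 1) by apply: Rinv_0_lt_compat; have := pos_INR k; lra.
  have : Rbar_le (Rbar.Finite (d + / (INR k + 1))) (Rbar.Finite d).
    apply: h2 => r [w [hw ->]]; apply: Rnot_lt_le => hlt; apply: hno; by exists w.
  by rewrite /=; lra.
have [u hu] := choice _ hk.
have ub k : vnorm (vsub (u k) z) <= d + 1.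
  have := proj2 (hu k); rewrite vdistC /vdist.
  have : / (INR k + 1) <= 1 by rewrite -Rinv_1; apply: Rinv_le_contravar; have := pos_INR k; lra.
  lra.
have [phi [Y [h3 h4]]] := bounded_subseq_Cn n (fun k => vsub (u k) z) _ ub.
pose q := vadd z Y.
have hq k : vdist (u k) q = vdist (vsub (u k) z) Y.
  by rewrite /vdist /q; congr vnorm; apply: vext => j; rewrite /vsub /vadd; ring.
have conv e : 0 < e -> exists k, vdist (u (phi k)) q < e /\ / (INR (phi k) + 1) < e.
  move=> he; have [N1 hN1] := h4 e he; have [N2 [hN2 hN2']] := archimed_cor1 e he.
  exists (maxn N1 N2); split; first by rewrite hq; apply: hN1; exact: leq_maxl.
  apply: Rle_lt_trans _ hN2; apply: Rinv_le_contravar; first exact: lt_0_INR.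
  by have := le_INR _ _ (leP (leq_trans (leq_maxr N1 N2) (h3 (maxn N1 N2)))); lra.
have bq : boundary Omega q.
  apply: (boundary_closed (fun k => u (phi k))) => [k|e he]; first exact: (proj1 (hu _)).
  by have [k [hk1 _]] := conv e he; exists k.
exists q; split=> //; apply: Rle_antisym; first by apply: h1; exists q.
apply: le_epsilon => e he; have [k [hk1 hk2]] := conv (e / 2) ltac:(lra).
by have := vdist_triangle _ z (u (phi k)) q; have := proj2 (hu (phi k)); lra.
Qed.

Lemma dist_bdry_lipschitz z w p : boundary Omega p -> Rabs (dist_bdry Omega z - dist_bdry Omega w) <= vdist z w.
Proof.
move=> hp.
have h x y : dist_bdry Omega x - dist_bdry Omega y <= vdist x y.
  have [q [hq ->]] := nearest_boundary_point y p hp.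
  by have := dist_bdry_le x q hq; have := vdist_triangle _ x y q; lra.
by have := h z w; have := h w z; rewrite (vdistC _ w z) => h1 h2; apply: Rabs_le; lra.
Qed.

Lemma dist_bdry_gt0 z p : boundary Omega p -> Omega z -> 0 < dist_bdry Omega z.
Proof.
move=> hp hz; have [q [hq ->]] := nearest_boundary_point z p hp.
case: (vdist_ge0 _ z q) => // e; case: (proj1 hq); by rewrite -(vdist_eq0 _ z q (esym e)).
Qed.

(** Otherwise the segment from [z] to [w] has a first exit time [m], and its exit point is a
    boundary point at distance at most [|w - z|] from [z]. *)
Lemma ball_dist_bdry z p w : boundary Omega p -> Omega z -> vdist w z < dist_bdry Omega z -> Omega w.
Proof.
move=> hp hz hw; apply: NNPP => hno.
pose x t := vadd z (vscal (RtoC t) (vsub w z)).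
have x0 : x 0 = z by apply: vext => j; rewrite /x /vadd /vscal /vsub; ring.
have x1 : x 1 = w by apply: vext => j; rewrite /x /vadd /vscal /vsub; ring.
have xd t s : vdist (x t) (x s) = Rabs (t - s) * vdist w z.
  rewrite /vdist -vnorm_scalR; congr vnorm; apply: vext => j.
  by rewrite /x /vadd /vscal /vsub RtoC_minus; ring.
pose T t := 0 <= t <= 1 /\ forall s, 0 <= s <= t -> Omega (x s).
have T0 : T 0 by split; [lra | move=> s hs; have -> : s = 0 by [lra]; rewrite x0].
have Tb : bound T by exists 1 => t [[_ ht] _].
have [m [hm1 hm2]] := completeness T Tb (ex_intro _ 0 T0).
have m0 : 0 <= m by exact: hm1.
have m1 : m <= 1 by apply: hm2 => t [[_ ht] _].
have below s : 0 <= s < m -> Omega (x s).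
  move=> [hs0 hs]; apply: NNPP => hns; have : m <= s; last lra.
  by apply: hm2 => t [_ ht]; apply: Rnot_lt_le => hlt; apply: hns; apply: ht; lra.
have w0 := vdist_ge0 _ w z.
have hxm : ~ Omega (x m).
  move=> hO; case: (Rle_lt_or_eq_dec _ _ m1) => hm; last by apply: hno; rewrite -x1 -hm.
  have [r [hr hb]] := Omega_open _ hO.
  pose tau := Rmin (1 - m) (r / 2 / (vdist w z + 1)).
  have r1 : 0 < r / 2 / (vdist w z + 1) by apply: Rdiv_lt_0_compat; lra.
  have ht : 0 < tau by apply: Rmin_pos; lra.
  have t1 := Rmin_l (1 - m) (r / 2 / (vdist w z + 1)); have t2 := Rmin_r (1 - m) (r / 2 / (vdist w z + 1)).
  rewrite -/tau in t1 t2.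
  have : m + tau <= m; last lra.
  apply: hm1; split; first lra.
  move=> s hs; case: (Rlt_le_dec s m) => hsm; first by apply: below; lra.
  apply: hb; rewrite xd Rabs_pos_eq; last lra.
  have : (s - m) * vdist w z <= r / 2 / (vdist w z + 1) * (vdist w z + 1) by apply: Rmult_le_compat; lra.
  by have -> : r / 2 / (vdist w z + 1) * (vdist w z + 1) = r / 2 by [field; lra]; lra.
have bx : boundary Omega (x m).
  split=> // r hr.
  have hm : 0 < m by case: m0 => // e; case: hxm; rewrite -e x0.
  pose tau := Rmin m (r / 2 / (vdist w z + 1)).
  have r1 : 0 < r / 2 / (vdist w z + 1) by apply: Rdiv_lt_0_compat; lra.
  have ht : 0 < tau by apply: Rmin_pos; lra.
  have t1 := Rmin_l m (r / 2 / (vdist w z + 1)); have t2 := Rmin_r m (r / 2 / (vdist w z + 1)).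
  rewrite -/tau in t1 t2.
  exists (x (m - tau)); split; first by apply: below; lra.
  rewrite xd Rabs_left; last lra.
  have : - (m - tau - m) * vdist w z <= r / 2 / (vdist w z + 1) * (vdist w z + 1) by apply: Rmult_le_compat; lra.
  by have -> : r / 2 / (vdist w z + 1) * (vdist w z + 1) = r / 2 by [field; lra]; lra.
have := dist_bdry_le z (x m) bx; rewrite -{2}x0 xd Rabs_left1; last lra.
have : - (0 - m) * vdist w z <= 1 * vdist w z by apply: Rmult_le_compat_r; lra.
lra.
Qed.
End NearestPoint.

(** * Unit vectors and tangential projections *)

Section UnitVectors.
Variable n : nat.
Implicit Types (u v w h : Cn n).

Definition coE := (co_sub n, co_add n, co_scal n).
Definition unit_of : Cn n -> Cn n := locked (fun u => vscal (RtoC (/ vnorm u)) u).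
Lemma unit_ofE u : unit_of u = vscal (RtoC (/ vnorm u)) u. Proof. by rewrite /unit_of -lock. Qed.
(* Projection onto the orthogonal complement of a unit vector [u], for the real inner product. *)
Definition orth u w : Cn n := vsub w (vscal (RtoC (rdot u w)) u).

Lemma vnorm_unit_of u : 0 < vnorm u -> vnorm (unit_of u) = 1.
Proof.
move=> h; rewrite unit_ofE vnorm_scalR Rabs_pos_eq; first by field; lra.
by apply: Rlt_le; apply: Rinv_0_lt_compat.
Qed.

Lemma unit_of_scale u : 0 < vnorm u -> u = vscal (RtoC (vnorm u)) (unit_of u).
Proof. by move=> h; apply: co_eq => d; rewrite !unit_ofE !coE; field; lra. Qed.

Lemma unit_of_lipschitz u v : 0 < vnorm u -> 0 < vnorm v ->
  vdist (unit_of v) (unit_of u) <= 2 * vdist v u / vnorm u.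
Proof.
move=> hu hv.
have e : vsub (unit_of v) (unit_of u) =
   vscal (RtoC (/ vnorm u)) (vadd (vsub v u) (vscal (RtoC (vnorm u - vnorm v)) (unit_of v))).
  by apply: co_eq => d; rewrite !unit_ofE !coE; field; lra.
have iu : 0 < / vnorm u by apply: Rinv_0_lt_compat.
rewrite /vdist e vnorm_scalR Rabs_pos_eq; last lra.
have h := vnorm_triangle _ (vsub v u) (vscal (RtoC (vnorm u - vnorm v)) (unit_of v)).
rewrite vnorm_scalR vnorm_unit_of // Rmult_1_r in h.
have k1 := vnorm_sub_ge _ u v; have k2 := vnorm_sub_ge _ v u; rewrite vnorm_opp in k1.
have k3 : Rabs (vnorm u - vnorm v) <= vnorm (vsub v u) by apply: Rabs_le; lra.
rewrite /Rdiv (Rmult_comm _ (/ _)); apply: Rmult_le_compat_l; lra.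
Qed.

(** The derivative of [u / |u|] is the projection orthogonal to [u] divided by [|u|]. The remainder
    consists of the second-order error of [|v|] and of the radial component [a] times the change of
    direction. *)
Lemma unit_of_expansion u v : 0 < vnorm u -> vdist v u <= vnorm u / 2 ->
  vdist (vsub (unit_of v) (unit_of u)) (vscal (RtoC (/ vnorm u)) (orth (unit_of u) (vsub v u))) <=
  3 * (vdist v u * vdist v u) / (vnorm u * vnorm u).
Proof.
move=> hu; rewrite /vdist; set D := vsub v u => hD.
have D0 := vnorm_ge0 _ D.
have hv0 : vnorm u / 2 <= vnorm v by have := vnorm_sub_ge _ u v; rewrite vnorm_opp -/D; lra.
have hv : 0 < vnorm v by lra.
set a := rdot (unit_of u) D.
have u1 := vnorm_unit_of u hu; have v1 := vnorm_unit_of v hv.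
have ha : Rabs a <= vnorm D by have := rdot_CS _ (unit_of u) D; rewrite u1 Rmult_1_l.
have e : vsub (vsub (unit_of v) (unit_of u)) (vscal (RtoC (/ vnorm u)) (orth (unit_of u) D)) =
   vscal (RtoC (/ vnorm u)) (vsub (vscal (RtoC (vnorm u + a - vnorm v)) (unit_of v))
      (vscal (RtoC a) (vsub (unit_of v) (unit_of u)))).
  by apply: co_eq => d; rewrite /orth -/a !unit_ofE /D !coE; field; lra.
have iu : 0 < / vnorm u by apply: Rinv_0_lt_compat.
rewrite e vnorm_scalR Rabs_pos_eq; last lra.
have h := vnorm_sub_le _ (vscal (RtoC (vnorm u + a - vnorm v)) (unit_of v)) (vscal (RtoC a) (vsub (unit_of v) (unit_of u))).
rewrite (vnorm_scalR _ (vnorm u + a - vnorm v)) (vnorm_scalR _ a) v1 Rmult_1_r in h.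
have l := unit_of_lipschitz u v hu hv; rewrite /vdist -/D in l.
have t1 : Rabs a * vnorm (vsub (unit_of v) (unit_of u)) <= vnorm D * (2 * vnorm D / vnorm u).
  by apply: Rmult_le_compat => //; [exact: Rabs_pos | exact: vnorm_ge0].
have vv : vnorm v * vnorm v = vnorm u * vnorm u + 2 * vnorm u * a + vnorm D * vnorm D.
  have -> : v = vadd u D by rewrite /D vadd_sub.
  rewrite !vnorm_sq rdotDl (rdotDr _ u u D) (rdotDr _ D u D) (rdotC _ D u) /a !unit_ofE rdotZl; field; lra.
move/Rabs_le_between: ha => ha.
have t2 : Rabs (vnorm u + a - vnorm v) <= vnorm D * vnorm D / vnorm u.
  (* [X (|v| + |u| + a) = a^2 - |D|^2] by expanding [|v|^2], and the second factor is at least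
     [|u|]. *)
  set X := vnorm u + a - vnorm v.
  have sp : vnorm u <= vnorm v + vnorm u + a by lra.
  have pr : X * (vnorm v + vnorm u + a) = a * a - vnorm D * vnorm D by rewrite /X; nra.
  have aD : 0 <= a * a <= vnorm D * vnorm D by split; nra.
  apply: (Rmult_le_reg_r (vnorm u)) => //; have -> : vnorm D * vnorm D / vnorm u * vnorm u = vnorm D * vnorm D by field; lra.
  have -> : Rabs X * vnorm u = Rabs (X * vnorm u) by rewrite Rabs_mult (Rabs_pos_eq (vnorm u)) //; lra.
  have : Rabs (X * vnorm u) <= Rabs (X * (vnorm v + vnorm u + a)).
    rewrite !Rabs_mult; apply: Rmult_le_compat_l; first exact: Rabs_pos.
    by rewrite !Rabs_pos_eq; lra.
  by rewrite pr => hX; apply: Rle_trans hX _; apply: Rabs_le; lra.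
have -> : 3 * (vnorm D * vnorm D) / (vnorm u * vnorm u) = / vnorm u * (vnorm D * vnorm D / vnorm u + vnorm D * (2 * vnorm D / vnorm u)).
  by field; lra.
apply: Rmult_le_compat_l; lra.
Qed.

Lemma rdot_orth u v w : rdot (orth u v) w = rdot v (orth u w).
Proof. by rewrite /orth rdotBl rdotBr rdotZl rdotZr (rdotC _ v u); ring. Qed.

Lemma vnorm_orth u w : vnorm u = 1 -> vnorm (orth u w) <= 2 * vnorm w.
Proof.
move=> hu; apply: Rle_trans (vnorm_sub_le _ _ _) _; rewrite vnorm_scalR hu.
by have := rdot_CS _ u w; rewrite hu; lra.
Qed.

Lemma co_rdot_rdir u d : co u d = rdot u (rdir d).
Proof.
rewrite rdot_co (rsum_ext _ _ (fun d' => if d' == d then co u d' else 0)); last first.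
  by move=> d'; rewrite co_rdir; case: ifP => _; ring.
by rewrite /rsum -big_mkcond /= big_pred1_eq.
Qed.
End UnitVectors.

(* A defining function seen through its gradient field [G] and Hessian [H]. *)
Record smooth_hypersurface (n : nat) (e : R) (Omega : Cn n -> Prop) (p : Cn n) (rho : Cn n -> R)
   (G : Cn n -> Cn n) (H : Cn n -> Cn n -> Cn n) (r g K : R) : Prop := {
  sh_e : 0 < e <= 1;
  sh_r : 0 < r <= / 4;
  sh_g : 0 < g <= 1;
  sh_K : 1 <= K;
  sh_bdry : boundary Omega p;
  sh_side : forall w, vdist w p < r -> (Omega w <-> rho w < 0);
  sh_zero : forall w, vdist w p < r -> boundary Omega w -> rho w = 0;
  sh_taylor : forall x y, vdist x p < r -> vdist y p < r ->
    Rabs (rho x - rho y - rdot (vsub x y) (G y)) <= K * (vdist x y * vdist x y);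
  sh_lip : forall x y, vdist x p < r -> vdist y p < r -> vdist (G x) (G y) <= K * vdist x y;
  sh_diff : forall x y D, vdist x p < r -> vdist y p < r -> vdist x y <= D -> 0 < D <= 1 ->
    vdist (vsub (G x) (G y)) (H y (vsub x y)) <= K * D * Rpower D e;
  sh_low : forall w, vdist w p < r -> g <= vnorm (G w);
  sh_up : forall w, vdist w p < r -> vnorm (G w) <= K;
  sh_add : forall w u v, H w (vadd u v) = vadd (H w u) (H w v);
  sh_scal : forall w (t : R) u, H w (vscal (RtoC t) u) = vscal (RtoC t) (H w u);
  sh_bound : forall w u, vdist w p < r -> vnorm (H w u) <= K * vnorm u;
  sh_holder : forall x y D u, vdist x p < r -> vdist y p < r -> vdist x y <= D -> 0 < D <= 1 ->
    vdist (H x u) (H y u) <= K * Rpower D e * vnorm u;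
  sh_sym : forall w u v, vdist w p < r -> rdot (H w u) v = rdot (H w v) u }.

(** * Foot points and the derivatives of the distance *)

Section FootPoint.
Variables (n : nat) (e : R) (Omega : Cn n -> Prop) (p : Cn n) (rho : Cn n -> R).
Variables (G : Cn n -> Cn n) (H : Cn n -> Cn n -> Cn n) (r g K : R).
Hypothesis Omega_open : is_open Omega.
Hypothesis hs : smooth_hypersurface n e Omega p rho G H r g K.
Implicit Types (z w q h u v x y : Cn n).

Let e_range := sh_e _ _ _ _ _ _ _ _ _ _ hs.
Let r_range := sh_r _ _ _ _ _ _ _ _ _ _ hs.
Let g_range := sh_g _ _ _ _ _ _ _ _ _ _ hs.
Let K_ge1 := sh_K _ _ _ _ _ _ _ _ _ _ hs.
Let p_bdry := sh_bdry _ _ _ _ _ _ _ _ _ _ hs.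
Let delta := dist_bdry Omega.
Let nu w := unit_of n (G w).
Let K2 := 2 * K / g.

Definition foot z q := boundary Omega q /\ delta z = vdist z q.

Lemma footE z : exists q, foot z q.
Proof. exact: nearest_boundary_point Omega_open _ _ p_bdry. Qed.

Lemma foot_near z q : foot z q -> vdist q p <= 2 * vdist z p.
Proof.
move=> [_ hd]; have := dist_bdry_le _ Omega z p p_bdry; rewrite -/(delta z) hd.
by have := vdist_triangle _ q z p; rewrite (vdistC _ q z); lra.
Qed.

(** At this distance foot points stay in the ball of radius [r], and [delta K2 <= 1/2] with [K2] a
    Lipschitz constant of the normal; this plays the part of staying below the focal distance. *)
Let r2 := r / 4 * (g / (4 * K)).

Lemma r2_range : 0 < r2 <= r / 4 /\ r2 * K2 <= / 2.
Proof.
have h : 0 < g / (4 * K) <= / 4.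
  split; first by apply: Rdiv_lt_0_compat; lra.
  apply: (Rmult_le_reg_r (4 * K)); first lra.
  by have -> : g / (4 * K) * (4 * K) = g by [field; lra]; lra.
split; first by rewrite /r2; nra.
have -> : r2 * K2 = r / 8 by rewrite /r2 /K2; field; lra.
lra.
Qed.

Lemma K2_ge1 : 1 <= K2.
Proof.
apply: (Rmult_le_reg_r g); first lra.
by have -> : K2 * g = 2 * K by [rewrite /K2; field; lra]; lra.
Qed.

Lemma G_pos w : vdist w p < r -> 0 < vnorm (G w).
Proof. by move=> hw; have := sh_low _ _ _ _ _ _ _ _ _ _ hs w hw; lra. Qed.

Lemma nu_unit w : vdist w p < r -> vnorm (nu w) = 1.
Proof. by move=> hw; apply: vnorm_unit_of; exact: G_pos. Qed.

Lemma nu_lipschitz x y : vdist x p < r -> vdist y p < r -> vdist (nu x) (nu y) <= K2 * vdist x y.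
Proof.
move=> hx hy; have gx := G_pos x hx; have gy := G_pos y hy.
apply: Rle_trans (unit_of_lipschitz _ _ _ gy gx) _.
have h1 := sh_lip _ _ _ _ _ _ _ _ _ _ hs x y hx hy; have h2 := sh_low _ _ _ _ _ _ _ _ _ _ hs y hy.
have h3 : / vnorm (G y) <= / g by apply: Rinv_le_contravar; lra.
have h4 : 0 < / vnorm (G y) by apply: Rinv_0_lt_compat.
have -> : K2 * vdist x y = (2 * (K * vdist x y)) * / g by rewrite /K2; field; lra.
by apply: Rmult_le_compat; try lra; have := vdist_ge0 _ (G x) (G y); lra.
Qed.

Section At.
Variables (z q : Cn n).
Hypothesis z_near : vdist z p < r2.
Hypothesis z_in : Omega z.
Hypothesis z_foot : foot z q.

Lemma foot_in : vdist q p < r.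
Proof. by have := foot_near z q z_foot; have := r2_range; lra. Qed.

Lemma delta_range : 0 < delta z < r2.
Proof.
split; first exact: (dist_bdry_gt0 _ _ Omega_open z p p_bdry z_in).
by have := dist_bdry_le _ Omega z p p_bdry; rewrite -/(delta z); lra.
Qed.

(* The open ball of radius [delta z] about [z] lies in the domain, so the inner normal at the foot point points to [z]. *)
Lemma foot_normal : z = vsub q (vscal (RtoC (delta z)) (nu q)).
Proof.
have [d0 d1] := delta_range; have hr2 := r2_range; have hq := foot_in; have gq := G_pos q hq.
have nq := nu_unit q hq.
pose u := vscal (RtoC (/ delta z)) (vsub z q).
have nzq : vnorm (vsub z q) = delta z by rewrite (proj2 z_foot).
have id : 0 < / delta z by apply: Rinv_0_lt_compat.
have nu1 : vnorm u = 1 by rewrite /u vnorm_scalR nzq Rabs_pos_eq; [field; lra | lra].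
(* A direction leading into the ball about [z] cannot leave [Omega] to first order: otherwise, for
   small [t], the point [q + t h] would lie in the ball, hence in [Omega], although [rho] is
   positive there. *)
have key h : 0 < rdot h (vsub z q) -> rdot h (G q) <= 0.
  move=> hh; apply: Rnot_lt_le => hG.
  set a := rdot h (vsub z q) in hh; set b := rdot h (G q) in hG.
  have h0 := vnorm_ge0 _ h; set m := vnorm h in h0.
  have m1 : 0 < m * m + 1 by nra.
  pose t := Rmin (a / (m * m + 1)) (Rmin (b / 2 / (K * (m * m + 1))) (r / 2 / (m + 1))).
  have t0 : 0 < t by repeat apply: Rmin_pos; apply: Rdiv_lt_0_compat; nra.
  have t1 : t <= a / (m * m + 1) by exact: Rmin_l.
  have t2 : t <= b / 2 / (K * (m * m + 1)) by apply: Rle_trans (Rmin_r _ _) (Rmin_l _ _).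
  have t3 : t <= r / 2 / (m + 1) by apply: Rle_trans (Rmin_r _ _) (Rmin_r _ _).
  have t1' : t * (m * m + 1) <= a.
    have : t * (m * m + 1) <= a / (m * m + 1) * (m * m + 1) by apply: Rmult_le_compat_r; lra.
    by have -> : a / (m * m + 1) * (m * m + 1) = a by field; lra.
  have t2' : t * (K * (m * m + 1)) <= b / 2.
    have : t * (K * (m * m + 1)) <= b / 2 / (K * (m * m + 1)) * (K * (m * m + 1)) by apply: Rmult_le_compat_r; nra.
    by have -> : b / 2 / (K * (m * m + 1)) * (K * (m * m + 1)) = b / 2 by field; lra.
  have t3' : t * (m + 1) <= r / 2.
    have : t * (m + 1) <= r / 2 / (m + 1) * (m + 1) by apply: Rmult_le_compat_r; lra.
    by have -> : r / 2 / (m + 1) * (m + 1) = r / 2 by field; lra.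
  pose x := vadd q (vscal (RtoC t) h).
  have xq : vdist x q = t * m by rewrite /x vdist_add vnorm_scalR Rabs_pos_eq //; lra.
  have xp : vdist x p < r.
    by have := vdist_triangle _ x q p; have := foot_near z q z_foot; rewrite xq; nra.
  have xz : vdist x z < delta z.
    have xz0 := vdist_ge0 _ x z.
    suff : vdist x z * vdist x z < delta z * delta z by nra.
    have -> : delta z * delta z = rdot (vsub z q) (vsub z q) by rewrite -vnorm_sq nzq.
    rewrite {1 2}/vdist vnorm_sq.
    have -> : vsub x z = vsub (vscal (RtoC t) h) (vsub z q) by apply: co_eq => d; rewrite /x !coE; ring.
    rewrite rdotBl !(rdotBr _ _ (vscal (RtoC t) h)) (rdotC _ (vsub z q) (vscal _ _)) !rdotZl !rdotZr -/a -vnorm_sq -/m.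
    nra.
  have xO := ball_dist_bdry _ _ Omega_open z p x p_bdry z_in xz.
  have rx := proj1 (sh_side _ _ _ _ _ _ _ _ _ _ hs x xp) xO.
  have rq := sh_zero _ _ _ _ _ _ _ _ _ _ hs q hq (proj1 z_foot).
  have := sh_taylor _ _ _ _ _ _ _ _ _ _ hs x q xp hq; rewrite rq xq.
  have -> : vsub x q = vscal (RtoC t) h by apply: co_eq => d; rewrite /x !coE; ring.
  rewrite rdotZl -/b => /Rabs_le_between.
  nra.
(* The products of [u + nu q] with [u] and with [nu q] both equal [1 + rdot u (nu q)], so [key]
   leaves only [u = - nu q]. *)
have hk := key (vadd u (nu q)).
have e1 : vsub z q = vscal (RtoC (delta z)) u by apply: co_eq => d; rewrite /u !coE; field; lra.
have e2 : G q = vscal (RtoC (vnorm (G q))) (nu q) by exact: unit_of_scale.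
have uu : rdot u u = 1 by rewrite -vnorm_sq nu1; ring.
have nn : rdot (nu q) (nu q) = 1 by rewrite -vnorm_sq nq; ring.
have h1 : rdot (vadd u (nu q)) (vsub z q) = delta z * (1 + rdot u (nu q)).
  by rewrite e1 rdotZr rdotDl uu (rdotC _ (nu q) u).
have h2 : rdot (vadd u (nu q)) (G q) = vnorm (G q) * (rdot u (nu q) + 1).
  by rewrite {1}e2 rdotZr rdotDl nn.
rewrite h1 h2 in hk.
have s1 : rdot u (nu q) <= -1.
  apply: Rnot_lt_le => hlt; have := hk ltac:(nra); nra.
have s2 : vnorm (vadd u (nu q)) = 0.
  have w0 := vnorm_ge0 _ (vadd u (nu q)).
  have := vnorm_sq _ (vadd u (nu q)); rewrite rdotDl (rdotDr _ u) (rdotDr _ (nu q)) uu nn (rdotC _ (nu q) u); nra.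
have s3 := vnorm_eq0 _ _ s2.
have s4 d : / delta z * (co z d - co q d) + co (nu q) d = 0.
  have := f_equal (fun w => co w d) s3; rewrite /u co_add co_scal co_sub => ->.
  by rewrite /co /vzero; case: d.2.
apply: co_eq => d; rewrite co_sub co_scal.
have : delta z * (/ delta z * (co z d - co q d) + co (nu q) d) = 0 by rewrite s4; ring.
by rewrite Rmult_plus_distr_l -Rmult_assoc Rinv_r; lra.
Qed.
End At.

Section Pair.
Variables (z q z' q' : Cn n).
Hypothesis z_near : vdist z p < r2.
Hypothesis z_in : Omega z.
Hypothesis z_foot : foot z q.
Hypothesis z_near' : vdist z' p < r2.
Hypothesis z_in' : Omega z'.
Hypothesis z_foot' : foot z' q'.
Let v := vsub z' z.
Let m := vdist z' z.

Let q_in : vdist q p < r := foot_in z q z_near z_foot.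
Let q_in' : vdist q' p < r := foot_in z' q' z_near' z_foot'.
Let m0 : 0 <= m := vdist_ge0 _ z' z.

Lemma delta_lipschitz : Rabs (delta z' - delta z) <= m.
Proof. exact: dist_bdry_lipschitz Omega_open _ _ _ p_bdry. Qed.

Let cz d : co z d = co q d - delta z * co (nu q) d.
Proof. by rewrite {1}(foot_normal z q z_near z_in z_foot) co_sub co_scal. Qed.
Let cz' d : co z' d = co q' d - delta z' * co (nu q') d.
Proof. by rewrite {1}(foot_normal z' q' z_near' z_in' z_foot') co_sub co_scal. Qed.

(** [q' - q] is [v] plus [(delta z' - delta z) nu'] plus [delta z (nu' - nu)]. The last term is at
    most [|q' - q| / 2] by the choice of [r2] and is absorbed on the left. *)
Lemma foot_lipschitz : vdist q' q <= 4 * m.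
Proof.
have e1 : vsub q' q = vadd v (vadd (vscal (RtoC (delta z' - delta z)) (nu q')) (vscal (RtoC (delta z)) (vsub (nu q') (nu q)))).
  by apply: co_eq => d; rewrite /v !(coE n) cz cz'; ring.
have h1 := vnorm_triangle _ v (vadd (vscal (RtoC (delta z' - delta z)) (nu q')) (vscal (RtoC (delta z)) (vsub (nu q') (nu q)))).
have h2 := vnorm_triangle _ (vscal (RtoC (delta z' - delta z)) (nu q')) (vscal (RtoC (delta z)) (vsub (nu q') (nu q))).
rewrite -e1 in h1; rewrite !vnorm_scalR (nu_unit q' q_in') in h2.
have [d0 d1] := delta_range z z_near z_in; rewrite (Rabs_pos_eq (delta z)) in h2; last lra.
have l := nu_lipschitz q' q q_in' q_in; rewrite /vdist in l.
have hd := delta_lipschitz; have [_ hr2] := r2_range; have k := K2_ge1.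
have w0 := vdist_ge0 _ q' q.
have h3 : delta z * vnorm (vsub (nu q') (nu q)) <= / 2 * vdist q' q.
  have : delta z * vnorm (vsub (nu q') (nu q)) <= delta z * (K2 * vdist q' q) by apply: Rmult_le_compat_l; rewrite /vdist; lra.
  have : delta z * K2 * vdist q' q <= / 2 * vdist q' q by apply: Rmult_le_compat_r => //; nra.
  lra.
rewrite -/(vdist q' q) in h1; rewrite /m -/v /vdist -/v in hd *; rewrite /vdist in h1 h3 w0; lra.
Qed.

(** Each squared distance is at most the squared distance to the foot of the other point. The two
    inequalities bound [delta z'] from both sides, and [foot_lipschitz] lets the normal at [q'] be
    replaced by the normal at [q]. *)
Lemma delta_expansion : Rabs (delta z * (delta z' - delta z + rdot (nu q) v)) <= 6 * (m * m).
Proof.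
have [d0 d1] := delta_range z z_near z_in; have [d0' d1'] := delta_range z' z_near' z_in'.
have hd := delta_lipschitz; have hq := foot_lipschitz.
have nn : rdot (nu q) (nu q) = 1 by rewrite -vnorm_sq nu_unit //; ring.
have nn' : rdot (nu q') (nu q') = 1 by rewrite -vnorm_sq nu_unit //; ring.
have mm : rdot v v = m * m by rewrite -vnorm_sq.
have up : delta z' * delta z' <= m * m - 2 * delta z * rdot (nu q) v + delta z * delta z.
  have h1 := dist_bdry_le _ Omega z' q (proj1 z_foot); rewrite -/(delta z') in h1.
  have : delta z' * delta z' <= vdist z' q * vdist z' q by apply: Rmult_le_compat; lra.
  rewrite /vdist vnorm_sq.
  have -> : vsub z' q = vsub v (vscal (RtoC (delta z)) (nu q)) by apply: co_eq => d; rewrite /v !(coE n) cz; ring.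
  rewrite rdotBl (rdotBr _ v) (rdotBr _ (vscal _ _)) !rdotZl !rdotZr (rdotC _ v (nu q)) mm nn; lra.
have lo : delta z * delta z <= m * m + 2 * delta z' * rdot (nu q') v + delta z' * delta z'.
  have h1 := dist_bdry_le _ Omega z q' (proj1 z_foot'); rewrite -/(delta z) in h1.
  have : delta z * delta z <= vdist z q' * vdist z q' by apply: Rmult_le_compat; lra.
  rewrite /vdist vnorm_opp vnorm_sq.
  have -> : vsub q' z = vadd v (vscal (RtoC (delta z')) (nu q')) by apply: co_eq => d; rewrite /v !(coE n) cz'; ring.
  rewrite rdotDl (rdotDr _ v) (rdotDr _ (vscal _ _)) !rdotZl !rdotZr (rdotC _ v (nu q')) mm nn'; lra.
have cr : Rabs (delta z' * rdot (nu q') v - delta z * rdot (nu q) v) <= 5 * (m * m).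
  have -> : delta z' * rdot (nu q') v - delta z * rdot (nu q) v = rdot (vsub (vsub q' q) v) v.
    rewrite -!rdotZl -rdotBl; congr rdot; apply: co_eq => d; rewrite /v !(coE n) cz cz'; ring.
  apply: Rle_trans (rdot_CS _ _ _) _.
  have h2 := vnorm_sub_le _ (vsub q' q) v; rewrite -/(vdist q' q) in h2.
  have h3 : vnorm (vsub (vsub q' q) v) <= 5 * m by rewrite /m in hq *; rewrite /v /vdist in h2 hq *; lra.
  have -> : 5 * (m * m) = 5 * m * m by ring.
  by apply: Rmult_le_compat_r.
have sq : (delta z' - delta z) * (delta z' - delta z) <= m * m.
  by move/Rabs_le_between: hd; nra.
by move/Rabs_le_between: cr => cr; apply: Rabs_le; nra.
Qed.

(** The second error is of first order in [m]: the foot map is described by the tangential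
    projection only up to [O(delta)], and this is the source of the error [O(delta)] in the Hessian
    of the distance. *)
Lemma foot_expansion : vdist (vsub q' q) (orth n (nu q) v) <= 6 * (m * m) / delta z + 4 * K2 * delta z' * m.
Proof.
have [d0 d1] := delta_range z z_near z_in; have [d0' d1'] := delta_range z' z_near' z_in'.
have e1 : vsub (vsub q' q) (orth n (nu q) v) = vadd (vscal (RtoC (delta z' - delta z + rdot (nu q) v)) (nu q))
   (vscal (RtoC (delta z')) (vsub (nu q') (nu q))).
  apply: co_eq => d.
  by rewrite /orth !(coE n) cz cz'; ring.
rewrite {1}/vdist e1; apply: Rle_trans (vnorm_triangle _ _ _) _.
rewrite !vnorm_scalR (nu_unit q q_in) (Rabs_pos_eq (delta z')); last lra.
have h1 := delta_expansion; have hq := foot_lipschitz; have k := K2_ge1.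
have l := nu_lipschitz q' q q_in' q_in; rewrite {1}/vdist in l.
apply: Rplus_le_compat.
  apply: (Rmult_le_reg_l (delta z)) => //.
  have -> : delta z * (6 * (m * m) / delta z) = 6 * (m * m) by field; lra.
  by rewrite Rabs_mult (Rabs_pos_eq (delta z)) in h1; lra.
have -> : 4 * K2 * delta z' * m = delta z' * (K2 * (4 * m)) by ring.
apply: Rmult_le_compat_l; first lra.
apply: Rle_trans l _; apply: Rmult_le_compat_l => //; lra.
Qed.

(** Three expansions are composed: of the unit vector in terms of the gradient, of the gradient in
    terms of the foot point, and of the foot point in terms of [v]. Each term of the bound is the
    error of one of them. *)
Lemma normal_expansion w : 0 < m -> 4 * K * m <= g / 2 -> 4 * m <= 1 ->
  Rabs (rdot (vsub (nu q') (nu q)) w - rdot (H q (orth n (nu q) v)) (orth n (nu q) w) / vnorm (G q)) <=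
  vnorm w * (48 * (K * K) * (m * m) / (g * g) +
     2 / g * (K * (4 * m) * Rpower (4 * m) e + K * (6 * (m * m) / delta z + 4 * K2 * delta z' * m))).
Proof.
move=> mp hm1 hm2.
have gq := G_pos q q_in; have gl := sh_low _ _ _ _ _ _ _ _ _ _ hs q q_in.
have hq := foot_lipschitz; have q0 := vdist_ge0 _ q' q.
set DG := vsub (G q') (G q).
have hDG : vnorm DG <= 4 * K * m.
  have := sh_lip _ _ _ _ _ _ _ _ _ _ hs q' q q_in' q_in; rewrite {1}/vdist -/DG.
  have : K * vdist q' q <= K * (4 * m) by apply: Rmult_le_compat_l; lra.
  lra.
have D0 := vnorm_ge0 _ DG; have w0 := vnorm_ge0 _ w.
have h1 := unit_of_expansion _ _ (G q') gq ltac:(rewrite /vdist -/DG; lra).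
rewrite -/(nu q) -/(nu q') in h1; set R1 := vsub _ _ in h1; rewrite {1}/vdist in h1.
rewrite /vdist -/DG in h1.
have h2 := sh_diff _ _ _ _ _ _ _ _ _ _ hs q' q (4 * m) q_in' q_in hq ltac:(lra).
rewrite -/DG in h2.
pose RH := vsub DG (H q (vsub q' q)); rewrite {1}/vdist -/RH in h2.
pose R3 := vsub (vsub q' q) (orth n (nu q) v).
have h3 := foot_expansion; rewrite /vdist -/R3 in h3.
have eq1 : H q (vsub q' q) = vadd (H q (orth n (nu q) v)) (H q R3).
  rewrite -(sh_add _ _ _ _ _ _ _ _ _ _ hs); congr H; rewrite /R3; move: (orth n (nu q) v) (vsub q' q) => O w'.
  by apply: co_eq => d; rewrite !(coE n); ring.
have h4 := sh_bound _ _ _ _ _ _ _ _ _ _ hs q R3 q_in.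
have eq2 : DG = vadd (H q (orth n (nu q) v)) (vadd (H q R3) RH).
  apply: co_eq => d; have := co_sub n DG (H q (vsub q' q)) d; rewrite -/RH eq1 co_add => E.
  by rewrite co_add (co_add _ (H q R3)); lra.
have eq3 : rdot (vsub (nu q') (nu q)) w - rdot (H q (orth n (nu q) v)) (orth n (nu q) w) / vnorm (G q) =
   rdot (vsub (vsub (nu q') (nu q)) (vscal (RtoC (/ vnorm (G q))) (orth n (nu q) DG))) w +
   rdot (vadd (H q R3) RH) (orth n (nu q) w) / vnorm (G q).
  rewrite (rdotBl _ (vsub (nu q') (nu q))) rdotZl rdot_orth eq2 rdotDl; field; lra.
rewrite eq3; apply: Rle_trans (Rabs_triang _ _) _; rewrite Rmult_plus_distr_l.
have ig : / vnorm (G q) <= / g by apply: Rinv_le_contravar; lra.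
have ig0 : 0 < / vnorm (G q) by apply: Rinv_0_lt_compat.
apply: Rplus_le_compat.
  apply: Rle_trans (rdot_CS _ _ _) _; rewrite Rmult_comm; apply: Rmult_le_compat_l => //.
  apply: Rle_trans h1 _.
  have -> : 3 * (vnorm DG * vnorm DG) / (vnorm (G q) * vnorm (G q)) = 3 * ((vnorm DG * vnorm DG) * (/ vnorm (G q) * / vnorm (G q))) by field; lra.
  have -> : 48 * (K * K) * (m * m) / (g * g) = 3 * ((4 * K * m) * (4 * K * m) * (/ g * / g)) by field; lra.
  apply: Rmult_le_compat_l; first lra.
  by apply: Rmult_le_compat; [nra | nra | apply: Rmult_le_compat | apply: Rmult_le_compat; lra].
rewrite /Rdiv Rabs_mult (Rabs_pos_eq (/ vnorm (G q))); last lra.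
have h5 := rdot_CS _ (vadd (H q R3) RH) (orth n (nu q) w).
have h6 := vnorm_triangle _ (H q R3) RH.
have h7 := vnorm_orth _ (nu q) w (nu_unit q q_in).
have -> : vnorm w * (2 * / g * (K * (4 * m) * Rpower (4 * m) e + K * (6 * (m * m) * / delta z + 4 * K2 * delta z' * m))) =
   (K * (4 * m) * Rpower (4 * m) e + K * (6 * (m * m) * / delta z + 4 * K2 * delta z' * m)) * (2 * vnorm w) * / g by rewrite /Rdiv; ring.
apply: Rmult_le_compat; [exact: Rabs_pos | lra | | exact: ig].
apply: Rle_trans h5 _; apply: Rmult_le_compat => //; try exact: vnorm_ge0.
have : K * vnorm R3 <= K * (6 * (m * m) * / delta z + 4 * K2 * delta z' * m) by apply: Rmult_le_compat_l; [lra | exact: h3].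
lra.
Qed.
End Pair.

Lemma small_move z : vdist z p < r2 -> Omega z -> exists t0, 0 < t0 /\ forall t d, Rabs t < t0 ->
  vdist (vadd z (vscal (RtoC t) (rdir d))) p < r2 /\ Omega (vadd z (vscal (RtoC t) (rdir d))).
Proof.
move=> hz hO; have [r0 [hr0 hb]] := Omega_open z hO.
exists (Rmin r0 (r2 - vdist z p)); split; first by apply: Rmin_pos; lra.
move=> t d ht; have h1 := Rmin_l r0 (r2 - vdist z p); have h2 := Rmin_r r0 (r2 - vdist z p).
have hd : vdist (vadd z (vscal (RtoC t) (rdir d))) z = Rabs t by rewrite vdist_add vnorm_scalR vnorm_rdir; ring.
split; last by apply: hb; lra.
by have := vdist_triangle _ (vadd z (vscal (RtoC t) (rdir d))) z p; lra.
Qed.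

Let moved z t d : vsub (vadd z (vscal (RtoC t) (rdir d))) z = vscal (RtoC t) (rdir d).
Proof. by apply: co_eq => d'; rewrite !(coE n); ring. Qed.
Let moved_dist z t d : vdist (vadd z (vscal (RtoC t) (rdir d))) z = Rabs t.
Proof. by rewrite vdist_add vnorm_scalR vnorm_rdir; ring. Qed.
Let unmoved z d : vadd z (vscal (RtoC 0) (rdir d)) = z.
Proof. by apply: co_eq => d'; rewrite !(coE n); ring. Qed.

(** Dividing [delta_expansion] by [delta z] times [t] leaves the error [6 |t| / delta z], which
    tends to 0; so the first derivatives are exact. *)
Lemma pd_dist_bdry z q d : vdist z p < r2 -> Omega z -> foot z q -> pd delta d z = - co (nu q) d.
Proof.
move=> hz hO hq; have [t0 [ht0 hm]] := small_move z hz hO; have [d0 d1] := delta_range z hz hO.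
suff h : forall eta, 0 < eta -> Rabs (pd delta d z - - co (nu q) d) <= eta.
  have : Rabs (pd delta d z - - co (nu q) d) <= 0 by apply: le_epsilon => eta he; have := h eta he; lra.
  by move=> h0; have h1 := Rabs_pos (pd delta d z - - co (nu q) d); have : pd delta d z - - co (nu q) d = 0 by [apply: Rabs_eq_0; lra]; lra.
move=> eta he.
have he' : 0 < eta * delta z / 6 by apply: Rmult_lt_0_compat; nra.
apply: (Derive_bounded_quotient _ _ _ _ (Rmin t0 (eta * delta z / 6))); first by apply: Rmin_pos.
move=> t [ht1 ht2]; have k1 := Rmin_l t0 (eta * delta z / 6); have k2 := Rmin_r t0 (eta * delta z / 6).
rewrite Rplus_0_l unmoved; set z' := vadd z _.
have [hz' hO'] := hm t d ltac:(lra); rewrite -/z' in hz' hO'.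
have [q' hq'] := footE z'.
have := delta_expansion z q z' q' hz hO hq hz' hO' hq'.
rewrite /z' moved moved_dist rdotZr -co_rdot_rdir -/z' => h.
have tn : t <> 0 by move=> t00; rewrite t00 Rabs_R0 in ht1; lra.
have -> : (delta z' - delta z) / t - - co (nu q) d = delta z * (delta z' - delta z + t * co (nu q) d) * / (delta z * t) by field; lra.
rewrite Rabs_mult Rabs_inv (Rabs_mult (delta z) t) (Rabs_pos_eq (delta z)); last lra.
have i0 : 0 < / (delta z * Rabs t) by apply: Rinv_0_lt_compat; nra.
apply: Rle_trans (Rmult_le_compat_r _ _ _ (Rlt_le _ _ i0) h) _.
have -> : 6 * (Rabs t * Rabs t) * / (delta z * Rabs t) = 6 * Rabs t / delta z by field; lra.
apply: (Rmult_le_reg_r (delta z)) => //; have -> : 6 * Rabs t / delta z * delta z = 6 * Rabs t by field; lra.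
lra.
Qed.

Let C2 := 48 * (K * K) / (g * g) + 2 / g * (K * 4 + K * (6 + 8 * K2)).

(** Difference quotients of the exact gradient [- nu]. Their error does not tend to 0 with the
    increment but stays below [C2 delta z], and this bound passes to [Derive] whether or not the
    limit exists. *)
Lemma pd2_dist_bdry z q d d' : vdist z p < r2 -> Omega z -> foot z q ->
  Rabs (pd (pd delta d') d z + rdot (H q (orth n (nu q) (rdir d))) (orth n (nu q) (rdir d')) / vnorm (G q)) <= C2 * delta z.
Proof.
move=> hz hO hq; have [t0 [ht0 hm]] := small_move z hz hO; have [d0 d1] := delta_range z hz hO.
have [x0 [hx0 hsm]] := Rpower_small e (delta z) ltac:(lra) d0.
have [hr2 hr2'] := r2_range; have k := K2_ge1.
have gK : 0 < g / (8 * K) by apply: Rdiv_lt_0_compat; lra.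
(* [tm <= delta^2] makes [|t| / delta] at most [delta], and [4 tm <= x0] makes [(4 |t|)^e] at most
   [delta]; the other bounds are the side conditions of [small_move] and [normal_expansion]. *)
pose tm := Rmin (Rmin t0 (x0 / 4)) (Rmin (delta z * delta z) (Rmin (g / (8 * K)) (/ 4))).
have htm : 0 < tm by repeat apply: Rmin_pos; nra.
have k1 : tm <= t0 by apply: Rle_trans (Rmin_l _ _) (Rmin_l _ _).
have k2 : tm <= x0 / 4 by apply: Rle_trans (Rmin_l _ _) (Rmin_r _ _).
have k3 : tm <= delta z * delta z by apply: Rle_trans (Rmin_r _ _) (Rmin_l _ _).
have k4 : tm <= g / (8 * K) by apply: Rle_trans (Rmin_r _ _) (Rle_trans _ _ _ (Rmin_r _ _) (Rmin_l _ _)).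
have k5 : tm <= / 4 by apply: Rle_trans (Rmin_r _ _) (Rle_trans _ _ _ (Rmin_r _ _) (Rmin_r _ _)).
set a := rdot _ _ / _.
have -> : pd (pd delta d') d z + a = pd (pd delta d') d z - - a by ring.
apply: (Derive_bounded_quotient _ _ _ _ tm) => // t [ht1 ht2].
rewrite Rplus_0_l unmoved; set z' := vadd z _.
have [hz' hO'] := hm t d ltac:(lra); rewrite -/z' in hz' hO'.
have [q' hq'] := footE z'.
rewrite (pd_dist_bdry z' q' d' hz' hO' hq') (pd_dist_bdry z q d' hz hO hq).
have md : vdist z' z = Rabs t by exact: moved_dist.
have c4 : 4 * K * Rabs t <= g / 2.
  have : 4 * K * Rabs t <= 4 * K * (g / (8 * K)) by apply: Rmult_le_compat_l; lra.
  by have -> : 4 * K * (g / (8 * K)) = g / 2 by field; lra.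
have := normal_expansion z q z' q' hz hO hq hz' hO' hq' (rdir d').
rewrite md => /(_ ht1 c4 ltac:(lra)).
have -> : vsub z' z = vscal (RtoC t) (rdir d) by exact: moved.
have -> : orth n (nu q) (vscal (RtoC t) (rdir d)) = vscal (RtoC t) (orth n (nu q) (rdir d)).
  by apply: co_eq => d2; rewrite /orth !(coE n) rdotZr; ring.
rewrite (sh_scal _ _ _ _ _ _ _ _ _ _ hs) rdotZl -co_rdot_rdir co_sub vnorm_rdir Rmult_1_l => h.
have tn : t <> 0 by move=> t00; rewrite t00 Rabs_R0 in ht1; lra.
have gq := G_pos q (foot_in z q hz hq).
have -> : (- co (nu q') d' - - co (nu q) d') / t - - a =
  - ((co (nu q') d' - co (nu q) d' - t * rdot (H q (orth n (nu q) (rdir d))) (orth n (nu q) (rdir d')) / vnorm (G q)) * / t).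
  by rewrite /a; field; lra.
rewrite Rabs_Ropp Rabs_mult Rabs_inv.
have i0 : 0 < / Rabs t by apply: Rinv_0_lt_compat.
apply: Rle_trans (Rmult_le_compat_r _ _ _ (Rlt_le _ _ i0) h) _.
have -> : (48 * (K * K) * (Rabs t * Rabs t) / (g * g) + 2 / g * (K * (4 * Rabs t) * Rpower (4 * Rabs t) e + K * (6 * (Rabs t * Rabs t) / delta z + 4 * K2 * delta z' * Rabs t))) * / Rabs t =
  48 * (K * K) / (g * g) * Rabs t + 2 / g * (K * 4 * Rpower (4 * Rabs t) e + K * (6 * (Rabs t / delta z) + 4 * K2 * delta z')).
  by field; lra.
have td : Rabs t <= delta z by nra.
have p1 : Rpower (4 * Rabs t) e <= delta z by apply: hsm; lra.
have p2 : Rabs t / delta z <= delta z.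
  apply: (Rmult_le_reg_r (delta z)) => //; have -> : Rabs t / delta z * delta z = Rabs t by field; lra.
  lra.
have p3 : delta z' <= 2 * delta z.
  have := delta_lipschitz z z'; rewrite md => /Rabs_le_between; lra.
have q1 : 0 <= 48 * (K * K) / (g * g) by apply: Rmult_le_pos; [nra | apply: Rlt_le; apply: Rinv_0_lt_compat; nra].
have q2 : 0 <= 2 / g by apply: Rlt_le; apply: Rdiv_lt_0_compat; lra.
have p4 : 4 * K2 * delta z' <= 8 * K2 * delta z by have : 4 * K2 * delta z' <= 4 * K2 * (2 * delta z) by [apply: Rmult_le_compat_l; lra]; lra.
have p5 : K * 4 * Rpower (4 * Rabs t) e <= K * 4 * delta z by apply: Rmult_le_compat_l; lra.
have p6 : K * (6 * (Rabs t / delta z) + 4 * K2 * delta z') <= K * (6 * delta z + 8 * K2 * delta z) by apply: Rmult_le_compat_l; lra.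
have -> : C2 * delta z = 48 * (K * K) / (g * g) * delta z + 2 / g * (K * 4 * delta z + K * (6 * delta z + 8 * K2 * delta z)) by rewrite /C2; ring.
by apply: Rplus_le_compat; apply: Rmult_le_compat_l => //; lra.
Qed.
End FootPoint.

(** * Gradient and Hessian fields of a defining function *)

Section GradientField.
Variable n : nat.
Notation dir := ('I_n * bool)%type.
Variables (e : R) (rho : Cn n -> R) (p : Cn n) (r0 M1 : R).
Hypothesis e_range : 0 < e <= 1.
Hypothesis reg : regular_near n e rho p r0 M1.
Implicit Types (z h u v w x y : Cn n).

Lemma vnorm_co_bound u B : (forall d, Rabs (co u d) <= B) -> vnorm u <= INR n * (2 * B).
Proof.
move=> h; apply: vnorm_le_const => j; apply: Rle_trans (Cmod_le_ReIm _) _.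
by have := h (j, false); have := h (j, true); rewrite /co /=; lra.
Qed.

Definition grad (f : Cn n -> R) z : Cn n := fun j => (pd f (j, false) z, pd f (j, true) z).
Definition hess_vec z u : Cn n := fun j =>
  (rsum (fun d => co u d * hess n rho z d (j, false)), rsum (fun d => co u d * hess n rho z d (j, true))).

Lemma co_grad f z d : co (grad f z) d = pd f d z.
Proof. by case: d => j []. Qed.
Lemma co_hess z u d' : co (hess_vec z u) d' = rsum (fun d => co u d * hess n rho z d d').
Proof. by case: d' => j []. Qed.

Let N := INR #|{: dir}|.
Let N0 : 0 <= N. Proof. exact: pos_INR. Qed.
Let n0 : 0 <= INR n. Proof. exact: pos_INR. Qed.
Let M1_ge0 := reg_M _ _ _ _ _ _ reg.
Let r0_range := reg_r _ _ _ _ _ _ reg.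

Let apart x y : vdist x p < r0 / 9 -> vdist y p < r0 / 9 -> forall u, vdist u y <= vnorm (vsub x y) -> vdist u p < r0 / 3.
Proof.
move=> hx hy u; rewrite -/(vdist x y) => hu.
by have := vdist_triangle _ u y p; have := vdist_triangle _ x p y; rewrite (vdistC _ p y); lra.
Qed.

Lemma grad_taylor x y : vdist x p < r0 / 9 -> vdist y p < r0 / 9 ->
  Rabs (rho x - rho y - rdot (vsub x y) (grad rho y)) <= N * (N * M1) * (vdist x y * vdist x y).
Proof.
move=> hx hy; have hb := apart x y hx hy.
have [|xi [hxi hinc]] := coordinate_increment n rho y (vsub x y).
  by move=> d u hu; apply: (reg_pd _ _ _ _ _ _ reg); have := hb u hu; lra.
rewrite vadd_sub in hinc; rewrite hinc rdot_co -rsumB.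
rewrite (rsum_ext _ _ (fun d => co (vsub x y) d * (pd rho d (xi d) - pd rho d y))); last first.
  by move=> d; rewrite co_grad; ring.
have hd d : Rabs (pd rho d (xi d) - pd rho d y) <= N * M1 * vdist x y.
  apply: Rle_trans (gradient_lipschitz n e rho p r0 M1 reg (xi d) y d (hb _ (hxi d)) ltac:(lra)) _.
  by apply: Rmult_le_compat_l; [apply: Rmult_le_pos | exact: hxi].
apply: Rle_trans (weighted_sum_bound _ _ _ (vdist x y) _ (vdist_ge0 _ x y) (co_le n (vsub x y)) hd) _.
by apply: Req_le; rewrite -/N; ring.
Qed.

Lemma grad_lipschitz x y : vdist x p < r0 / 9 -> vdist y p < r0 / 9 ->
  vdist (grad rho x) (grad rho y) <= INR n * (2 * (N * M1)) * vdist x y.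
Proof.
move=> hx hy; have h d : Rabs (co (vsub (grad rho x) (grad rho y)) d) <= N * M1 * vdist x y.
  by rewrite co_sub !co_grad; apply: (gradient_lipschitz n e rho p r0 M1 reg); lra.
by apply: Rle_trans (vnorm_co_bound _ _ h) _; apply: Req_le; ring.
Qed.

Lemma grad_diff x y D : vdist x p < r0 / 9 -> vdist y p < r0 / 9 -> vdist x y <= D -> 0 < D <= 1 ->
  vdist (vsub (grad rho x) (grad rho y)) (hess_vec y (vsub x y)) <= INR n * (2 * (N * M1)) * D * Rpower D e.
Proof.
move=> hx hy hD hD1; have hb := apart x y hx hy.
have P0 := Rpower_pos D e.
have h d' : Rabs (co (vsub (vsub (grad rho x) (grad rho y)) (hess_vec y (vsub x y))) d') <= N * (D * (M1 * Rpower D e)).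
  rewrite co_sub (co_sub _ (grad rho x)) !co_grad co_hess.
  have [|xi [hxi hinc]] := coordinate_increment n (pd rho d') y (vsub x y).
    by move=> d u hu; apply: (reg_pd2 _ _ _ _ _ _ reg); have := hb u hu; lra.
  rewrite vadd_sub in hinc; rewrite hinc -rsumB.
  rewrite (rsum_ext _ _ (fun d => co (vsub x y) d * (pd (pd rho d') d (xi d) - pd (pd rho d') d y))); last first.
    by move=> d; rewrite /hess; ring.
  apply: (weighted_sum_bound _ _ _ D); first lra.
    by move=> d; apply: Rle_trans (co_le n _ d) hD.
  move=> d; apply: (reg_holder _ _ _ _ _ _ reg) => //; try lra.
    by have := hb _ (hxi d); lra.
  exact: Rle_trans (hxi d) hD.
by apply: Rle_trans (vnorm_co_bound _ _ h) _; apply: Req_le; ring.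
Qed.

Lemma grad_bound w : vdist w p < r0 / 9 -> vnorm (grad rho w) <= INR n * (2 * M1).
Proof.
move=> hw; apply: vnorm_co_bound => d; rewrite co_grad; apply: (reg_b1 _ _ _ _ _ _ reg); lra.
Qed.

Lemma hess_vecD w u v : hess_vec w (vadd u v) = vadd (hess_vec w u) (hess_vec w v).
Proof.
by apply: co_eq => d'; rewrite co_add !co_hess -rsumD; apply: rsum_ext => d; rewrite co_add; ring.
Qed.

Lemma hess_vecZ w (t : R) u : hess_vec w (vscal (RtoC t) u) = vscal (RtoC t) (hess_vec w u).
Proof.
by apply: co_eq => d'; rewrite co_scal !co_hess -rsumZ; apply: rsum_ext => d; rewrite co_scal; ring.
Qed.

Lemma hess_vec_bound w u : vdist w p < r0 / 9 -> vnorm (hess_vec w u) <= INR n * (2 * (N * M1)) * vnorm u.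
Proof.
move=> hw; have h d' : Rabs (co (hess_vec w u) d') <= N * (vnorm u * M1).
  rewrite co_hess; apply: weighted_sum_bound; [exact: vnorm_ge0 | exact: co_le |].
  by move=> d; apply: (reg_b2 _ _ _ _ _ _ reg); lra.
by apply: Rle_trans (vnorm_co_bound _ _ h) _; apply: Req_le; ring.
Qed.

Lemma hess_vec_holder x y D u : vdist x p < r0 / 9 -> vdist y p < r0 / 9 -> vdist x y <= D -> 0 < D <= 1 ->
  vdist (hess_vec x u) (hess_vec y u) <= INR n * (2 * (N * M1)) * Rpower D e * vnorm u.
Proof.
move=> hx hy hD hD1; have h d' : Rabs (co (vsub (hess_vec x u) (hess_vec y u)) d') <= N * (vnorm u * (M1 * Rpower D e)).
  rewrite co_sub !co_hess -rsumB (rsum_ext _ _ (fun d => co u d * (hess n rho x d d' - hess n rho y d d'))); last by move=> d; ring.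
  apply: weighted_sum_bound; [exact: vnorm_ge0 | exact: co_le |].
  by move=> d; apply: (reg_holder _ _ _ _ _ _ reg); lra.
by apply: Rle_trans (vnorm_co_bound _ _ h) _; apply: Req_le; ring.
Qed.

Lemma rdot_hess w u v : rdot (hess_vec w u) v = rsum (fun d => rsum (fun d' => co u d * co v d' * hess n rho w d d')).
Proof.
rewrite rdot_co rsum_exchange; apply: rsum_ext => d'; rewrite co_hess Rmult_comm -rsumZ.
by apply: rsum_ext => d; ring.
Qed.

Lemma hess_vec_sym w u v : vdist w p < r0 / 9 -> rdot (hess_vec w u) v = rdot (hess_vec w v) u.
Proof.
move=> hw; rewrite !rdot_hess rsum_exchange; apply: rsum_ext => d; apply: rsum_ext => d'.
by rewrite /hess (reg_sym _ _ _ _ _ _ reg w d d'); [ring | lra].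
Qed.

Variable Omega : Cn n -> Prop.
Hypothesis Omega_rho : forall z, vdist z p < r0 -> (Omega z <-> rho z < 0).

Lemma boundary_zero w : vdist w p < r0 / 3 -> boundary Omega w -> rho w = 0.
Proof.
move=> hw [h1 h2]; apply: Rle_antisym.
  apply: le_epsilon => eta he.
  have NM : 0 <= N * M1 by apply: Rmult_le_pos.
  have hq : 0 < eta / (N * M1 + 1) by apply: Rdiv_lt_0_compat; lra.
  have [z [hz hzw]] := h2 (Rmin (r0 / 3 - vdist w p) (eta / (N * M1 + 1))) ltac:(apply: Rmin_pos; lra).
  have k1 := Rmin_l (r0 / 3 - vdist w p) (eta / (N * M1 + 1)); have k2 := Rmin_r (r0 / 3 - vdist w p) (eta / (N * M1 + 1)).
  have hzp : vdist z p < r0 / 3 by have := vdist_triangle _ z w p; lra.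
  have hz0 := proj1 (Omega_rho z ltac:(lra)) hz.
  have := rho_lipschitz n e rho p r0 M1 reg w z hw hzp; rewrite -/N vdistC => /Rabs_le_between hl.
  have : N * M1 * vdist z w <= (N * M1 + 1) * (eta / (N * M1 + 1)).
    by apply: Rmult_le_compat; try lra; exact: vdist_ge0.
  have -> : (N * M1 + 1) * (eta / (N * M1 + 1)) = eta by field; lra.
  lra.
by apply: Rnot_lt_le => hlt; apply: h1; apply/Omega_rho => //; lra.
Qed.

Hypothesis p_bdry : boundary Omega p.
Hypothesis grad_neq0 : exists d, pd rho d p <> 0.

Lemma smooth_near : exists r g K, r <= r0 / 9 /\ smooth_hypersurface n e Omega p rho (grad rho) hess_vec r g K.
Proof.
have g00 : 0 < vnorm (grad rho p).
  case: (vnorm_ge0 _ (grad rho p)) => // e0; exfalso; have [d hd] := grad_neq0.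
  by apply: hd; have := co_le n (grad rho p) d; rewrite -e0 co_grad => h; have := Rabs_pos (pd rho d p) => h'; apply: Rabs_eq_0; lra.
set g0 := vnorm _ in g00.
pose K0 := N * (N * M1) + INR n * (2 * (N * M1)) + INR n * (2 * M1).
have a1 : 0 <= N * (N * M1) by do 2 (apply: Rmult_le_pos => //).
have a2 : 0 <= INR n * (2 * (N * M1)) by apply: Rmult_le_pos => //; apply: Rmult_le_pos; [lra | apply: Rmult_le_pos].
have a3 : 0 <= INR n * (2 * M1) by apply: Rmult_le_pos => //; lra.
pose K := 1 + K0.
have KK : 1 <= K by rewrite /K /K0; lra.
pose r := Rmin (r0 / 9) (Rmin (/ 4) (g0 / 2 / K)).
have k1 : r <= r0 / 9 := Rmin_l _ _.
have k2 : r <= / 4 by apply: Rle_trans (Rmin_r _ _) (Rmin_l _ _).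
have k3 : r <= g0 / 2 / K by apply: Rle_trans (Rmin_r _ _) (Rmin_r _ _).
have hr : 0 < r by repeat apply: Rmin_pos; try lra; apply: Rdiv_lt_0_compat; lra.
have d0 x y := vdist_ge0 n x y.
exists r, (Rmin 1 (g0 / 2)), K; split=> //; split=> //.
- by split; [apply: Rmin_pos; lra | exact: Rmin_l].
- by move=> w hw; apply: Omega_rho; lra.
- by move=> w hw; apply: boundary_zero; lra.
- move=> x y hx hy; apply: Rle_trans (grad_taylor x y ltac:(lra) ltac:(lra)) _.
  by apply: Rmult_le_compat_r; [apply: Rmult_le_pos | rewrite /K /K0; lra].
- move=> x y hx hy; apply: Rle_trans (grad_lipschitz x y ltac:(lra) ltac:(lra)) _.
  by apply: Rmult_le_compat_r => //; rewrite /K /K0; lra.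
- move=> x y D hx hy hD hD1; apply: Rle_trans (grad_diff x y D ltac:(lra) ltac:(lra) hD hD1) _.
  apply: Rmult_le_compat_r; first by apply: Rlt_le; exact: Rpower_pos.
  by apply: Rmult_le_compat_r; [lra | rewrite /K /K0; lra].
- move=> w hw; apply: Rle_trans (Rmin_r _ _) _.
  have hp : vdist p p < r0 / 9 by rewrite vdist_self; lra.
  have h1 := grad_lipschitz w p ltac:(lra) hp.
  have h2 := vnorm_sub_ge _ (grad rho p) (grad rho w); rewrite vnorm_opp -/(vdist (grad rho w) (grad rho p)) -/g0 in h2.
  have h3 : INR n * (2 * (N * M1)) * vdist w p <= K * (g0 / 2 / K).
    by apply: Rmult_le_compat => //; [rewrite /K /K0; lra | lra].
  have h4 : K * (g0 / 2 / K) = g0 / 2 by field; lra.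
  lra.
- by move=> w hw; apply: Rle_trans (grad_bound w ltac:(lra)) _; rewrite /K /K0; lra.
- exact: hess_vecD.
- exact: hess_vecZ.
- move=> w u hw; apply: Rle_trans (hess_vec_bound w u ltac:(lra)) _.
  by apply: Rmult_le_compat_r; [exact: vnorm_ge0 | rewrite /K /K0; lra].
- move=> x y D u hx hy hD hD1; apply: Rle_trans (hess_vec_holder x y D u ltac:(lra) ltac:(lra) hD hD1) _.
  apply: Rmult_le_compat_r; first exact: vnorm_ge0.
  by apply: Rmult_le_compat_r; [apply: Rlt_le; exact: Rpower_pos | rewrite /K /K0; lra].
- by move=> w u v hw; apply: hess_vec_sym; lra.
Qed.
End GradientField.
(** * Comparison of the two metrics *)

(* With [a = x / dl] and [y = Gx / s], the expansions at the foot point give [y = a - h / N + O(p (|a| + xi))];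
   the cross terms [- 2 a h / N] of both sides cancel and everything left is an error. *)
Lemma quadratic_comparison K g A : 1 <= K -> 0 < g <= 1 -> 0 <= A ->
  exists C, 1 <= C /\ forall dl p N s x xi h Gx Hq Hz Hn D : R,
    0 < dl -> C * dl <= 1 -> dl <= p <= 1 -> g <= N <= K -> 0 <= xi ->
    Rabs (s - N * dl) <= K * (dl * dl) ->
    Rabs (Gx - (N * x - dl * h)) <= K * dl * p * xi ->
    Rabs h <= K * xi -> Rabs (Hz - Hq) <= K * p * (xi * xi) -> Rabs Hq <= K * (xi * xi) -> Rabs Hn <= K ->
    Rabs (D - (Hq - 2 * x * h + x * x * Hn) / N) <= A * dl * (xi * xi) ->
    Rabs (Gx * Gx / (s * s) + Hz / s - (x * x / (dl * dl) + D / dl)) <= C * p * (Gx * Gx / (s * s) + xi * xi / s).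
Proof.
move=> hK hg hA.
have sq0 (t : R) : 0 <= t * t by exact: Rle_0_sqr.
(* [K3] bounds [/ s - / (N dl)], [K4] comes from [/ N <= / g], and [A1] is the constant of the error
   [th]. [A3] collects the terms of [total], and [A4] serves to return from [a] to [y]. *)
pose K3 := 2 * K / (g * g); pose K4 := K / g; pose A1 := K3 * K + 2 * K / g.
have gg : 0 < g * g by nra.
have ig : 1 <= / g by rewrite -Rinv_1; apply: Rinv_le_contravar; lra.
have K30 : 0 < K3 by apply: Rdiv_lt_0_compat; lra.
have K41 : 1 <= K4 by rewrite /K4 /Rdiv; nra.
have Kg2 : 2 * K / g = 2 * K4 by rewrite /K4 /Rdiv; ring.
have A10 : 0 < A1 by rewrite /A1 Kg2; nra.
pose A2 := K4 * K4 + 2 * (2 * A1 * K4 + A1 * A1).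
have A20 : 0 < A2 by rewrite /A2; have := Rmult_lt_0_compat _ _ A10 A10; nra.
pose A3 := A2 + K * K3 + 3 * K4 + A.
have A30 : 0 < A3 by rewrite /A3; nra.
pose A4 := 8 * ((K4 + A1) * (K4 + A1)) + 1.
have A40 : 1 <= A4 by rewrite /A4; nra.
pose C := 1 + 2 * K4 + 2 * A1 + A3 * (8 + 2 * K * A4).
have C0 : 0 <= A3 * (8 + 2 * K * A4) by apply: Rmult_le_pos; nra.
exists C; split; first by rewrite /C; lra.
move=> dl p N s x xi h Gx Hq Hz Hn D dl0 hC hp hN hxi hs hG hh hHz hHq hHn hD.
have dK4 : 2 * K4 * dl <= 1.
  by apply: Rle_trans hC; apply: Rmult_le_compat_r; [lra | rewrite /C; lra].
have dA1 : 2 * A1 * dl <= 1.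
  by apply: Rle_trans hC; apply: Rmult_le_compat_r; [lra | rewrite /C; lra].
have dK : K * dl <= g / 2.
  have : K4 * dl * g = K * dl by rewrite /K4; field; lra.
  nra.
have N0 : 0 < N by lra.
have iN : 0 < / N by apply: Rinv_0_lt_compat.
have iNg : / N <= / g by apply: Rinv_le_contravar; lra.
move/Rabs_le_between: (hs) => hs'.
have Kdd : K * (dl * dl) <= g / 2 * dl by nra.
have slow : g / 2 * dl <= s by nra.
have sup : s <= 2 * K * dl by nra.
have s0 : 0 < s by nra.
have is0 : 0 < / s by apply: Rinv_0_lt_compat.
have idl : 0 < / dl by apply: Rinv_0_lt_compat.
have isl : / s <= 2 / g * / dl.
  have -> : 2 / g * / dl = / (g / 2 * dl) by field; lra.
  by apply: Rinv_le_contravar => //; nra.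
pose tau := / s - / (N * dl).
have htau : Rabs tau <= K3.
  have -> : tau = (N * dl - s) * (/ s * (/ N * / dl)) by rewrite /tau; field; lra.
  have i3 : 0 < / s * (/ N * / dl) by repeat apply: Rmult_lt_0_compat.
  rewrite Rabs_mult (Rabs_pos_eq (/ s * _)); last lra.
  have -> : K3 = K * (dl * dl) * (2 / g * / dl * (/ g * / dl)) by rewrite /K3; field; lra.
  apply: Rmult_le_compat; [exact: Rabs_pos | lra | by rewrite Rabs_minus_sym |].
  apply: Rmult_le_compat; [lra | nra | exact: isl | apply: Rmult_le_compat_r; lra].
have [a ea] : exists a, a = x / dl by eexists.
pose y := Gx / s; pose b := xi * xi / dl.
pose r := Gx - (N * x - dl * h); pose th := y - a + h / N.
have b0 : 0 <= b by apply: Rmult_le_pos; [nra | lra].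
have xib : xi * xi = dl * b by rewrite /b; field; lra.
have xb : xi * xi <= p * b by rewrite xib; apply: Rmult_le_compat_r; lra.
have hpb : p * b <= b by nra.
have xbb : xi * xi <= b by lra.
have eth : th = tau * (N * dl * a - dl * h) + r * / s by rewrite /th /tau /r /y ea; field; lra.
have ha0 := Rabs_pos a.
have hth : Rabs th <= A1 * (dl * Rabs a + p * xi).
  rewrite eth; apply: Rle_trans (Rabs_triang _ _) _; rewrite !Rabs_mult.
  have t1 : Rabs (N * dl * a - dl * h) <= K * (dl * Rabs a + p * xi).
    apply: Rle_trans (Rabs_triang _ _) _; rewrite Rabs_Ropp !Rabs_mult (Rabs_pos_eq N) ?(Rabs_pos_eq dl); try lra.
    have : N * dl * Rabs a <= K * (dl * Rabs a) by rewrite Rmult_assoc; apply: Rmult_le_compat_r; [nra | lra].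
    have : dl * Rabs h <= p * (K * xi) by apply: Rmult_le_compat; try lra; exact: Rabs_pos.
    lra.
  have t2 : Rabs tau * Rabs (N * dl * a - dl * h) <= K3 * (K * (dl * Rabs a + p * xi)).
    by apply: Rmult_le_compat => //; exact: Rabs_pos.
  have t3 : Rabs r * Rabs (/ s) <= K * dl * p * xi * (2 / g * / dl).
    by rewrite (Rabs_pos_eq (/ s)); [apply: Rmult_le_compat => //; [exact: Rabs_pos | lra] | lra].
  have t4 : K * dl * p * xi * (2 / g * / dl) = 2 * K / g * (p * xi) by field; lra.
  have t5 : 0 <= 2 * K / g * (dl * Rabs a) by apply: Rmult_le_pos; [rewrite Kg2; lra | nra].
  rewrite /A1; lra.
pose w := Rabs a + xi.
have w0 : 0 <= w by rewrite /w; lra.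
have ww : w * w <= 2 * (a * a + xi * xi).
  have : Rabs a * Rabs a = a * a by rewrite -Rabs_mult Rabs_pos_eq; nra.
  by rewrite /w; have := Rle_0_sqr (Rabs a - xi); rewrite /Rsqr; nra.
have pww : p * (w * w) <= 2 * (p * (a * a + b)).
  have : p * (w * w) <= p * (2 * (a * a + b)) by apply: Rmult_le_compat_l; lra.
  lra.
have hth2 : Rabs th <= A1 * p * w.
  apply: Rle_trans hth _; rewrite Rmult_assoc; apply: Rmult_le_compat_l; first lra.
  have : dl * Rabs a <= p * Rabs a by apply: Rmult_le_compat_r; lra.
  by rewrite /w; lra.
have hN4 : Rabs (h / N) <= K4 * xi.
  rewrite /Rdiv Rabs_mult (Rabs_pos_eq (/ N)); last lra.
  have -> : K4 * xi = K * xi * / g by rewrite /K4 /Rdiv; ring.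
  by apply: Rmult_le_compat; [exact: Rabs_pos | lra | lra | lra].
have hah : Rabs (a - h / N) <= K4 * w.
  apply: Rle_trans (Rabs_triang _ _) _; rewrite Rabs_Ropp /w.
  have : 1 * Rabs a <= K4 * Rabs a by apply: Rmult_le_compat_r; lra.
  lra.
have e1 : Rabs ((h / N) * (h / N)) <= K4 * K4 * (p * b).
  rewrite Rabs_mult; have : Rabs (h / N) * Rabs (h / N) <= K4 * xi * (K4 * xi) by apply: Rmult_le_compat; try exact: Rabs_pos.
  have : K4 * K4 * (xi * xi) <= K4 * K4 * (p * b) by apply: Rmult_le_compat_l; [exact: sq0 | lra].
  lra.
have e2 : Rabs (2 * th * (a - h / N)) <= 2 * A1 * K4 * (p * (w * w)).
  rewrite !Rabs_mult (Rabs_pos_eq 2); last lra.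
  have : Rabs th * Rabs (a - h / N) <= A1 * p * w * (K4 * w) by apply: Rmult_le_compat; try exact: Rabs_pos.
  lra.
have e3 : Rabs (th * th) <= A1 * A1 * (p * (w * w)).
  rewrite Rabs_mult; have : Rabs th * Rabs th <= A1 * p * w * (A1 * p * w) by apply: Rmult_le_compat; try exact: Rabs_pos.
  have : A1 * A1 * (w * w) * (p * p) <= A1 * A1 * (w * w) * p.
    by apply: Rmult_le_compat_l; [apply: Rmult_le_pos; nra | nra].
  lra.
have e4 : Rabs (Hq * tau) <= K * K3 * (p * b).
  rewrite Rabs_mult; have : Rabs Hq * Rabs tau <= K * (xi * xi) * K3 by apply: Rmult_le_compat => //; exact: Rabs_pos.
  have : K * K3 * (xi * xi) <= K * K3 * (p * b) by apply: Rmult_le_compat_l; [apply: Rmult_le_pos; lra | lra].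
  lra.
have e5 : Rabs ((Hz - Hq) * / s) <= 2 * K4 * (p * b).
  rewrite Rabs_mult (Rabs_pos_eq (/ s)); last lra.
  have : Rabs (Hz - Hq) * / s <= K * p * (xi * xi) * (2 / g * / dl) by apply: Rmult_le_compat => //; [exact: Rabs_pos | lra].
  by have -> : K * p * (xi * xi) * (2 / g * / dl) = 2 * K4 * (p * b) by rewrite /K4 /b; field; lra.
have e6 : Rabs (dl * (a * a) * (Hn * / N)) <= K4 * (p * (a * a)).
  rewrite Rabs_mult (Rabs_pos_eq (dl * (a * a))); last nra.
  rewrite Rabs_mult (Rabs_pos_eq (/ N)); last lra.
  have : dl * (a * a) * (Rabs Hn * / N) <= p * (a * a) * (K * / g).
    apply: Rmult_le_compat; [by apply: Rmult_le_pos; [lra | exact: sq0] | by apply: Rmult_le_pos; [exact: Rabs_pos | lra] | by apply: Rmult_le_compat_r; [exact: sq0 | lra] |].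
    by apply: Rmult_le_compat; try lra; exact: Rabs_pos.
  by rewrite /K4 /Rdiv; lra.
have e7 : Rabs ((D - (Hq - 2 * x * h + x * x * Hn) / N) * / dl) <= A * (p * b).
  rewrite Rabs_mult (Rabs_pos_eq (/ dl)); last lra.
  have : Rabs (D - (Hq - 2 * x * h + x * x * Hn) / N) * / dl <= A * dl * (xi * xi) * / dl by apply: Rmult_le_compat_r; lra.
  have -> : A * dl * (xi * xi) * / dl = A * (xi * xi) by field; lra.
  have : A * (xi * xi) <= A * (p * b) by apply: Rmult_le_compat_l.
  lra.
have total : Gx * Gx / (s * s) + Hz / s - (x * x / (dl * dl) + D / dl) =
   h / N * (h / N) + 2 * th * (a - h / N) + th * th + Hq * tau + (Hz - Hq) * / s - dl * (a * a) * (Hn * / N)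
   - (D - (Hq - 2 * x * h + x * x * Hn) / N) * / dl.
  by rewrite /th /tau /y ea; field; lra.
have yy : Gx * Gx / (s * s) = y * y by rewrite /y; field; lra.
have main : Rabs (Gx * Gx / (s * s) + Hz / s - (x * x / (dl * dl) + D / dl)) <= A3 * (p * (a * a + b)).
  rewrite total.
  have u1 : K4 * (p * (a * a)) <= K4 * (p * (a * a + b)).
    by apply: Rmult_le_compat_l; [lra | apply: Rmult_le_compat_l; lra].
  have pb : p * b <= p * (a * a + b) by apply: Rmult_le_compat_l; [lra | have := sq0 a; lra].
  have v k : 0 <= k -> k * (p * b) <= k * (p * (a * a + b)) by move=> k0; apply: Rmult_le_compat_l.
  have v1 := v (K4 * K4) (sq0 K4); have v2 := v (K * K3) ltac:(apply: Rmult_le_pos; lra); have v3 := v (2 * K4) ltac:(lra); have v4 := v A hA.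
  have v5 : (2 * A1 * K4 + A1 * A1) * (p * (w * w)) <= (2 * A1 * K4 + A1 * A1) * (2 * (p * (a * a + b))).
    apply: Rmult_le_compat_l => //; have := sq0 A1; have : 0 <= A1 * K4 by [apply: Rmult_le_pos; lra]; lra.
  move/Rabs_le_between: e1 => e1; move/Rabs_le_between: e2 => e2; move/Rabs_le_between: e3 => e3; move/Rabs_le_between: e4 => e4.
  move/Rabs_le_between: e5 => e5; move/Rabs_le_between: e6 => e6; move/Rabs_le_between: e7 => e7.
  by apply: Rabs_le; rewrite /A3 /A2; split; lra.
(* The claim is relative to [y = Gx / s], not to [a]. As [2 A1 dl <= 1], the part of [th]
   proportional to [|a|] is absorbed on the left. *)
have ya : a * a <= 8 * (y * y) + (A4 - 1) * b.
  have h1 : Rabs a <= Rabs y + Rabs (h / N) + Rabs th.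
    have -> : a = y + h / N - th by rewrite /th; ring.
    apply: Rle_trans (Rabs_triang _ _) _; rewrite Rabs_Ropp.
    by have := Rabs_triang y (h / N); lra.
  have h2 : A1 * dl * Rabs a <= / 2 * Rabs a by apply: Rmult_le_compat_r; lra.
  have h3 : p * xi <= 1 * xi by apply: Rmult_le_compat_r; lra.
  have h3' : A1 * (p * xi) <= A1 * xi by apply: Rmult_le_compat_l; lra.
  have h4 : Rabs a <= 2 * Rabs y + 2 * ((K4 + A1) * xi) by lra.
  have h5 : Rabs a * Rabs a <= (2 * Rabs y + 2 * ((K4 + A1) * xi)) * (2 * Rabs y + 2 * ((K4 + A1) * xi)).
    by apply: Rmult_le_compat.
  have sa : Rabs a * Rabs a = a * a by rewrite -Rabs_mult Rabs_pos_eq //; exact: sq0.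
  have sy : Rabs y * Rabs y = y * y by rewrite -Rabs_mult Rabs_pos_eq //; exact: sq0.
  have h6 : (K4 + A1) * (K4 + A1) * (xi * xi) <= (K4 + A1) * (K4 + A1) * b by apply: Rmult_le_compat_l; [exact: sq0 | lra].
  have h7 := Rle_0_sqr (Rabs y - (K4 + A1) * xi); rewrite /Rsqr in h7.
  rewrite /A4; lra.
have bs : b <= 2 * K * (xi * xi / s).
  have : / dl <= 2 * K * / s.
    have -> : 2 * K * / s = / (s / (2 * K)) by field; lra.
    apply: Rinv_le_contravar; first by apply: Rdiv_lt_0_compat; lra.
    by apply: (Rmult_le_reg_r (2 * K)); [lra | have -> : s / (2 * K) * (2 * K) = s by [field; lra]; lra].
  move=> hi; have : xi * xi * / dl <= xi * xi * (2 * K * / s) by apply: Rmult_le_compat_l; [exact: sq0 | lra].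
  by rewrite /b /Rdiv; lra.
apply: Rle_trans main _; rewrite yy.
have bs0 : 0 <= xi * xi / s by apply: Rmult_le_pos; [exact: sq0 | lra].
have y0 : 0 <= y * y by exact: sq0.
have f1 : a * a + b <= (8 + 2 * K * A4) * (y * y + xi * xi / s).
  have : A4 * b <= A4 * (2 * K * (xi * xi / s)) by apply: Rmult_le_compat_l; lra.
  have : 0 <= 2 * K * A4 * (y * y) by apply: Rmult_le_pos => //; apply: Rmult_le_pos; lra.
  have : 0 <= xi * xi / s by []. lra.
have f2 : A3 * (p * (a * a + b)) <= A3 * (p * ((8 + 2 * K * A4) * (y * y + xi * xi / s))).
  by apply: Rmult_le_compat_l; [lra | apply: Rmult_le_compat_l; lra].
have f3 : 0 <= p * (y * y + xi * xi / s) by apply: Rmult_le_pos; lra.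
have f4 : A3 * (8 + 2 * K * A4) * (p * (y * y + xi * xi / s)) <= C * (p * (y * y + xi * xi / s)).
  by apply: Rmult_le_compat_r => //; rewrite /C; lra.
lra.
Qed.

(** * Complex forms as averages of real forms *)

Section QuarterForms.
Variable n : nat.
Notation dir := ('I_n * bool)%type.
Implicit Types (z u v w X Y : Cn n) (f : Cn n -> R).

Lemma additive_coords (F : Cn n -> R) X : (forall u v, F (vadd u v) = F u + F v) ->
  (forall (t : R) u, F (vscal (RtoC t) u) = t * F u) -> F X = rsum (fun d => co X d * F (rdir d)).
Proof.
move=> hD hZ.
suff step (s : seq dir) : uniq s -> F (part n X s) = \big[Rplus/0]_(d <- s) (co X d * F (rdir d)).
  rewrite /rsum -(step _ (index_enum_uniq _)); congr F.
  by apply: co_eq => d; rewrite co_part mem_index_enum.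
elim: s => [_|d s IH /= /andP[ds us]].
  rewrite big_nil; have -> : part n X [::] = vscal (RtoC 0) X.
    by apply: co_eq => d; rewrite co_part in_nil co_scal; ring.
  by rewrite hZ; ring.
rewrite big_cons -IH // -hZ Rplus_comm -hD; congr F.
apply: co_eq => d'; rewrite co_add co_scal !co_part co_rdir in_cons.
by case: eqP => [->|_] /=; rewrite ?(negbTE ds); ring.
Qed.

Definition times_i X : Cn n := vscal Ci X.

Lemma vnorm_times_i X : vnorm (times_i X) = vnorm X.
Proof.
rewrite /times_i vnorm_scal; have -> : Cmod Ci = 1; last by ring.
by rewrite /Cmod /Ci /=; have -> : 0 * (0 * 1) + 1 * (1 * 1) = 1 by [ring]; exact: sqrt_1.
Qed.

(** The real derivatives along [X] and [i X] are twice the real part and minus twice the imaginary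
    part of the complex differential; a comparison of real forms at both vectors thus gives the
    complex one. *)
Lemma dpair_quarter f z X : Cmod (dpair f z X) * Cmod (dpair f z X) =
  (D1 f X z * D1 f X z + D1 f (times_i X) z * D1 f (times_i X) z) / 4.
Proof.
rewrite Cmod_sq dpair_grad !D1_grad /times_i linZ; move: (lin _ _) => [a b].
by rewrite !CE /Ci /Re /Im /=; field.
Qed.

(** The holomorphic part of the Hessian changes sign under [X -> i X] and cancels in the average. No
    symmetry of the second derivatives enters, so this applies to the distance function as it
    stands. *)
Lemma levi_quarter f z X : levi f z X = (D2 f X z + D2 f (times_i X) z) / 4.
Proof.
have h Y : D2 f Y z = 2 * (Re (bil (hess_hol n (hess n f z)) Y Y) + Re (bil (hess_levi n (hess n f z)) Y (vconj Y))).
  by rewrite -hess_split D2E /hess; field.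
rewrite !h levi_hess /times_i bilZl bilZr vconjZ bilZl bilZr.
move: (bil _ X X) (bil _ X (vconj X)) => [a b] [a' b'].
by rewrite !CE /Ci /Re /Im /=; field.
Qed.

Lemma pd_opp f d : pd (fun w => - f w) d = fun w => - pd f d w.
Proof. by apply: functional_extensionality => w; rewrite /pd Derive_opp. Qed.

Lemma D2_opp f X z : D2 (fun w => - f w) X z = - D2 f X z.
Proof.
rewrite !D2E -[RHS]Rmult_1_l; have -> (t : R) : 1 * - t = -1 * t by ring.
rewrite -rsumZ; apply: rsum_ext => d; rewrite -rsumZ; apply: rsum_ext => d'.
by rewrite !pd_opp; ring.
Qed.

Lemma D1_rdot f X z : D1 f X z = rdot (grad n f z) X.
Proof. by rewrite rdotC rdot_co; apply: rsum_ext => d; rewrite co_grad. Qed.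

Lemma D2_rdot f X z : D2 f X z = rdot (hess_vec n f z X) X.
Proof. by rewrite rdot_hess D2E. Qed.
End QuarterForms.

(** * Comparison of the real forms at the foot point *)

Section MetricComparison.
Variables (n : nat) (e : R) (Omega : Cn n -> Prop) (p : Cn n) (rho : Cn n -> R) (r g K : R).
Hypothesis Omega_open : is_open Omega.
Hypothesis hs : smooth_hypersurface n e Omega p rho (grad n rho) (hess_vec n rho) r g K.
Implicit Types (z q X : Cn n).

Let e_range := sh_e _ _ _ _ _ _ _ _ _ _ hs.
Let r_range := sh_r _ _ _ _ _ _ _ _ _ _ hs.
Let g_range := sh_g _ _ _ _ _ _ _ _ _ _ hs.
Let K_ge1 := sh_K _ _ _ _ _ _ _ _ _ _ hs.
Let p_bdry := sh_bdry _ _ _ _ _ _ _ _ _ _ hs.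
Let delta := dist_bdry Omega.
Let G := grad n rho.
Let H := hess_vec n rho.

Let rdotHD w u v x : rdot (H w (vadd u v)) x = rdot (H w u) x + rdot (H w v) x.
Proof. by rewrite /H hess_vecD rdotDl. Qed.
Let rdotHZ w (t : R) u x : rdot (H w (vscal (RtoC t) u)) x = t * rdot (H w u) x.
Proof. by rewrite /H hess_vecZ rdotZl. Qed.

Let orthD (nu u v : Cn n) : orth n nu (vadd u v) = vadd (orth n nu u) (orth n nu v).
Proof.
apply: co_eq => d; rewrite /orth rdotDr; move: (rdot nu u) (rdot nu v) => a b.
by rewrite !(coE n); ring.
Qed.
Let orthZ (nu u : Cn n) (t : R) : orth n nu (vscal (RtoC t) u) = vscal (RtoC t) (orth n nu u).
Proof. by apply: co_eq => d; rewrite /orth rdotZr !(coE n); ring. Qed.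

Lemma hessian_coords q (nu : Cn n) X : rdot (H q (orth n nu X)) (orth n nu X) =
  rsum (fun d => rsum (fun d' => co X d * co X d' * rdot (H q (orth n nu (rdir d))) (orth n nu (rdir d')))).
Proof.
rewrite (additive_coords n (fun u => rdot (H q (orth n nu u)) (orth n nu X)) X); first last.
- by move=> t u; rewrite orthZ rdotHZ.
- by move=> u v; rewrite orthD rdotHD.
apply: rsum_ext => d.
rewrite (additive_coords n (fun u => rdot (H q (orth n nu (rdir d))) (orth n nu u)) X) -?rsumZ; first last.
- by move=> t u; rewrite orthZ rdotZr.
- by move=> u v; rewrite orthD rdotDr.
by apply: rsum_ext => d'; ring.
Qed.

Lemma hessian_orth q (nu : Cn n) X : vdist q p < r -> rdot (H q (orth n nu X)) (orth n nu X) =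
  rdot (H q X) X - 2 * rdot nu X * rdot (H q nu) X + rdot nu X * rdot nu X * rdot (H q nu) nu.
Proof.
move=> hq; have sy u v := sh_sym _ _ _ _ _ _ _ _ _ _ hs q u v hq.
set x := rdot nu X.
have eP : orth n nu X = vadd X (vscal (RtoC (- x)) nu) by apply: co_eq => d; rewrite /orth -/x !(coE n); ring.
have s1 : rdot (H q X) nu = rdot (H q nu) X by exact: sy.
by rewrite eP rdotHD rdotHZ (rdotDr _ (H q X)) (rdotDr _ (H q nu)) !rdotZr s1; ring.
Qed.

Lemma metric_comparison : exists C r1, 0 < C /\ 0 < r1 /\ forall z, vdist z p < r1 -> Omega z ->
  0 < delta z <= 1 /\ delta z <= vdist z p /\ 0 < - rho z <= 2 * K * delta z /\
  forall X, Rabs (D1 rho X z * D1 rho X z / (- rho z * - rho z) + D2 rho X z / - rho z -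
      (D1 delta X z * D1 delta X z / (delta z * delta z) + - D2 delta X z / delta z)) <=
    C * Rpower (delta z) e * (D1 rho X z * D1 rho X z / (- rho z * - rho z) + vnorm X * vnorm X / - rho z).
Proof.
pose C2 := 48 * (K * K) / (g * g) + 2 / g * (K * 4 + K * (6 + 8 * (2 * K / g))).
have C20 : 0 <= C2.
  have g2 : 0 < / (g * g) by apply: Rinv_0_lt_compat; nra.
  have g1 : 0 < / g by apply: Rinv_0_lt_compat; lra.
  have h1 : 0 <= 48 * (K * K) / (g * g) by apply: Rmult_le_pos; [nra | lra].
  have h2 : 0 <= 2 * K / g by apply: Rmult_le_pos; lra.
  have h3 : 0 <= 2 / g by apply: Rmult_le_pos; lra.
  have h4 : 0 <= 2 / g * (K * 4 + K * (6 + 8 * (2 * K / g))) by apply: Rmult_le_pos => //; nra.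
  rewrite /C2; lra.
pose N := INR #|{: 'I_n * bool}|; have N0 : 0 <= N by exact: pos_INR.
pose A := N * (N * C2); have A0 : 0 <= A by repeat apply: Rmult_le_pos.
have [C [C1 hC]] := quadratic_comparison K g A K_ge1 g_range A0.
have gK : 0 < g / (4 * K) <= / 4.
  split; first by apply: Rdiv_lt_0_compat; lra.
  apply: (Rmult_le_reg_r (4 * K)); first lra.
  by have -> : g / (4 * K) * (4 * K) = g by [field; lra]; lra.
(* The second bound gives [C delta <= 1], as [quadratic_comparison] requires, and
   [K delta <= g / 2], so that [- rho z] is comparable with [delta z]. *)
pose r1 := Rmin (r / 4 * (g / (4 * K))) (/ (C + K / g * 2)).
have Kg : 0 < K / g by apply: Rdiv_lt_0_compat; lra.
have hr1 : 0 < r1 by apply: Rmin_pos; [nra | apply: Rinv_0_lt_compat; lra].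
have l1 : r1 <= r / 4 * (g / (4 * K)) := Rmin_l _ _.
have l2 : r1 <= / (C + K / g * 2) := Rmin_r _ _.
exists C, r1; split; first lra; split=> // z hz hO.
have hz2 : vdist z p < r / 4 * (g / (4 * K)) by lra.
have [q hq] := footE n e Omega p rho G H r g K Omega_open hs z.
have [d0 d1] := delta_range n e Omega p rho G H r g K Omega_open hs z hz2 hO; rewrite -/(delta z) in d0 d1.
have dz : delta z <= vdist z p by exact: dist_bdry_le.
have d2 : delta z <= 1 by nra.
have qin := foot_in n e Omega p rho G H r g K hs z q hz2 hq.
have zin : vdist z p < r by nra.
have nE := foot_normal n e Omega p rho G H r g K Omega_open hs z q hz2 hO hq.
set nu := unit_of n (G q); rewrite -/nu -/(delta z) in nE.
have gq : 0 < vnorm (G q) by exact: (G_pos n e Omega p rho G H r g K hs).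
have nu1 : vnorm nu = 1 by exact: vnorm_unit_of.
have Gq : G q = vscal (RtoC (vnorm (G q))) nu by exact: unit_of_scale.
have zq : vdist z q = delta z by exact: esym (proj2 hq).
have nn : rdot nu nu = 1 by rewrite -vnorm_sq nu1; ring.
have zqv : vsub z q = vscal (RtoC (- delta z)) nu.
  by apply: co_eq => d; rewrite {1}nE !(coE n); ring.
have hN : g <= vnorm (G q) <= K by split; [exact: (sh_low _ _ _ _ _ _ _ _ _ _ hs) | exact: (sh_up _ _ _ _ _ _ _ _ _ _ hs)].
have Cd : (C + K / g * 2) * delta z <= 1.
  have : (C + K / g * 2) * delta z <= (C + K / g * 2) * / (C + K / g * 2) by apply: Rmult_le_compat_l; lra.
  by rewrite Rinv_r; lra.
have hsN : Rabs (- rho z - vnorm (G q) * delta z) <= K * (delta z * delta z).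
  have := sh_taylor _ _ _ _ _ _ _ _ _ _ hs z q zin qin.
  rewrite (sh_zero _ _ _ _ _ _ _ _ _ _ hs q qin (proj1 hq)) zq zqv rdotZl -/G {1}Gq rdotZr nn.
  by rewrite -Rabs_Ropp => h; apply: Rle_trans h; apply: Req_le; congr Rabs; ring.
have Kd : K * delta z <= g / 2.
  have : K / g * 2 * delta z <= 1 by nra.
  have -> : K * delta z = K / g * 2 * delta z * (g / 2) by field; lra.
  nra.
have sr : 0 < - rho z <= 2 * K * delta z.
  by move/Rabs_le_between: hsN => hsN; split; nra.
do 3 (split=> //).
move=> X.
have p1 : Rpower (delta z) e <= 1.
  by rewrite -(Rpower_O (delta z)) //; apply: Rpower_le_exponent; lra.
have p2 : delta z <= Rpower (delta z) e.
  by rewrite -{1}(Rpower_1 (delta z)) //; apply: Rpower_le_exponent; lra.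
have x0 := vnorm_ge0 _ X.
have D1d : D1 delta X z = - rdot nu X.
  rewrite rdotC rdot_co; have -> : - rsum (fun d => co X d * co nu d) = -1 * rsum (fun d => co X d * co nu d) by ring.
  rewrite -rsumZ; apply: rsum_ext => d.
  by rewrite (pd_dist_bdry n e Omega p rho G H r g K Omega_open hs z q d hz2 hO hq) -/nu; ring.
rewrite D1d; have -> : - rdot nu X * - rdot nu X = rdot nu X * rdot nu X by ring.
(* The small parameter [delta^e] dominates both [delta] and the Hölder variation of the Hessian
   between [z] and its foot, which are [delta] apart. *)
apply: (hC (delta z) (Rpower (delta z) e) (vnorm (G q)) (- rho z) (rdot nu X) (vnorm X) (rdot (H q nu) X)
   (D1 rho X z) (rdot (H q X) X) (D2 rho X z) (rdot (H q nu) nu) (- D2 delta X z)) => //.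
- by have : 0 <= K / g * 2 * delta z by [apply: Rmult_le_pos; lra]; lra.
- have h := sh_diff _ _ _ _ _ _ _ _ _ _ hs z q (delta z) zin qin (Req_le _ _ zq) (conj d0 d2).
  rewrite -/G -/H zqv in h.
  have e1 : D1 rho X z - (vnorm (G q) * rdot nu X - delta z * rdot (H q nu) X) =
     rdot (vsub (vsub (G z) (G q)) (H q (vscal (RtoC (- delta z)) nu))) X.
    by rewrite D1_rdot rdotBl (rdotBl _ (G z)) rdotHZ -/G {2}Gq rdotZl; ring.
  rewrite e1; apply: Rle_trans (rdot_CS _ _ _) _; apply: Rmult_le_compat_r => //.
- apply: Rle_trans (rdot_CS _ _ _) _; apply: Rmult_le_compat_r => //.
  by have := sh_bound _ _ _ _ _ _ _ _ _ _ hs q nu qin; rewrite nu1 Rmult_1_r.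
- have h := sh_holder _ _ _ _ _ _ _ _ _ _ hs z q (delta z) X zin qin (Req_le _ _ zq) (conj d0 d2).
  rewrite D2_rdot -/H -rdotBl; apply: Rle_trans (rdot_CS _ _ _) _.
  by rewrite -!Rmult_assoc; apply: Rmult_le_compat_r.
- apply: Rle_trans (rdot_CS _ _ _) _; rewrite -Rmult_assoc; apply: Rmult_le_compat_r => //.
  exact: (sh_bound _ _ _ _ _ _ _ _ _ _ hs).
- apply: Rle_trans (rdot_CS _ _ _) _; rewrite nu1 Rmult_1_r.
  by have := sh_bound _ _ _ _ _ _ _ _ _ _ hs q nu qin; rewrite nu1 Rmult_1_r.
rewrite -hessian_orth // hessian_coords D2E.
set S := rsum _; set T := rsum _.
have -> : - S - T / vnorm (G q) = - (S + / vnorm (G q) * T) by field; lra.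
rewrite Rabs_Ropp /S /T -rsumZ -rsumD.
rewrite (rsum_ext _ _ (fun d => co X d * rsum (fun d' => co X d' * (pd (pd delta d') d z +
   rdot (H q (orth n nu (rdir d))) (orth n nu (rdir d')) / vnorm (G q))))); last first.
  by move=> d; rewrite -!rsumZ -rsumD; apply: rsum_ext => d'; field; lra.
have b1 d d' := pd2_dist_bdry n e Omega p rho G H r g K Omega_open hs z q d d' hz2 hO hq.
have b2 d := weighted_sum_bound _ (co X) _ (vnorm X) _ x0 (co_le n X) (b1 d).
apply: Rle_trans (weighted_sum_bound _ (co X) _ (vnorm X) _ x0 (co_le n X) b2) _.
by apply: Req_le; rewrite -/N -/(delta z) /A /C2; ring.
Qed.
End MetricComparison.

(** The error is relative to [m], the form known to be nonnegative; that [Q] is nonnegative then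
    follows from [eta <= 1/2]. *)
Lemma sqrt_comparison m Q eta : 0 <= m -> 0 <= eta <= / 2 -> Rabs (m - Q) <= eta * m ->
  (1 - eta) * sqrt Q <= sqrt m <= (1 + 2 * eta) * sqrt Q.
Proof.
move=> hm he /Rabs_le_between h.
have Q0 : 0 <= Q by nra.
have sq t : 0 <= t -> t * sqrt Q = sqrt (t * t * Q).
  by move=> ht; rewrite sqrt_mult_alt ?sqrt_square //; exact: Rle_0_sqr.
rewrite !sq; try lra.
split; apply: sqrt_le_1_alt.
  have h1 : (1 - eta) * (1 - eta) * Q <= (1 - eta) * (1 - eta) * ((1 + eta) * m).
    by apply: Rmult_le_compat_l; [exact: Rle_0_sqr | lra].
  have h2 : (1 - eta) * (1 - eta) * (1 + eta) <= 1 by nra.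
  have := Rmult_le_compat_r m _ _ hm h2; lra.
have h1 : (1 + 2 * eta) * (1 + 2 * eta) * ((1 - eta) * m) <= (1 + 2 * eta) * (1 + 2 * eta) * Q.
  by apply: Rmult_le_compat_l; [exact: Rle_0_sqr | lra].
have h2 : 1 <= (1 + 2 * eta) * (1 + 2 * eta) * (1 - eta) by nra.
have := Rmult_le_compat_r m _ _ hm h2; lra.
Qed.

(** * The estimate in terms of the distance *)

Section Estimate.
Variables (n : nat) (e : R) (Omega : Cn n -> Prop) (rho : Cn n -> R) (p : Cn n) (r0 M1 : R).
Hypothesis Omega_open : is_open Omega.
Hypothesis e_range : 0 < e <= 1.
Hypothesis p_bdry : boundary Omega p.
Hypothesis reg : regular_near n e rho p r0 M1.
Hypothesis Omega_rho : forall z, vdist z p < r0 -> (Omega z <-> rho z < 0).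
Hypothesis grad_neq0 : exists d, pd rho d p <> 0.
Hypothesis levi_pos : forall X, (exists j, X j <> RtoC 0) -> dpair rho p X = RtoC 0 -> 0 < levi rho p X.
Let delta := dist_bdry Omega.

Definition distance_form z X :=
  Cmod (dpair delta z X) * Cmod (dpair delta z X) / (delta z * delta z) + levi (fun w => - delta w) z X / delta z.

Let r0_range := reg_r _ _ _ _ _ _ reg.

(** The real comparison is averaged over [X] and [i X]. Coercivity of the completed Levi form bounds
    the error [|X|^2 / s] by a multiple of the metric itself, which makes the error relative. *)
Lemma chart_comparison : exists M c K r B C K1 r1, 0 <= M /\ 0 < c /\ 0 <= K /\ 0 < r /\ 0 <= B /\ 0 < C /\ 1 <= K1 /\ 0 < r1 /\
  forall z, vdist z p < r1 -> Omega z -> 0 < delta z <= 1 /\ delta z <= vdist z p /\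
    exists ch : chart n M c, taylor_domain K r e B ch Omega z /\ ch_s ch <= K1 * delta z /\
      forall X, Rabs (metric_form ch X - distance_form z X) <= C * Rpower (delta z) e * metric_form ch X.
Proof.
have rho_p : rho p = 0.
  by apply: (boundary_zero n e rho p r0 M1 reg Omega Omega_rho p _ p_bdry); rewrite vdist_self; lra.
have [M [c [K [r [B [r1 [hM [hc [hK [hr [hB [hr1 hch]]]]]]]]]]]] :=
  charts_near n e rho p r0 M1 e_range reg rho_p grad_neq0 levi_pos Omega Omega_rho.
have [r' [g [K0 [_ hs]]]] := smooth_near n e rho p r0 M1 e_range reg Omega Omega_rho p_bdry grad_neq0.
have [C [r2 [hC [hr2 hcmp]]]] := metric_comparison n e Omega p rho r' g K0 Omega_open hs.
have K01 := sh_K _ _ _ _ _ _ _ _ _ _ hs.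
have ic : 0 < / c by apply: Rinv_0_lt_compat.
pose C3 := C * (1 + / c) + K * (2 * K0).
have k1 : 0 <= K * (2 * K0) by apply: Rmult_le_pos; lra.
have k2 : 0 < C * (1 + / c) by apply: Rmult_lt_0_compat; lra.
exists M, c, K, r, B, C3, (2 * K0), (Rmin r1 r2).
do 5 (split=> //); split; first by rewrite /C3; lra.
split; first lra; split; first by apply: Rmin_pos; lra.
move=> z hz hO; have l1 := Rmin_l r1 r2; have l2 := Rmin_r r1 r2.
have [hd [hdz [hsd hX]]] := hcmp z ltac:(lra) hO; rewrite -/(delta z) in hd hdz hsd hX.
split=> //; split=> //.
have [ch [es [ea [el ht]]]] := hch z ltac:(lra) hO.
exists ch; split=> //; split; first by rewrite es; lra.
move=> X.
set pw := Rpower (delta z) e in hX *.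
have p2 : delta z <= pw by rewrite /pw -{1}(Rpower_1 (delta z)); [apply: Rpower_le_exponent; lra | lra].
have sp : 0 < - rho z by lra.
have i0 : 0 < / - rho z by apply: Rinv_0_lt_compat.
pose L2 := Cmod (lin (ch_a ch) X) * Cmod (lin (ch_a ch) X).
have L20 : 0 <= L2 by exact: Rle_0_sqr.
have ge := levi_norm_ge n M c ch X.
have mE : metric_form ch X = L2 / (- rho z * - rho z) + levi_norm ch X / - rho z by rewrite /metric_form es.
have lE : levi_norm ch X = levi rho z X + K * L2 by rewrite el /L2 ea.
have v2 : 0 <= vnorm X * vnorm X by exact: Rle_0_sqr.
have Ld : L2 = (D1 rho X z * D1 rho X z + D1 rho (times_i n X) z * D1 rho (times_i n X) z) / 4.
  by rewrite -dpair_quarter /L2 ea.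
have h1 := hX X; have h2 := hX (times_i n X); rewrite vnorm_times_i in h2.
have ed : distance_form z X = (D1 delta X z * D1 delta X z / (delta z * delta z) + - D2 delta X z / delta z +
   (D1 delta (times_i n X) z * D1 delta (times_i n X) z / (delta z * delta z) + - D2 delta (times_i n X) z / delta z)) / 4.
  by rewrite /distance_form dpair_quarter levi_quarter !D2_opp; field; lra.
have em : metric_form ch X = (D1 rho X z * D1 rho X z / (- rho z * - rho z) + D2 rho X z / - rho z +
   (D1 rho (times_i n X) z * D1 rho (times_i n X) z / (- rho z * - rho z) + D2 rho (times_i n X) z / - rho z)) / 4 + K * L2 / - rho z.
  by rewrite mE lE levi_quarter Ld; field; lra.
rewrite -/delta in h1 h2.
move/Rabs_le_between: h1 => h1; move/Rabs_le_between: h2 => h2.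
have sum : (C * pw * (D1 rho X z * D1 rho X z / (- rho z * - rho z) + vnorm X * vnorm X / - rho z) +
   C * pw * (D1 rho (times_i n X) z * D1 rho (times_i n X) z / (- rho z * - rho z) + vnorm X * vnorm X / - rho z)) / 4 =
   C * pw * (L2 / (- rho z * - rho z) + vnorm X * vnorm X / - rho z / 2) by rewrite Ld; field; lra.
set a := L2 / (- rho z * - rho z); rewrite -/a in sum mE.
have a0 : 0 <= a by apply: Rmult_le_pos => //; apply: Rlt_le; apply: Rinv_0_lt_compat; nra.
set b := vnorm X * vnorm X / - rho z in sum h1 h2.
have b0 : 0 <= b by apply: Rmult_le_pos => //; lra.
set l := levi_norm ch X / - rho z in mE.
have bl : c * b <= l.
  have -> : c * b = c * (vnorm X * vnorm X) * / - rho z by rewrite /b /Rdiv; ring.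
  by apply: Rmult_le_compat_r; lra.
have m0 : 0 <= metric_form ch X by nra.
have pw0 : 0 < pw by exact: Rpower_pos.
have t1 : C * pw * (a + b / 2) <= C * (1 + / c) * pw * metric_form ch X.
  have e1 : b = / c * (c * b) by field; lra.
  have e2 : / c * (c * b) <= / c * l by apply: Rmult_le_compat_l; lra.
  have e3 : 0 <= / c * a by apply: Rmult_le_pos; lra.
  have e4 : a + b / 2 <= (1 + / c) * metric_form ch X by rewrite mE; nra.
  have : C * pw * (a + b / 2) <= C * pw * ((1 + / c) * metric_form ch X) by apply: Rmult_le_compat_l => //; nra.
  lra.
(* The completion adds [K |l|^2 / s = K s (|l|^2 / s^2)] to the metric; since [s = O(delta)], this
   too is a relative error. *)
have t2 : 0 <= K * L2 / - rho z <= K * (2 * K0) * pw * metric_form ch X.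
  have -> : K * L2 / - rho z = K * (- rho z * a) by rewrite /a; field; lra.
  have s1 : - rho z * a <= 2 * K0 * pw * metric_form ch X.
    apply: Rmult_le_compat; try lra; last by rewrite mE; nra.
    by apply: Rle_trans (proj2 hsd) _; apply: Rmult_le_compat_l; lra.
  split; first by apply: Rmult_le_pos => //; nra.
  have : K * (- rho z * a) <= K * (2 * K0 * pw * metric_form ch X) by apply: Rmult_le_compat_l.
  lra.
apply: Rabs_le; rewrite ed {2 3}em /C3; split; lra.
Qed.

Lemma kobayashi_distance_estimate : exists C r, 0 < C /\ 0 < r /\ forall z X, Omega z -> vdist z p < r ->
  Rbar_le (Rbar.Finite ((1 - C * Rpower (delta z) e) * sqrt (distance_form z X))) (kobayashi Omega z X) /\
  Rbar_le (kobayashi Omega z X) (Rbar.Finite ((1 + C * Rpower (delta z) e) * sqrt (distance_form z X))).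
Proof.
have [M [c [K [r [B [C [K1 [r1 [hM [hc [hK [hr [hB [hC [hK1 [hr1 H]]]]]]]]]]]]]]]] := chart_comparison.
have [Cu [su [hCu [hsu hu]]]] := kobayashi_upper_model n M c hM hc K r e B hK hr e_range hB.
have [Cl [sl [hCl [hsl hl]]]] := kobayashi_lower_model n M c hM hc K r e B hK hr e_range hB.
have [x1 [hx1 sm1]] := Rpower_small e (/ (2 * C)) ltac:(lra) ltac:(apply: Rinv_0_lt_compat; lra).
have KCl : 0 < K1 * Cl by nra.
have KCu : 0 < K1 * Cu by nra.
have [x2 [hx2 sm2]] := Rpower_small e (/ (K1 * Cl)) ltac:(lra) ltac:(apply: Rinv_0_lt_compat; lra).
have i1 : 0 < / K1 by apply: Rinv_0_lt_compat; lra.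
pose r2 := Rmin r1 (Rmin (Rmin x1 x2) (Rmin (su * / K1) (sl * / K1))).
have hr2 : 0 < r2 by repeat apply: Rmin_pos => //; nra.
have l1 : r2 <= r1 := Rmin_l _ _.
have l2 : r2 <= x1 by apply: Rle_trans (Rmin_r _ _) (Rle_trans _ _ _ (Rmin_l _ _) (Rmin_l _ _)).
have l3 : r2 <= x2 by apply: Rle_trans (Rmin_r _ _) (Rle_trans _ _ _ (Rmin_l _ _) (Rmin_r _ _)).
have l4 : r2 <= su * / K1 by apply: Rle_trans (Rmin_r _ _) (Rle_trans _ _ _ (Rmin_r _ _) (Rmin_l _ _)).
have l5 : r2 <= sl * / K1 by apply: Rle_trans (Rmin_r _ _) (Rle_trans _ _ _ (Rmin_r _ _) (Rmin_r _ _)).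
(* From [(1 + K1 Cu p) (1 + 2 C p)] and [(1 - K1 Cl p) (1 - C p)] with [p = delta^e <= 1]. [K1]
   enters through [s^e <= (K1 delta)^e <= K1 delta^e], where [e <= 1 <= K1]. *)
exists (K1 * Cu + K1 * Cl + 2 * C + K1 * Cu * (2 * C)), r2; split; first nra.
split=> // z X hO hz.
have [[d0 d1] [dz [ch [ht [hs hX]]]]] := H z ltac:(lra) hO.
have hs0 := ch_s_range _ _ _ ch.
set pw := Rpower (delta z) e.
have pw0 : 0 < pw by exact: Rpower_pos.
have p1 : pw <= 1 by rewrite /pw -(Rpower_O (delta z)) //; apply: Rpower_le_exponent; lra.
have pC : C * pw <= / 2.
  have := sm1 (delta z) ltac:(lra); rewrite -/pw => h.
  have : C * pw <= C * / (2 * C) by apply: Rmult_le_compat_l; lra.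
  by have -> : C * / (2 * C) = / 2 by field; lra.
(* Makes the factor [1 - K1 Cl p] nonnegative, so that the lower bound for [sqrt (metric_form ch X)]
   may be multiplied by it. *)
have pL : K1 * Cl * pw <= 1.
  have := sm2 (delta z) ltac:(lra); rewrite -/pw => h.
  have : K1 * Cl * pw <= K1 * Cl * / (K1 * Cl) by apply: Rmult_le_compat_l; lra.
  by rewrite Rinv_r; lra.
have m0 := metric_form_ge0 n M c hc ch X.
have [lo up] := sqrt_comparison (metric_form ch X) (distance_form z X) (C * pw) m0 ltac:(nra) (hX X).
have sK : K1 * delta z < su /\ K1 * delta z < sl.
  have h1 : K1 * delta z < K1 * (su * / K1) by apply: Rmult_lt_compat_l; lra.
  have h2 : K1 * delta z < K1 * (sl * / K1) by apply: Rmult_lt_compat_l; lra.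
  have e1 t : K1 * (t * / K1) = t by field; lra.
  by rewrite !e1 in h1 h2.
have sp : Rpower (ch_s ch) e <= K1 * pw.
  have h1 : Rpower (ch_s ch) e <= Rpower (K1 * delta z) e by apply: Rle_Rpower_l; lra.
  have h2 : Rpower (K1 * delta z) e = Rpower K1 e * pw by rewrite /pw Rpower_mult_distr //; lra.
  have h3 : Rpower K1 e <= K1 by rewrite -{2}(Rpower_1 K1); [apply: Rle_Rpower; lra | lra].
  have : Rpower K1 e * pw <= K1 * pw by apply: Rmult_le_compat_r; lra.
  lra.
have q0 := sqrt_pos (distance_form z X); set q := sqrt (distance_form z X) in q0 lo up *.
have sm0 := sqrt_pos (metric_form ch X); set sm := sqrt (metric_form ch X) in sm0 lo up *.
have ps0 := Rpower_pos (ch_s ch) e.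
split.
  apply: Rbar_le_trans (hl ch Omega z ltac:(lra) ht X); rewrite /= -/sm.
  have h1 : (1 - K1 * Cl * pw) * sm <= (1 - Cl * Rpower (ch_s ch) e) * sm.
    apply: Rmult_le_compat_r => //.
    have : Cl * Rpower (ch_s ch) e <= Cl * (K1 * pw) by apply: Rmult_le_compat_l; lra.
    lra.
  have h2 : (1 - K1 * Cl * pw) * ((1 - C * pw) * q) <= (1 - K1 * Cl * pw) * sm by apply: Rmult_le_compat_l; lra.
  have h3 : 0 <= K1 * Cl * pw * (C * pw) * q by apply: Rmult_le_pos => //; apply: Rmult_le_pos; nra.
  have h4 : 0 <= (K1 * Cu + C + K1 * Cu * (2 * C)) * pw * q.
    apply: Rmult_le_pos => //; apply: Rmult_le_pos; last lra.
    by have : 0 <= K1 * Cu * (2 * C) by [apply: Rmult_le_pos; lra]; lra.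
  lra.
apply: Rbar_le_trans (hu ch Omega z ltac:(lra) ht X) _; rewrite /= -/sm.
have h1 : (1 + Cu * Rpower (ch_s ch) e) * sm <= (1 + K1 * Cu * pw) * ((1 + 2 * (C * pw)) * q).
  apply: Rmult_le_compat => //.
    by have : 0 <= Cu * Rpower (ch_s ch) e by [apply: Rmult_le_pos; lra]; lra.
  have : Cu * Rpower (ch_s ch) e <= Cu * (K1 * pw) by apply: Rmult_le_compat_l; lra.
  lra.
have h2 : K1 * Cu * pw * (2 * (C * pw)) * q <= K1 * Cu * (2 * C) * pw * q.
  apply: Rmult_le_compat_r => //.
  have : K1 * Cu * (2 * C) * (pw * pw) <= K1 * Cu * (2 * C) * pw.
    by apply: Rmult_le_compat_l; [apply: Rmult_le_pos; lra | nra].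
  lra.
have h3 : 0 <= K1 * Cl * pw * q by apply: Rmult_le_pos => //; apply: Rmult_le_pos; lra.
lra.
Qed.
End Estimate.

Theorem theorem2 (n : nat) (Omega : Cn n -> Prop) (eps : R) (k : nat) (p : Cn n) :
  is_domain Omega ->
  0 < eps <= 1 ->
  (k = 0%nat \/ k = 1%nat) ->
  boundary Omega p ->
  spsc_point (k + 2) eps Omega p ->
  exists (Cst : R) (U : Cn n -> Prop),
    0 < Cst /\ is_open U /\ U p /\
    forall z X : Cn n, Omega z -> U z ->
      let d := dist_bdry Omega z in
      let ek := (INR k + eps) / 2 in
      let Q := Cmod (dpair (dist_bdry Omega) z X) * Cmod (dpair (dist_bdry Omega) z X) / (d * d)
               + levi (fun w => - dist_bdry Omega w) z X / d in
      Rbar_le (Rbar.Finite ((1 - Cst * Rpower d ek) * sqrt Q)) (kobayashi Omega z X) /\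
      Rbar_le (kobayashi Omega z X) (Rbar.Finite ((1 + Cst * Rpower d ek) * sqrt Q)).
Proof.
move=> [Omega_open _] heps hk hp [W [rho [hW [Wp [hC [hO [hg hl]]]]]]].
pose e := (INR k + eps) / 2.
have [r [M [hr reg]]] : exists r M, (forall z, vdist z p < r -> W z) /\ regular_near n e rho p r M.
  rewrite /e; case: hk hC => -> hC.
    by rewrite /= Rplus_0_l; exact: regular_of_C2.
  exact: regular_of_C3.
have he : 0 < e <= 1 by rewrite /e; case: hk => ->; rewrite /=; lra.
have [C [r1 [hC1 [hr1 H]]]] := kobayashi_distance_estimate n e Omega rho p r M Omega_open he hp reg
  (fun z hz => hO z (hr z hz)) (hg p Wp) hl.
exists C, (fun z => vdist z p < r1); split=> //; split.
  move=> z hz; exists (r1 - vdist z p); split=> [|w hw]; first lra.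
  by have := vdist_triangle _ w z p; lra.
split; first by rewrite vdist_self.
by move=> z X hz hU d ek Q; exact: H.
Qed.
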